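(* Let $\nu\in\mathbb{C}\setminus\mathbb{Z}$ with $\Re(\nu)\ge0$, let $\chi$ be an odd primitive Dirichlet character modulo $q$, and let $N$ be an integer with $N\ge\lfloor\frac{\Re(\nu)+1}{2}\rfloor$. Then for every $x>0$ with $qx\notin\mathbb{Z}_{>0}$, \begin{align*} & 8\pi x^{\nu/2} \sum_{n=1}^{\infty} \sigma_{-\nu, \bar{\chi}}(n) n^{\nu/2} K_{\nu}(4\pi \sqrt{nx}) =-\frac{ \Gamma(\nu) L(\nu, \bar{\chi})}{(2\pi)^{\nu-1} } + \frac{2\Gamma(1+\nu) L(1+\nu, \bar{\chi})}{(2\pi)^{\nu+1} }x^{-1} + \frac{2iq^{1-\nu} }{\tau(\chi) \cos \left(\frac{\pi \nu}{2}\right)} \\ &\quad \times\left\{ \zeta(\nu+1)L(1,{\chi})(qx)^{\nu} - \sum_{j=1}^{N} \zeta(2j)\, L(2j-\nu, \chi)(qx)^{2j-1} - (qx)^{2N+1}\sum_{n=1}^{\infty} \frac{\bar{\sigma}_{-\nu, \chi}(n)}{n} \left(\frac{ n^{\nu+1-2N}-(qx)^{\nu+1-2N} }{ n^2-(qx)^2}\right) \right\}. \end{align*}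
   Context: For a Dirichlet character $\chi$ and $z\in\mathbb{C}$: $\sigma_{z,\chi}(n)=\sum_{d\mid n}d^z\chi(d)$ and $\bar{\sigma}_{z,\chi}(n)=\sum_{d\mid n}d^z\chi(n/d)$. $\tau(\chi)=\sum_{h=1}^q\chi(h)e^{2\pi i h/q}$ is the Gauss sum, $L(s,\chi)$ the Dirichlet $L$-function, $\zeta$ the Riemann zeta function, and $K_\nu$ the modified Bessel function of the second kind. *)

(* Defs.v *)
From Stdlib Require Import Reals ZArith ClassicalEpsilon.
From Coquelicot Require Import Coquelicot.
Open Scope R_scope.

Definition cexp (z : C) : C := Cmult (RtoC (exp (Re z))) (cos (Im z), sin (Im z)).
Definition cpow (x : R) (s : C) : C := cexp (Cmult s (RtoC (ln x))).
Definition ccos (z : C) : C := Cdiv (Cplus (cexp (Cmult Ci z)) (cexp (Copp (Cmult Ci z)))) (RtoC 2).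
Definition ccosh (z : C) : C := Cdiv (Cplus (cexp z) (cexp (Copp z))) (RtoC 2).

Definition holo_at (f : C -> C) (z : C) : Prop :=
  @ex_derive C_AbsRing C_NormedModule f z.

(* ---------- special functions, each defined as the (unique) analytic
   continuation characterised by its defining series/integral ---------- *)

Definition is_Gamma (f : C -> C) : Prop :=
  (forall z : C, (forall k : nat, z <> RtoC (- INR k)) -> holo_at f z) /\
  (forall s : C, 0 < Re s ->
     @is_RInt_gen C_R_NormedModule
       (fun t => Cmult (cpow t (Cminus s (RtoC 1))) (RtoC (exp (- t))))
       (at_right 0) (Rbar_locally p_infty) (f s)).
Definition Gamma (s : C) : C := epsilon (inhabits (fun _ : C => RtoC 0)) is_Gamma s.

Definition is_zeta (f : C -> C) : Prop :=
  (forall z : C, z <> RtoC 1 -> holo_at f z) /\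
  (forall s : C, 1 < Re s ->
     @is_series C_AbsRing C_NormedModule
       (fun n => cpow (INR (S n)) (Copp s)) (f s)).
Definition zeta (s : C) : C := epsilon (inhabits (fun _ : C => RtoC 0)) is_zeta s.

Definition dirichlet_char (q : nat) (chi : Z -> C) : Prop :=
  (1 <= q)%nat /\
  (forall m : Z, chi (m + Z.of_nat q)%Z = chi m) /\
  (forall m n : Z, chi (m * n)%Z = Cmult (chi m) (chi n)) /\
  chi 1%Z = RtoC 1 /\
  (forall m : Z, chi m = RtoC 0 <-> Z.gcd m (Z.of_nat q) <> 1%Z).

(* primitive: not induced by any character of a modulus d | q with d < q *)
Definition primitive_char (q : nat) (chi : Z -> C) : Prop :=
  dirichlet_char q chi /\
  forall d : nat, (0 < d)%nat -> Nat.divide d q -> (d < q)%nat ->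
    exists a : Z, Z.gcd a (Z.of_nat q) = 1%Z /\ Z.modulo a (Z.of_nat d) = Z.modulo 1 (Z.of_nat d)
                  /\ chi a <> RtoC 1.

Definition odd_char (chi : Z -> C) : Prop := chi (-1)%Z = RtoC (-1).

Definition conj_char (chi : Z -> C) : Z -> C := fun n => Cconj (chi n).

(* Dirichlet L-function of a NON-PRINCIPAL character: the entire function
   equal to sum chi(n) n^{-s} for Re s > 1 (only used for non-principal chi) *)
Definition is_Lfun (chi : Z -> C) (f : C -> C) : Prop :=
  (forall z : C, holo_at f z) /\
  (forall s : C, 1 < Re s ->
     @is_series C_AbsRing C_NormedModule
       (fun n => Cmult (chi (Z.of_nat (S n))) (cpow (INR (S n)) (Copp s))) (f s)).
Definition Lfun (chi : Z -> C) (s : C) : C :=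
  epsilon (inhabits (fun _ : C => RtoC 0)) (is_Lfun chi) s.

Definition gauss_sum (q : nat) (chi : Z -> C) : C :=
  @sum_n_m C_AbelianMonoid
    (fun h => Cmult (chi (Z.of_nat h)) (cexp (0%R, 2 * PI * INR h / INR q))) 1 q.

Definition sigma_chi (z : C) (chi : Z -> C) (n : nat) : C :=
  @sum_n_m C_AbelianMonoid
    (fun d => if Nat.eqb (Nat.modulo n d) 0
              then Cmult (cpow (INR d) z) (chi (Z.of_nat d)) else RtoC 0) 1 n.

Definition sigma_bar_chi (z : C) (chi : Z -> C) (n : nat) : C :=
  @sum_n_m C_AbelianMonoid
    (fun d => if Nat.eqb (Nat.modulo n d) 0
              then Cmult (cpow (INR d) z) (chi (Z.of_nat (Nat.div n d))) else RtoC 0) 1 n.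

Definition BesselK (nu : C) (x : R) : C :=
  @RInt_gen C_R_CompleteNormedModule
    (fun t => Cmult (RtoC (exp (- x * cosh t))) (ccosh (Cmult nu (RtoC t))))
    (at_point 0) (Rbar_locally p_infty).

(* Main.v *)
Require Import Defs.
From Stdlib Require Import Reals ZArith Lra Lia Psatz ClassicalEpsilon List Permutation.
From Coquelicot Require Import Coquelicot.
Open Scope R_scope.

(** Write [A(v) = sum_d chib(d) exp(-2 pi d v)] and [B(w) = 1/(exp(2 pi w) - 1)]. Since
    [2 (b/a)^(nu/2) K_nu(2 sqrt(ab))] is the integral of [exp(-a v - b/v) v^(nu-1)] over
    [v > 0], the Bessel series is, up to elementary factors, the integral [J(nu)] of
    [A(v) B(x/v) v^(nu-1)], which is entire in [nu].

    Splitting [B(w) = D(w) + 1/(2 pi w) - 1/2] produces the two Gamma terms, because the Mellin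
    transform of [A] is [(2 pi)^(-s) Gamma(s) L(s, chib)]. Fourier series and Gauss sums give the
    partial fractions [D(w) = (w/pi) sum_n 1/(n^2 + w^2)] and
    [A(v) = A0 - kap q^2 v^2 sum_k chi(k)/(k (k^2 + q^2 v^2))] with [kap = i q/(pi tau(chi))]
    and [A0 = kap L(1, chi)]. For [0 < Re nu < 1] the remaining integral of [A(v) D(x/v) v^(nu-1)]
    is evaluated termwise, and the elementary Mellin transform of [1/(a^2 + b^2 v^2)] yields the
    case [N = 0]. Passing from [N] to [N + 1] removes the Dirichlet series
    [zeta(2N+2) L(2N+2-nu, chi)] from the last sum, and the improved convergence lets the identity
    theorem extend the formula to [0 < Re nu < 2N+1], and continuity to [Re nu = 0].

    The same Mellin integrals provide the analytic continuations of [zeta] and [L]. *)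

(** [zeta], [Lfun] and [Gamma] are choices among functions with a characterising property, so
    nothing is known about them before such a function has been constructed. The variable [u = ln v]
    turns each Mellin integral into one over the whole line of a function of exponential decay; a
    single notion of domination then gives convergence, termwise integration and holomorphy in the
    exponent. The identity theorem rests on Cauchy's formula for a primitive.

    The range of [nu] is the obstacle: the Mellin transform of [1/(a^2 + b^2 v^2)] is used for
    [|Re nu| < 1], while the last sum is controlled for [-1 < Re nu < 2N + 1]. The floor in the
    hypothesis says exactly [Re nu < 2N + 1]. The condition on [q x] keeps the denominators
    [(d m)^2 - (q x)^2] nonzero. The identity is continued after multiplication by [cos(pi nu/2)],
    so that in the strip only [nu = 0] has to be avoided; the division comes last. One argument with
    the equation [f'' = lam f] yields the partial fractions of [A] and [D] and also the Mellin
    transform of [1/(1 + v^2)]. *)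

Ltac deriv_cont := apply (@ex_derive_continuous R_AbsRing R_NormedModule); auto_derive.

Lemma exp_ge0 (u : R) : 0 <= exp u.
Proof. left. apply exp_pos. Qed.

(** * Complex exponential and complex derivatives *)

Lemma C_eq (z w : C) : Re z = Re w -> Im z = Im w -> z = w.
Proof. destruct z, w; simpl; intros; subst; reflexivity. Qed.

Lemma Cmod_le_abs (z : C) : Cmod z <= Rabs (Re z) + Rabs (Im z).
Proof.
  destruct z as [a b]. simpl.
  replace (a, b) with ((RtoC a) + Ci * RtoC b)%C
    by (unfold Ci, RtoC, Cmult, Cplus; simpl; f_equal; ring).
  eapply Rle_trans; [apply Cmod_triangle|].
  rewrite Cmod_mult, Cmod_Ci, !Cmod_R. lra.
Qed.

Lemma im_le_Cmod (z : C) : Rabs (Im z) <= Cmod z.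
Proof.
  eapply Rle_trans; [|apply Rmax_Cmod]. apply Rmax_r.
Qed.

Lemma Cmod_sub_sym (z w : C) : Cmod (z - w) = Cmod (w - z).
Proof. rewrite <- Cmod_opp. f_equal. ring. Qed.

Lemma Cmod_triangle_sub (z w : C) : Cmod (z - w) <= Cmod z + Cmod w.
Proof. unfold Cminus. eapply Rle_trans; [apply Cmod_triangle|]. rewrite Cmod_opp. lra. Qed.

Lemma Cmod_triangle_rev (z w : C) : Cmod z - Cmod w <= Cmod (z - w).
Proof.
  assert (H : Cmod z <= Cmod (z - w) + Cmod w)
    by (eapply Rle_trans; [|apply Cmod_triangle]; apply Req_le; f_equal; ring).
  lra.
Qed.

Lemma Cmod_small_eq (z : C) : (forall eps, 0 < eps -> Cmod z <= eps) -> z = RtoC 0.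
Proof.
  intros H. apply Cmod_eq_0. destruct (Rle_or_lt (Cmod z) 0) as [h|h].
  - pose proof (Cmod_ge_0 z). lra.
  - specialize (H (Cmod z / 2)). lra.
Qed.

Lemma Cmod_RtoC_pos (r : R) : 0 <= r -> Cmod (RtoC r) = r.
Proof. intros. rewrite Cmod_R. apply Rabs_pos_eq; auto. Qed.

Lemma RtoC_neq0 (r : R) : r <> 0 -> RtoC r <> RtoC 0.
Proof. intros H E. apply H. apply RtoC_inj. exact E. Qed.

Lemma Re_RtoC (r : R) : Re (RtoC r) = r.
Proof. reflexivity. Qed.
Lemma Re_plus (z w : C) : Re (z + w)%C = Re z + Re w.
Proof. reflexivity. Qed.
Lemma Im_plus (z w : C) : Im (z + w)%C = Im z + Im w.
Proof. reflexivity. Qed.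
Lemma Re_opp (z : C) : Re (- z)%C = - Re z.
Proof. reflexivity. Qed.
Lemma Re_minus (z w : C) : Re (z - w)%C = Re z - Re w.
Proof. reflexivity. Qed.
Lemma Im_minus (z w : C) : Im (z - w)%C = Im z - Im w.
Proof. reflexivity. Qed.
Lemma Re_scalr (z : C) (r : R) : Re (z * RtoC r)%C = Re z * r.
Proof. unfold Re; simpl. ring. Qed.
Lemma Im_scalr (z : C) (r : R) : Im (z * RtoC r)%C = Im z * r.
Proof. unfold Im; simpl. ring. Qed.
Lemma Re_div2 (z : C) : Re (z / RtoC 2)%C = Re z / 2.
Proof. unfold Cdiv, Re; simpl. field. Qed.

Lemma cexp_plus (z w : C) : cexp (z + w) = (cexp z * cexp w)%C.
Proof.
  unfold cexp. destruct z as [a b], w as [c d]; simpl.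
  rewrite exp_plus, cos_plus, sin_plus.
  apply C_eq; simpl; ring.
Qed.

Lemma cexp_0 : cexp (RtoC 0) = RtoC 1.
Proof.
  unfold cexp; simpl. rewrite exp_0, cos_0, sin_0. apply C_eq; simpl; ring.
Qed.

Lemma Cmod_cexp (z : C) : Cmod (cexp z) = exp (Re z).
Proof.
  unfold cexp. rewrite Cmod_mult, Cmod_R, Rabs_pos_eq by (apply exp_ge0).
  replace (Cmod (cos (Im z), sin (Im z))) with 1; [ring|].
  unfold Cmod. cbn [fst snd]. symmetry. rewrite <- sqrt_1 at 1. f_equal.
  pose proof (sin2_cos2 (Im z)) as H. unfold Rsqr in H. simpl. lra.
Qed.

Lemma cexp_neq0 (z : C) : cexp z <> RtoC 0.
Proof. apply Cmod_gt_0. rewrite Cmod_cexp. apply exp_pos. Qed.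

Lemma cexp_opp (z : C) : cexp (- z) = (/ cexp z)%C.
Proof.
  assert (H : (cexp z * cexp (- z))%C = RtoC 1)
    by (rewrite <- cexp_plus, <- cexp_0; f_equal; ring).
  pose proof (cexp_neq0 z).
  replace (cexp (- z)) with (/ cexp z * (cexp z * cexp (- z)))%C by (field; auto).
  rewrite H. ring.
Qed.

Lemma cexp_RtoC (r : R) : cexp (RtoC r) = RtoC (exp r).
Proof. unfold cexp; simpl. rewrite cos_0, sin_0. apply C_eq; simpl; ring. Qed.

Lemma cexp_pow (z : C) (n : nat) : (cexp z ^ n)%C = cexp (RtoC (INR n) * z).
Proof.
  induction n as [|n IH].
  - simpl. rewrite <- cexp_0. f_equal. ring.
  - rewrite S_INR, RtoC_plus. simpl. rewrite IH, <- cexp_plus. f_equal. ring.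
Qed.

Lemma cpow_plus (x : R) (s t : C) : cpow x (s + t) = (cpow x s * cpow x t)%C.
Proof. unfold cpow. rewrite <- cexp_plus. f_equal. ring. Qed.

Lemma cpow_opp (x : R) (s : C) : cpow x (- s) = (/ cpow x s)%C.
Proof. unfold cpow. rewrite <- cexp_opp. f_equal. ring. Qed.

Lemma cpow_minus (x : R) (s t : C) : cpow x (s - t) = (cpow x s / cpow x t)%C.
Proof. unfold Cminus, Cdiv. rewrite cpow_plus, cpow_opp. reflexivity. Qed.

Lemma cpow_mult (x y : R) (s : C) : 0 < x -> 0 < y ->
  cpow (x * y) s = (cpow x s * cpow y s)%C.
Proof.
  intros. unfold cpow. rewrite <- cexp_plus, ln_mult by auto. f_equal.
  rewrite RtoC_plus. ring.
Qed.

Lemma cpow_neq0 (x : R) (s : C) : cpow x s <> RtoC 0.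
Proof. apply cexp_neq0. Qed.

Lemma cpow_inv (x : R) (s : C) : 0 < x -> cpow (/ x) s = (/ cpow x s)%C.
Proof.
  intros. unfold cpow. rewrite ln_Rinv by auto. rewrite <- cexp_opp. f_equal.
  rewrite RtoC_opp. ring.
Qed.

Lemma cpow_div (x y : R) (s : C) : 0 < x -> 0 < y ->
  cpow (x / y) s = (cpow x s / cpow y s)%C.
Proof.
  intros. unfold Rdiv. rewrite cpow_mult by (auto; apply Rinv_0_lt_compat; auto).
  rewrite cpow_inv by auto. reflexivity.
Qed.

Lemma cpow_1 (s : C) : cpow 1 s = RtoC 1.
Proof. unfold cpow. rewrite ln_1, <- cexp_0. f_equal. ring. Qed.

Lemma cpow_exp (u : R) (s : C) : cpow (exp u) s = cexp (s * RtoC u).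
Proof. unfold cpow. rewrite ln_exp. reflexivity. Qed.

Lemma Cmod_cpow (x : R) (s : C) : 0 < x -> Cmod (cpow x s) = Rpower x (Re s).
Proof.
  intros. unfold cpow, Rpower. rewrite Cmod_cexp. f_equal. rewrite Re_scalr. ring.
Qed.

Lemma cpow_RtoC (x r : R) : cpow x (RtoC r) = RtoC (Rpower x r).
Proof. unfold cpow, Rpower. rewrite <- RtoC_mult, cexp_RtoC. reflexivity. Qed.

Lemma cpow_INR (x : R) (n : nat) : 0 < x -> cpow x (RtoC (INR n)) = RtoC (x ^ n).
Proof. intros. rewrite cpow_RtoC, Rpower_pow by auto. reflexivity. Qed.

Lemma cpow_one (x : R) : 0 < x -> cpow x (RtoC 1) = RtoC x.
Proof. intros. rewrite cpow_RtoC, Rpower_1 by auto. reflexivity. Qed.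

(** * Second-order Taylor estimates for the real and complex exponential *)

Lemma exp_taylor1 (a : R) : 0 <= exp a - 1 - a <= a * a * exp (Rabs a).
Proof.
  split. { pose proof (exp_ineq1_le a). lra. }
  assert (h1 : exp a - 1 <= a * exp a).
  { pose proof (exp_ineq1_le (- a)) as h. pose proof (exp_pos a) as hp.
    rewrite exp_Ropp in h.
    assert (exp a * (1 + - a) <= exp a * / exp a) by (apply Rmult_le_compat_l; lra).
    rewrite Rinv_r in H by lra. nra. }
  destruct (Rle_or_lt 0 a) as [h|h].
  - rewrite Rabs_pos_eq by auto. nra.
  - assert (h2 : 1 - exp a <= - a) by (pose proof (exp_ineq1_le a); lra).
    assert (1 <= exp (Rabs a)) by (pose proof (exp_ineq1_le (Rabs a)); pose proof (Rabs_pos a); lra).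
    assert (exp a - 1 - a <= a * (exp a - 1)) by nra.
    assert (a * (exp a - 1) <= a * a) by nra.
    nra.
Qed.

Lemma sin_abs_le (x : R) : Rabs (sin x) <= Rabs x.
Proof.
  assert (H : forall y, 0 <= y -> Rabs (sin y) <= y).
  { intros y [hy|<-]; [|rewrite sin_0, Rabs_R0; lra].
    apply Rabs_le. split.
    - destruct (Rle_or_lt y 1) as [h|h].
      + assert (0 < sin y) by (apply sin_gt_0; pose proof PI2_1; lra). lra.
      + pose proof (SIN_bound y). lra.
    - left. apply sin_lt_x; auto. }
  destruct (Rle_or_lt 0 x) as [h|h].
  - rewrite (Rabs_pos_eq x) by auto. auto.
  - rewrite <- (Rabs_Ropp (sin x)), <- sin_neg, <- (Rabs_Ropp x), (Rabs_pos_eq (- x)) by lra.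
    apply H; lra.
Qed.

Lemma cos_sub1_le (x : R) : Rabs (cos x - 1) <= x * x / 2 /\ Rabs (cos x - 1) <= Rabs x.
Proof.
  assert (E : 1 - cos x = 2 * (sin (x / 2) * sin (x / 2))).
  { replace x with (2 * (x / 2)) at 1 by field. rewrite cos_2a_sin. ring. }
  assert (B : Rabs (sin (x/2)) <= Rabs x / 2).
  { eapply Rle_trans; [apply sin_abs_le|]. unfold Rdiv. rewrite Rabs_mult, (Rabs_pos_eq (/2)) by lra. lra. }
  pose proof (Rabs_pos (sin (x/2))). pose proof (Rabs_pos x).
  assert (S : sin (x/2) * sin (x/2) = Rabs (sin (x/2)) * Rabs (sin (x/2))).
  { rewrite <- Rabs_mult. symmetry. apply Rabs_pos_eq. apply Rle_0_sqr. }
  assert (X : x * x = Rabs x * Rabs x).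
  { rewrite <- Rabs_mult. symmetry. apply Rabs_pos_eq. apply Rle_0_sqr. }
  assert (Rabs (sin (x/2)) <= 1) by (apply Rabs_le; apply SIN_bound).
  rewrite Rabs_minus_sym, E, S, Rabs_pos_eq by nra. split; nra.
Qed.

Lemma sin_sub_le (x : R) : Rabs (sin x - x) <= x * x.
Proof.
  destruct (MVT_gen sin 0 x cos) as (c & hc & E).
  - intros y _. apply is_derive_sin.
  - intros y _. apply continuity_sin.
  - rewrite sin_0, !Rminus_0_r in E. rewrite E.
    replace (cos c * x - x) with ((cos c - 1) * x) by ring.
    rewrite Rabs_mult.
    assert (Rabs (cos c - 1) <= Rabs x).
    { eapply Rle_trans; [apply cos_sub1_le|].
      revert hc. unfold Rmin, Rmax, Rabs. repeat (destruct Rle_dec || destruct Rcase_abs); lra. }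
    pose proof (Rabs_pos x).
    replace (x * x) with (Rabs x * Rabs x) by (rewrite <- Rabs_mult; apply Rabs_pos_eq; apply Rle_0_sqr).
    nra.
Qed.

(** This quadratic remainder is the common source of the derivative of [cexp], of Mellin integrals
    in the exponent, and of Dirichlet series. Only uniformity in [w] matters, not the constant. *)
Lemma cexp_taylor1 (w : C) : Cmod (cexp w - 1 - w) <= 3 * (Cmod w * Cmod w) * exp (Cmod w).
Proof.
  destruct w as [a b].
  set (e := cexp (0, b)).
  assert (He : e = (cos b, sin b)).
  { unfold e, cexp; simpl. rewrite exp_0. apply C_eq; simpl; ring. }
  (* Modulus and phase are separated: the real remainder multiplies the phase [e], the phase has its
     own second-order remainder, and the cross term [a (e - 1)] is of order [|a b|]. *)
  assert (E : (cexp (a, b) - 1 - (a, b) = RtoC (exp a - 1 - a) * e + ((e - 1 - (0, b)) + RtoC a * (e - 1)))%C).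
  { replace (cexp (a, b)) with (RtoC (exp a) * e)%C.
    - rewrite He. apply C_eq; simpl; ring.
    - rewrite He. reflexivity. }
  assert (he : Cmod e = 1) by (unfold e; rewrite Cmod_cexp; simpl; apply exp_0).
  assert (M : Cmod (a, b) * Cmod (a, b) = a * a + b * b).
  { pose proof (Cmod2_alt (a, b)) as h. simpl in h. ring_simplify. ring_simplify in h. simpl. lra. }
  assert (ha : Rabs a <= Cmod (a, b)) by apply (re_le_Cmod (a, b)).
  assert (hx : exp (Rabs a) <= exp (Cmod (a, b)))
    by (destruct ha as [h|h]; [left; apply exp_increasing; auto|rewrite h; lra]).
  assert (hx1 : 1 <= exp (Rabs a)) by (pose proof (exp_ineq1_le (Rabs a)); pose proof (Rabs_pos a); lra).
  rewrite E.
  eapply Rle_trans; [apply Cmod_triangle|].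
  rewrite Cmod_mult, he, Cmod_R, Rmult_1_r.
  assert (h1 : Cmod (e - 1 - (0, b) + RtoC a * (e - 1)) <= 2 * (b * b) + 2 * (Rabs a * Rabs b)).
  { eapply Rle_trans; [apply Cmod_triangle|]. rewrite Cmod_mult, Cmod_R.
    assert (Cmod (e - 1 - (0, b)) <= 2 * (b * b)).
    { rewrite He. eapply Rle_trans; [apply Cmod_le_abs|]. simpl.
      replace (cos b + - (1) + - 0) with (cos b - 1) by ring.
      replace (sin b + - 0 + - b) with (sin b - b) by ring.
      pose proof (cos_sub1_le b) as [? _]. pose proof (sin_sub_le b).
      pose proof (Rle_0_sqr b) as h0. unfold Rsqr in h0. lra. }
    assert (Cmod (e - 1) <= 2 * Rabs b).
    { rewrite He. eapply Rle_trans; [apply Cmod_le_abs|]. simpl.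
      replace (cos b + - (1)) with (cos b - 1) by ring.
      replace (sin b + - 0) with (sin b) by ring.
      pose proof (cos_sub1_le b) as [_ ?]. pose proof (sin_abs_le b). lra. }
    pose proof (Rabs_pos a). nra. }
  pose proof (exp_taylor1 a) as [p1 p2].
  rewrite (Rabs_pos_eq (exp a - 1 - a)) by auto.
  assert (h2 : 2 * (Rabs a * Rabs b) <= a * a + b * b).
  { assert (Rabs a * Rabs a = a * a) by (rewrite <- Rabs_mult; apply Rabs_pos_eq, Rle_0_sqr).
    assert (Rabs b * Rabs b = b * b) by (rewrite <- Rabs_mult; apply Rabs_pos_eq, Rle_0_sqr).
    pose proof (Rle_0_sqr (Rabs a - Rabs b)) as h0. unfold Rsqr in h0. nra. }
  rewrite M. pose proof (Rle_0_sqr a) as ha0. pose proof (Rle_0_sqr b) as hb0. unfold Rsqr in *. nra.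
Qed.

(** * Complex derivatives in epsilon-delta form *)

Definition cdiff (f : C -> C) (z l : C) : Prop :=
  forall eps, 0 < eps -> exists d, 0 < d /\
    forall w, Cmod (w - z) < d -> Cmod (f w - f z - l * (w - z)) <= eps * Cmod (w - z).

(** [holo_at] is stated with filters and hides the value of the derivative; [cdiff] names it, which
    the chain rules, the primitive and the uniqueness of the derivative all require. *)
Lemma holo_cdiff (f : C -> C) (z : C) : holo_at f z <-> exists l, cdiff f z l.
Proof.
  split.
  - intros [l [_ H]]. exists l. intros eps he.
    destruct (H z (fun P h => h) (mkposreal eps he)) as [d Hd].
    exists d. split; [apply cond_pos|]. intros w hw.
    specialize (Hd w hw). simpl in Hd.
    eapply Rle_trans; [|exact Hd]. apply Req_le.
    change (Cmod (f w - f z - l * (w - z)) = Cmod (f w - f z - (w - z) * l)).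
    f_equal. ring.
  - intros [l H]. exists l. split; [apply is_linear_scal_l|].
    intros x hx. apply (@is_filter_lim_locally_unique C_AbsRing (AbsRing_NormedModule C_AbsRing) z x) in hx. subst x.
    intros [eps he]. destruct (H eps he) as (d & hd & Hd).
    exists (mkposreal d hd). intros w hw. specialize (Hd w hw). simpl.
    eapply Rle_trans; [|exact Hd]. apply Req_le.
    change (Cmod (f w - f z - (w - z) * l) = Cmod (f w - f z - l * (w - z))).
    f_equal. ring.
Qed.

Definition ccontin (f : C -> C) (z : C) : Prop :=
  forall eps, 0 < eps -> exists d, 0 < d /\ forall w, Cmod (w - z) < d -> Cmod (f w - f z) < eps.

Lemma cdiff_contin (f : C -> C) (z l : C) : cdiff f z l -> ccontin f z.
Proof.
  intros H eps he. destruct (H 1 Rlt_0_1) as (d & hd & Hd).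
  pose proof (Cmod_ge_0 l).
  exists (Rmin d (eps / (2 + Cmod l))). split.
  { apply Rmin_pos; auto. apply Rdiv_lt_0_compat; lra. }
  intros w hw.
  assert (h1 := Rlt_le_trans _ _ _ hw (Rmin_l _ _)).
  assert (h2 := Rlt_le_trans _ _ _ hw (Rmin_r _ _)).
  specialize (Hd w h1).
  assert (h3 : Cmod (f w - f z) <= (1 + Cmod l) * Cmod (w - z)).
  { replace (f w - f z)%C with ((f w - f z - l * (w - z)) + l * (w - z))%C by ring.
    eapply Rle_trans; [apply Cmod_triangle|]. rewrite Cmod_mult. lra. }
  apply (Rmult_lt_compat_l (2 + Cmod l)) in h2; [|lra].
  replace ((2 + Cmod l) * (eps / (2 + Cmod l))) with eps in h2 by (field; lra).
  pose proof (Cmod_ge_0 (w - z)). nra.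
Qed.

Lemma holo_contin (f : C -> C) (z : C) : holo_at f z -> ccontin f z.
Proof. intros H. apply holo_cdiff in H. destruct H as [l H]. eapply cdiff_contin; eauto. Qed.

Lemma cdiff_const (c z : C) : cdiff (fun _ => c) z (RtoC 0).
Proof.
  intros eps he. exists 1. split; [lra|]. intros w _.
  replace (c - c - 0 * (w - z))%C with (RtoC 0) by ring. rewrite Cmod_0.
  pose proof (Cmod_ge_0 (w - z)). nra.
Qed.

Lemma cdiff_id (z : C) : cdiff (fun w => w) z (RtoC 1).
Proof.
  intros eps he. exists 1. split; [lra|]. intros w _.
  replace (w - z - 1 * (w - z))%C with (RtoC 0) by ring. rewrite Cmod_0.
  pose proof (Cmod_ge_0 (w - z)). nra.
Qed.

Lemma cdiff_plus (f g : C -> C) (z l m : C) :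
  cdiff f z l -> cdiff g z m -> cdiff (fun w => f w + g w)%C z (l + m).
Proof.
  intros Hf Hg eps he.
  destruct (Hf (eps/2)) as (d1 & hd1 & H1); [lra|].
  destruct (Hg (eps/2)) as (d2 & hd2 & H2); [lra|].
  exists (Rmin d1 d2). split; [apply Rmin_pos; auto|]. intros w hw.
  specialize (H1 w (Rlt_le_trans _ _ _ hw (Rmin_l _ _))).
  specialize (H2 w (Rlt_le_trans _ _ _ hw (Rmin_r _ _))).
  replace (f w + g w - (f z + g z) - (l + m) * (w - z))%C with
    ((f w - f z - l * (w - z)) + (g w - g z - m * (w - z)))%C by ring.
  eapply Rle_trans; [apply Cmod_triangle|]. lra.
Qed.

Lemma cdiff_comp (f g : C -> C) (z l m : C) :
  cdiff f z l -> cdiff g (f z) m -> cdiff (fun w => g (f w)) z (m * l).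
Proof.
  intros Hf Hg eps he.
  pose proof (Cmod_ge_0 l) as hl. pose proof (Cmod_ge_0 m) as hm.
  set (e1 := eps / (2 * (1 + Cmod l))).
  set (e2 := eps / (2 * (1 + Cmod m))).
  assert (he1 : 0 < e1) by (apply Rdiv_lt_0_compat; lra).
  assert (he2 : 0 < e2) by (apply Rdiv_lt_0_compat; lra).
  destruct (Hg e1 he1) as (d1 & hd1 & H1).
  destruct (Hf (Rmin 1 e2)) as (d2 & hd2 & H2); [apply Rmin_pos; lra|].
  destruct (cdiff_contin _ _ _ Hf d1 hd1) as (d3 & hd3 & H3).
  exists (Rmin d2 d3). split; [apply Rmin_pos; auto|]. intros w hw.
  specialize (H2 w (Rlt_le_trans _ _ _ hw (Rmin_l _ _))).
  specialize (H3 w (Rlt_le_trans _ _ _ hw (Rmin_r _ _))).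
  specialize (H1 (f w) H3).
  pose proof (Cmod_ge_0 (w - z)) as hw0.
  pose proof (Rmin_l 1 e2). pose proof (Rmin_r 1 e2).
  assert (A : Cmod (f w - f z) <= (1 + Cmod l) * Cmod (w - z)).
  { replace (f w - f z)%C with ((f w - f z - l * (w - z)) + l * (w - z))%C by ring.
    eapply Rle_trans; [apply Cmod_triangle|]. rewrite Cmod_mult. nra. }
  replace (g (f w) - g (f z) - m * l * (w - z))%C with
    ((g (f w) - g (f z) - m * (f w - f z)) + m * (f w - f z - l * (w - z)))%C by ring.
  eapply Rle_trans; [apply Cmod_triangle|]. rewrite Cmod_mult.
  assert (B1 : e1 * Cmod (f w - f z) <= eps / 2 * Cmod (w - z)).
  { eapply Rle_trans; [apply Rmult_le_compat_l; [lra|exact A]|].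
    unfold e1. right. field. lra. }
  assert (B2 : Cmod m * Cmod (f w - f z - l * (w - z)) <= eps / 2 * Cmod (w - z)).
  { apply Rle_trans with (Cmod m * (e2 * Cmod (w - z))).
    - apply Rmult_le_compat_l; auto. nra.
    - replace (eps / 2) with ((1 + Cmod m) * e2) by (unfold e2; field; lra). nra. }
  lra.
Qed.

Lemma cdiff_ext_loc (f g : C -> C) (z l : C) (d : R) :
  0 < d -> (forall w, Cmod (w - z) < d -> g w = f w) -> cdiff f z l -> cdiff g z l.
Proof.
  intros hd E H eps he. destruct (H eps he) as (d1 & hd1 & H1).
  exists (Rmin d d1). split; [apply Rmin_pos; auto|]. intros w hw.
  specialize (H1 w (Rlt_le_trans _ _ _ hw (Rmin_r _ _))).
  rewrite (E w (Rlt_le_trans _ _ _ hw (Rmin_l _ _))).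
  rewrite (E z); auto. replace (z - z)%C with (RtoC 0) by ring. rewrite Cmod_0; auto.
Qed.

Lemma cdiff_scal (f : C -> C) (c z l : C) : cdiff f z l -> cdiff (fun w => c * f w)%C z (c * l).
Proof.
  intros H eps he. pose proof (Cmod_ge_0 c) as hc.
  destruct (H (eps / (1 + Cmod c))) as (d & hd & Hd); [apply Rdiv_lt_0_compat; lra|].
  exists d. split; auto. intros w hw. specialize (Hd w hw).
  replace (c * f w - c * f z - c * l * (w - z))%C with (c * (f w - f z - l * (w - z)))%C by ring.
  rewrite Cmod_mult. pose proof (Cmod_ge_0 (w - z)) as hw0.
  assert (h : eps / (1 + Cmod c) * (1 + Cmod c) = eps) by (field; lra).
  assert (0 < eps / (1 + Cmod c)) by (apply Rdiv_lt_0_compat; lra).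
  set (e := eps / (1 + Cmod c)) in *. apply Rle_trans with (Cmod c * (e * Cmod (w - z))).
  - apply Rmult_le_compat_l; auto.
  - rewrite <- h. nra.
Qed.

Lemma cdiff_sqr (z : C) : cdiff (fun w => w * w)%C z (RtoC 2 * z).
Proof.
  intros eps he. exists eps. split; auto. intros w hw.
  replace (w * w - z * z - RtoC 2 * z * (w - z))%C with ((w - z) * (w - z))%C by ring.
  rewrite Cmod_mult. pose proof (Cmod_ge_0 (w - z)). nra.
Qed.

(* Polarisation reduces products to squares. *)
Lemma cdiff_mult (f g : C -> C) (z l m : C) :
  cdiff f z l -> cdiff g z m -> cdiff (fun w => f w * g w)%C z (l * g z + f z * m).
Proof.
  intros Hf Hg.
  assert (H1 := cdiff_comp _ _ _ _ _ (cdiff_plus _ _ _ _ _ Hf Hg) (cdiff_sqr _)).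
  assert (H2 := cdiff_comp _ _ _ _ _ (cdiff_plus _ _ _ _ _ Hf (cdiff_scal _ (RtoC (-1)) _ _ Hg)) (cdiff_sqr _)).
  assert (H3 := cdiff_scal _ (RtoC (1/4)) _ _ (cdiff_plus _ _ _ _ _ H1 (cdiff_scal _ (RtoC (-1)) _ _ H2))).
  simpl in H3.
  assert (e4 : (RtoC (1/4) * RtoC 4 = 1)%C) by (rewrite <- RtoC_mult; f_equal; field).
  assert (em : RtoC (-1) = (- RtoC 1)%C) by (rewrite <- RtoC_opp; reflexivity).
  assert (e2 : RtoC 4 = (RtoC 2 + RtoC 2)%C) by (rewrite <- RtoC_plus; f_equal; ring).
  assert (e22 : RtoC 2 = (1 + 1)%C) by (rewrite <- RtoC_plus; f_equal; ring).
  match type of H3 with cdiff _ _ ?L => replace (l * g z + f z * m)%C with L end.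
  - eapply cdiff_ext_loc; [apply Rlt_0_1| |exact H3]. intros w _. simpl.
    rewrite em. transitivity (RtoC (1/4) * RtoC 4 * (f w * g w))%C; [rewrite e4; ring|].
    rewrite e2, e22. ring.
  - rewrite em. transitivity (RtoC (1/4) * RtoC 4 * (l * g z + f z * m))%C; [|rewrite e4; ring].
    rewrite e2, e22. ring.
Qed.

Lemma cdiff_inv (z : C) : z <> RtoC 0 -> cdiff (fun w => / w)%C z (- / (z * z)).
Proof.
  intros hz eps he. pose proof (proj1 (Cmod_gt_0 z) hz) as hm.
  set (M := Cmod z) in *.
  exists (Rmin (M / 2) (eps * (M * M * M) / 2)). split.
  { apply Rmin_pos; [lra|]. apply Rdiv_lt_0_compat; [|lra]. repeat apply Rmult_lt_0_compat; auto. }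
  intros w hw.
  assert (h1 := Rlt_le_trans _ _ _ hw (Rmin_l _ _)).
  assert (h2 := Rlt_le_trans _ _ _ hw (Rmin_r _ _)).
  assert (hw1 : M / 2 <= Cmod w).
  { pose proof (Cmod_triangle_rev z (z - w)) as h.
    replace (z - (z - w))%C with w in h by ring. rewrite (Cmod_sub_sym z w) in h. fold M in h. lra. }
  assert (hw0 : w <> RtoC 0) by (apply Cmod_gt_0; lra).
  replace (/ w - / z - - / (z * z) * (w - z))%C with ((w - z) * (w - z) * (/ (z * z) * / w))%C
    by (field; auto).
  assert (hzz : (z * z)%C <> RtoC 0) by (apply Cmult_neq_0; auto).
  rewrite !Cmod_mult, !Cmod_inv, Cmod_mult by auto. fold M.
  assert (hi : / Cmod w <= 2 / M).
  { replace (2 / M) with (/ (M / 2)) by (field; lra). apply Rinv_le_contravar; lra. }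
  pose proof (Cmod_ge_0 (w - z)) as hd0.
  assert (hi0 : 0 < / (M * M)) by (apply Rinv_0_lt_compat; nra).
  apply Rle_trans with (Cmod (w - z) * Cmod (w - z) * (/ (M * M) * (2 / M))).
  - apply Rmult_le_compat_l; [nra|]. apply Rmult_le_compat_l; lra.
  - replace (/ (M * M) * (2 / M)) with (2 / (M * M * M)) by (field; lra).
    assert (h3 : Cmod (w - z) * (2 / (M * M * M)) <= eps).
    { assert (hmm : 0 < M * M * M) by (repeat apply Rmult_lt_0_compat; auto).
      apply (Rmult_le_reg_r (M * M * M / 2)); [lra|].
      replace (Cmod (w - z) * (2 / (M * M * M)) * (M * M * M / 2)) with (Cmod (w - z)) by (field; lra).
      lra. }
    nra.
Qed.

Lemma cdiff_cexp (z : C) : cdiff cexp z (cexp z).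
Proof.
  intros eps he. set (M := Cmod (cexp z)).
  assert (hM : 0 < M) by (unfold M; rewrite Cmod_cexp; apply exp_pos).
  pose proof (exp_pos 1) as hE.
  exists (Rmin 1 (eps / (3 * M * exp 1))). split.
  { apply Rmin_pos; [lra|]. apply Rdiv_lt_0_compat; auto. repeat apply Rmult_lt_0_compat; lra. }
  intros w hw.
  assert (h1 := Rlt_le_trans _ _ _ hw (Rmin_l _ _)).
  assert (h2 := Rlt_le_trans _ _ _ hw (Rmin_r _ _)).
  replace (cexp w) with (cexp z * cexp (w - z))%C by (rewrite <- cexp_plus; f_equal; ring).
  replace (cexp z * cexp (w - z) - cexp z - cexp z * (w - z))%C
    with (cexp z * (cexp (w - z) - 1 - (w - z)))%C by ring.
  rewrite Cmod_mult. fold M.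
  pose proof (cexp_taylor1 (w - z)) as h.
  pose proof (Cmod_ge_0 (w - z)) as hd0.
  assert (hx : exp (Cmod (w - z)) <= exp 1) by (left; apply exp_increasing; auto).
  set (x := Cmod (w - z)) in *.
  apply Rle_trans with (M * (3 * (x * x) * exp 1)).
  - apply Rmult_le_compat_l; [lra|]. eapply Rle_trans; [exact h|]. apply Rmult_le_compat_l; nra.
  - assert (h3 : x * (3 * M * exp 1) <= eps).
    { apply (Rmult_lt_compat_r (3 * M * exp 1)) in h2; [|repeat apply Rmult_lt_0_compat; lra].
      replace (eps / (3 * M * exp 1) * (3 * M * exp 1)) with eps in h2 by (field; lra). lra. }
    replace (M * (3 * (x * x) * exp 1)) with (x * (3 * M * exp 1) * x) by ring.
    apply Rmult_le_compat_r; auto.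
Qed.

Lemma holo_const (c z : C) : holo_at (fun _ => c) z.
Proof. apply holo_cdiff. eexists. apply cdiff_const. Qed.
Lemma holo_id (z : C) : holo_at (fun w => w) z.
Proof. apply holo_cdiff. eexists. apply cdiff_id. Qed.
Lemma holo_plus (f g : C -> C) (z : C) :
  holo_at f z -> holo_at g z -> holo_at (fun w => f w + g w)%C z.
Proof. rewrite !holo_cdiff. intros [l ?] [m ?]. eexists. apply cdiff_plus; eauto. Qed.
Lemma holo_mult (f g : C -> C) (z : C) :
  holo_at f z -> holo_at g z -> holo_at (fun w => f w * g w)%C z.
Proof. rewrite !holo_cdiff. intros [l ?] [m ?]. eexists. apply cdiff_mult; eauto. Qed.
Lemma holo_comp (f g : C -> C) (z : C) :
  holo_at f z -> holo_at g (f z) -> holo_at (fun w => g (f w)) z.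
Proof. rewrite !holo_cdiff. intros [l ?] [m ?]. eexists. eapply cdiff_comp; eauto. Qed.
Lemma holo_ext_loc (f g : C -> C) (z : C) (d : R) :
  0 < d -> (forall w, Cmod (w - z) < d -> g w = f w) -> holo_at f z -> holo_at g z.
Proof. rewrite !holo_cdiff. intros hd E [l ?]. exists l. eapply cdiff_ext_loc; eauto. Qed.
Lemma holo_ext (f g : C -> C) (z : C) : (forall w, g w = f w) -> holo_at f z -> holo_at g z.
Proof. intros E. apply (holo_ext_loc _ _ _ 1); auto. lra. Qed.
Lemma holo_opp (f : C -> C) (z : C) : holo_at f z -> holo_at (fun w => - f w)%C z.
Proof.
  intros H. apply (holo_ext (fun w => RtoC (-1) * f w)%C).
  - intros. replace (RtoC (-1)) with (- RtoC 1)%C by (rewrite <- RtoC_opp; reflexivity). ring.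
  - apply holo_mult; auto. apply holo_const.
Qed.
Lemma holo_minus (f g : C -> C) (z : C) :
  holo_at f z -> holo_at g z -> holo_at (fun w => f w - g w)%C z.
Proof. intros. apply holo_plus; auto. apply holo_opp; auto. Qed.
Lemma holo_inv (f : C -> C) (z : C) : f z <> RtoC 0 -> holo_at f z -> holo_at (fun w => / f w)%C z.
Proof.
  intros h H. apply (holo_comp f (fun w => / w)%C); auto.
  apply holo_cdiff. eexists. apply cdiff_inv; auto.
Qed.
Lemma holo_div (f g : C -> C) (z : C) : g z <> RtoC 0 -> holo_at f z -> holo_at g z ->
  holo_at (fun w => f w / g w)%C z.
Proof. intros. apply holo_mult; auto. apply holo_inv; auto. Qed.
Lemma holo_cexp (f : C -> C) (z : C) : holo_at f z -> holo_at (fun w => cexp (f w)) z.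
Proof. intros. apply (holo_comp f cexp); auto. apply holo_cdiff. eexists. apply cdiff_cexp. Qed.
Lemma holo_cpow (x : R) (f : C -> C) (z : C) : holo_at f z -> holo_at (fun w => cpow x (f w)) z.
Proof. intros. apply holo_cexp, holo_mult; auto. apply holo_const. Qed.
Ltac holo := repeat first
  [ assumption
  | match goal with
    | |- holo_at (fun _ => ?c) ?z => exact (holo_const c z)
    | |- holo_at (fun w => w) ?z => exact (holo_id z)
    | |- holo_at (fun w => Cplus (@?f w) (@?g w)) ?z => apply (holo_plus f g z)
    | |- holo_at (fun w => Cminus (@?f w) (@?g w)) ?z => apply (holo_minus f g z)
    | |- holo_at (fun w => Copp (@?f w)) ?z => apply (holo_opp f z)
    | |- holo_at (fun w => Cmult (@?f w) (@?g w)) ?z => apply (holo_mult f g z)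
    | |- holo_at (fun w => cexp (@?f w)) ?z => apply (holo_cexp f z)
    | |- holo_at (fun w => cpow ?x (@?f w)) ?z => apply (holo_cpow x f z)
    end ].

Lemma holo_ccos (f : C -> C) (z : C) : holo_at f z -> holo_at (fun w => ccos (f w)) z.
Proof.
  intros. unfold ccos. apply holo_div.
  - apply RtoC_neq0; lra.
  - holo.
  - holo.
Qed.

Definition csin (z : C) : C := ((cexp (Ci * z) - cexp (- (Ci * z))) / (RtoC 2 * Ci))%C.

Lemma Ci_neq0 : Ci <> RtoC 0.
Proof. intros E. injection E. lra. Qed.
Lemma C2_neq0 : RtoC 2 <> RtoC 0.
Proof. apply RtoC_neq0; lra. Qed.

Lemma holo_csin (f : C -> C) (z : C) : holo_at f z -> holo_at (fun w => csin (f w)) z.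
Proof.
  intros. unfold csin. apply holo_div.
  - apply Cmult_neq_0; [apply C2_neq0|apply Ci_neq0].
  - holo.
  - holo.
Qed.

Ltac holo ::= repeat first
  [ assumption
  | match goal with
    | |- holo_at (fun _ => ?c) ?z => exact (holo_const c z)
    | |- holo_at (fun w => w) ?z => exact (holo_id z)
    | |- holo_at (fun w => Cplus (@?f w) (@?g w)) ?z => apply (holo_plus f g z)
    | |- holo_at (fun w => Cminus (@?f w) (@?g w)) ?z => apply (holo_minus f g z)
    | |- holo_at (fun w => Copp (@?f w)) ?z => apply (holo_opp f z)
    | |- holo_at (fun w => Cmult (@?f w) (@?g w)) ?z => apply (holo_mult f g z)
    | |- holo_at (fun w => Cdiv (@?f w) (@?g w)) ?z => apply (holo_div f g z)
    | |- holo_at (fun w => cexp (@?f w)) ?z => apply (holo_cexp f z)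
    | |- holo_at (fun w => cpow ?x (@?f w)) ?z => apply (holo_cpow x f z)
    | |- holo_at (fun w => ccos (@?f w)) ?z => apply (holo_ccos f z)
    | |- holo_at (fun w => csin (@?f w)) ?z => apply (holo_csin f z)
    end ].

(** * Complex-valued functions of a real variable *)

Definition rcont (f : R -> C) (t : R) : Prop :=
  forall eps, 0 < eps -> exists d, 0 < d /\ forall s, Rabs (s - t) < d -> Cmod (f s - f t) < eps.

(** The uniform structure of [C] is that of a product, so its balls are squares, and a square of
    half side [eps] lies only in the disc of radius [sqrt 2 * eps]. Working with [rcont] keeps this
    factor out of later estimates. *)
Lemma rcont_continuous (f : R -> C) (t : R) :
  rcont f t <-> @continuous R_UniformSpace C_R_NormedModule f t.
Proof.
  split.
  - intros H. apply filterlim_locally. intros [eps he].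
    destruct (H eps he) as (d & hd & Hd). exists (mkposreal d hd). intros s hs.
    apply C_NormedModule_mixin_compat1. apply (Hd s). exact hs.
  - intros H eps he.
    assert (he' : 0 < eps / sqrt 2) by (apply Rdiv_lt_0_compat; auto; apply sqrt_lt_R0; lra).
    apply filterlim_locally with (eps := mkposreal _ he') in H. destruct H as [d Hd].
    exists d. split; [apply cond_pos|]. intros s hs.
    specialize (Hd s hs). apply C_NormedModule_mixin_compat2 in Hd. simpl in Hd.
    assert (0 < sqrt 2) by (apply sqrt_lt_R0; lra).
    replace (sqrt 2 * (eps / sqrt 2)) with eps in Hd by (field; lra). exact Hd.
Qed.

Lemma rcont_const (c : C) (t : R) : rcont (fun _ => c) t.
Proof.
  intros eps he. exists 1. split; [lra|]. intros.
  replace (c - c)%C with (RtoC 0) by ring. rewrite Cmod_0; auto.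
Qed.

Lemma rcont_RtoC (f : R -> R) (t : R) : continuous f t -> rcont (fun s => RtoC (f s)) t.
Proof.
  intros H eps he. apply filterlim_locally with (eps := mkposreal _ he) in H. destruct H as [d Hd].
  exists d. split; [apply cond_pos|]. intros s hs. specialize (Hd s hs).
  rewrite <- RtoC_minus, Cmod_R. exact Hd.
Qed.

Lemma rcont_plus (f g : R -> C) (t : R) : rcont f t -> rcont g t -> rcont (fun s => f s + g s)%C t.
Proof.
  intros Hf Hg eps he.
  destruct (Hf (eps/2)) as (d1 & hd1 & H1); [lra|].
  destruct (Hg (eps/2)) as (d2 & hd2 & H2); [lra|].
  exists (Rmin d1 d2). split; [apply Rmin_pos; auto|]. intros s hs.
  specialize (H1 s (Rlt_le_trans _ _ _ hs (Rmin_l _ _))).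
  specialize (H2 s (Rlt_le_trans _ _ _ hs (Rmin_r _ _))).
  replace (f s + g s - (f t + g t))%C with ((f s - f t) + (g s - g t))%C by ring.
  eapply Rle_lt_trans; [apply Cmod_triangle|]. lra.
Qed.

Lemma rcont_comp (f : R -> C) (g : C -> C) (t : R) : rcont f t -> ccontin g (f t) -> rcont (fun s => g (f s)) t.
Proof.
  intros Hf Hg eps he. destruct (Hg eps he) as (d & hd & H).
  destruct (Hf d hd) as (d1 & hd1 & H1). exists d1. split; auto.
Qed.

Lemma rcont_comp_r (f : R -> C) (g : R -> R) (t : R) : continuous g t -> rcont f (g t) -> rcont (fun s => f (g s)) t.
Proof.
  intros Hg Hf eps he. destruct (Hf eps he) as (d & hd & H).
  apply filterlim_locally with (eps := mkposreal _ hd) in Hg. destruct Hg as [d1 H1].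
  exists d1. split; [apply cond_pos|]. intros s hs. apply H. exact (H1 s hs).
Qed.

Lemma rcont_scal (c : C) (f : R -> C) (t : R) : rcont f t -> rcont (fun s => c * f s)%C t.
Proof.
  intros. apply (rcont_comp f (fun w => c * w)%C); auto.
  apply holo_contin. holo.
Qed.

Lemma rcont_opp (f : R -> C) (t : R) : rcont f t -> rcont (fun s => - f s)%C t.
Proof.
  intros. apply (rcont_comp f (fun w => - w)%C); auto. apply holo_contin. holo.
Qed.

Lemma rcont_minus (f g : R -> C) (t : R) : rcont f t -> rcont g t -> rcont (fun s => f s - g s)%C t.
Proof. intros. apply rcont_plus; auto. apply rcont_opp; auto. Qed.

(** Polarisation once more: squaring is holomorphic, hence continuous, and the product is a quarter
    of a difference of two squares. *)
Lemma rcont_mult (f g : R -> C) (t : R) : rcont f t -> rcont g t -> rcont (fun s => f s * g s)%C t.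
Proof.
  intros Hf Hg.
  assert (sq : forall h, rcont h t -> rcont (fun s => h s * h s)%C t).
  { intros h Hh. apply (rcont_comp h (fun w => w * w)%C); auto. apply holo_contin. holo. }
  assert (H := rcont_scal (RtoC (1/4)) _ _ (rcont_minus _ _ _ (sq _ (rcont_plus _ _ _ Hf Hg)) (sq _ (rcont_minus _ _ _ Hf Hg)))).
  assert (e : forall s, (RtoC (1/4) * ((f s + g s) * (f s + g s) - (f s - g s) * (f s - g s)) = f s * g s)%C).
  { intros s. transitivity ((RtoC (1/4) * (1 + 1 + 1 + 1)) * (f s * g s))%C; [ring|].
    replace (RtoC (1/4) * (1 + 1 + 1 + 1))%C with (RtoC 1); [ring|].
    rewrite <- !RtoC_plus, <- RtoC_mult. f_equal. field. }
  intros eps he. destruct (H eps he) as (d & hd & Hd). exists d. split; auto.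
  intros s hs. specialize (Hd s hs). rewrite !e in Hd. exact Hd.
Qed.

Lemma rcont_inv (f : R -> C) (t : R) : f t <> RtoC 0 -> rcont f t -> rcont (fun s => / f s)%C t.
Proof.
  intros. apply (rcont_comp f (fun w => / w)%C); auto. apply holo_contin.
  apply holo_inv; auto. apply holo_id.
Qed.

Lemma rcont_div (f g : R -> C) (t : R) : g t <> RtoC 0 -> rcont f t -> rcont g t -> rcont (fun s => f s / g s)%C t.
Proof. intros. apply rcont_mult; auto. apply rcont_inv; auto. Qed.

Lemma rcont_cexp (f : R -> C) (t : R) : rcont f t -> rcont (fun s => cexp (f s)) t.
Proof. intros. apply (rcont_comp f cexp); auto. apply holo_contin. apply (holo_cexp (fun z => z)). holo. Qed.

Lemma rcont_ext (f g : R -> C) (t : R) : (forall s, f s = g s) -> rcont f t -> rcont g t.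
Proof.
  intros E H eps he. destruct (H eps he) as (d & hd & Hd). exists d. split; auto.
  intros s hs. rewrite <- !E. auto.
Qed.

Lemma rcont_Cmod (f : R -> C) (t : R) : rcont f t -> continuous (fun s => Cmod (f s)) t.
Proof.
  intros H. apply filterlim_locally. intros [eps he]. destruct (H eps he) as (d & hd & Hd).
  exists (mkposreal d hd). intros s hs. specialize (Hd s hs).
  change (Rabs (Cmod (f s) - Cmod (f t)) < eps).
  eapply Rle_lt_trans; [|exact Hd]. apply Rabs_le. split.
  - pose proof (Cmod_triangle_rev (f t) (f s)). rewrite Cmod_sub_sym in H0. lra.
  - apply Cmod_triangle_rev.
Qed.

Ltac rcont := repeat first
  [ assumption
  | match goal with
    | |- rcont (fun _ => ?c) ?t => exact (rcont_const c t)
    | |- rcont (fun w => Cplus (@?f w) (@?g w)) ?t => apply (rcont_plus f g t)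
    | |- rcont (fun w => Cminus (@?f w) (@?g w)) ?t => apply (rcont_minus f g t)
    | |- rcont (fun w => Copp (@?f w)) ?t => apply (rcont_opp f t)
    | |- rcont (fun w => Cmult (@?f w) (@?g w)) ?t => apply (rcont_mult f g t)
    | |- rcont (fun w => Cdiv (@?f w) (@?g w)) ?t => apply (rcont_div f g t)
    | |- rcont (fun w => cexp (@?f w)) ?t => apply (rcont_cexp f t)
    | |- rcont (fun w => RtoC (@?f w)) ?t => apply (rcont_RtoC f t)
    end ].

Definition CInt (f : R -> C) (a b : R) : C := @RInt C_R_CompleteNormedModule f a b.

Definition rcont_on (f : R -> C) (a b : R) : Prop := forall t, Rmin a b <= t <= Rmax a b -> rcont f t.

Lemma CInt_correct (f : R -> C) (a b : R) : rcont_on f a b -> @is_RInt C_R_NormedModule f a b (CInt f a b).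
Proof.
  intros H. apply (@RInt_correct C_R_CompleteNormedModule).
  apply (@ex_RInt_continuous C_R_CompleteNormedModule). intros t ht. apply rcont_continuous. auto.
Qed.

Lemma CInt_unique (f : R -> C) (a b : R) (l : C) : @is_RInt C_R_NormedModule f a b l -> CInt f a b = l.
Proof. intros. apply (@is_RInt_unique C_R_CompleteNormedModule). auto. Qed.

(** The integral lives in a module over the reals, so its linearity covers real factors only; a
    complex factor is treated by components. *)
Lemma is_CInt_scal (f : R -> C) (a b : R) (c l : C) :
  @is_RInt C_R_NormedModule f a b l -> @is_RInt C_R_NormedModule (fun t => c * f t)%C a b (c * l)%C.
Proof.
  intros H. destruct c as [c1 c2], l as [l1 l2].
  assert (H1 := @is_RInt_fct_extend_fst R_NormedModule R_NormedModule _ _ _ _ H).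
  assert (H2 := @is_RInt_fct_extend_snd R_NormedModule R_NormedModule _ _ _ _ H).
  simpl in H1, H2.
  apply (@is_RInt_fct_extend_pair R_NormedModule R_NormedModule).
  - apply (@is_RInt_minus R_NormedModule); apply (@is_RInt_scal R_NormedModule); auto.
  - apply (@is_RInt_plus R_NormedModule); apply (@is_RInt_scal R_NormedModule); auto.
Qed.

Lemma CInt_scal (f : R -> C) (a b : R) (c : C) : rcont_on f a b ->
  CInt (fun t => c * f t)%C a b = (c * CInt f a b)%C.
Proof. intros. apply CInt_unique. apply is_CInt_scal. apply CInt_correct; auto. Qed.

Lemma CInt_plus (f g : R -> C) (a b : R) : rcont_on f a b -> rcont_on g a b ->
  CInt (fun t => f t + g t)%C a b = (CInt f a b + CInt g a b)%C.
Proof. intros. apply CInt_unique. apply (@is_RInt_plus C_R_NormedModule); apply CInt_correct; auto. Qed.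

Lemma CInt_minus (f g : R -> C) (a b : R) : rcont_on f a b -> rcont_on g a b ->
  CInt (fun t => f t - g t)%C a b = (CInt f a b - CInt g a b)%C.
Proof. intros. apply CInt_unique. apply (@is_RInt_minus C_R_NormedModule); apply CInt_correct; auto. Qed.

Lemma CInt_ext (f g : R -> C) (a b : R) : (forall t, Rmin a b < t < Rmax a b -> f t = g t) ->
  CInt f a b = CInt g a b.
Proof. intros. apply (@RInt_ext C_R_CompleteNormedModule). auto. Qed.

Lemma CInt_const (c : C) (a b : R) : CInt (fun _ => c) a b = (RtoC (b - a) * c)%C.
Proof.
  apply CInt_unique. rewrite <- scal_R_Cmult. apply (@is_RInt_const C_R_NormedModule).
Qed.

Lemma CInt_swap (f : R -> C) (a b : R) : rcont_on f a b -> CInt f b a = (- CInt f a b)%C.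
Proof.
  intros. apply CInt_unique. apply (@is_RInt_swap C_R_NormedModule). apply CInt_correct; auto.
Qed.

Lemma CInt_point (f : R -> C) (a : R) : CInt f a a = RtoC 0.
Proof. apply CInt_unique. apply (@is_RInt_point C_R_NormedModule). Qed.

Lemma CInt_Chasles (f : R -> C) (a b c : R) : rcont_on f a b -> rcont_on f b c ->
  (CInt f a b + CInt f b c)%C = CInt f a c.
Proof.
  intros. symmetry. apply CInt_unique.
  apply (@is_RInt_Chasles C_R_NormedModule _ a b c); apply CInt_correct; auto.
Qed.

Lemma CInt_le (f : R -> C) (g : R -> R) (a b l : R) : a <= b -> rcont_on f a b ->
  (forall t, a <= t <= b -> Cmod (f t) <= g t) -> is_RInt g a b l -> Cmod (CInt f a b) <= l.
Proof.
  intros hab Hf Hg Hl. rewrite Cmod_norm.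
  apply (@norm_RInt_le C_R_NormedModule f g a b); auto.
  - intros t ht. rewrite <- Cmod_norm. auto.
  - apply CInt_correct; auto.
Qed.

Lemma CInt_bound (f : R -> C) (M a b : R) : rcont_on f a b ->
  (forall t, Rmin a b <= t <= Rmax a b -> Cmod (f t) <= M) -> Cmod (CInt f a b) <= M * Rabs (b - a).
Proof.
  intros Hf HM.
  assert (K : forall a b, a <= b -> rcont_on f a b ->
     (forall t, Rmin a b <= t <= Rmax a b -> Cmod (f t) <= M) -> Cmod (CInt f a b) <= M * (b - a)).
  { clear. intros a b hab Hf HM. rewrite Rmult_comm.
    apply (CInt_le f (fun _ => M) a b (scal (b - a) M)); auto.
    - intros t ht. apply HM. rewrite Rmin_left, Rmax_right; auto.
    - apply (@is_RInt_const R_NormedModule). }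
  destruct (Rle_or_lt a b) as [h|h].
  - rewrite (Rabs_pos_eq (b - a)) by lra. auto.
  - rewrite Rabs_left by lra. rewrite CInt_swap.
    + rewrite Cmod_opp. replace (- (b - a)) with (a - b) by ring. apply K; [lra| |].
      * intros t ht. apply Hf. rewrite Rmin_comm, Rmax_comm. auto.
      * intros t ht. apply HM. rewrite Rmin_comm, Rmax_comm. auto.
    + intros t ht. apply Hf. rewrite Rmin_comm, Rmax_comm. auto.
Qed.

(** * Derivatives along the real line and the fundamental theorem of calculus *)

Definition rdiff (f : R -> C) (t : R) (l : C) : Prop :=
  forall eps, 0 < eps -> exists d, 0 < d /\
    forall s, Rabs (s - t) < d -> Cmod (f s - f t - l * RtoC (s - t)) <= eps * Rabs (s - t).

Lemma rdiff_is_derive (f : R -> C) (t : R) (l : C) :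
  rdiff f t l -> @is_derive R_AbsRing C_R_NormedModule f t l.
Proof.
  intros H. split; [apply is_linear_scal_l|].
  intros x hx. apply (@is_filter_lim_locally_unique R_AbsRing (AbsRing_NormedModule R_AbsRing) t x) in hx. subst x.
  intros [eps he]. destruct (H eps he) as (d & hd & Hd). exists (mkposreal d hd). intros s hs.
  specialize (Hd s hs). rewrite <- Cmod_norm. rewrite scal_R_Cmult.
  eapply Rle_trans; [|exact Hd]. apply Req_le.
  change (Cmod (f s - f t - RtoC (s - t) * l) = Cmod (f s - f t - l * RtoC (s - t))). f_equal. ring.
Qed.

Lemma rdiff_cdiff_comp (f : R -> C) (g : C -> C) (t : R) (l m : C) :
  rdiff f t l -> cdiff g (f t) m -> rdiff (fun s => g (f s)) t (m * l).
Proof.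
  intros Hf Hg eps he.
  pose proof (Cmod_ge_0 l) as hl. pose proof (Cmod_ge_0 m) as hm.
  set (e1 := eps / (2 * (1 + Cmod l))).
  set (e2 := eps / (2 * (1 + Cmod m))).
  assert (he1 : 0 < e1) by (apply Rdiv_lt_0_compat; lra).
  assert (he2 : 0 < e2) by (apply Rdiv_lt_0_compat; lra).
  destruct (Hg e1 he1) as (d1 & hd1 & H1).
  destruct (Hf (Rmin 1 e2)) as (d2 & hd2 & H2); [apply Rmin_pos; lra|].
  pose proof (Rmin_l 1 e2) as m1. pose proof (Rmin_r 1 e2) as m2.
  assert (hd3 : 0 < d1 / (1 + Cmod l)) by (apply Rdiv_lt_0_compat; lra).
  exists (Rmin d2 (d1 / (1 + Cmod l))). split; [apply Rmin_pos; auto|]. intros s hs.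
  specialize (H2 s (Rlt_le_trans _ _ _ hs (Rmin_l _ _))).
  assert (h3 := Rlt_le_trans _ _ _ hs (Rmin_r _ _)).
  pose proof (Rabs_pos (s - t)) as hw0.
  assert (A : Cmod (f s - f t) <= (1 + Cmod l) * Rabs (s - t)).
  { replace (f s - f t)%C with ((f s - f t - l * RtoC (s - t)) + l * RtoC (s - t))%C by ring.
    eapply Rle_trans; [apply Cmod_triangle|]. rewrite Cmod_mult, Cmod_R. nra. }
  assert (A' : Cmod (f s - f t) < d1).
  { eapply Rle_lt_trans; [exact A|].
    apply (Rmult_lt_compat_l (1 + Cmod l)) in h3; [|lra].
    replace ((1 + Cmod l) * (d1 / (1 + Cmod l))) with d1 in h3 by (field; lra). exact h3. }
  specialize (H1 (f s) A').
  replace (g (f s) - g (f t) - m * l * RtoC (s - t))%C with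
    ((g (f s) - g (f t) - m * (f s - f t)) + m * (f s - f t - l * RtoC (s - t)))%C by ring.
  eapply Rle_trans; [apply Cmod_triangle|]. rewrite Cmod_mult.
  assert (B1 : e1 * Cmod (f s - f t) <= eps / 2 * Rabs (s - t)).
  { eapply Rle_trans; [apply Rmult_le_compat_l; [lra|exact A]|].
    unfold e1. right. field. lra. }
  assert (B2 : Cmod m * Cmod (f s - f t - l * RtoC (s - t)) <= eps / 2 * Rabs (s - t)).
  { apply Rle_trans with (Cmod m * (e2 * Rabs (s - t))).
    - apply Rmult_le_compat_l; auto. nra.
    - replace (eps / 2) with ((1 + Cmod m) * e2) by (unfold e2; field; lra). nra. }
  lra.
Qed.

Lemma rdiff_affine (a b : C) (t : R) : rdiff (fun s => a + b * RtoC s)%C t b.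
Proof.
  intros eps he. exists 1. split; [lra|]. intros s _.
  replace (a + b * RtoC s - (a + b * RtoC t) - b * RtoC (s - t))%C with (RtoC 0)
    by (rewrite RtoC_minus; ring).
  rewrite Cmod_0. pose proof (Rabs_pos (s - t)). nra.
Qed.

Lemma rdiff_Re (f : R -> C) (t : R) (l : C) : rdiff f t l -> is_derive (fun s => Re (f s)) t (Re l).
Proof.
  intros H. split; [apply (@is_linear_scal_l R_AbsRing R_NormedModule)|].
  intros x hx. apply (@is_filter_lim_locally_unique R_AbsRing (AbsRing_NormedModule R_AbsRing) t x) in hx. subst x.
  intros [eps he]. destruct (H eps he) as (d & hd & Hd). exists (mkposreal d hd). intros s hs.
  specialize (Hd s hs). eapply Rle_trans; [|exact Hd].
  eapply Rle_trans; [|apply re_le_Cmod].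
  apply Req_le. change (Rabs (Re (f s) - Re (f t) - (s - t) * Re l) = Rabs (Re (f s - f t - l * RtoC (s - t)))).
  f_equal. rewrite !Re_minus, Re_scalr. ring.
Qed.

Lemma rdiff_Im (f : R -> C) (t : R) (l : C) : rdiff f t l -> is_derive (fun s => Im (f s)) t (Im l).
Proof.
  intros H. split; [apply (@is_linear_scal_l R_AbsRing R_NormedModule)|].
  intros x hx. apply (@is_filter_lim_locally_unique R_AbsRing (AbsRing_NormedModule R_AbsRing) t x) in hx. subst x.
  intros [eps he]. destruct (H eps he) as (d & hd & Hd). exists (mkposreal d hd). intros s hs.
  specialize (Hd s hs). eapply Rle_trans; [|exact Hd].
  eapply Rle_trans; [|apply im_le_Cmod].
  apply Req_le. change (Rabs (Im (f s) - Im (f t) - (s - t) * Im l) = Rabs (Im (f s - f t - l * RtoC (s - t)))).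
  f_equal. rewrite !Im_minus, Im_scalr. ring.
Qed.

Lemma rdiff_of_ReIm (f : R -> C) (t : R) (l : C) :
  is_derive (fun s => Re (f s)) t (Re l) -> is_derive (fun s => Im (f s)) t (Im l) -> rdiff f t l.
Proof.
  intros [_ H1] [_ H2] eps he.
  assert (he2 : 0 < eps / 2) by lra.
  destruct (H1 t (fun P h => h) (mkposreal _ he2)) as [d1 Hd1].
  destruct (H2 t (fun P h => h) (mkposreal _ he2)) as [d2 Hd2].
  exists (Rmin d1 d2). split; [apply Rmin_pos; apply cond_pos|]. intros s hs.
  specialize (Hd1 s (Rlt_le_trans _ _ _ hs (Rmin_l _ _))).
  specialize (Hd2 s (Rlt_le_trans _ _ _ hs (Rmin_r _ _))).
  eapply Rle_trans; [apply Cmod_le_abs|].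
  rewrite !Re_minus, Re_scalr, !Im_minus, Im_scalr.
  change (Rabs (Re (f s) - Re (f t) - (s - t) * Re l) <= eps / 2 * Rabs (s - t)) in Hd1.
  change (Rabs (Im (f s) - Im (f t) - (s - t) * Im l) <= eps / 2 * Rabs (s - t)) in Hd2.
  rewrite (Rmult_comm (Re l)), (Rmult_comm (Im l)). lra.
Qed.

Lemma CInt_FTC (f df : R -> C) (a b : R) :
  (forall t, Rmin a b <= t <= Rmax a b -> rdiff f t (df t)) -> rcont_on df a b ->
  CInt df a b = (f b - f a)%C.
Proof.
  intros H Hc. apply CInt_unique.
  apply (@is_RInt_derive C_R_CompleteNormedModule).
  - intros t ht. apply rdiff_is_derive. auto.
  - intros t ht. apply rcont_continuous. apply Hc; auto.
Qed.

Lemma CInt_Re (f : R -> C) (a b : R) : rcont_on f a b ->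
  is_RInt (fun t => Re (f t)) a b (Re (CInt f a b)).
Proof.
  intros H. exact (@is_RInt_fct_extend_fst R_NormedModule R_NormedModule _ _ _ _ (CInt_correct _ _ _ H)).
Qed.

Lemma CInt_Im (f : R -> C) (a b : R) : rcont_on f a b ->
  is_RInt (fun t => Im (f t)) a b (Im (CInt f a b)).
Proof.
  intros H. exact (@is_RInt_fct_extend_snd R_NormedModule R_NormedModule _ _ _ _ (CInt_correct _ _ _ H)).
Qed.

Lemma rdiff_zero_const (f : R -> C) (a b : R) : a <= b ->
  (forall t, a <= t <= b -> rdiff f t (RtoC 0)) -> f b = f a.
Proof.
  intros hab H.
  assert (E := CInt_FTC f (fun _ => RtoC 0) a b).
  rewrite CInt_const in E.
  assert (f b - f a = 0)%C.
  { rewrite <- E; [ring| |].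
    - intros t ht. apply H. rewrite Rmin_left, Rmax_right in ht; auto.
    - intros t _. apply rcont_const. }
  replace (f b) with ((f b - f a) + f a)%C by ring. rewrite H0. ring.
Qed.

(** * Cauchy's theorem and the identity theorem *)

Lemma cdiff_unique (f : C -> C) (z l m : C) : cdiff f z l -> cdiff f z m -> l = m.
Proof.
  intros Hl Hm.
  assert (E : (l - m)%C = RtoC 0).
  { apply Cmod_small_eq. intros eps he.
    destruct (Hl (eps/2)) as (d1 & hd1 & H1); [lra|].
    destruct (Hm (eps/2)) as (d2 & hd2 & H2); [lra|].
    set (h := Rmin d1 d2 / 2).
    assert (hh : 0 < Rmin d1 d2) by (apply Rmin_pos; auto).
    assert (hp : 0 < h) by (unfold h; lra).
    assert (e : (z + RtoC h - z)%C = RtoC h) by ring.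
    specialize (H1 (z + RtoC h)%C). specialize (H2 (z + RtoC h)%C).
    rewrite e, Cmod_RtoC_pos in H1, H2 by lra.
    pose proof (Rmin_l d1 d2). pose proof (Rmin_r d1 d2).
    assert (H1' := H1 ltac:(unfold h; lra)). assert (H2' := H2 ltac:(unfold h; lra)).
    assert (K : Cmod (l - m) * h <= eps * h).
    { rewrite <- (Cmod_RtoC_pos h) at 1 by lra. rewrite <- Cmod_mult.
      replace ((l - m) * RtoC h)%C with
        ((f (z + RtoC h) - f z - m * RtoC h) - (f (z + RtoC h) - f z - l * RtoC h))%C by ring.
      eapply Rle_trans; [apply Cmod_triangle_sub|]. lra. }
    apply Rmult_le_reg_r with h; auto. }
  replace l with ((l - m) + m)%C by ring. rewrite E. ring.
Qed.

(** The integral over the boundary of the rectangle, counterclockwise; opposite sides are merged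
    into one integrand because they share a parameter and carry opposite signs. *)
Definition rectint (f : C -> C) (a b c d : R) : C :=
  (CInt (fun t => f (t, c) - f (t, d)) a b + Ci * CInt (fun t => f (b, t) - f (a, t)) c d)%C.

Definition in_rect (a b c d : R) (z : C) : Prop := a <= Re z <= b /\ c <= Im z <= d.

Lemma ccontin_hline (f : C -> C) (y t : R) : ccontin f (t, y) -> rcont (fun s => f (s, y)) t.
Proof.
  intros H eps he. destruct (H eps he) as (d & hd & Hd). exists d. split; auto.
  intros s hs. apply Hd.
  eapply Rle_lt_trans; [apply Cmod_le_abs|]. simpl.
  replace (y + - y) with 0 by ring. rewrite Rabs_R0, Rplus_0_r. exact hs.
Qed.

Lemma ccontin_vline (f : C -> C) (x t : R) : ccontin f (x, t) -> rcont (fun s => f (x, s)) t.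
Proof.
  intros H eps he. destruct (H eps he) as (d & hd & Hd). exists d. split; auto.
  intros s hs. apply Hd.
  eapply Rle_lt_trans; [apply Cmod_le_abs|]. simpl.
  replace (x + - x) with 0 by ring. rewrite Rabs_R0, Rplus_0_l. exact hs.
Qed.

Lemma rectint_hsplit (f : C -> C) (a m b c d : R) : a <= m <= b -> c <= d ->
  (forall z, in_rect a b c d z -> ccontin f z) ->
  rectint f a b c d = (rectint f a m c d + rectint f m b c d)%C.
Proof.
  intros hm hcd H. unfold rectint.
  assert (Hh : forall y a' b', c <= y <= d -> a <= a' <= b' -> b' <= b -> rcont_on (fun t => f (t, y)) a' b').
  { intros y a' b' hy ha hb t ht. rewrite Rmin_left, Rmax_right in ht by lra.
    apply ccontin_hline, H. split; simpl; lra. }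
  assert (Hv : forall x, a <= x <= b -> rcont_on (fun t => f (x, t)) c d).
  { intros x hx t ht. rewrite Rmin_left, Rmax_right in ht by lra.
    apply ccontin_vline, H. split; simpl; lra. }
  rewrite <- (CInt_Chasles (fun t => f (t, c) - f (t, d))%C a m b).
  - assert (E : CInt (fun t => f (b, t) - f (a, t))%C c d =
      (CInt (fun t => f (m, t) - f (a, t)) c d + CInt (fun t => f (b, t) - f (m, t)) c d)%C).
    { rewrite <- CInt_plus.
      - apply CInt_ext. intros. ring.
      - intros t ht. apply rcont_minus; apply Hv; auto; lra.
      - intros t ht. apply rcont_minus; apply Hv; auto; lra. }
    rewrite E. ring.
  - intros t ht. apply rcont_minus; [apply (Hh c a m)|apply (Hh d a m)]; auto; lra.
  - intros t ht. apply rcont_minus; [apply (Hh c m b)|apply (Hh d m b)]; auto; lra.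
Qed.

Lemma rectint_vsplit (f : C -> C) (a b c m d : R) : a <= b -> c <= m <= d ->
  (forall z, in_rect a b c d z -> ccontin f z) ->
  rectint f a b c d = (rectint f a b c m + rectint f a b m d)%C.
Proof.
  intros hab hm H. unfold rectint.
  assert (Hh : forall y, c <= y <= d -> rcont_on (fun t => f (t, y)) a b).
  { intros y hy t ht. rewrite Rmin_left, Rmax_right in ht by lra.
    apply ccontin_hline, H. split; simpl; lra. }
  assert (Hv : forall x c' d', a <= x <= b -> c <= c' <= d' -> d' <= d -> rcont_on (fun t => f (x, t)) c' d').
  { intros x c' d' hx hc hd t ht. rewrite Rmin_left, Rmax_right in ht by lra.
    apply ccontin_vline, H. split; simpl; lra. }
  rewrite <- (CInt_Chasles (fun t => f (b, t) - f (a, t))%C c m d).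
  - assert (E : CInt (fun t => f (t, c) - f (t, d))%C a b =
      (CInt (fun t => f (t, c) - f (t, m)) a b + CInt (fun t => f (t, m) - f (t, d)) a b)%C).
    { rewrite <- CInt_plus.
      - apply CInt_ext. intros. ring.
      - intros t ht. apply rcont_minus; apply Hh; auto; lra.
      - intros t ht. apply rcont_minus; apply Hh; auto; lra. }
    rewrite E. ring.
  - intros t ht. apply rcont_minus; [apply (Hv b c m)|apply (Hv a c m)]; auto; lra.
  - intros t ht. apply rcont_minus; [apply (Hv b m d)|apply (Hv a m d)]; auto; lra.
Qed.

Definition rect : Type := (R * R) * (R * R).
Definition rx0 (r : rect) := fst (fst r).
Definition rx1 (r : rect) := snd (fst r).
Definition ry0 (r : rect) := fst (snd r).
Definition ry1 (r : rect) := snd (snd r).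
Definition rsize (r : rect) := (rx1 r - rx0 r) + (ry1 r - ry0 r).

(** The threshold is quadratic in the half perimeter: quartering halves [rsize], so four quarters
    below their thresholds add up to exactly the threshold of the whole. *)
Definition small_rect (f : C -> C) (e : R) (r : rect) : Prop :=
  Cmod (rectint f (rx0 r) (rx1 r) (ry0 r) (ry1 r)) <= e * (rsize r * rsize r).

(** The first quarter that violates the threshold. The last one is taken without a test: if the
    other three are small and the whole is not, it must be large. *)
Definition bad_quarter (f : C -> C) (e : R) (r : rect) : rect :=
  let mx := (rx0 r + rx1 r) / 2 in
  let my := (ry0 r + ry1 r) / 2 in
  let r1 := ((rx0 r, mx), (ry0 r, my)) in
  let r2 := ((mx, rx1 r), (ry0 r, my)) in
  let r3 := ((rx0 r, mx), (my, ry1 r)) in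
  let r4 := ((mx, rx1 r), (my, ry1 r)) in
  if excluded_middle_informative (small_rect f e r1) then
  if excluded_middle_informative (small_rect f e r2) then
  if excluded_middle_informative (small_rect f e r3) then r4
  else r3 else r2 else r1.

Definition good_rect (r : rect) := rx0 r <= rx1 r /\ ry0 r <= ry1 r.

Lemma bad_quarter_sub (f : C -> C) (e : R) (r : rect) : good_rect r ->
  good_rect (bad_quarter f e r) /\
  rx0 r <= rx0 (bad_quarter f e r) /\ rx1 (bad_quarter f e r) <= rx1 r /\
  ry0 r <= ry0 (bad_quarter f e r) /\ ry1 (bad_quarter f e r) <= ry1 r /\
  rsize (bad_quarter f e r) = rsize r / 2.
Proof.
  intros [h1 h2]. unfold bad_quarter, good_rect, rsize.
  repeat destruct excluded_middle_informative; unfold rx0, rx1, ry0, ry1 in *; simpl; lra.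
Qed.

Lemma bad_quarter_bad (f : C -> C) (e : R) (r : rect) : good_rect r ->
  (forall z, in_rect (rx0 r) (rx1 r) (ry0 r) (ry1 r) z -> ccontin f z) ->
  ~ small_rect f e r -> ~ small_rect f e (bad_quarter f e r).
Proof.
  intros [h1 h2] Hc Hb. unfold bad_quarter.
  repeat destruct excluded_middle_informative; auto.
  intros s4. apply Hb. unfold small_rect, rsize in *. unfold rx0, rx1, ry0, ry1 in *. simpl in *.
  destruct r as [[a b] [c d]]. simpl in *.
  rewrite (rectint_hsplit f a ((a+b)/2) b c d) by (auto; lra).
  rewrite (rectint_vsplit f a ((a+b)/2) c ((c+d)/2) d);
    [|lra|lra|intros z hz; apply Hc; destruct hz; split; lra].
  rewrite (rectint_vsplit f ((a+b)/2) b c ((c+d)/2) d);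
    [|lra|lra|intros z hz; apply Hc; destruct hz; split; lra].
  eapply Rle_trans; [apply Cmod_triangle|].
  match goal with |- Cmod (?A + ?B) + Cmod (?D + ?E) <= _ =>
    pose proof (Cmod_triangle A B); pose proof (Cmod_triangle D E) end.
  lra.
Qed.

Lemma nested_point (a b : nat -> R) :
  (forall n, a n <= a (S n)) -> (forall n, b (S n) <= b n) -> (forall n, a n <= b n) ->
  exists x, forall n, a n <= x <= b n.
Proof.
  intros Ha Hb Hab.
  assert (Ha' : forall n m, (n <= m)%nat -> a n <= a m).
  { intros n m hnm. induction hnm; [lra|]. eapply Rle_trans; eauto. }
  assert (Hb' : forall n m, (n <= m)%nat -> b m <= b n).
  { intros n m hnm. induction hnm; [lra|]. eapply Rle_trans; eauto. }
  assert (K : forall n m, a n <= b m).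
  { intros n m. apply Rle_trans with (a (Nat.max n m)); [apply Ha'; lia|].
    eapply Rle_trans; [apply Hab|]. apply Hb'; lia. }
  destruct (completeness (fun y => exists n, y = a n)) as [x [H1 H2]].
  - exists (b 0%nat). intros y [n ->]. apply K.
  - exists (a 0%nat). eauto.
  - exists x. intros n. split; [apply H1; eauto|]. apply H2. intros y [m ->]. apply K.
Qed.

(** Goursat's subdivision. If a threshold fails, large quarters shrink to a point; differentiability
    there makes the integral over a tiny rectangle smaller than [e] times the square of its half
    perimeter, a contradiction. As every [e] is admissible, the integral vanishes. *)
Lemma Goursat_ordered (f : C -> C) (a b c d : R) : a <= b -> c <= d ->
  (forall z, in_rect a b c d z -> holo_at f z) -> rectint f a b c d = RtoC 0.
Proof.
  intros hab hcd H.
  set (r0 := ((a, b), (c, d)) : rect).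
  assert (Hall : forall e, 0 < e -> small_rect f e r0).
  { intros e he. destruct (excluded_middle_informative (small_rect f e r0)) as [h|hbad]; auto. exfalso.
    set (rs := fix rs n := match n with O => r0 | S k => bad_quarter f e (rs k) end).
    assert (intR : forall n, good_rect (rs n) /\ ~ small_rect f e (rs n) /\ rsize (rs n) = rsize r0 / 2 ^ n /\
              a <= rx0 (rs n) /\ rx1 (rs n) <= b /\ c <= ry0 (rs n) /\ ry1 (rs n) <= d).
    { induction n as [|n IH].
      - simpl rs. unfold good_rect, r0 in *; unfold rx0, rx1, ry0, ry1; simpl.
        split; [lra|]. split; [exact hbad|]. split; [|lra]. change (2 ^ 0) with 1. rewrite Rdiv_1_r. reflexivity.
      - destruct IH as (g & hb & hs & i1 & i2 & i3 & i4).
        destruct (bad_quarter_sub f e (rs n) g) as (g' & j1 & j2 & j3 & j4 & j5).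
        change (rs (S n)) with (bad_quarter f e (rs n)).
        split; [exact g'|]. split; [|split; [|lra]].
        + apply bad_quarter_bad; auto. intros z hz. apply holo_contin, H. destruct hz; split; lra.
        + rewrite j5, hs. simpl. field. apply pow_nonzero. lra. }
    assert (J : forall n, rx0 (rs n) <= rx0 (rs (S n)) /\ rx1 (rs (S n)) <= rx1 (rs n) /\
                          ry0 (rs n) <= ry0 (rs (S n)) /\ ry1 (rs (S n)) <= ry1 (rs n)).
    { intros n. destruct (intR n) as (g & _). destruct (bad_quarter_sub f e (rs n) g) as (g' & j1 & j2 & j3 & j4 & j5).
      change (rs (S n)) with (bad_quarter f e (rs n)). lra. }
    destruct (nested_point (fun n => rx0 (rs n)) (fun n => rx1 (rs n))) as [x hx];
      [apply J|apply J|apply intR|].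
    destruct (nested_point (fun n => ry0 (rs n)) (fun n => ry1 (rs n))) as [y hy];
      [apply J|apply J|apply intR|].
    assert (hz : holo_at f (x, y)).
    { apply H. specialize (hx 0%nat). specialize (hy 0%nat).
      unfold rs, r0, rx0, rx1, ry0, ry1 in hx, hy; simpl in hx, hy. split; simpl; lra. }
    apply holo_cdiff in hz. destruct hz as [l hl].
    (* Half of [e] is taken because each integrand below is a difference of two remainders. *)
    destruct (hl (e/2)) as (del & hdel & Hdel); [lra|].
    destruct (pow_lt_1_zero (1/2) ltac:(rewrite Rabs_pos_eq; lra) (del / (1 + rsize r0))) as [n Hn].
    { apply Rdiv_lt_0_compat; auto. unfold rsize, r0, rx0, rx1, ry0, ry1; simpl. lra. }
    specialize (Hn n (Nat.le_refl n)).
    destruct (intR n) as (g & hb & hs & i1 & i2 & i3 & i4).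
    specialize (hx n). specialize (hy n). apply hb. unfold small_rect.
    assert (hS : 0 <= rsize r0) by (unfold rsize, r0, rx0, rx1, ry0, ry1; simpl; lra).
    assert (hsz : rsize (rs n) < del).
    { rewrite hs. rewrite Rabs_pos_eq in Hn by (apply pow_le; lra).
      replace ((1/2)^n) with (/ 2 ^ n) in Hn by (rewrite <- pow_inv; f_equal; lra).
      unfold Rdiv. apply Rle_lt_trans with ((1 + rsize r0) * / 2 ^ n).
      - apply Rmult_le_compat_r; [left; apply Rinv_0_lt_compat, pow_lt; lra|lra].
      - apply (Rmult_lt_compat_l (1 + rsize r0)) in Hn; [|lra].
        replace ((1 + rsize r0) * (del / (1 + rsize r0))) with del in Hn by (field; lra). exact Hn. }
    unfold good_rect in g.
    set (s := rsize (rs n)) in *. unfold rsize in s.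
    set (a' := rx0 (rs n)) in *. set (b' := rx1 (rs n)) in *.
    set (c' := ry0 (rs n)) in *. set (d' := ry1 (rs n)) in *.
    (* The affine part of [f] at the limit point contributes opposite multiples of the area through
       the two pairs of sides, so only [rem] survives in the contour integral. *)
    set (rem := fun w => (f w - f (x, y) - l * (w - (x, y)))%C).
    assert (hrem : forall w, in_rect a' b' c' d' w -> Cmod (rem w) <= e / 2 * s).
    { intros w [hw1 hw2].
      assert (K : Cmod (w - (x, y)) <= s).
      { eapply Rle_trans; [apply Cmod_le_abs|]. rewrite Re_minus, Im_minus. simpl.
        unfold s. apply Rplus_le_compat; apply Rabs_le; lra. }
      eapply Rle_trans; [apply Hdel; lra|]. apply Rmult_le_compat_l; lra. }
    assert (hcr : forall w, in_rect a' b' c' d' w -> ccontin rem w).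
    { intros w [hw1 hw2]. apply holo_contin. unfold rem.
      assert (holo_at f w) by (apply H; split; lra). holo. }
    assert (E1 : CInt (fun t => f (t, c') - f (t, d'))%C a' b' =
       (l * Ci * RtoC (c' - d') * RtoC (b' - a') + CInt (fun t => rem (t, c') - rem (t, d')) a' b')%C).
    { transitivity (CInt (fun t => l * Ci * RtoC (c' - d') + (rem (t, c') - rem (t, d')))%C a' b').
      - apply CInt_ext. intros t _. unfold rem.
        replace (l * Ci * RtoC (c' - d'))%C with (l * ((t, c') - (t, d')))%C.
        + ring.
        + rewrite <- Cmult_assoc. f_equal. apply C_eq; simpl; ring.
      - rewrite CInt_plus.
        + rewrite CInt_const. ring.
        + intros t _. apply rcont_const.
        + intros t ht. rewrite Rmin_left, Rmax_right in ht by lra.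
          apply rcont_minus; apply (ccontin_hline rem), hcr; split; simpl; lra. }
    assert (E2 : CInt (fun t => f (b', t) - f (a', t))%C c' d' =
       (l * RtoC (b' - a') * RtoC (d' - c') + CInt (fun t => rem (b', t) - rem (a', t)) c' d')%C).
    { transitivity (CInt (fun t => l * RtoC (b' - a') + (rem (b', t) - rem (a', t)))%C c' d').
      - apply CInt_ext. intros t _. unfold rem.
        replace (l * RtoC (b' - a'))%C with (l * ((b', t) - (a', t)))%C.
        + ring.
        + f_equal. apply C_eq; simpl; ring.
      - rewrite CInt_plus.
        + rewrite CInt_const. ring.
        + intros t _. apply rcont_const.
        + intros t ht. rewrite Rmin_left, Rmax_right in ht by lra.
          apply rcont_minus; apply (ccontin_vline rem), hcr; split; simpl; lra. }
    unfold rectint. rewrite E1, E2.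
    replace (l * Ci * RtoC (c' - d') * RtoC (b' - a') + CInt (fun t => rem (t, c') - rem (t, d')) a' b' +
       Ci * (l * RtoC (b' - a') * RtoC (d' - c') + CInt (fun t => rem (b', t) - rem (a', t)) c' d'))%C
      with (CInt (fun t => rem (t, c') - rem (t, d')) a' b' + Ci * CInt (fun t => rem (b', t) - rem (a', t)) c' d')%C
      by (rewrite !RtoC_minus; ring).
    eapply Rle_trans; [apply Cmod_triangle|]. rewrite Cmod_mult, Cmod_Ci, Rmult_1_l.
    assert (B1 : Cmod (CInt (fun t => rem (t, c') - rem (t, d'))%C a' b') <= (e * s) * Rabs (b' - a')).
    { apply CInt_bound.
      - intros t ht. rewrite Rmin_left, Rmax_right in ht by lra.
        apply rcont_minus; apply (ccontin_hline rem), hcr; split; simpl; lra.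
      - intros t ht. rewrite Rmin_left, Rmax_right in ht by lra.
        eapply Rle_trans; [apply Cmod_triangle_sub|].
        assert (k1 := hrem (t, c') ltac:(split; simpl; lra)).
        assert (k2 := hrem (t, d') ltac:(split; simpl; lra)). lra. }
    assert (B2 : Cmod (CInt (fun t => rem (b', t) - rem (a', t))%C c' d') <= (e * s) * Rabs (d' - c')).
    { apply CInt_bound.
      - intros t ht. rewrite Rmin_left, Rmax_right in ht by lra.
        apply rcont_minus; apply (ccontin_vline rem), hcr; split; simpl; lra.
      - intros t ht. rewrite Rmin_left, Rmax_right in ht by lra.
        eapply Rle_trans; [apply Cmod_triangle_sub|].
        assert (k1 := hrem (a', t) ltac:(split; simpl; lra)).
        assert (k2 := hrem (b', t) ltac:(split; simpl; lra)). lra. }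
    rewrite Rabs_pos_eq in B1, B2 by lra.
    replace (e * (s * s)) with (e * s * (b' - a') + e * s * (d' - c')) by (unfold s; ring). lra. }
  apply Cmod_small_eq. intros eps he.
  set (S := rsize r0 * rsize r0).
  assert (hS : 0 <= S) by (unfold S; apply Rle_0_sqr).
  assert (he' : 0 < eps / (1 + S)) by (apply Rdiv_lt_0_compat; lra).
  specialize (Hall _ he'). unfold small_rect in Hall. fold S in Hall.
  unfold r0, rx0, rx1, ry0, ry1 in Hall; simpl in Hall.
  eapply Rle_trans; [exact Hall|].
  replace eps with (eps / (1 + S) * (1 + S)) at 2 by (field; lra). nra.
Qed.

(** Exchanging two parallel sides only changes the sign of [rectint]. The unordered form is needed
    because a primitive is integrated from the centre in all directions. *)
Lemma Goursat (f : C -> C) (a b c d : R) :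
  (forall z, Rmin a b <= Re z <= Rmax a b -> Rmin c d <= Im z <= Rmax c d -> holo_at f z) ->
  rectint f a b c d = RtoC 0.
Proof.
  intros H.
  assert (Hh : forall y, Rmin c d <= y <= Rmax c d -> rcont_on (fun t => f (t, y)) a b).
  { intros y hy t ht. apply ccontin_hline, holo_contin, H; auto. }
  assert (Hv : forall x, Rmin a b <= x <= Rmax a b -> rcont_on (fun t => f (x, t)) c d).
  { intros x hx t ht. apply ccontin_vline, holo_contin, H; auto. }
  pose proof (Rmin_l a b). pose proof (Rmin_r a b). pose proof (Rmax_l a b). pose proof (Rmax_r a b).
  pose proof (Rmin_l c d). pose proof (Rmin_r c d). pose proof (Rmax_l c d). pose proof (Rmax_r c d).
  assert (Sx : rectint f b a c d = (- rectint f a b c d)%C).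
  { unfold rectint. rewrite (CInt_swap (fun t => f (t, c) - f (t, d))%C a b).
    - rewrite (CInt_ext (fun t => f (a, t) - f (b, t))%C (fun t => RtoC (-1) * (f (b, t) - f (a, t)))%C).
      + rewrite CInt_scal.
        * replace (RtoC (-1)) with (- RtoC 1)%C by (rewrite <- RtoC_opp; reflexivity). ring.
        * intros t ht. apply rcont_minus; apply Hv; auto; lra.
      + intros t _. replace (RtoC (-1)) with (- RtoC 1)%C by (rewrite <- RtoC_opp; reflexivity). ring.
    - intros t ht. apply rcont_minus; apply Hh; auto; lra. }
  assert (Sy : forall a b, (forall y, Rmin c d <= y <= Rmax c d -> rcont_on (fun t => f (t, y)) a b) ->
     (forall x, (x = a \/ x = b) -> rcont_on (fun t => f (x, t)) c d) ->
     rectint f a b d c = (- rectint f a b c d)%C).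
  { intros a' b' Hh' Hv'. unfold rectint. rewrite (CInt_swap (fun t => f (b', t) - f (a', t))%C c d).
    - rewrite (CInt_ext (fun t => f (t, d) - f (t, c))%C (fun t => RtoC (-1) * (f (t, c) - f (t, d)))%C).
      + rewrite CInt_scal.
        * replace (RtoC (-1)) with (- RtoC 1)%C by (rewrite <- RtoC_opp; reflexivity). ring.
        * intros t ht. apply rcont_minus; apply Hh'; auto; lra.
      + intros t _. replace (RtoC (-1)) with (- RtoC 1)%C by (rewrite <- RtoC_opp; reflexivity). ring.
    - intros t ht. apply rcont_minus; apply Hv'; auto. }
  assert (N : forall z : C, (- z)%C = RtoC 0 -> z = RtoC 0).
  { intros z hz. replace z with (- (- z))%C by ring. rewrite hz. ring. }
  destruct (Rle_or_lt a b) as [hab|hab]; destruct (Rle_or_lt c d) as [hcd|hcd].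
  - apply Goursat_ordered; auto. intros z [h1 h2]. apply H; rewrite Rmin_left, Rmax_right; auto.
  - apply N. rewrite <- Sy.
    + apply Goursat_ordered; try lra. intros z [h1 h2].
      apply H; [rewrite Rmin_left, Rmax_right|rewrite Rmin_right, Rmax_left]; auto; lra.
    + auto.
    + intros x [->| ->]; apply Hv; lra.
  - apply N. rewrite <- Sx.
    apply Goursat_ordered; try lra. intros z [h1 h2].
    apply H; [rewrite Rmin_right, Rmax_left|rewrite Rmin_left, Rmax_right]; auto; lra.
  - apply N. rewrite <- Sx. apply N. rewrite <- Sy.
    + apply Goursat_ordered; try lra. intros z [h1 h2].
      apply H; rewrite Rmin_right, Rmax_left; auto; lra.
    + intros y hy t ht. apply (Hh y hy). rewrite Rmin_comm, Rmax_comm. auto.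
    + intros x [->| ->]; apply Hv; lra.
Qed.

(** Integral of [f] along an L-shaped path from [c] to [z]: horizontal first, then vertical. *)
Definition prim (f : C -> C) (c z : C) : C :=
  (CInt (fun t => f (t, Im c)) (Re c) (Re z) + Ci * CInt (fun t => f (Re z, t)) (Im c) (Im z))%C.

Lemma Cmod_le_mono (z w : C) : Rabs (Re z) <= Rabs (Re w) -> Rabs (Im z) <= Rabs (Im w) -> Cmod z <= Cmod w.
Proof.
  intros h1 h2. unfold Cmod. apply sqrt_le_1_alt.
  change (Re z ^ 2 + Im z ^ 2 <= Re w ^ 2 + Im w ^ 2).
  rewrite <- (pow2_abs (Re z)), <- (pow2_abs (Im z)), <- (pow2_abs (Re w)), <- (pow2_abs (Im w)).
  apply Rplus_le_compat; apply pow_incr; split; auto; apply Rabs_pos.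
Qed.

Lemma between_abs (x0 x t : R) : Rmin x0 x <= t <= Rmax x0 x -> Rabs (t - x0) <= Rabs (x - x0).
Proof.
  unfold Rmin, Rmax, Rabs. repeat (destruct Rle_dec || destruct Rcase_abs); lra.
Qed.

(** The two L-shaped paths from [c] to [z] bound a rectangle inside the disc, so Goursat's theorem
    allows the vertical leg to come first. *)
Lemma prim_alt (f : C -> C) (c z : C) (r : R) : Cmod (z - c) < r ->
  (forall w, Cmod (w - c) < r -> holo_at f w) ->
  prim f c z = (CInt (fun t => f (t, Im z)) (Re c) (Re z) + Ci * CInt (fun t => f (Re c, t)) (Im c) (Im z))%C.
Proof.
  intros hz H.
  assert (Hin : forall w, Rmin (Re c) (Re z) <= Re w <= Rmax (Re c) (Re z) ->
     Rmin (Im c) (Im z) <= Im w <= Rmax (Im c) (Im z) -> holo_at f w).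
  { intros w h1 h2. apply H. eapply Rle_lt_trans; [|exact hz].
    apply Cmod_le_mono; rewrite ?Re_minus, ?Im_minus; apply between_abs; auto. }
  assert (G := Goursat f (Re c) (Re z) (Im c) (Im z) Hin). unfold rectint in G.
  pose proof (Rmin_l (Re c) (Re z)). pose proof (Rmin_r (Re c) (Re z)).
  pose proof (Rmax_l (Re c) (Re z)). pose proof (Rmax_r (Re c) (Re z)).
  pose proof (Rmin_l (Im c) (Im z)). pose proof (Rmin_r (Im c) (Im z)).
  pose proof (Rmax_l (Im c) (Im z)). pose proof (Rmax_r (Im c) (Im z)).
  rewrite !CInt_minus in G.
  - unfold prim.
    match type of G with (?A - ?B + Ci * (?D - ?E))%C = _ =>
      transitivity ((A - B + Ci * (D - E)) + (B + Ci * E))%C; [ring|rewrite G; ring] end.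
  - intros t ht. apply ccontin_vline, holo_contin, Hin; simpl; auto; lra.
  - intros t ht. apply ccontin_vline, holo_contin, Hin; simpl; auto; lra.
  - intros t ht. apply ccontin_hline, holo_contin, Hin; simpl; auto; lra.
  - intros t ht. apply ccontin_hline, holo_contin, Hin; simpl; auto; lra.
Qed.

Lemma prim_cdiff (f : C -> C) (c z : C) (r : R) : Cmod (z - c) < r ->
  (forall w, Cmod (w - c) < r -> holo_at f w) -> cdiff (prim f c) z (f z).
Proof.
  intros hz H eps he.
  destruct (holo_contin f z (H z hz) (eps/2)) as (d & hd & Hd); [lra|].
  set (d0 := Rmin d ((r - Cmod (z - c)) / 2)).
  assert (hd0 : 0 < d0) by (apply Rmin_pos; lra).
  exists d0. split; auto. intros w hw.
  assert (hw1 := Rlt_le_trans _ _ _ hw (Rmin_l _ _)).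
  assert (hw2 := Rlt_le_trans _ _ _ hw (Rmin_r _ _)).
  (* The corner between [z] and [w]. From [m] to [w] the original path is extended vertically; from
     [z] to [m] the other L-shaped path is extended horizontally. *)
  set (m := (Re w, Im z) : C).
  assert (near : forall p : C, Rmin (Re z) (Re w) <= Re p <= Rmax (Re z) (Re w) ->
     Rmin (Im z) (Im w) <= Im p <= Rmax (Im z) (Im w) -> Cmod (p - z) <= Cmod (w - z)).
  { intros p h1 h2. apply Cmod_le_mono; rewrite ?Re_minus, ?Im_minus; apply between_abs; auto. }
  assert (ball : forall p : C, Cmod (p - z) <= Cmod (w - z) -> Cmod (p - c) < r).
  { intros p hp. replace (p - c)%C with ((p - z) + (z - c))%C by ring.
    eapply Rle_lt_trans; [apply Cmod_triangle|]. lra. }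
  pose proof (Rmin_l (Re z) (Re w)). pose proof (Rmin_r (Re z) (Re w)).
  pose proof (Rmax_l (Re z) (Re w)). pose proof (Rmax_r (Re z) (Re w)).
  pose proof (Rmin_l (Im z) (Im w)). pose proof (Rmin_r (Im z) (Im w)).
  pose proof (Rmax_l (Im z) (Im w)). pose proof (Rmax_r (Im z) (Im w)).
  assert (hm : Cmod (m - c) < r) by (apply ball, near; simpl; lra).
  assert (line : forall p, Cmod (p - c) < r -> forall t, Rmin (Im c) (Im p) <= t <= Rmax (Im c) (Im p) ->
     rcont (fun t => f (Re p, t)) t).
  { intros p hp t ht. apply ccontin_vline, holo_contin, H. eapply Rle_lt_trans; [|exact hp].
    apply Cmod_le_mono; rewrite ?Re_minus, ?Im_minus; simpl; [lra|apply between_abs; auto]. }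
  assert (lineh : forall p, Cmod (p - c) < r -> forall t, Rmin (Re c) (Re p) <= t <= Rmax (Re c) (Re p) ->
     rcont (fun t => f (t, Im p)) t).
  { intros p hp t ht. apply ccontin_hline, holo_contin, H. eapply Rle_lt_trans; [|exact hp].
    apply Cmod_le_mono; rewrite ?Re_minus, ?Im_minus; simpl; [apply between_abs; auto|lra]. }
  assert (Hv : rcont_on (fun t => f (Re w, t)) (Im z) (Im w)).
  { intros t ht. apply ccontin_vline, holo_contin, H, ball, near; simpl; auto; lra. }
  assert (Hh : rcont_on (fun t => f (t, Im z)) (Re z) (Re w)).
  { intros t ht. apply ccontin_hline, holo_contin, H, ball, near; simpl; auto; lra. }
  assert (E1 : (prim f c w - prim f c m = Ci * CInt (fun t => f (Re w, t)) (Im z) (Im w))%C).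
  { unfold prim, m. simpl Re. simpl Im.
    rewrite <- (CInt_Chasles (fun t => f (Re w, t)) (Im c) (Im z) (Im w)).
    - ring.
    - exact (line m hm).
    - exact Hv. }
  assert (E2 : (prim f c m - prim f c z = CInt (fun t => f (t, Im z)) (Re z) (Re w))%C).
  { rewrite (prim_alt f c m r), (prim_alt f c z r) by auto. unfold m. simpl Re. simpl Im.
    rewrite <- (CInt_Chasles (fun t => f (t, Im z)) (Re c) (Re z) (Re w)).
    - ring.
    - exact (lineh z hz).
    - exact Hh. }
  assert (E : (prim f c w - prim f c z - f z * (w - z) =
     CInt (fun t => f (t, Im z) - f z) (Re z) (Re w) + Ci * CInt (fun t => f (Re w, t) - f z) (Im z) (Im w))%C).
  { rewrite !CInt_minus, !CInt_const; auto; try (intros t _; apply rcont_const).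
    rewrite <- E2.
    replace (Ci * (CInt (fun t => f (Re w, t)) (Im z) (Im w) - RtoC (Im w - Im z) * f z))%C
      with ((prim f c w - prim f c m) - Ci * RtoC (Im w - Im z) * f z)%C by (rewrite E1; ring).
    replace (w - z)%C with (RtoC (Re w - Re z) + Ci * RtoC (Im w - Im z))%C
      by (apply C_eq; unfold Re, Im; simpl; ring).
    ring. }
  rewrite E. eapply Rle_trans; [apply Cmod_triangle|]. rewrite Cmod_mult, Cmod_Ci, Rmult_1_l.
  assert (B1 : Cmod (CInt (fun t => f (t, Im z) - f z)%C (Re z) (Re w)) <= eps / 2 * Rabs (Re w - Re z)).
  { apply CInt_bound.
    - intros t ht. apply rcont_minus; [apply Hh; auto|apply rcont_const].
    - intros t ht. left. apply Hd. eapply Rle_lt_trans; [|exact hw1]. apply near; simpl; auto; lra. }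
  assert (B2 : Cmod (CInt (fun t => f (Re w, t) - f z)%C (Im z) (Im w)) <= eps / 2 * Rabs (Im w - Im z)).
  { apply CInt_bound.
    - intros t ht. apply rcont_minus; [apply Hv; auto|apply rcont_const].
    - intros t ht. left. apply Hd. eapply Rle_lt_trans; [|exact hw1]. apply near; simpl; auto; lra. }
  assert (A1 := re_le_Cmod (w - z)). assert (A2 := im_le_Cmod (w - z)).
  rewrite Re_minus in A1. rewrite Im_minus in A2. nra.
Qed.

Lemma ccontin_comp (f g : C -> C) (z : C) : ccontin f z -> ccontin g (f z) -> ccontin (fun w => g (f w)) z.
Proof.
  intros Hf Hg eps he. destruct (Hg eps he) as (d & hd & H).
  destruct (Hf d hd) as (d1 & hd1 & H1). exists d1. split; auto.
Qed.

Lemma ccontin_const (c z : C) : ccontin (fun _ => c) z.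
Proof. apply holo_contin. holo. Qed.

Lemma ccontin_plus (f g : C -> C) (z : C) : ccontin f z -> ccontin g z -> ccontin (fun w => f w + g w)%C z.
Proof.
  intros Hf Hg eps he.
  destruct (Hf (eps/2)) as (d1 & hd1 & H1); [lra|].
  destruct (Hg (eps/2)) as (d2 & hd2 & H2); [lra|].
  exists (Rmin d1 d2). split; [apply Rmin_pos; auto|]. intros s hs.
  specialize (H1 s (Rlt_le_trans _ _ _ hs (Rmin_l _ _))).
  specialize (H2 s (Rlt_le_trans _ _ _ hs (Rmin_r _ _))).
  replace (f s + g s - (f z + g z))%C with ((f s - f z) + (g s - g z))%C by ring.
  eapply Rle_lt_trans; [apply Cmod_triangle|]. lra.
Qed.

Lemma ccontin_mult (f g : C -> C) (z : C) : ccontin f z -> ccontin g z -> ccontin (fun w => f w * g w)%C z.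
Proof.
  intros Hf Hg eps he.
  pose proof (Cmod_ge_0 (f z)) as m1. pose proof (Cmod_ge_0 (g z)) as m2.
  set (e := Rmin 1 (eps / (2 + Cmod (f z) + Cmod (g z)))).
  assert (he0 : 0 < e) by (apply Rmin_pos; [lra|apply Rdiv_lt_0_compat; lra]).
  destruct (Hf e he0) as (d1 & hd1 & H1). destruct (Hg e he0) as (d2 & hd2 & H2).
  exists (Rmin d1 d2). split; [apply Rmin_pos; auto|]. intros s hs.
  specialize (H1 s (Rlt_le_trans _ _ _ hs (Rmin_l _ _))).
  specialize (H2 s (Rlt_le_trans _ _ _ hs (Rmin_r _ _))).
  replace (f s * g s - f z * g z)%C with
    ((f s - f z) * (g s - g z) + (f z * (g s - g z) + g z * (f s - f z)))%C by ring.
  eapply Rle_lt_trans; [apply Cmod_triangle|].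
  eapply Rle_lt_trans; [apply Rplus_le_compat_l, Cmod_triangle|].
  rewrite !Cmod_mult.
  assert (e1 : e <= 1) by apply Rmin_l.
  assert (e2 : e * (2 + Cmod (f z) + Cmod (g z)) <= eps).
  { apply Rle_trans with (eps / (2 + Cmod (f z) + Cmod (g z)) * (2 + Cmod (f z) + Cmod (g z))).
    - apply Rmult_le_compat_r; [lra|apply Rmin_r].
    - right. field. lra. }
  pose proof (Cmod_ge_0 (f s - f z)) as n1. pose proof (Cmod_ge_0 (g s - g z)) as n2.
  assert (t1 : Cmod (f s - f z) * Cmod (g s - g z) <= e * 1) by (apply Rmult_le_compat; lra).
  assert (t2 : Cmod (f z) * Cmod (g s - g z) <= Cmod (f z) * e) by (apply Rmult_le_compat_l; lra).
  assert (t3 : Cmod (g z) * Cmod (f s - f z) <= Cmod (g z) * e) by (apply Rmult_le_compat_l; lra).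
  lra.
Qed.

Lemma ccontin_Re (z : C) : ccontin (fun w => RtoC (Re w)) z.
Proof.
  intros eps he. exists eps. split; auto. intros w hw.
  rewrite <- RtoC_minus, Cmod_R. eapply Rle_lt_trans; [|exact hw]. rewrite <- Re_minus. apply re_le_Cmod.
Qed.

Lemma ccontin_Im (z : C) : ccontin (fun w => RtoC (Im w)) z.
Proof.
  intros eps he. exists eps. split; auto. intros w hw.
  rewrite <- RtoC_minus, Cmod_R. eapply Rle_lt_trans; [|exact hw]. rewrite <- Im_minus. apply im_le_Cmod.
Qed.

(* Here and below a pair of real variables is encoded as one complex variable. *)
Lemma CInt_param_proj (p : C -> R) (G Gs : R -> R -> C) (a b s d : R) :
  (forall z w, Rabs (p z - p w) <= Cmod (z - w)) ->
  (forall f t l, rdiff f t l -> is_derive (fun u => p (f u)) t (p l)) ->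
  (forall f a b, rcont_on f a b -> is_RInt (fun t => p (f t)) a b (p (CInt f a b))) ->
  0 < d ->
  (forall u t, Rabs (u - s) < d -> rdiff (fun v => G v t) u (Gs u t)) ->
  (forall t, ccontin (fun z => Gs (Re z) (Im z)) (s, t)) ->
  (forall u t, Rabs (u - s) < d -> rcont (G u) t) ->
  is_derive (fun u => p (CInt (G u) a b)) s (p (CInt (Gs s) a b)).
Proof.
  intros Hp Hd HI hd HG Hc HGc.
  assert (D : forall u t, Rabs (u - s) < d -> Derive (fun v => p (G v t)) u = p (Gs u t)).
  { intros u t hu. apply is_derive_unique. apply Hd. auto. }
  assert (Hs0 : Rabs (s - s) < d) by (rewrite Rminus_eq_0, Rabs_R0; auto).
  assert (M := is_derive_RInt_param (fun u t => p (G u t)) a b s).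
  assert (E : RInt (fun t => Derive (fun u => p (G u t)) s) a b = p (CInt (Gs s) a b)).
  { rewrite (RInt_ext _ (fun t => p (Gs s t))).
    - apply is_RInt_unique, HI. intros t _.
      apply (ccontin_vline (fun z => Gs (Re z) (Im z)) s t), Hc.
    - intros t _. apply D. auto. }
  cbv beta in M. rewrite E in M.
  apply (is_derive_ext_loc (fun u => RInt (fun t => p (G u t)) a b)).
  - exists (mkposreal d hd). intros u hu. apply is_RInt_unique, HI. intros t _. apply HGc. exact hu.
  - apply M.
    + exists (mkposreal d hd). intros u hu t _. eexists. apply Hd, HG. exact hu.
    + intros t _ eps.
      destruct (Hc t eps (cond_pos eps)) as (d1 & hd1 & H1).
      assert (hm : 0 < Rmin d (d1 / 2)) by (apply Rmin_pos; lra).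
      exists (mkposreal _ hm). intros u v hu hv. simpl in hu, hv.
      rewrite (D u v) by (eapply Rlt_le_trans; [exact hu|apply Rmin_l]). rewrite (D s t) by auto.
      eapply Rle_lt_trans; [apply Hp|].
      apply (H1 (u, v)). eapply Rle_lt_trans; [apply Cmod_le_abs|]. simpl.
      assert (Rmin d (d1/2) <= d1/2) by apply Rmin_r.
      unfold Rminus in hu, hv. lra.
    + exists (mkposreal d hd). intros u hu. eexists. apply HI. intros t _. apply HGc. exact hu.
Qed.

(** Differentiation under the integral sign is available for real integrands and is applied to real
    and imaginary parts; joint continuity of the derivative at [(s, t)] is the decisive
    hypothesis. *)
Lemma CInt_param (G Gs : R -> R -> C) (a b s d : R) : 0 < d ->
  (forall u t, Rabs (u - s) < d -> rdiff (fun v => G v t) u (Gs u t)) ->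
  (forall t, ccontin (fun z => Gs (Re z) (Im z)) (s, t)) ->
  (forall u t, Rabs (u - s) < d -> rcont (G u) t) ->
  rdiff (fun u => CInt (G u) a b) s (CInt (Gs s) a b).
Proof.
  intros. apply rdiff_of_ReIm.
  - apply (CInt_param_proj Re G Gs a b s d); auto.
    + intros. rewrite <- Re_minus. apply re_le_Cmod.
    + apply rdiff_Re.
    + apply CInt_Re.
  - apply (CInt_param_proj Im G Gs a b s d); auto.
    + intros. rewrite <- Im_minus. apply im_le_Cmod.
    + apply rdiff_Im.
    + apply CInt_Im.
Qed.

(** * Cauchy's integral formula on a circle *)

Definition circ (r t : R) : C := (RtoC r * cexp (Ci * RtoC t))%C.

Lemma Cmod_circ (r t : R) : 0 <= r -> Cmod (circ r t) = r.
Proof.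
  intros. unfold circ. rewrite Cmod_mult, Cmod_RtoC_pos, Cmod_cexp by auto.
  replace (Re (Ci * RtoC t)) with 0 by (simpl; ring). rewrite exp_0. ring.
Qed.

Lemma rcont_circ (r t : R) : rcont (circ r) t.
Proof. unfold circ. rcont. apply continuous_id. Qed.

Lemma cexp_2PI : cexp (Ci * RtoC (2 * PI)) = RtoC 1.
Proof.
  replace (Ci * RtoC (2 * PI))%C with ((0, 2 * PI) : C) by (apply C_eq; unfold Re, Im; simpl; ring).
  unfold cexp, Re, Im. cbn [fst snd]. rewrite exp_0, cos_2PI, sin_2PI. apply C_eq; simpl; ring.
Qed.

Lemma circ_2PI (r : R) : circ r (2 * PI) = circ r 0.
Proof.
  unfold circ. rewrite cexp_2PI. replace (Ci * RtoC 0)%C with (RtoC 0) by ring. rewrite cexp_0. reflexivity.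
Qed.

Lemma rdiff_scal_l (c : C) (f : R -> C) (t : R) (l : C) : rdiff f t l -> rdiff (fun s => c * f s)%C t (c * l).
Proof.
  intros H. apply (rdiff_cdiff_comp f (fun w => c * w)%C t l c); auto.
  assert (K := cdiff_scal (fun w => w) c (f t) (RtoC 1) (cdiff_id _)).
  replace (c * 1)%C with c in K by ring. exact K.
Qed.

Lemma rdiff_cexp_lin (k : C) (t : R) : rdiff (fun s => cexp (k * RtoC s)) t (k * cexp (k * RtoC t)).
Proof.
  replace (k * cexp (k * RtoC t))%C with (cexp (k * RtoC t) * k)%C by ring.
  assert (H := rdiff_affine (RtoC 0) k t).
  apply (rdiff_cdiff_comp (fun s => k * RtoC s)%C cexp).
  - intros eps he. destruct (H eps he) as (d & hd & Hd). exists d. split; auto. intros s hs.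
    specialize (Hd s hs). eapply Rle_trans; [|exact Hd]. apply Req_le. f_equal. ring.
  - apply cdiff_cexp.
Qed.

Lemma rdiff_circ (r t : R) : rdiff (circ r) t (Ci * circ r t).
Proof.
  replace (Ci * circ r t)%C with (RtoC r * (Ci * cexp (Ci * RtoC t)))%C by (unfold circ; ring).
  apply rdiff_scal_l, rdiff_cexp_lin.
Qed.

Section CauchyFormula.
Variables (F f : C -> C) (c : C) (R0 r : R) (h : C).
Hypothesis Hr : 0 < r < R0.
Hypothesis Hh : Cmod h < r.
Hypothesis HF : forall w, Cmod (w - c) < R0 -> cdiff F w (f w).
Hypothesis Hf : forall w, Cmod (w - c) < R0 -> ccontin f w.

(** [K t dt] is [dz / (i (z - c - h))] on the circle. [pt s t] contracts the circle ([s = 1]) to the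
    point [c + h] ([s = 0]), and the margin [eta] keeps it in the disc of radius [R0] slightly
    beyond both ends, so that two-sided derivatives in [s] exist there. *)
Let K (t : R) : C := (circ r t / (circ r t - h))%C.
Let pt (s t : R) : C := (c + h + (circ r t - h) * RtoC s)%C.
Let eta := (R0 - r) / (4 * r).

Lemma cauchy_den (t : R) : (circ r t - h)%C <> RtoC 0.
Proof.
  apply Cmod_gt_0. pose proof (Cmod_triangle_rev (circ r t) h) as H. rewrite Cmod_circ in H; lra.
Qed.

Lemma cauchy_eta : 0 < eta.
Proof. apply Rdiv_lt_0_compat; lra. Qed.

Lemma cauchy_pt_in (s t : R) : - eta < s < 1 + eta -> Cmod (pt s t - c) < R0.
Proof.
  intros hs. pose proof cauchy_eta as he.
  replace (pt s t - c)%C with (RtoC (1 - s) * h + RtoC s * circ r t)%C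
    by (unfold pt; rewrite RtoC_minus; ring).
  eapply Rle_lt_trans; [apply Cmod_triangle|]. rewrite !Cmod_mult, !Cmod_R, Cmod_circ by lra.
  assert (h1 : Rabs (1 - s) * Cmod h <= Rabs (1 - s) * r).
  { apply Rmult_le_compat_l; [apply Rabs_pos|lra]. }
  assert (h2 : Rabs (1 - s) + Rabs s <= 1 + 2 * eta).
  { unfold Rabs. repeat destruct Rcase_abs; lra. }
  assert (h3 : (1 + 2 * eta) * r < R0) by (unfold eta; replace ((1 + 2 * ((R0 - r) / (4 * r))) * r) with (r + (R0 - r) / 2) by (field; lra); lra).
  nra.
Qed.

Lemma cauchy_ccontin_pt (z : C) : ccontin (fun w => pt (Re w) (Im w)) z.
Proof.
  unfold pt, circ.
  apply (ccontin_plus (fun _ => c + h)%C); [apply ccontin_const|].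
  apply (ccontin_mult (fun w => RtoC r * cexp (Ci * RtoC (Im w)) - h)%C (fun w => RtoC (Re w))); [|apply ccontin_Re].
  apply (ccontin_comp (fun w => RtoC (Im w)) (fun w => RtoC r * cexp (Ci * w) - h)%C); [apply ccontin_Im|].
  apply holo_contin. holo.
Qed.

Lemma cauchy_rcont_pt (s t : R) : rcont (pt s) t.
Proof. unfold pt, circ. rcont. apply continuous_id. Qed.

(** Up to the factor [i s] the integrand is the derivative of [F] along the closed curve [pt s], so
    it integrates to zero. At [s = 0] the curve degenerates and the integral of [circ] over a period
    is used instead. *)
Lemma cauchy_tangential (s : R) : - eta < s < 1 + eta ->
  CInt (fun t => circ r t * f (pt s t))%C 0 (2 * PI) = RtoC 0.
Proof.
  intros hs.
  assert (hc : forall s, - eta < s < 1 + eta -> rcont_on (fun t => circ r t * f (pt s t))%C 0 (2 * PI)).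
  { intros s' hs' t _. apply rcont_mult; [apply rcont_circ|].
    apply (rcont_comp (pt s') f); [apply cauchy_rcont_pt|]. apply Hf, cauchy_pt_in; auto. }
  destruct (Req_dec s 0) as [->|hs0].
  - rewrite (CInt_ext _ (fun t => (f (c + h)%C / Ci) * (Ci * circ r t))%C).
    + rewrite CInt_scal by (intros t _; apply rcont_scal, rcont_circ).
      rewrite (CInt_FTC (circ r)).
      * rewrite circ_2PI. ring.
      * intros t _. apply rdiff_circ.
      * intros t _. apply rcont_scal, rcont_circ.
    + intros t _. unfold pt. replace (c + h + (circ r t - h) * 0)%C with (c + h)%C by ring.
      field. apply Ci_neq0.
  - assert (E : CInt (fun t => (RtoC s * Ci) * (circ r t * f (pt s t)))%C 0 (2 * PI) = RtoC 0).
    { rewrite (CInt_ext _ (fun t => f (pt s t) * (RtoC s * (Ci * circ r t)))%C) by (intros; ring).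
      rewrite (CInt_FTC (fun t => F (pt s t))).
      - unfold pt. rewrite circ_2PI. ring.
      - intros t _. apply (rdiff_cdiff_comp (pt s) F).
        + assert (H := rdiff_scal_l (RtoC s) _ _ _ (rdiff_circ r t)).
          intros eps he. destruct (H eps he) as (d & hd & Hd). exists d. split; auto. intros u hu.
          specialize (Hd u hu). eapply Rle_trans; [|exact Hd]. apply Req_le. f_equal. unfold pt. ring.
        + apply HF, cauchy_pt_in; auto.
      - intros t ht. apply rcont_mult.
        + apply (rcont_comp (pt s) f); [apply cauchy_rcont_pt|]. apply Hf, cauchy_pt_in; auto.
        + apply rcont_scal, rcont_scal, rcont_circ. }
    rewrite CInt_scal in E by auto.
    assert (N : (RtoC s * Ci)%C <> RtoC 0) by (apply Cmult_neq_0; [apply RtoC_neq0; auto|apply Ci_neq0]).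
    replace (CInt (fun t => circ r t * f (pt s t))%C 0 (2 * PI)) with
      (/ (RtoC s * Ci) * (RtoC s * Ci * CInt (fun t => circ r t * f (pt s t)) 0 (2 * PI)))%C
      by (field; split; [apply Ci_neq0|apply RtoC_neq0; auto]).
    rewrite E. ring.
Qed.

Lemma rcont_kernel (t : R) : rcont K t.
Proof.
  unfold K. apply rcont_div; [apply cauchy_den| |]; try apply rcont_circ.
  apply rcont_minus; [apply rcont_circ|apply rcont_const].
Qed.

(** Differentiating the integral of [K t * F (pt s t)] in [s] produces the factor [circ r t - h],
    which cancels the denominator of [K]; the tangential integral is left and vanishes, so the ends
    of the homotopy agree. *)
Lemma cauchy_homotopy :
  CInt (fun t => K t * F (c + circ r t))%C 0 (2 * PI) = (CInt K 0 (2 * PI) * F (c + h))%C.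
Proof.
  set (G := fun s t => (K t * F (pt s t))%C).
  assert (E : CInt (G 1) 0 (2 * PI) = CInt (G 0) 0 (2 * PI)).
  { apply (rdiff_zero_const (fun s => CInt (G s) 0 (2 * PI)) 0 1); [lra|].
    intros s hs. pose proof cauchy_eta as he.
    rewrite <- (cauchy_tangential s) by lra.
    apply (CInt_param G (fun s t => circ r t * f (pt s t))%C 0 (2 * PI) s eta); auto.
    - intros u t hu. assert (hu' : - eta < u < 1 + eta) by (apply Rabs_def2 in hu; lra).
      replace (circ r t * f (pt u t))%C with (K t * (f (pt u t) * (circ r t - h)))%C
        by (unfold K; field; apply cauchy_den).
      unfold G. apply rdiff_scal_l.
      apply (rdiff_cdiff_comp (fun v => pt v t) F); [apply rdiff_affine|]. apply HF, cauchy_pt_in; auto.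
    - intros t.
      apply (ccontin_mult (fun w => circ r (Im w)) (fun w => f (pt (Re w) (Im w)))).
      + unfold circ. apply (ccontin_comp (fun w => RtoC (Im w)) (fun w => RtoC r * cexp (Ci * w))%C); [apply ccontin_Im|].
        apply holo_contin. holo.
      + apply (ccontin_comp (fun w => pt (Re w) (Im w)) f); [apply cauchy_ccontin_pt|].
        simpl. apply Hf, cauchy_pt_in. lra.
    - intros u t hu. assert (hu' : - eta < u < 1 + eta) by (apply Rabs_def2 in hu; lra).
      unfold G. apply rcont_mult; [apply rcont_kernel|].
      apply (rcont_comp (pt u) F); [apply cauchy_rcont_pt|].
      eapply cdiff_contin, HF, cauchy_pt_in; auto. }
  transitivity (CInt (G 1) 0 (2 * PI)).
  - apply CInt_ext. intros t _. unfold G, pt. do 2 f_equal. ring.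
  - rewrite E. rewrite (CInt_ext (G 0) (fun t => F (c + h)%C * K t)%C).
    + rewrite CInt_scal by (intros t _; apply rcont_kernel). ring.
    + intros t _. unfold G, pt. replace (c + h + (circ r t - h) * 0)%C with (c + h)%C by ring. ring.
Qed.

Lemma circ_neq0 (t : R) : circ r t <> RtoC 0.
Proof. apply Cmod_gt_0. rewrite Cmod_circ; lra. Qed.

Lemma rcont_circ_inv_pow (n : nat) (t : R) : rcont (fun t => (/ circ r t) ^ n)%C t.
Proof.
  induction n as [|n IH]; simpl.
  - apply rcont_const.
  - apply rcont_mult; auto. apply rcont_inv; [apply circ_neq0|apply rcont_circ].
Qed.

(** One step of the geometric expansion of [1 / (1 - h / z)] on the circle. Iterated, it exhibits
    the Fourier integrals against [(/ circ r t) ^ j] as Taylor coefficients. *)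
Lemma kernel_step (g : R -> C) (n : nat) : (forall t, rcont g t) ->
  CInt (fun t => g t * (/ circ r t) ^ n * K t)%C 0 (2 * PI) =
  (CInt (fun t => g t * (/ circ r t) ^ n) 0 (2 * PI) +
   h * CInt (fun t => g t * (/ circ r t) ^ (S n) * K t) 0 (2 * PI))%C.
Proof.
  intros Hg. rewrite <- CInt_scal.
  2:{ intros t _. apply rcont_mult; [apply rcont_mult; [auto|apply rcont_circ_inv_pow]|apply rcont_kernel]. }
  rewrite <- CInt_plus.
  - apply CInt_ext. intros t _. unfold K. simpl.
    replace (circ r t / (circ r t - h))%C with (1 + h * / circ r t * (circ r t / (circ r t - h)))%C at 1
      by (field; split; [apply cauchy_den|apply circ_neq0]).
    ring.
  - intros t _. apply rcont_mult; [auto|apply rcont_circ_inv_pow].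
  - intros t _. apply rcont_scal, rcont_mult; [apply rcont_mult; [auto|apply rcont_circ_inv_pow]|apply rcont_kernel].
Qed.

Lemma kernel_taylor (g : R -> C) (n : nat) : (forall t, rcont g t) ->
  (forall j, (j < n)%nat -> CInt (fun t => g t * (/ circ r t) ^ j)%C 0 (2 * PI) = RtoC 0) ->
  CInt (fun t => g t * K t)%C 0 (2 * PI) = (h ^ n * CInt (fun t => g t * (/ circ r t) ^ n * K t) 0 (2 * PI))%C.
Proof.
  intros Hg. induction n as [|n IH]; intros H0.
  - simpl. rewrite Cmult_1_l. apply CInt_ext. intros. ring.
  - rewrite IH by (intros; apply H0; lia). rewrite kernel_step, (H0 n) by (auto; lia). simpl. ring.
Qed.

Lemma kernel_bound (t : R) : Cmod (K t) <= r / (r - Cmod h).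
Proof.
  unfold K. rewrite Cmod_div by apply cauchy_den. rewrite Cmod_circ by lra.
  unfold Rdiv. apply Rmult_le_compat_l; [lra|]. apply Rinv_le_contravar; [lra|].
  pose proof (Cmod_triangle_rev (circ r t) h) as H. rewrite Cmod_circ in H; lra.
Qed.

Lemma Cmod_circ_inv_pow (n : nat) (t : R) : Cmod ((/ circ r t) ^ n) = (/ r) ^ n.
Proof. rewrite Cmod_pow, Cmod_inv, Cmod_circ by (apply circ_neq0 || lra). reflexivity. Qed.

Lemma kernel_remainder (g : R -> C) (M : R) (n : nat) : (forall t, rcont g t) ->
  (forall t, 0 <= t <= 2 * PI -> Cmod (g t) <= M) ->
  Cmod (CInt (fun t => g t * (/ circ r t) ^ n * K t)%C 0 (2 * PI)) <= M * (/ r) ^ n * (r / (r - Cmod h)) * (2 * PI).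
Proof.
  intros Hg HM. pose proof PI_RGT_0 as hpi.
  assert (B : forall t, Rmin 0 (2 * PI) <= t <= Rmax 0 (2 * PI) -> Cmod (g t * (/ circ r t) ^ n * K t) <= M * (/ r) ^ n * (r / (r - Cmod h))).
  { intros t ht. rewrite Rmin_left, Rmax_right in ht by lra. rewrite !Cmod_mult, Cmod_circ_inv_pow.
    apply Rmult_le_compat.
    - apply Rmult_le_pos; [apply Cmod_ge_0|apply pow_le; left; apply Rinv_0_lt_compat; lra].
    - apply Cmod_ge_0.
    - apply Rmult_le_compat_r; [apply pow_le; left; apply Rinv_0_lt_compat; lra|auto].
    - apply kernel_bound. }
  assert (E := CInt_bound _ _ 0 (2 * PI)
    (fun t _ => rcont_mult _ _ t (rcont_mult _ _ t (Hg t) (rcont_circ_inv_pow n t)) (rcont_kernel t)) B).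
  rewrite Rminus_0_r, (Rabs_pos_eq (2 * PI)) in E by lra. exact E.
Qed.

Lemma geom_small (M x : R) : 0 <= x < 1 -> forall eps, 0 < eps -> exists n, (1 <= n)%nat /\ M * x ^ n <= eps.
Proof.
  intros hx eps he.
  destruct (pow_lt_1_zero x ltac:(rewrite Rabs_pos_eq; lra) (eps / (1 + Rabs M))) as [n Hn].
  { apply Rdiv_lt_0_compat; auto. pose proof (Rabs_pos M). lra. }
  exists (S n). split; [lia|]. specialize (Hn (S n) ltac:(lia)).
  rewrite Rabs_pos_eq in Hn by (apply pow_le; lra).
  pose proof (Rabs_pos M) as hM. pose proof (Rle_abs M) as hM'.
  assert (0 <= x ^ S n) by (apply pow_le; lra).
  apply Rle_trans with ((1 + Rabs M) * x ^ S n); [nra|].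
  apply (Rmult_lt_compat_l (1 + Rabs M)) in Hn; [|lra].
  replace ((1 + Rabs M) * (eps / (1 + Rabs M))) with eps in Hn by (field; lra). lra.
Qed.

Lemma ratio_h : 0 <= Cmod h * / r < 1.
Proof.
  split.
  - apply Rmult_le_pos; [apply Cmod_ge_0|left; apply Rinv_0_lt_compat; lra].
  - apply Rmult_lt_reg_r with r; [lra|]. rewrite Rmult_assoc, Rinv_l by lra. lra.
Qed.

Lemma taylor_zero (g : R -> C) (M : R) : (forall t, rcont g t) ->
  (forall t, 0 <= t <= 2 * PI -> Cmod (g t) <= M) ->
  (forall j, CInt (fun t => g t * (/ circ r t) ^ j)%C 0 (2 * PI) = RtoC 0) ->
  CInt (fun t => g t * K t)%C 0 (2 * PI) = RtoC 0.
Proof.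
  intros Hg HM H0. apply Cmod_small_eq. intros eps he.
  destruct (geom_small (M * (r / (r - Cmod h)) * (2 * PI)) _ ratio_h eps he) as (n & _ & Hn).
  rewrite (kernel_taylor g n) by auto.
  rewrite Cmod_mult, Cmod_pow.
  eapply Rle_trans; [apply Rmult_le_compat_l; [apply pow_le, Cmod_ge_0|apply (kernel_remainder g M n); auto]|].
  eapply Rle_trans; [|exact Hn]. right. rewrite Rpow_mult_distr. ring.
Qed.

Lemma circ_inv_pow_int (j : nat) : (1 <= j)%nat -> CInt (fun t => (/ circ r t) ^ j)%C 0 (2 * PI) = RtoC 0.
Proof.
  intros hj.
  set (k := (- (RtoC (INR j) * Ci))%C).
  assert (hk : k <> RtoC 0).
  { unfold k. intros E. apply (Cmult_neq_0 (RtoC (INR j)) Ci).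
    - apply RtoC_neq0. apply not_0_INR. lia.
    - apply Ci_neq0.
    - replace (RtoC (INR j) * Ci)%C with (- - (RtoC (INR j) * Ci))%C by ring. rewrite E. ring. }
  assert (P : forall t, ((/ circ r t) ^ j = (RtoC (/ r)) ^ j * / k * (k * cexp (k * RtoC t)))%C).
  { intros t. unfold circ.
    replace (/ (RtoC r * cexp (Ci * RtoC t)))%C with (RtoC (/ r) * cexp (- (Ci * RtoC t)))%C.
    - rewrite Cpow_mult_l, cexp_pow.
      replace (RtoC (INR j) * - (Ci * RtoC t))%C with (k * RtoC t)%C by (unfold k; ring).
      field. auto.
    - rewrite cexp_opp, RtoC_inv by lra. field. split; [apply cexp_neq0|apply RtoC_neq0; lra]. }
  rewrite (CInt_ext _ (fun t => (RtoC (/ r)) ^ j * / k * (k * cexp (k * RtoC t)))%C) by (intros; apply P).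
  assert (hc : forall t, rcont (fun t => k * cexp (k * RtoC t))%C t) by (intros; rcont; apply continuous_id).
  rewrite CInt_scal by (intros t _; apply hc).
  rewrite (CInt_FTC (fun t => cexp (k * RtoC t))).
  - replace (k * RtoC 0)%C with (RtoC 0) by ring. rewrite cexp_0.
    replace (k * RtoC (2 * PI))%C with (- (RtoC (INR j) * (Ci * RtoC (2 * PI))))%C by (unfold k; ring).
    rewrite cexp_opp, <- cexp_pow, cexp_2PI, Cpow_1_l.
    replace (/ 1 - 1)%C with (RtoC 0) by (field; apply RtoC_neq0; lra). ring.
  - intros t _. apply rdiff_cexp_lin.
  - intros t _. apply hc.
Qed.

(** After the constant term [1], every Taylor coefficient of the kernel is the integral of a nonzero
    frequency and vanishes; the remainder is geometric in [Cmod h / r]. *)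
Lemma kernel_total : CInt K 0 (2 * PI) = RtoC (2 * PI).
Proof.
  assert (E : (CInt K 0 (2 * PI) - RtoC (2 * PI))%C = RtoC 0).
  { apply Cmod_small_eq. intros eps he.
    destruct (geom_small (r / (r - Cmod h) * (2 * PI)) _ ratio_h eps he) as (n & hn & Hn).
    set (g := fun t : R => (h * / circ r t)%C).
    rewrite (CInt_ext K (fun t => RtoC 1 + h * ((/ circ r t) ^ 1 * K t))%C).
    2:{ intros t _. unfold K. simpl. field. split; [apply cauchy_den|apply circ_neq0]. }
    assert (hc : forall t, rcont (fun t => (/ circ r t) ^ 1 * K t)%C t).
    { intros. apply rcont_mult; [apply rcont_circ_inv_pow|apply rcont_kernel]. }
    rewrite CInt_plus, CInt_const.
    2:{ intros t _. apply rcont_const. }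
    2:{ intros t _. apply rcont_scal, hc. }
    rewrite CInt_scal by (intros t _; apply hc).
    destruct n as [|n]; [lia|].
    rewrite (kernel_taylor (fun t => (/ circ r t) ^ 1)%C n).
    2:{ intros; apply rcont_circ_inv_pow. }
    2:{ intros j hj. rewrite (CInt_ext _ (fun t => (/ circ r t) ^ (S j))%C) by (intros; simpl; ring).
        apply circ_inv_pow_int. lia. }
    assert (hg1 : forall t, 0 <= t <= 2 * PI -> Cmod ((/ circ r t) ^ 1) <= (/ r) ^ 1)
      by (intros; rewrite Cmod_circ_inv_pow; lra).
    assert (B := kernel_remainder (fun t => (/ circ r t) ^ 1)%C ((/ r) ^ 1) n (rcont_circ_inv_pow 1) hg1).
    match goal with |- Cmod (_ + h * (_ * ?X) - _)%C <= _ =>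
      replace (RtoC (2 * PI - 0) * 1 + h * (h ^ n * X) - RtoC (2 * PI))%C with (h ^ (S n) * X)%C
        by (rewrite Rminus_0_r; simpl; ring) end.
    rewrite Cmod_mult, Cmod_pow.
    eapply Rle_trans; [apply Rmult_le_compat_l; [apply pow_le, Cmod_ge_0|exact B]|].
    eapply Rle_trans; [|exact Hn]. right. rewrite Rpow_mult_distr. simpl. ring. }
  replace (CInt K 0 (2 * PI)) with ((CInt K 0 (2 * PI) - RtoC (2 * PI)) + RtoC (2 * PI))%C by ring.
  rewrite E. ring.
Qed.

Lemma cauchy_formula :
  CInt (fun t => F (c + circ r t) * K t)%C 0 (2 * PI) = (RtoC (2 * PI) * F (c + h))%C.
Proof.
  rewrite <- kernel_total, <- cauchy_homotopy. apply CInt_ext. intros. ring.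
Qed.

End CauchyFormula.

Lemma rcont_bounded (g : R -> C) (a b : R) : a <= b -> (forall t, rcont g t) ->
  exists M, forall t, a <= t <= b -> Cmod (g t) <= M.
Proof.
  intros hab Hg.
  destruct (continuity_ab_maj (fun t => Cmod (g t)) a b hab) as (x & Hx & _).
  - intros t _. apply continuity_pt_filterlim. apply (rcont_Cmod g t (Hg t)).
  - eauto.
Qed.

(** Cauchy's formula above requires a continuous derivative, so it is applied to the primitive [F]
    of [f], which also vanishes on the real segment. Its Taylor coefficients vanish one after the
    other: if those below [n] do, then [0 = F (c + x) = x^n (A + x Q)] up to a factor, with [Q]
    bounded, and [x] tends to zero. *)
Lemma holo_zero_ball (f : C -> C) (c : C) (R0 rho : R) : 0 < rho ->
  (forall w, Cmod (w - c) < R0 -> holo_at f w) ->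
  (forall x, Rabs x < rho -> f (c + RtoC x)%C = RtoC 0) ->
  forall z, Cmod (z - c) < R0 -> f z = RtoC 0.
Proof.
  intros hrho H H0.
  set (F := prim f c).
  assert (HF : forall w, Cmod (w - c) < R0 -> cdiff F w (f w)) by (intros; eapply prim_cdiff; eauto).
  assert (HFx : forall x, Rabs x < rho -> F (c + RtoC x)%C = RtoC 0).
  { intros x hx. unfold F, prim.
    replace (Im (c + RtoC x)) with (Im c) by (rewrite Im_plus; simpl; ring). rewrite CInt_point.
    rewrite (CInt_ext _ (fun _ => RtoC 0)).
    - rewrite CInt_const. ring.
    - intros t ht. replace (t, Im c) with (c + RtoC (t - Re c))%C by (apply C_eq; unfold Re, Im; simpl; ring).
      apply H0. eapply Rle_lt_trans; [|exact hx].
      rewrite Re_plus, Re_RtoC in ht.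
      replace x with ((Re c + x) - Re c) by ring. apply between_abs. lra. }
  assert (Z : forall w, Cmod (w - c) < R0 -> F w = RtoC 0).
  { intros z hz. set (r := (Cmod (z - c) + R0) / 2).
    pose proof (Cmod_ge_0 (z - c)) as hz0.
    assert (hr : 0 < r < R0) by (unfold r; lra).
    set (g := fun t => F (c + circ r t)%C).
    assert (Hg : forall t, rcont g t).
    { intros t. apply (rcont_comp (fun t => c + circ r t)%C F).
      - apply rcont_plus; [apply rcont_const|apply rcont_circ].
      - eapply cdiff_contin, HF. replace (c + circ r t - c)%C with (circ r t) by ring.
        rewrite Cmod_circ; lra. }
    pose proof PI_RGT_0 as hpi.
    destruct (rcont_bounded g 0 (2 * PI)) as [M HM]; [lra|exact Hg|].
    assert (Hfc : forall w, Cmod (w - c) < R0 -> ccontin f w) by (intros; apply holo_contin; auto).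
    assert (A : forall n j, (j < n)%nat -> CInt (fun t => g t * (/ circ r t) ^ j)%C 0 (2 * PI) = RtoC 0).
    { induction n as [|n IH]; intros j hj; [lia|].
      destruct (Nat.eq_dec j n) as [->|hjn]; [|apply IH; lia].
      set (A := CInt (fun t => g t * (/ circ r t) ^ n)%C 0 (2 * PI)).
      apply Cmod_small_eq. intros eps he.
      set (B := M * (/ r) ^ (S n) * 2 * (2 * PI)).
      (* Three requirements: [c + x] lies on the segment where [F] vanishes, [x <= r/2] bounds the
         factor [r / (r - x)] by 2, and [x * B] falls below [eps]. *)
      set (x := Rmin (rho / 2) (Rmin (r / 2) (eps / (1 + Rabs B)))).
      pose proof (Rabs_pos B) as hB.
      assert (hx : 0 < x).
      { repeat apply Rmin_pos; try lra. apply Rdiv_lt_0_compat; lra. }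
      assert (hx1 : x <= rho / 2) by apply Rmin_l.
      assert (hx2 : x <= r / 2) by (eapply Rle_trans; [apply Rmin_r|apply Rmin_l]).
      assert (hx3 : x <= eps / (1 + Rabs B)) by (eapply Rle_trans; [apply Rmin_r|apply Rmin_r]).
      assert (hm : Cmod (RtoC x) = x) by (apply Cmod_RtoC_pos; lra).
      assert (hxr : Cmod (RtoC x) < r) by lra.
      assert (E := cauchy_formula F f c R0 r (RtoC x) hr hxr HF Hfc).
      rewrite HFx in E by (rewrite Rabs_pos_eq; lra).
      assert (T := kernel_taylor R0 r (RtoC x) hr hxr g n Hg (fun j hj => IH j hj)).
      assert (T2 := kernel_step R0 r (RtoC x) hr hxr g n Hg).
      assert (B1 := kernel_remainder R0 r (RtoC x) hr hxr g M (S n) Hg HM).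
      change (CInt (fun t => g t * (circ r t / (circ r t - RtoC x)))%C 0 (2 * PI) = (RtoC (2 * PI) * 0)%C) in E.
      cbv beta zeta in T, T2, B1. rewrite E, T2 in T. fold A in T.
      set (Q := CInt (fun t => g t * (/ circ r t) ^ S n * (circ r t / (circ r t - RtoC x)))%C 0 (2 * PI)) in *.
      assert (hpow : (RtoC x ^ n)%C <> RtoC 0) by (apply Cpow_nz, RtoC_neq0; lra).
      assert (EA : A = (- (RtoC x * Q))%C).
      { replace A with (/ RtoC x ^ n * (RtoC x ^ n * (A + RtoC x * Q)) - RtoC x * Q)%C by (field; auto).
        rewrite <- T. ring. }
      rewrite EA, Cmod_opp, Cmod_mult, hm.
      assert (hM0 : 0 <= M) by (eapply Rle_trans; [apply (Cmod_ge_0 (g 0))|apply HM; lra]).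
      assert (hi : 0 < / r) by (apply Rinv_0_lt_compat; lra).
      assert (B2 : Cmod Q <= B).
      { eapply Rle_trans; [exact B1|]. unfold B. apply Rmult_le_compat_r; [lra|].
        apply Rmult_le_compat_l; [apply Rmult_le_pos; [auto|apply pow_le; lra]|].
        rewrite hm. apply Rmult_le_reg_r with (r - x); [lra|].
        unfold Rdiv. rewrite Rmult_assoc, Rinv_l by lra. lra. }
      apply Rle_trans with (eps / (1 + Rabs B) * (1 + Rabs B)).
      - apply Rmult_le_compat; try lra; [apply Cmod_ge_0|]. pose proof (Rle_abs B). lra.
      - right. field. lra. }
    assert (hzr : Cmod (z - c) < r) by (unfold r; lra).
    assert (E := cauchy_formula F f c R0 r (z - c) hr hzr HF Hfc).
    replace (c + (z - c))%C with z in E by ring.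
    change (CInt (fun t => g t * (circ r t / (circ r t - (z - c))))%C 0 (2 * PI) = (RtoC (2 * PI) * F z)%C) in E.
    assert (T0 := taylor_zero R0 r (z - c) hr hzr g M Hg HM (fun j => A (S j) j (Nat.lt_succ_diag_r j))).
    cbv beta zeta in T0. rewrite T0 in E.
    assert (N : RtoC (2 * PI) <> RtoC 0) by (apply RtoC_neq0; lra).
    replace (F z) with (/ RtoC (2 * PI) * (RtoC (2 * PI) * F z))%C by (field; auto).
    rewrite <- E. ring. }
  (* [F] is zero near [z], and its derivative there is [f z]. *)
  intros z hz. apply (cdiff_unique F z); [auto|].
  apply (cdiff_ext_loc (fun _ => RtoC 0) F z (RtoC 0) (R0 - Cmod (z - c))); [lra| |apply cdiff_const].
  intros w hw. apply Z. replace (w - c)%C with ((w - z) + (z - c))%C by ring.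
  eapply Rle_lt_trans; [apply Cmod_triangle|]. lra.
Qed.

(** A chain of discs of radius [del] along the segment from [p] to [z]. Consecutive centres are
    closer than [del / 2], so the disc already covered contains a horizontal segment of half length
    [del / 2] about the next centre. Convexity of the strip keeps all discs inside it. *)
Lemma holo_zero_strip (f : C -> C) (a b p e : R) : a < p < b -> 0 < e ->
  (forall z, a < Re z < b -> holo_at f z) ->
  (forall x, Rabs (x - p) < e -> f (RtoC x) = RtoC 0) ->
  forall z, a < Re z < b -> f z = RtoC 0.
Proof.
  intros hp he H H0 z hz.
  set (del := Rmin (Rmin (p - a) (b - p)) (Rmin (Re z - a) (b - Re z))).
  assert (hd : 0 < del) by (repeat apply Rmin_pos; lra).
  assert (d1 : del <= p - a) by (eapply Rle_trans; [apply Rmin_l|apply Rmin_l]).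
  assert (d2 : del <= b - p) by (eapply Rle_trans; [apply Rmin_l|apply Rmin_r]).
  assert (d3 : del <= Re z - a) by (eapply Rle_trans; [apply Rmin_r|apply Rmin_l]).
  assert (d4 : del <= b - Re z) by (eapply Rle_trans; [apply Rmin_r|apply Rmin_r]).
  destruct (nfloor_ex (Cmod (z - RtoC p) / (del / 2))) as [n0 Hn].
  { apply Rmult_le_pos; [apply Cmod_ge_0|left; apply Rinv_0_lt_compat; lra]. }
  set (n := S n0).
  assert (hn : 0 < INR n) by (apply lt_0_INR; unfold n; lia).
  assert (hstep : Cmod (z - RtoC p) / INR n < del / 2).
  { destruct Hn as [_ Hn]. unfold n. rewrite S_INR.
    apply Rmult_lt_reg_r with (INR n0 + 1); [pose proof (pos_INR n0); lra|].
    unfold Rdiv at 1. rewrite Rmult_assoc, Rinv_l, Rmult_1_r by (pose proof (pos_INR n0); lra).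
    apply (Rmult_lt_compat_r (del / 2)) in Hn; [|lra].
    unfold Rdiv at 1 in Hn. rewrite Rmult_assoc, Rinv_l, Rmult_1_r in Hn by lra. lra. }
  set (pk := fun k : nat => (RtoC p + (z - RtoC p) * RtoC (INR k / INR n))%C).
  assert (in_strip : forall k w, (k <= n)%nat -> Cmod (w - pk k) < del -> a < Re w < b).
  { intros k w hk hw.
    assert (hk1 : 0 <= INR k / INR n <= 1).
    { split.
      - apply Rmult_le_pos; [apply pos_INR|left; apply Rinv_0_lt_compat; auto].
      - apply Rmult_le_reg_r with (INR n); auto. unfold Rdiv. rewrite Rmult_assoc, Rinv_l by lra.
        apply le_INR in hk. lra. }
    pose proof (re_le_Cmod (w - pk k)) as h1. rewrite Re_minus in h1.
    assert (h2 : Rabs (Re w - Re (pk k)) < del) by lra. apply Rabs_def2 in h2.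
    assert (h3 : Re (pk k) = p + (Re z - p) * (INR k / INR n)).
    { unfold pk. rewrite Re_plus, Re_scalr, Re_minus, Re_RtoC. reflexivity. }
    set (t := INR k / INR n) in *. nra. }
  assert (intR : forall k, (k <= n)%nat -> forall w, Cmod (w - pk k) < del -> f w = RtoC 0).
  { induction k as [|k IH]; intros hk.
    - apply (holo_zero_ball f (pk 0%nat) del e he).
      + intros w hw. apply H. apply (in_strip 0%nat); auto.
      + intros x hx. unfold pk. replace (INR 0 / INR n) with 0 by (change (INR 0) with 0; unfold Rdiv; ring).
        replace (RtoC p + (z - RtoC p) * 0 + RtoC x)%C with (RtoC (p + x)) by (rewrite RtoC_plus; ring).
        apply H0. replace (p + x - p) with x by ring. auto.
    - apply (holo_zero_ball f (pk (S k)) del (del / 2)); [lra| |].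
      + intros w hw. apply H. apply (in_strip (S k)); auto.
      + intros x hx. apply IH; [lia|].
        replace (pk (S k) + RtoC x - pk k)%C with ((z - RtoC p) * RtoC (/ INR n) + RtoC x)%C.
        * eapply Rle_lt_trans; [apply Cmod_triangle|]. rewrite Cmod_mult, !Cmod_R.
          rewrite (Rabs_pos_eq (/ INR n)) by (left; apply Rinv_0_lt_compat; auto).
          unfold Rdiv in hstep at 1. lra.
        * unfold pk. rewrite S_INR.
          replace ((INR k + 1) / INR n) with (INR k / INR n + / INR n) by (field; lra).
          rewrite RtoC_plus. ring. }
  apply (intR n (Nat.le_refl n)). unfold pk. replace (INR n / INR n) with 1 by (field; lra).
  replace (z - (RtoC p + (z - RtoC p) * 1))%C with (RtoC 0) by ring. rewrite Cmod_0. auto.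
Qed.

Lemma holo_eq_strip (f g : C -> C) (a b p e : R) : a < p < b -> 0 < e ->
  (forall z, a < Re z < b -> holo_at f z) -> (forall z, a < Re z < b -> holo_at g z) ->
  (forall x, Rabs (x - p) < e -> f (RtoC x) = g (RtoC x)) ->
  forall z, a < Re z < b -> f z = g z.
Proof.
  intros hp he Hf Hg H z hz.
  assert (E := holo_zero_strip (fun z => f z - g z)%C a b p e hp he
    (fun z hz => holo_minus f g z (Hf z hz) (Hg z hz))).
  assert (E' : (f z - g z)%C = RtoC 0).
  { apply E; auto. intros x hx. rewrite (H x hx). ring. }
  replace (f z) with ((f z - g z) + g z)%C by ring. rewrite E'. ring.
Qed.

(** * Series *)

Notation Cser := (@is_series C_AbsRing C_NormedModule).
Definition Rsum (a : nat -> R) (n m : nat) : R := @sum_n_m R_AbelianMonoid a n m.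
Definition Csum (a : nat -> C) (n m : nat) : C := @sum_n_m C_AbelianMonoid a n m.

Lemma Csum_Sm (a : nat -> C) (n m : nat) : (n <= S m)%nat ->
  Csum a n (S m) = (Csum a n m + a (S m))%C.
Proof. intros. apply (@sum_n_Sm C_AbelianMonoid). auto. Qed.

Lemma Csum_0 (a : nat -> C) (n m : nat) : (m < n)%nat -> Csum a n m = RtoC 0.
Proof. intros. apply (@sum_n_m_zero C_AbelianMonoid). auto. Qed.

Lemma Csum_nn (a : nat -> C) (n : nat) : Csum a n n = a n.
Proof. apply (@sum_n_n C_AbelianMonoid). Qed.

Lemma Csum_ext (a b : nat -> C) (n m : nat) : (forall k, (n <= k <= m)%nat -> a k = b k) -> Csum a n m = Csum b n m.
Proof. apply (@sum_n_m_ext_loc C_AbelianMonoid). Qed.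

Lemma Csum_ind (P : C -> Prop) (a : nat -> C) (n m : nat) : P (RtoC 0) ->
  (forall z w, P z -> P w -> P (z + w)%C) -> (forall k, (n <= k <= m)%nat -> P (a k)) -> P (Csum a n m).
Proof.
  intros P0 Pp. induction m as [|m IH]; intros Pa.
  - destruct n as [|n]; [rewrite Csum_nn; apply Pa; lia|rewrite Csum_0 by lia; auto].
  - destruct (Nat.le_gt_cases n (S m)) as [h|h].
    + rewrite Csum_Sm by auto. apply Pp; [apply IH; intros; apply Pa; lia|apply Pa; lia].
    + rewrite Csum_0 by lia. auto.
Qed.

Lemma Csum_scal (c : C) (a : nat -> C) (n m : nat) : Csum (fun k => c * a k)%C n m = (c * Csum a n m)%C.
Proof. apply (@sum_n_m_mult_l C_Ring). Qed.

Lemma Csum_plus (a b : nat -> C) (n m : nat) : Csum (fun k => a k + b k)%C n m = (Csum a n m + Csum b n m)%C.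
Proof. apply (@sum_n_m_plus C_AbelianMonoid). Qed.

Lemma Csum_Cmod_le (a : nat -> C) (b : nat -> R) (n m : nat) :
  (forall k, (n <= k <= m)%nat -> Cmod (a k) <= b k) -> Cmod (Csum a n m) <= Rsum b n m.
Proof.
  induction m as [|m IH]; intros H.
  - destruct n as [|n].
    + rewrite Csum_nn. unfold Rsum. rewrite (@sum_n_n R_AbelianMonoid). apply H; lia.
    + rewrite Csum_0, Cmod_0 by lia. unfold Rsum. rewrite (@sum_n_m_zero R_AbelianMonoid) by lia. apply Rle_refl.
  - destruct (Nat.le_gt_cases n (S m)) as [h|h].
    + rewrite Csum_Sm by auto. unfold Rsum. rewrite (@sum_n_Sm R_AbelianMonoid) by auto. fold (Rsum b n m).
      eapply Rle_trans; [apply Cmod_triangle|].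
      apply Rplus_le_compat; [apply IH; intros; apply H; lia|apply H; lia].
    + rewrite Csum_0, Cmod_0 by lia. unfold Rsum. rewrite (@sum_n_m_zero R_AbelianMonoid) by lia. apply Rle_refl.
Qed.

Lemma Cser_eps (a : nat -> C) (l : C) :
  Cser a l <-> (forall eps, 0 < eps -> exists N, forall n, (N <= n)%nat -> Cmod (Csum a 0 n - l) < eps).
Proof.
  split.
  - intros H eps he.
    assert (he' : 0 < eps / sqrt 2) by (apply Rdiv_lt_0_compat; auto; apply sqrt_lt_R0; lra).
    assert (H' := proj1 (filterlim_locally (U := C_NormedModule) _ _) H (mkposreal _ he')).
    destruct H' as [N HN]. exists N. intros n hn. specialize (HN n hn).
    apply C_NormedModule_mixin_compat2 in HN. simpl in HN.
    assert (0 < sqrt 2) by (apply sqrt_lt_R0; lra).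
    replace (sqrt 2 * (eps / sqrt 2)) with eps in HN by (field; lra). exact HN.
  - intros H. apply (filterlim_locally (U := C_NormedModule)). intros [eps he].
    destruct (H eps he) as [N HN]. exists N. intros n hn.
    apply C_NormedModule_mixin_compat1. apply (HN n hn).
Qed.

Lemma Cser_unique (a : nat -> C) (l m : C) : Cser a l -> Cser a m -> l = m.
Proof.
  intros Hl Hm. assert (E : (l - m)%C = RtoC 0).
  { apply Cmod_small_eq. intros eps he.
    destruct (proj1 (Cser_eps _ _) Hl (eps/2)) as [N1 H1]; [lra|].
    destruct (proj1 (Cser_eps _ _) Hm (eps/2)) as [N2 H2]; [lra|].
    specialize (H1 (N1 + N2)%nat ltac:(lia)). specialize (H2 (N1 + N2)%nat ltac:(lia)).
    replace (l - m)%C with ((Csum a 0 (N1 + N2) - m) - (Csum a 0 (N1 + N2) - l))%C by ring.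
    eapply Rle_trans; [apply Cmod_triangle_sub|]. lra. }
  replace l with ((l - m) + m)%C by ring. rewrite E. ring.
Qed.

Lemma Cser_ext (a b : nat -> C) (l : C) : (forall n, a n = b n) -> Cser a l -> Cser b l.
Proof. intros. eapply is_series_ext; eauto. Qed.

Lemma Cser_scal (c : C) (a : nat -> C) (l : C) : Cser a l -> Cser (fun n => c * a n)%C (c * l)%C.
Proof. intros. apply (is_series_scal c a l). auto. Qed.

Lemma Cser_plus (a b : nat -> C) (l m : C) : Cser a l -> Cser b m -> Cser (fun n => a n + b n)%C (l + m)%C.
Proof. intros. apply (is_series_plus a b l m); auto. Qed.

Lemma Cser_minus (a b : nat -> C) (l m : C) : Cser a l -> Cser b m -> Cser (fun n => a n - b n)%C (l - m)%C.
Proof. intros. apply (is_series_minus a b l m); auto. Qed.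

Lemma Cser_dominated (a : nat -> C) (b : nat -> R) :
  (forall n, Cmod (a n) <= b n) -> ex_series b -> exists l, Cser a l.
Proof. intros H Hb. exact (@ex_series_le C_AbsRing C_CompleteNormedModule a b H Hb). Qed.

Lemma Cser_tail (a : nat -> C) (b : nat -> R) (l : C) (B : R) (n : nat) :
  (forall n, Cmod (a n) <= b n) -> Cser a l -> is_series b B ->
  Cmod (l - Csum a 0 n) <= B - sum_n b n.
Proof.
  intros H Ha Hb. apply le_epsilon. intros eps he.
  destruct (proj1 (Cser_eps _ _) Ha eps he) as [N HN].
  set (m := (N + n)%nat). specialize (HN m ltac:(unfold m; lia)).
  assert (hbpos : forall k, 0 <= b k) by (intros k; eapply Rle_trans; [apply Cmod_ge_0|apply H]).
  assert (K : forall j, Cmod (Csum a 0 (n + j) - Csum a 0 n) <= sum_n b (n + j) - sum_n b n).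
  { induction j as [|j IH].
    - rewrite Nat.add_0_r. replace (Csum a 0 n - Csum a 0 n)%C with (RtoC 0) by ring. rewrite Cmod_0. lra.
    - rewrite Nat.add_succ_r, Csum_Sm by lia. rewrite sum_Sn.
      replace (Csum a 0 (n + j) + a (S (n + j)) - Csum a 0 n)%C with
        ((Csum a 0 (n + j) - Csum a 0 n) + a (S (n + j)))%C by ring.
      eapply Rle_trans; [apply Cmod_triangle|]. specialize (H (S (n + j))).
      change (plus (sum_n b (n + j)) (b (S (n + j)))) with (sum_n b (n + j) + b (S (n + j))). lra. }
  specialize (K N). replace (n + N)%nat with m in K by (unfold m; lia).
  assert (P : sum_n b m <= B).
  { apply (is_lim_seq_incr_compare (sum_n b) B Hb). intros k. rewrite sum_Sn.
    change (plus (sum_n b k) (b (S k))) with (sum_n b k + b (S k)). specialize (hbpos (S k)). lra. }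
  replace (l - Csum a 0 n)%C with ((Csum a 0 m - Csum a 0 n) - (Csum a 0 m - l))%C by ring.
  eapply Rle_trans; [apply Cmod_triangle_sub|]. lra.
Qed.

Lemma Cser_Cmod_le (a : nat -> C) (b : nat -> R) (l : C) (B : R) :
  (forall n, Cmod (a n) <= b n) -> Cser a l -> is_series b B -> Cmod l <= B.
Proof.
  intros H Ha Hb. pose proof (Cser_tail a b l B 0 H Ha Hb) as T.
  rewrite Csum_nn, sum_O in T. specialize (H 0%nat).
  replace l with ((l - a 0%nat) + a 0%nat)%C by ring. eapply Rle_trans; [apply Cmod_triangle|]. lra.
Qed.

Lemma Cser_RtoC (a : nat -> R) (l : R) : is_series a l -> Cser (fun n => RtoC (a n)) (RtoC l).
Proof.
  intros H. apply Cser_eps. intros eps he.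
  assert (H' := proj1 (filterlim_locally (U := R_NormedModule) _ _) H (mkposreal _ he)).
  destruct H' as [N HN]. exists N. intros n hn. specialize (HN n hn).
  assert (E : Csum (fun n => RtoC (a n)) 0 n = RtoC (sum_n a n)).
  { clear. induction n as [|n IH].
    - rewrite Csum_nn, sum_O. reflexivity.
    - rewrite Csum_Sm, IH, sum_Sn by lia. symmetry. apply RtoC_plus. }
  rewrite E, <- RtoC_minus, Cmod_R. exact HN.
Qed.

Lemma Cser_Re (a : nat -> C) (l : C) : Cser a l -> is_series (fun n => Re (a n)) (Re l).
Proof.
  intros H. apply (filterlim_locally (U := R_NormedModule)). intros [eps he].
  destruct (proj1 (Cser_eps _ _) H eps he) as [N HN]. exists N. intros n hn. specialize (HN n hn).
  assert (E : sum_n (fun n => Re (a n)) n = Re (Csum a 0 n)).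
  { clear. induction n as [|n IH].
    - rewrite Csum_nn, sum_O. reflexivity.
    - rewrite Csum_Sm, sum_Sn, IH by lia. reflexivity. }
  change (Rabs (sum_n (fun n => Re (a n)) n - Re l) < eps). rewrite E, <- Re_minus.
  eapply Rle_lt_trans; [apply re_le_Cmod|exact HN].
Qed.

(** Comparison with a telescoping series: the mean value theorem for [x^(1-p)] bounds each term,
    from the second on, by a multiple of [g n - g (S n)], and [g] tends to zero. *)
Lemma ex_series_Rpower (p : R) : 1 < p -> ex_series (fun n => Rpower (INR (S n)) (- p)).
Proof.
  intros hp.
  set (g := fun n : nat => Rpower (INR (S n)) (1 - p)).
  assert (hpos : forall n, 0 < INR (S n)) by (intros; apply lt_0_INR; lia).
  assert (T : forall n, Rpower (INR (S (S n))) (- p) <= / (p - 1) * (g n - g (S n))).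
  { intros n. unfold g.
    destruct (MVT_gen (fun x => Rpower x (1 - p)) (INR (S n)) (INR (S (S n))) (fun x => (1 - p) * Rpower x (1 - p - 1))) as (c & hc & E).
    - intros x hx. rewrite Rmin_left in hx by (apply le_INR; lia).
      apply is_derive_Reals, derivable_pt_lim_power. specialize (hpos n). lra.
    - intros x hx. rewrite Rmin_left in hx by (apply le_INR; lia).
      apply derivable_continuous_pt. eexists. apply derivable_pt_lim_power. specialize (hpos n). lra.
    - rewrite Rmin_left, Rmax_right in hc by (apply le_INR; lia).
      replace (g n - g (S n)) with (- (Rpower (INR (S (S n))) (1 - p) - Rpower (INR (S n)) (1 - p))) by (unfold g; ring).
      replace (Rpower (INR (S n)) (1 - p) - Rpower (INR (S (S n))) (1 - p)) with
        (- (Rpower (INR (S (S n))) (1 - p) - Rpower (INR (S n)) (1 - p))) by ring.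
      rewrite E. rewrite (S_INR (S n)).
      replace (/ (p - 1) * - ((1 - p) * Rpower c (1 - p - 1) * (INR (S n) + 1 - INR (S n)))) with (Rpower c (1 - p - 1)) by (field; lra).
      replace (1 - p - 1) with (- p) by ring.
      rewrite !Rpower_Ropp. rewrite <- S_INR. specialize (hpos n).
      apply Rinv_le_contravar; [apply exp_pos|]. apply Rle_Rpower_l; lra. }
  apply (ex_series_incr_1 (fun n => Rpower (INR (S n)) (- p))).
  apply (@ex_series_le R_AbsRing R_CompleteNormedModule _ (fun n => / (p - 1) * (g n - g (S n)))).
  - intros n. change (Rabs (Rpower (INR (S (S n))) (- p)) <= / (p - 1) * (g n - g (S n))).
    rewrite Rabs_pos_eq by (apply exp_ge0). apply T.
  - apply (ex_series_scal_l (/ (p - 1)) (fun n => g n - g (S n))).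
    exists (g 0%nat - 0). change (is_lim_seq (sum_n (fun n => g n - g (S n))) (g 0%nat - 0)). apply (is_lim_seq_ext (fun n => g 0%nat - g (S n))).
    + intros n. induction n as [|n IH].
      * rewrite sum_O. reflexivity.
      * rewrite sum_Sn, <- IH. change (plus (g 0%nat - g (S n)) (g (S n) - g (S (S n)))) with ((g 0%nat - g (S n)) + (g (S n) - g (S (S n)))). ring.
    + apply is_lim_seq_minus'; [apply is_lim_seq_const|].
      apply (is_lim_seq_incr_1 g).
      apply is_lim_seq_spec. intros eps.
      (* This threshold is the solution of [t^(1-p) = eps]. *)
      destruct (nfloor_ex (Rpower eps (/ (1 - p)))) as [N [_ HN]]; [apply exp_ge0|].
      exists N. intros n hn. rewrite Rminus_0_r. unfold g. rewrite Rabs_pos_eq by (apply exp_ge0).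
      assert (h : Rpower eps (/ (1 - p)) < INR (S n)).
      { rewrite S_INR. apply le_INR in hn. lra. }
      replace (pos eps) with (Rpower (Rpower eps (/ (1 - p))) (1 - p)).
      * replace (1 - p) with (- (p - 1)) by ring.
        rewrite (Rpower_Ropp (INR (S n)) (p - 1)), (Rpower_Ropp _ (p - 1)). apply Rinv_lt_contravar.
        -- apply Rmult_lt_0_compat; apply exp_pos.
        -- apply Rlt_Rpower_l; [lra|]. split; [apply exp_pos|].
           replace (- (p - 1)) with (1 - p) by ring. exact h.
      * rewrite Rpower_mult. replace (/ (1 - p) * (1 - p)) with 1 by (field; lra). apply Rpower_1, cond_pos.
Qed.

Lemma Rpower_le_one (n : nat) (a b : R) : a <= b -> Rpower (INR (S n)) a <= Rpower (INR (S n)) b.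
Proof.
  intros. apply Rle_Rpower; auto. replace 1 with (INR 1) by reflexivity. apply le_INR. lia.
Qed.

(** * Dirichlet convolution *)

(** Divisor sums with a weight depending on both [d] and [n / d]. Both [sigma_chi] and
    [sigma_bar_chi] are instances by conversion, and weights that are not products, such as
    integrands in [u], are covered too. *)
Definition dconv (g : nat -> nat -> C) (n : nat) : C :=
  Csum (fun d => if Nat.eqb (Nat.modulo n d) 0 then g d (Nat.div n d) else RtoC 0) 1 n.

Lemma Csum_zero (a : nat -> C) (n m : nat) : (forall k, (n <= k <= m)%nat -> a k = RtoC 0) -> Csum a n m = RtoC 0.
Proof.
  intros H. apply (Csum_ind (fun z => z = RtoC 0)); auto. intros z w -> ->. ring.
Qed.

Lemma Csum_single (a : nat -> C) (m j : nat) : (1 <= j <= m)%nat ->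
  (forall k, (1 <= k <= m)%nat -> k <> j -> a k = RtoC 0) -> Csum a 1 m = a j.
Proof.
  intros hj. induction m as [|m IH]; intros H; [lia|].
  rewrite Csum_Sm by lia. destruct (Nat.eq_dec j (S m)) as [->|hn].
  - rewrite (Csum_zero a 1 m) by (intros k hk; apply H; lia). ring.
  - rewrite IH by (try lia; intros; apply H; lia). rewrite (H (S m)) by lia. ring.
Qed.

Lemma Csum_extend (a : nat -> C) (n m : nat) : (n <= m)%nat ->
  (forall k, (n < k <= m)%nat -> a k = RtoC 0) -> Csum a 1 m = Csum a 1 n.
Proof.
  induction m as [|m IH]; intros h H.
  - replace n with 0%nat by lia. reflexivity.
  - destruct (Nat.eq_dec n (S m)) as [->|hn]; [reflexivity|].
    rewrite Csum_Sm, IH, (H (S m)) by (try lia; intros; apply H; lia). ring.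
Qed.

Lemma Csum_swap (a : nat -> nat -> C) (n m : nat) :
  Csum (fun i => Csum (fun j => a i j) 1 m) 1 n = Csum (fun j => Csum (fun i => a i j) 1 n) 1 m.
Proof.
  induction n as [|n IH].
  - rewrite Csum_0 by lia. symmetry. apply Csum_zero. intros. apply Csum_0. lia.
  - rewrite Csum_Sm, IH, <- Csum_plus by lia. apply Csum_ext. intros k _. rewrite Csum_Sm by lia. reflexivity.
Qed.

(** A sum over all pairs of a square with the indicator of [d * m = n] can be exchanged freely,
    which the quotient [n / d] does not allow. *)
Lemma dconv_indicator (g : nat -> nat -> C) (n X : nat) : (1 <= n <= X)%nat ->
  dconv g n = Csum (fun d => Csum (fun m => if Nat.eqb (d * m) n then g d m else RtoC 0) 1 X) 1 X.
Proof.
  intros hn.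
  assert (E : forall d, (1 <= d)%nat ->
    Csum (fun m => if Nat.eqb (d * m) n then g d m else RtoC 0) 1 X =
    if Nat.eqb (Nat.modulo n d) 0 then g d (Nat.div n d) else RtoC 0).
  { intros d hd. pose proof (Nat.div_mod n d ltac:(lia)) as D.
    destruct (Nat.eqb_spec (n mod d) 0) as [h|h].
    - assert (hq : (d * (n / d) = n)%nat) by lia.
      rewrite (Csum_single _ X (n / d)).
      + rewrite hq, Nat.eqb_refl. reflexivity.
      + split; [nia|]. apply Nat.le_trans with n; [|lia]. apply Nat.Div0.div_le_upper_bound. nia.
      + intros k hk hkn. destruct (Nat.eqb_spec (d * k) n); auto. exfalso. apply hkn. nia.
    - apply Csum_zero. intros k hk. destruct (Nat.eqb_spec (d * k) n) as [e|]; auto.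
      exfalso. apply h. rewrite <- e, Nat.mul_comm. apply Nat.Div0.mod_mul. }
  transitivity (Csum (fun d => if Nat.eqb (Nat.modulo n d) 0 then g d (Nat.div n d) else RtoC 0) 1 X).
  - symmetry. apply Csum_extend; [lia|]. intros k hk.
    rewrite Nat.mod_small by lia. destruct (Nat.eqb_spec n 0); [lia|auto].
  - apply Csum_ext. intros d hd. symmetry. apply E. lia.
Qed.

Lemma dconv_partial (g : nat -> nat -> C) (X : nat) :
  Csum (dconv g) 1 X = Csum (fun d => Csum (fun m => if Nat.leb (d * m) X then g d m else RtoC 0) 1 X) 1 X.
Proof.
  rewrite (Csum_ext (dconv g) (fun n => Csum (fun d => Csum (fun m => if Nat.eqb (d * m) n then g d m else RtoC 0) 1 X) 1 X))
    by (intros; apply dconv_indicator; lia).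
  rewrite Csum_swap. apply Csum_ext. intros d hd. rewrite Csum_swap. apply Csum_ext. intros m hm.
  destruct (Nat.leb_spec (d * m) X) as [h|h].
  - rewrite (Csum_single _ X (d * m)); [rewrite Nat.eqb_refl; reflexivity|nia|].
    intros k hk hkn. destruct (Nat.eqb_spec (d * m) k); auto. lia.
  - apply Csum_zero. intros k hk. destruct (Nat.eqb_spec (d * m) k); auto. lia.
Qed.

Lemma Rsum_Sm (a : nat -> R) (n m : nat) : (n <= S m)%nat ->
  Rsum a n (S m) = Rsum a n m + a (S m).
Proof. intros. apply (@sum_n_Sm R_AbelianMonoid). auto. Qed.

Lemma Rsum_0 (a : nat -> R) (n m : nat) : (m < n)%nat -> Rsum a n m = 0.
Proof. intros. apply (@sum_n_m_zero R_AbelianMonoid). auto. Qed.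

Lemma Rsum_le (a b : nat -> R) (m : nat) : (forall k, (1 <= k <= m)%nat -> a k <= b k) ->
  Rsum a 1 m <= Rsum b 1 m.
Proof.
  induction m as [|m IH]; intros H.
  - rewrite !Rsum_0 by lia. lra.
  - rewrite !Rsum_Sm by lia. apply Rplus_le_compat; [apply IH; intros; apply H; lia|apply H; lia].
Qed.

Lemma Rsum_scal (c : R) (a : nat -> R) (m : nat) : Rsum (fun k => c * a k) 1 m = c * Rsum a 1 m.
Proof.
  induction m as [|m IH]; [rewrite !Rsum_0 by lia; ring|]. rewrite !Rsum_Sm, IH by lia. ring.
Qed.

Lemma Rsum_extend (a : nat -> R) (n m : nat) : (n <= m)%nat ->
  (forall k, (n < k <= m)%nat -> a k = 0) -> Rsum a 1 m = Rsum a 1 n.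
Proof.
  induction m as [|m IH]; intros h H.
  - replace n with 0%nat by lia. reflexivity.
  - destruct (Nat.eq_dec n (S m)) as [->|hn]; [reflexivity|].
    rewrite Rsum_Sm, IH, (H (S m)) by (try lia; intros; apply H; lia). ring.
Qed.

(** When [Y * Y <= X], a pair above the hyperbola [d m = X] cannot lie in the square of side [Y];
    its weight is therefore part of the difference between the two squares. *)
Lemma hyperbola_error (al be : nat -> R) (X Y : nat) : (Y <= X)%nat -> (Y * Y <= X)%nat ->
  (forall k, 0 <= al k) -> (forall k, 0 <= be k) ->
  Rsum (fun d => Rsum (fun m => if Nat.leb (d * m) X then 0 else al d * be m) 1 X) 1 X
  <= Rsum al 1 X * Rsum be 1 X - Rsum al 1 Y * Rsum be 1 Y.
Proof.
  intros hYX hYY ha hb.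
  set (t := fun d m : nat => if (Nat.leb d Y && Nat.leb m Y)%bool then al d * be m else 0).
  assert (E1 : Rsum al 1 X * Rsum be 1 X = Rsum (fun d => Rsum (fun m => al d * be m) 1 X) 1 X).
  { rewrite Rmult_comm, <- Rsum_scal. apply (@sum_n_m_ext R_AbelianMonoid). intros d. change (Rsum be 1 X * al d = Rsum (fun m => al d * be m) 1 X). rewrite Rsum_scal. apply Rmult_comm. }
  assert (E2 : Rsum al 1 Y * Rsum be 1 Y = Rsum (fun d => Rsum (t d) 1 X) 1 X).
  { rewrite (Rsum_extend (fun d => Rsum (t d) 1 X) Y X hYX).
    - rewrite Rmult_comm, <- Rsum_scal. apply (@sum_n_m_ext_loc R_AbelianMonoid). intros d hd.
      rewrite (Rsum_extend (t d) Y X hYX).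
      + rewrite Rmult_comm, <- Rsum_scal. apply (@sum_n_m_ext_loc R_AbelianMonoid). intros m hm.
        unfold t. rewrite (proj2 (Nat.leb_le d Y)), (proj2 (Nat.leb_le m Y)) by lia. reflexivity.
      + intros k hk. unfold t. rewrite (proj2 (Nat.leb_gt k Y)) by lia. rewrite Bool.andb_false_r. reflexivity.
    - intros k hk. rewrite (Rsum_extend _ 0 X) by (try lia; intros; unfold t; rewrite (proj2 (Nat.leb_gt k Y)) by lia; reflexivity).
      apply Rsum_0. lia. }
  rewrite E1, E2.
  assert (Hsum : forall (u v : nat -> R) M, Rsum (fun k => u k - v k) 1 M = Rsum u 1 M - Rsum v 1 M).
  { intros u v M. induction M as [|M IH]; [rewrite !Rsum_0 by lia; ring|]. rewrite !Rsum_Sm, IH by lia. ring. }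
  rewrite <- Hsum. apply Rsum_le. intros d hd. rewrite <- Hsum. apply Rsum_le. intros m hm.
  assert (hp : 0 <= al d * be m) by (apply Rmult_le_pos; auto).
  unfold t. destruct (Nat.leb_spec (d * m) X); destruct (Nat.leb_spec d Y); destruct (Nat.leb_spec m Y); simpl; try lra.
  exfalso. nia.
Qed.

Lemma Csum_shift (a : nat -> C) (n : nat) : Csum (fun k => a (S k)) 0 n = Csum a 1 (S n).
Proof.
  induction n as [|n IH]; [rewrite !Csum_nn; reflexivity|].
  rewrite Csum_Sm, IH, (Csum_Sm a 1 (S n)) by lia. reflexivity.
Qed.

Lemma Rsum_shift (a : nat -> R) (n : nat) : sum_n (fun k => a (S k)) n = Rsum a 1 (S n).
Proof.
  induction n as [|n IH]; [rewrite sum_O; unfold Rsum; rewrite sum_n_n; reflexivity|].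
  rewrite sum_Sn, IH, (Rsum_Sm a 1 (S n)) by lia. reflexivity.
Qed.

(** The partial sum over [d m <= X] and the product of partial sums up to [X] differ by the pairs
    above the hyperbola, controlled through [hyperbola_error] by products of sums of absolute
    values, which converge. *)
Lemma dconv_series (a b : nat -> C) (A B : C) :
  Cser (fun n => a (S n)) A -> Cser (fun n => b (S n)) B ->
  ex_series (fun n => Cmod (a (S n))) -> ex_series (fun n => Cmod (b (S n))) ->
  Cser (fun n => dconv (fun d m => a d * b m)%C (S n)) (A * B)%C.
Proof.
  intros HA HB [SA HSA] [SB HSB].
  set (al := fun n => Cmod (a n)). set (be := fun n => Cmod (b n)).
  assert (ha : forall k, 0 <= al k) by (intros; apply Cmod_ge_0).
  assert (hb : forall k, 0 <= be k) by (intros; apply Cmod_ge_0).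
  apply Cser_eps. intros eps he.
  assert (LA : is_lim_seq (fun n => Rsum al 1 (S n)) SA).
  { apply (is_lim_seq_ext (sum_n (fun n => al (S n)))); [intros; apply Rsum_shift|exact HSA]. }
  assert (LB : is_lim_seq (fun n => Rsum be 1 (S n)) SB).
  { apply (is_lim_seq_ext (sum_n (fun n => be (S n)))); [intros; apply Rsum_shift|exact HSB]. }
  assert (LP := is_lim_seq_mult' _ _ _ _ LA LB).
  apply is_lim_seq_spec in LP. destruct (LP (mkposreal (eps/4) ltac:(lra))) as [N1 H1]. simpl in H1.
  assert (LC : forall eps, 0 < eps -> exists N, forall n, (N <= n)%nat ->
     Cmod (Csum a 1 (S n) * Csum b 1 (S n) - A * B) < eps).
  { intros e he'. pose proof (Cmod_ge_0 A) as mA. pose proof (Cmod_ge_0 B) as mB.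
    set (e' := Rmin 1 (e / (2 + Cmod A + Cmod B))).
    assert (he0 : 0 < e') by (apply Rmin_pos; [lra|apply Rdiv_lt_0_compat; lra]).
    assert (e1 : e' <= 1) by apply Rmin_l.
    assert (e2 : e' * (2 + Cmod A + Cmod B) <= e).
    { apply Rle_trans with (e / (2 + Cmod A + Cmod B) * (2 + Cmod A + Cmod B)).
      - apply Rmult_le_compat_r; [lra|apply Rmin_r].
      - right. field. lra. }
    destruct (proj1 (Cser_eps _ _) HA e' he0) as [NA KA].
    destruct (proj1 (Cser_eps _ _) HB e' he0) as [NB KB].
    exists (NA + NB)%nat. intros n hn. specialize (KA n ltac:(lia)). specialize (KB n ltac:(lia)).
    rewrite Csum_shift in KA, KB.
    set (a' := Csum a 1 (S n)) in *. set (b' := Csum b 1 (S n)) in *.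
    replace (a' * b' - A * B)%C with ((a' - A) * (b' - B) + (A * (b' - B) + B * (a' - A)))%C by ring.
    eapply Rle_lt_trans; [apply Cmod_triangle|].
    eapply Rle_lt_trans; [apply Rplus_le_compat_l, Cmod_triangle|].
    rewrite !Cmod_mult.
    pose proof (Cmod_ge_0 (a' - A)) as n1. pose proof (Cmod_ge_0 (b' - B)) as n2.
    assert (t1 : Cmod (a' - A) * Cmod (b' - B) <= e' * 1) by (apply Rmult_le_compat; lra).
    assert (t2 : Cmod A * Cmod (b' - B) <= Cmod A * e') by (apply Rmult_le_compat_l; lra).
    assert (t3 : Cmod B * Cmod (a' - A) <= Cmod B * e') by (apply Rmult_le_compat_l; lra).
    lra. }
  destruct (LC (eps/4)) as [N2 H2]; [lra|].
  (* [Y] is where the product of absolute sums is already close to its limit; [n >= Y * Y] ensures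
     [Y * Y <= X]. *)
  set (Y := S N1). exists (Y * Y + N1 + N2)%nat. intros n hn.
  rewrite (Csum_shift (dconv (fun d m => (a d * b m)%C))), dconv_partial.
  set (X := S n).
  assert (hX1 : (Y <= X)%nat) by (unfold X, Y in *; lia).
  assert (hX2 : (Y * Y <= X)%nat) by (unfold X; lia).
  assert (D : (Csum a 1 X * Csum b 1 X - Csum (fun d => Csum (fun m => if Nat.leb (d * m) X then (a d * b m)%C else RtoC 0) 1 X) 1 X)%C
     = Csum (fun d => Csum (fun m => if Nat.leb (d * m) X then RtoC 0 else (a d * b m)%C) 1 X) 1 X).
  { assert (E : (Csum a 1 X * Csum b 1 X)%C = Csum (fun d => Csum (fun m => a d * b m)%C 1 X) 1 X).
    { rewrite Cmult_comm, <- Csum_scal. apply Csum_ext. intros d _. rewrite Csum_scal. apply Cmult_comm. }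
    rewrite E.
    assert (S : Csum (fun d => Csum (fun m => a d * b m)%C 1 X) 1 X =
       (Csum (fun d => Csum (fun m => if Nat.leb (d * m) X then RtoC 0 else (a d * b m)%C) 1 X) 1 X +
        Csum (fun d => Csum (fun m => if Nat.leb (d * m) X then (a d * b m)%C else RtoC 0) 1 X) 1 X)%C).
    { rewrite <- Csum_plus. apply Csum_ext. intros d _. rewrite <- Csum_plus. apply Csum_ext. intros m _.
      destruct Nat.leb; ring. }
    rewrite S. ring. }
  match goal with |- Cmod (?P - _) < _ => set (Pn := P) in * end.
  replace (Pn - A * B)%C with ((Csum a 1 X * Csum b 1 X - A * B) - (Csum a 1 X * Csum b 1 X - Pn))%C by ring.
  eapply Rle_lt_trans; [apply Cmod_triangle_sub|].
  assert (K2 := H2 n ltac:(lia)). fold X in K2. rewrite D.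
  assert (K3 : Cmod (Csum (fun d => Csum (fun m => if Nat.leb (d * m) X then RtoC 0 else (a d * b m)%C) 1 X) 1 X)
     <= Rsum al 1 X * Rsum be 1 X - Rsum al 1 Y * Rsum be 1 Y).
  { eapply Rle_trans; [|apply hyperbola_error; auto].
    apply Csum_Cmod_le. intros d _. apply Csum_Cmod_le. intros m _.
    destruct Nat.leb; [rewrite Cmod_0; lra|rewrite Cmod_mult; apply Rle_refl]. }
  assert (K4 := H1 n ltac:(lia)). assert (K5 := H1 N1 ltac:(lia)). fold X in K4. fold Y in K5.
  apply Rabs_def2 in K4. apply Rabs_def2 in K5. lra.
Qed.

Lemma dconv_ext (g h : nat -> nat -> C) (n : nat) : (1 <= n)%nat ->
  (forall d m, (1 <= d)%nat -> (1 <= m)%nat -> (d * m = n)%nat -> g d m = h d m) -> dconv g n = dconv h n.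
Proof.
  intros hn H. unfold dconv. apply Csum_ext. intros d hd.
  destruct (Nat.eqb_spec (n mod d) 0) as [e|]; auto.
  pose proof (Nat.div_mod n d ltac:(lia)) as D. apply H; nia.
Qed.

Lemma dconv_scal (c : C) (g : nat -> nat -> C) (n : nat) : dconv (fun d m => c * g d m)%C n = (c * dconv g n)%C.
Proof.
  unfold dconv. rewrite <- Csum_scal. apply Csum_ext. intros d _. destruct Nat.eqb; ring.
Qed.

(** The majorant is kept as the real part of a complex convolution of two real sequences, so that
    its summability is a case of [dconv_series]. *)
Lemma dconv_Cmod_le (g : nat -> nat -> C) (al be : nat -> R) (n : nat) : (1 <= n)%nat ->
  (forall d m, (1 <= d)%nat -> (1 <= m)%nat -> (d * m = n)%nat -> Cmod (g d m) <= al d * be m) ->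
  Cmod (dconv g n) <= Re (dconv (fun d m => RtoC (al d) * RtoC (be m))%C n).
Proof.
  intros hn H. unfold dconv.
  assert (K : forall N, (N <= n)%nat ->
    Cmod (Csum (fun d => if Nat.eqb (Nat.modulo n d) 0 then g d (Nat.div n d) else RtoC 0) 1 N) <=
    Re (Csum (fun d => if Nat.eqb (Nat.modulo n d) 0 then (RtoC (al d) * RtoC (be (Nat.div n d)))%C else RtoC 0) 1 N)).
  { induction N as [|N IH]; intros hN.
    - rewrite !Csum_0, Cmod_0 by lia. simpl. lra.
    - rewrite !Csum_Sm by lia. rewrite Re_plus. eapply Rle_trans; [apply Cmod_triangle|].
      apply Rplus_le_compat; [apply IH; lia|].
      destruct (Nat.eqb_spec (n mod S N) 0) as [e|].
      + rewrite <- RtoC_mult, Re_RtoC.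
        pose proof (Nat.div_mod n (S N) ltac:(lia)) as D. apply H; nia.
      + rewrite Cmod_0. simpl. lra. }
  apply K. lia.
Qed.

Lemma ex_series_dconv (al be : nat -> R) : (forall k, 0 <= al k) -> (forall k, 0 <= be k) ->
  ex_series (fun n => al (S n)) -> ex_series (fun n => be (S n)) ->
  ex_series (fun n => Re (dconv (fun d m => RtoC (al d) * RtoC (be m))%C (S n))).
Proof.
  intros ha hb [A HA] [B HB]. eexists. apply Cser_Re.
  apply (dconv_series (fun n => RtoC (al n)) (fun n => RtoC (be n)) (RtoC A) (RtoC B)).
  - apply Cser_RtoC; auto.
  - apply Cser_RtoC; auto.
  - exists A. eapply is_series_ext; [|exact HA]. intros. simpl. rewrite Cmod_RtoC_pos; auto.
  - exists B. eapply is_series_ext; [|exact HB]. intros. simpl. rewrite Cmod_RtoC_pos; auto.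
Qed.

(** * Integrals over the real line of exponentially decaying functions *)

(** Continuity and two-sided exponential decay with explicit constants. Explicit [M] and [d] are
    needed for termwise integration, where [d] is common to all terms and the [M] are summable. *)
Definition dom (M d : R) (f : R -> C) : Prop :=
  (forall t, rcont f t) /\ 0 < d /\ forall t, Cmod (f t) <= M * exp (- d * Rabs t).

Definition Dom (f : R -> C) : Prop := exists M d, dom M d f.

(** The end points go to infinity independently, which makes invariance under shifts and reflection
    immediate. *)
Definition isI (f : R -> C) (l : C) : Prop :=
  forall eps, 0 < eps -> exists M, forall a b, a <= - M -> M <= b -> Cmod (CInt f a b - l) <= eps.

(** A total function; the value is meaningful for integrands satisfying [Dom] and arbitrary when no
    limit exists. *)
Definition intR (f : R -> C) : C := epsilon (inhabits (RtoC 0)) (isI f).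

Lemma isI_unique (f : R -> C) (l m : C) : isI f l -> isI f m -> l = m.
Proof.
  intros Hl Hm. assert (E : (l - m)%C = RtoC 0).
  { apply Cmod_small_eq. intros eps he.
    destruct (Hl (eps/2)) as [M1 H1]; [lra|]. destruct (Hm (eps/2)) as [M2 H2]; [lra|].
    set (M := Rmax M1 M2). assert (M1 <= M) by apply Rmax_l. assert (M2 <= M) by apply Rmax_r.
    specialize (H1 (- M) M ltac:(lra) ltac:(lra)). specialize (H2 (- M) M ltac:(lra) ltac:(lra)).
    replace (l - m)%C with ((CInt f (- M) M - m) - (CInt f (- M) M - l))%C by ring.
    eapply Rle_trans; [apply Cmod_triangle_sub|]. lra. }
  replace l with ((l - m) + m)%C by ring. rewrite E. ring.
Qed.

Lemma I_unique (f : R -> C) (l : C) : isI f l -> intR f = l.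
Proof.
  intros H. apply (isI_unique f); auto. unfold intR. apply epsilon_spec. eauto.
Qed.

Lemma is_RInt_exp_lin (M k a b : R) : k <> 0 ->
  is_RInt (fun t => M * exp (k * t)) a b (M / k * exp (k * b) - M / k * exp (k * a)).
Proof.
  intros hk. apply (is_RInt_derive (fun t => M / k * exp (k * t))).
  - intros t _. auto_derive; auto. field. auto.
  - intros t _. deriv_cont. auto.
Qed.

Lemma exp_le (a b : R) : a <= b -> exp a <= exp b.
Proof. intros [h| ->]; [left; apply exp_increasing; auto|lra]. Qed.

Lemma dom_M_pos (M d : R) (f : R -> C) : dom M d f -> 0 <= M.
Proof.
  intros (_ & _ & H). specialize (H 0). rewrite Rabs_R0, Rmult_0_r, exp_0 in H.
  pose proof (Cmod_ge_0 (f 0)). lra.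
Qed.

Lemma dom_right (M d : R) (f : R -> C) (a b : R) : dom M d f -> 0 <= a <= b ->
  Cmod (CInt f a b) <= M / d * (exp (- d * a) - exp (- d * b)).
Proof.
  intros H hab. pose proof (dom_M_pos _ _ _ H) as hM. destruct H as (Hc & hd & Hb).
  replace (M / d * (exp (- d * a) - exp (- d * b))) with
    (M / (- d) * exp (- d * b) - M / (- d) * exp (- d * a)) by (field; lra).
  apply (CInt_le f (fun t => M * exp (- d * t))).
  - lra.
  - intros t _. auto.
  - intros t ht. specialize (Hb t). rewrite Rabs_pos_eq in Hb by lra. auto.
  - apply is_RInt_exp_lin. lra.
Qed.

Lemma dom_left (M d : R) (f : R -> C) (a b : R) : dom M d f -> a <= b <= 0 ->
  Cmod (CInt f a b) <= M / d * (exp (d * b) - exp (d * a)).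
Proof.
  intros H hab. pose proof (dom_M_pos _ _ _ H) as hM. destruct H as (Hc & hd & Hb).
  replace (M / d * (exp (d * b) - exp (d * a))) with
    (M / d * exp (d * b) - M / d * exp (d * a)) by (field; lra).
  apply (CInt_le f (fun t => M * exp (d * t))).
  - lra.
  - intros t _. auto.
  - intros t ht. specialize (Hb t). rewrite Rabs_left1 in Hb by lra.
    replace (- d * - t) with (d * t) in Hb by ring. auto.
  - apply is_RInt_exp_lin. lra.
Qed.

Lemma dom_split (M d : R) (f : R -> C) (a b : R) : dom M d f -> a <= 0 <= b ->
  Cmod (CInt f a b) <= 2 * M / d.
Proof.
  intros H hab. pose proof (dom_M_pos _ _ _ H) as hM.
  rewrite <- (CInt_Chasles f a 0 b) by (intros t _; apply H).
  eapply Rle_trans; [apply Cmod_triangle|].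
  pose proof (dom_left _ _ _ a 0 H ltac:(lra)) as h1.
  pose proof (dom_right _ _ _ 0 b H ltac:(lra)) as h2.
  rewrite Rmult_0_r, exp_0 in h1, h2.
  destruct H as (_ & hd & _).
  assert (hMd : 0 <= M / d) by (apply Rmult_le_pos; [auto|left; apply Rinv_0_lt_compat; auto]).
  pose proof (exp_pos (d * a)). pose proof (exp_pos (- d * b)).
  replace (2 * M / d) with (M / d * 1 + M / d * 1) by (field; lra). nra.
Qed.

Lemma dom_cauchy (M d : R) (f : R -> C) (a b a' b' : R) : dom M d f ->
  a' <= a -> a <= 0 -> 0 <= b -> b <= b' ->
  Cmod (CInt f a' b' - CInt f a b) <= M / d * (exp (d * a) + exp (- d * b)).
Proof.
  intros H h1 h2 h3 h4. pose proof (dom_M_pos _ _ _ H) as hM.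
  assert (Hc : forall u v, rcont_on f u v) by (intros u v t _; apply H).
  rewrite <- (CInt_Chasles f a' a b'), <- (CInt_Chasles f a b b') by auto.
  replace (CInt f a' a + (CInt f a b + CInt f b b') - CInt f a b)%C with (CInt f a' a + CInt f b b')%C by ring.
  eapply Rle_trans; [apply Cmod_triangle|].
  pose proof (dom_left _ _ _ a' a H ltac:(lra)) as k1.
  pose proof (dom_right _ _ _ b b' H ltac:(lra)) as k2.
  destruct H as (_ & hd & _).
  assert (hMd : 0 <= M / d) by (apply Rmult_le_pos; [auto|left; apply Rinv_0_lt_compat; auto]).
  pose proof (exp_pos (d * a')). pose proof (exp_pos (- d * b')). nra.
Qed.

Lemma exp_small (K d eps : R) : 0 < d -> 0 < eps -> exists M, 0 <= M /\ forall x, M <= x -> K * exp (- d * x) <= eps.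
Proof.
  intros hd he. pose proof (Rabs_pos K) as hK.
  exists ((Rabs K + 1) / eps / d). split.
  { apply Rmult_le_pos; [apply Rmult_le_pos; [lra|]|]; left; apply Rinv_0_lt_compat; auto. }
  intros x hx.
  assert (h1 : (Rabs K + 1) / eps <= d * x).
  { apply (Rmult_le_compat_l d) in hx; [|lra]. replace (d * ((Rabs K + 1) / eps / d)) with ((Rabs K + 1) / eps) in hx by (field; lra). auto. }
  assert (h2 : (Rabs K + 1) / eps <= exp (d * x)) by (pose proof (exp_ineq1_le (d * x)); lra).
  replace (- d * x) with (- (d * x)) by ring. rewrite exp_Ropp.
  pose proof (exp_pos (d * x)) as hp.
  apply Rmult_le_reg_r with (exp (d * x)); auto. rewrite Rmult_assoc, Rinv_l by lra.
  apply (Rmult_le_compat_l eps) in h2; [|lra].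
  replace (eps * ((Rabs K + 1) / eps)) with (Rabs K + 1) in h2 by (field; lra).
  pose proof (Rle_abs K). lra.
Qed.

(** Integrals over symmetric intervals form a Cauchy sequence, with limits taken in real and
    imaginary parts; the tail estimate then frees the two end points. The bound [2 * M / d] is the
    integral of the majorant. *)
Lemma dom_isI (M d : R) (f : R -> C) : dom M d f -> exists l, isI f l /\ Cmod l <= 2 * M / d.
Proof.
  intros H. pose proof (dom_M_pos _ _ _ H) as hM. assert (hd : 0 < d) by apply H.
  set (s := fun n : nat => CInt f (- INR n) (INR n)).
  assert (K : forall eps, 0 < eps -> exists M0, 0 <= M0 /\ forall a b a' b', a' <= a -> a <= - M0 -> M0 <= b -> b <= b' ->
     Cmod (CInt f a' b' - CInt f a b) <= eps).
  { intros eps he. destruct (exp_small (M / d) d (eps / 2) hd) as (M0 & hM0 & HM0); [lra|].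
    exists M0. split; auto. intros a b a' b' h1 h2 h3 h4.
    eapply Rle_trans; [apply (dom_cauchy M d); auto; lra|].
    pose proof (HM0 (- a) ltac:(lra)) as k1. pose proof (HM0 b ltac:(lra)) as k2.
    replace (- d * - a) with (d * a) in k1 by ring. lra. }
  assert (Ks : forall eps : posreal, exists N, forall n m, (N <= n)%nat -> (N <= m)%nat -> Cmod (s n - s m) <= eps).
  { intros eps. destruct (K eps (cond_pos eps)) as (M0 & hM0 & HM0).
    destruct (nfloor_ex M0 hM0) as [N [_ HN]]. exists (S N).
    assert (W : forall n m, (S N <= n)%nat -> (n <= m)%nat -> Cmod (s m - s n) <= eps).
    { intros n m hn hm. apply (HM0 (- INR n) (INR n) (- INR m) (INR m)).
      - apply Ropp_le_contravar, le_INR; auto.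
      - apply le_INR in hn. rewrite S_INR in hn. lra.
      - apply le_INR in hn. rewrite S_INR in hn. lra.
      - apply le_INR; auto. }
    intros n m hn hm. destruct (Nat.le_ge_cases n m) as [h|h].
    - rewrite Cmod_sub_sym. apply W; auto.
    - apply W; auto. }
  assert (c1 : ex_finite_lim_seq (fun n => Re (s n))).
  { apply ex_lim_seq_cauchy_corr. intros eps.
    destruct (Ks (mkposreal (eps/2) ltac:(pose proof (cond_pos eps); lra))) as [N HN]. exists N. intros n m hn hm.
    rewrite <- Re_minus. eapply Rle_lt_trans; [apply re_le_Cmod|]. eapply Rle_lt_trans; [apply HN; auto|].
    simpl. pose proof (cond_pos eps). lra. }
  assert (c2 : ex_finite_lim_seq (fun n => Im (s n))).
  { apply ex_lim_seq_cauchy_corr. intros eps.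
    destruct (Ks (mkposreal (eps/2) ltac:(pose proof (cond_pos eps); lra))) as [N HN]. exists N. intros n m hn hm.
    rewrite <- Im_minus. eapply Rle_lt_trans; [apply im_le_Cmod|]. eapply Rle_lt_trans; [apply HN; auto|].
    simpl. pose proof (cond_pos eps). lra. }
  destruct c1 as [l1 L1], c2 as [l2 L2]. set (l := (l1, l2) : C).
  apply is_lim_seq_spec in L1. apply is_lim_seq_spec in L2.
  assert (Hl : isI f l).
  { intros eps he. destruct (K (eps/3)) as (M0 & hM0 & HM0); [lra|].
    exists M0. intros a b ha hb.
    assert (he3 : 0 < eps / 3) by lra.
    destruct (L1 (mkposreal _ he3)) as [N1 H1]. destruct (L2 (mkposreal _ he3)) as [N2 H2].
    simpl in H1, H2.
    destruct (nfloor_ex (Rmax (- a) b)) as [N3 [_ H3]]; [eapply Rle_trans; [|apply Rmax_r]; lra|].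
    set (n := (N1 + N2 + S N3)%nat).
    specialize (H1 n ltac:(unfold n; lia)). specialize (H2 n ltac:(unfold n; lia)).
    assert (hn : Rmax (- a) b <= INR n).
    { left. eapply Rlt_le_trans; [exact H3|]. rewrite <- S_INR. apply le_INR. unfold n; lia. }
    pose proof (Rmax_l (- a) b). pose proof (Rmax_r (- a) b).
    pose proof (HM0 a b (- INR n) (INR n) ltac:(lra) ha hb ltac:(lra)) as k.
    replace (CInt f a b - l)%C with ((s n - l) - (CInt f (- INR n) (INR n) - CInt f a b))%C by (unfold s; ring).
    eapply Rle_trans; [apply Cmod_triangle_sub|].
    assert (Cmod (s n - l) <= 2 * (eps / 3)).
    { eapply Rle_trans; [apply Cmod_le_abs|]. rewrite Re_minus, Im_minus. simpl. lra. }
    lra. }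
  exists l. split; auto.
  apply le_epsilon. intros eps he. destruct (Hl eps he) as [M0 HM0].
  set (m := Rmax M0 0). assert (M0 <= m) by apply Rmax_l. assert (0 <= m) by apply Rmax_r.
  specialize (HM0 (- m) m ltac:(lra) ltac:(lra)).
  pose proof (dom_split M d f (- m) m H ltac:(lra)) as k.
  replace l with (CInt f (- m) m - (CInt f (- m) m - l))%C by ring.
  eapply Rle_trans; [apply Cmod_triangle_sub|]. lra.
Qed.

Lemma Dom_isI (f : R -> C) : Dom f -> isI f (intR f).
Proof.
  intros (M & d & H). destruct (dom_isI M d f H) as (l & hl & _).
  rewrite (I_unique f l hl). auto.
Qed.

Lemma I_bound (M d : R) (f : R -> C) : dom M d f -> Cmod (intR f) <= 2 * M / d.
Proof. intros H. destruct (dom_isI M d f H) as (l & hl & B). rewrite (I_unique f l hl). auto. Qed.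

Lemma Dom_rcont (f : R -> C) : Dom f -> forall t, rcont f t.
Proof. intros (M & d & H). apply H. Qed.

Lemma dom_plus (M1 d1 M2 d2 : R) (f g : R -> C) : dom M1 d1 f -> dom M2 d2 g ->
  dom (M1 + M2) (Rmin d1 d2) (fun t => f t + g t)%C.
Proof.
  intros H1 H2. pose proof (dom_M_pos _ _ _ H1) as p1. pose proof (dom_M_pos _ _ _ H2) as p2.
  destruct H1 as (c1 & q1 & b1), H2 as (c2 & q2 & b2). split; [|split].
  - intros t. apply rcont_plus; auto.
  - apply Rmin_pos; auto.
  - intros t. eapply Rle_trans; [apply Cmod_triangle|]. rewrite Rmult_plus_distr_r.
    pose proof (Rabs_pos t). pose proof (Rmin_l d1 d2). pose proof (Rmin_r d1 d2).
    apply Rplus_le_compat.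
    + eapply Rle_trans; [apply b1|]. apply Rmult_le_compat_l; auto. apply exp_le. nra.
    + eapply Rle_trans; [apply b2|]. apply Rmult_le_compat_l; auto. apply exp_le. nra.
Qed.

Lemma Dom_plus (f g : R -> C) : Dom f -> Dom g -> Dom (fun t => f t + g t)%C.
Proof. intros (M1 & d1 & H1) (M2 & d2 & H2). eexists _, _. eapply dom_plus; eauto. Qed.

Lemma dom_scal (M d : R) (c : C) (f : R -> C) : dom M d f -> dom (Cmod c * M) d (fun t => c * f t)%C.
Proof.
  intros (h1 & h2 & h3). split; [|split]; auto.
  - intros t. apply rcont_scal; auto.
  - intros t. rewrite Cmod_mult, Rmult_assoc. apply Rmult_le_compat_l; [apply Cmod_ge_0|auto].
Qed.

Lemma Dom_scal (c : C) (f : R -> C) : Dom f -> Dom (fun t => c * f t)%C.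
Proof. intros (M & d & H). eexists _, _. eapply dom_scal; eauto. Qed.

Lemma dom_ext (M d : R) (f g : R -> C) : (forall t, f t = g t) -> dom M d f -> dom M d g.
Proof.
  intros E (h1 & h2 & h3). split; [|split]; auto.
  - intros t. eapply rcont_ext; eauto.
  - intros t. rewrite <- E. auto.
Qed.

Lemma Dom_ext (f g : R -> C) : (forall t, f t = g t) -> Dom f -> Dom g.
Proof. intros E (M & d & H). exists M, d. eapply dom_ext; eauto. Qed.

Lemma Dom_minus (f g : R -> C) : Dom f -> Dom g -> Dom (fun t => f t - g t)%C.
Proof.
  intros H1 H2. apply (Dom_ext (fun t => f t + RtoC (-1) * g t)%C).
  - intros t. replace (RtoC (-1)) with (- RtoC 1)%C by (rewrite <- RtoC_opp; reflexivity). ring.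
  - apply Dom_plus; auto. apply Dom_scal; auto.
Qed.

Lemma isI_ext (f g : R -> C) (l : C) : (forall t, f t = g t) -> isI f l -> isI g l.
Proof.
  intros E H eps he. destruct (H eps he) as [M HM]. exists M. intros a b ha hb.
  rewrite <- (CInt_ext f g) by auto. auto.
Qed.

Lemma I_ext (f g : R -> C) : (forall t, f t = g t) -> Dom f -> intR f = intR g.
Proof. intros E H. symmetry. apply I_unique. eapply isI_ext; [exact E|]. apply Dom_isI; auto. Qed.

Lemma I_plus (f g : R -> C) : Dom f -> Dom g -> intR (fun t => f t + g t)%C = (intR f + intR g)%C.
Proof.
  intros Hf Hg. apply I_unique. intros eps he.
  destruct (Dom_isI f Hf (eps/2)) as [M1 H1]; [lra|]. destruct (Dom_isI g Hg (eps/2)) as [M2 H2]; [lra|].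
  exists (Rmax M1 M2). intros a b ha hb. pose proof (Rmax_l M1 M2). pose proof (Rmax_r M1 M2).
  rewrite CInt_plus by (intros t _; apply Dom_rcont; auto).
  replace (CInt f a b + CInt g a b - (intR f + intR g))%C with ((CInt f a b - intR f) + (CInt g a b - intR g))%C by ring.
  eapply Rle_trans; [apply Cmod_triangle|].
  specialize (H1 a b ltac:(lra) ltac:(lra)). specialize (H2 a b ltac:(lra) ltac:(lra)). lra.
Qed.

Lemma I_scal (c : C) (f : R -> C) : Dom f -> intR (fun t => c * f t)%C = (c * intR f)%C.
Proof.
  intros Hf. apply I_unique. intros eps he. pose proof (Cmod_ge_0 c) as hc.
  destruct (Dom_isI f Hf (eps / (1 + Cmod c))) as [M1 H1]; [apply Rdiv_lt_0_compat; lra|].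
  exists M1. intros a b ha hb. rewrite CInt_scal by (intros t _; apply Dom_rcont; auto).
  replace (c * CInt f a b - c * intR f)%C with (c * (CInt f a b - intR f))%C by ring.
  rewrite Cmod_mult. specialize (H1 a b ha hb).
  apply Rle_trans with ((1 + Cmod c) * (eps / (1 + Cmod c))).
  - apply Rmult_le_compat; try lra. apply Cmod_ge_0.
  - right. field. lra.
Qed.

Lemma I_minus (f g : R -> C) : Dom f -> Dom g -> intR (fun t => f t - g t)%C = (intR f - intR g)%C.
Proof.
  intros Hf Hg. rewrite <- (I_ext (fun t => f t + RtoC (-1) * g t)%C).
  - rewrite I_plus, I_scal by (auto; apply Dom_scal; auto).
    replace (RtoC (-1)) with (- RtoC 1)%C by (rewrite <- RtoC_opp; reflexivity). ring.
  - intros t. replace (RtoC (-1)) with (- RtoC 1)%C by (rewrite <- RtoC_opp; reflexivity). ring.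
  - apply Dom_plus; auto. apply Dom_scal; auto.
Qed.

Lemma CInt_shift (f : R -> C) (c a b : R) : (forall t, rcont f t) ->
  CInt (fun t => f (t + c)) a b = CInt f (a + c) (b + c).
Proof.
  intros Hc. apply CInt_unique.
  assert (H := @is_RInt_comp_lin C_R_NormedModule f 1 c a b (CInt f (a + c) (b + c))).
  rewrite !Rmult_1_l in H. specialize (H (CInt_correct f _ _ (fun t _ => Hc t))).
  eapply is_RInt_ext; [|exact H]. intros t _. simpl.
  rewrite scal_R_Cmult, Rmult_1_l. apply Cmult_1_l.
Qed.

Lemma I_shift (f : R -> C) (c : R) : Dom f -> intR (fun t => f (t + c)) = intR f.
Proof.
  intros H. apply I_unique. intros eps he. destruct (Dom_isI f H eps he) as [M HM].
  exists (M + Rabs c). intros a b ha hb. rewrite CInt_shift by (apply Dom_rcont; auto).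
  apply HM; revert ha hb; unfold Rabs; destruct Rcase_abs; lra.
Qed.

Lemma CInt_reflect (f : R -> C) (a b : R) : (forall t, rcont f t) ->
  CInt (fun t => f (- t)) a b = CInt f (- b) (- a).
Proof.
  intros Hc.
  assert (H := @is_RInt_comp_opp C_R_NormedModule f a b (CInt f (- a) (- b)) (CInt_correct f _ _ (fun t _ => Hc t))).
  apply is_CInt_scal with (c := RtoC (-1)) in H.
  rewrite (CInt_swap f (- a) (- b)) by (intros t _; auto).
  apply CInt_unique. replace (- CInt f (- a) (- b))%C with (RtoC (-1) * CInt f (- a) (- b))%C.
  - eapply is_RInt_ext; [|exact H]. intros t _. simpl.
    change (RtoC (-1) * - f (- t)%R = f (- t)%R)%C.
    replace (RtoC (-1)) with (- RtoC 1)%C by (rewrite <- RtoC_opp; reflexivity). ring.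
  - replace (RtoC (-1)) with (- RtoC 1)%C by (rewrite <- RtoC_opp; reflexivity). ring.
Qed.

Lemma I_reflect (f : R -> C) : Dom f -> intR (fun t => f (- t)) = intR f.
Proof.
  intros H. apply I_unique. intros eps he. destruct (Dom_isI f H eps he) as [M HM].
  exists M. intros a b ha hb. rewrite CInt_reflect by (apply Dom_rcont; auto). apply HM; lra.
Qed.

Lemma dom_weaken (M d M' d' : R) (f : R -> C) : dom M d f -> M <= M' -> 0 < d' <= d -> dom M' d' f.
Proof.
  intros H h1 h2. pose proof (dom_M_pos _ _ _ H) as hM. destruct H as (a & b & c). split; [|split]; auto; try lra.
  intros t. eapply Rle_trans; [apply c|]. pose proof (Rabs_pos t).
  apply Rmult_le_compat; try lra; [apply exp_ge0|]. apply exp_le. nra.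
Qed.

(** Dominated termwise integration. Since all terms decay at the same rate [d], the remainder after
    [n] terms is again dominated at that rate, with the tail of the series of the [M n] as constant,
    and [I_bound] makes its integral small. *)
Lemma I_series (f : nat -> R -> C) (F : R -> C) (M : nat -> R) (d : R) :
  (forall n, dom (M n) d (f n)) -> ex_series M -> (forall t, rcont F t) ->
  (forall t, Cser (fun n => f n t) (F t)) ->
  Dom F /\ Cser (fun n => intR (f n)) (intR F).
Proof.
  intros Hf [S HS] HF Hs.
  assert (hd : 0 < d) by apply (Hf 0%nat).
  assert (hM : forall n, 0 <= M n) by (intros n; eapply dom_M_pos; apply Hf).
  assert (Hse : forall t, is_series (fun n => M n * exp (- d * Rabs t)) (S * exp (- d * Rabs t))).
  { intros t. apply (is_series_scal_r (exp (- d * Rabs t)) M S HS). }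
  assert (HDF : dom S d F).
  { split; [|split]; auto. intros t. eapply Cser_Cmod_le; [|apply Hs|apply Hse]. intros n. apply Hf. }
  split; [exists S, d; auto|].
  assert (HP : forall n, dom (sum_n M n) d (fun t => Csum (fun k => f k t) 0 n) /\ intR (fun t => Csum (fun k => f k t) 0 n) = Csum (fun k => intR (f k)) 0 n).
  { induction n as [|n [IH1 IH2]].
    - split.
      + rewrite sum_O. eapply dom_ext; [|apply (Hf 0%nat)]. intros t. rewrite Csum_nn. reflexivity.
      + rewrite Csum_nn. symmetry. apply I_ext; [intros; rewrite Csum_nn; reflexivity|]. eexists _, _; apply Hf.
    - split.
      + rewrite sum_Sn. assert (D := dom_plus _ _ _ _ _ _ IH1 (Hf (Datatypes.S n))).
        rewrite Rmin_left in D by lra. eapply dom_ext; [|exact D]. intros t. rewrite Csum_Sm by lia. reflexivity.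
      + rewrite Csum_Sm, <- IH2, <- I_plus by (try lia; eexists _, _; eauto).
        symmetry. apply I_ext; [intros; rewrite Csum_Sm by lia; reflexivity|].
        apply Dom_plus; eexists _, _; eauto. }
  apply Cser_eps. intros eps he.
  assert (HS' := proj1 (filterlim_locally (U := R_NormedModule) _ _) HS (mkposreal (eps * d / 4) ltac:(apply Rdiv_lt_0_compat; [apply Rmult_lt_0_compat; auto|lra]))).
  destruct HS' as [N HN]. exists N. intros n hn. specialize (HN n hn).
  change (Rabs (sum_n M n - S) < eps * d / 4) in HN.
  destruct (HP n) as [P1 P2]. rewrite <- P2.
  rewrite Cmod_sub_sym, <- I_minus by (eexists _, _; eauto).
  assert (D : dom (S - sum_n M n) d (fun t => F t - Csum (fun k => f k t) 0 n)%C).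
  { split; [|split]; auto.
    - intros t. apply rcont_minus; auto. apply P1.
    - intros t. rewrite Rmult_minus_distr_r.
      eapply Rle_trans; [apply (Cser_tail _ (fun n => M n * exp (- d * Rabs t)) _ (S * exp (- d * Rabs t)))|].
      + intros k. apply Hf.
      + apply Hs.
      + apply Hse.
      + right. f_equal. exact (@sum_n_mult_r R_Ring (exp (- d * Rabs t)) M n). }
  eapply Rle_lt_trans; [apply (I_bound _ _ _ D)|].
  apply Rabs_def2 in HN. apply Rmult_lt_reg_r with d; auto.
  replace (2 * (S - sum_n M n) / d * d) with (2 * (S - sum_n M n)) by (field; lra). lra.
Qed.

Lemma xexp_le (k x : R) : 0 < k -> 0 <= x -> x * exp (- k * x) <= / k.
Proof.
  intros hk hx. replace (- k * x) with (- (k * x)) by ring. rewrite exp_Ropp.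
  pose proof (exp_pos (k * x)) as hp. pose proof (exp_ineq1_le (k * x)) as h.
  apply Rmult_le_reg_r with (exp (k * x)); auto. rewrite Rmult_assoc, Rinv_l by lra.
  apply Rmult_le_reg_l with k; auto. replace (k * (/ k * exp (k * x))) with (exp (k * x)) by (field; lra). lra.
Qed.

Lemma rcont_RtoC_id (t : R) : rcont (fun u => RtoC u) t.
Proof. apply rcont_RtoC. apply continuous_id. Qed.

Lemma rcont_expi (s : C) (t : R) : rcont (fun u => cexp (s * RtoC u)) t.
Proof. rcont. apply continuous_id. Qed.

(* A Mellin transform written in the variable [u = ln v]. *)
Definition mel (g : R -> C) (s : C) : C := intR (fun u => g u * cexp (s * RtoC u))%C.

(** The derivative carries a factor [u], paid for by half of the decay. The second-order remainder
    carries [u^2] and an exponential of rate [d/4]; it keeps the rate [d/4] and a constant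
    proportional to the square of [Cmod (w - s)]. *)
Lemma mel_holo (g : R -> C) (s : C) : Dom (fun u => g u * cexp (s * RtoC u))%C -> holo_at (mel g) s.
Proof.
  intros (M & d & H). pose proof (dom_M_pos _ _ _ H) as hM. assert (hd : 0 < d) by apply H.
  assert (Hc : forall t, rcont (fun u => g u * cexp (s * RtoC u))%C t) by apply H.
  (* Only the product with [cexp (s u)] is known to be continuous; multiplying by [cexp (- s u)]
     recovers [g]. *)
  assert (Hg : forall t, rcont g t).
  { intros t. eapply rcont_ext; [|apply rcont_mult; [apply (Hc t)|apply (rcont_expi (- s) t)]].
    intros u. simpl. rewrite <- Cmult_assoc, <- cexp_plus.
    replace (s * RtoC u + - s * RtoC u)%C with (RtoC 0) by ring. rewrite cexp_0. ring. }
  assert (H1 : dom (M * (2 / d)) (d / 2) (fun u => RtoC u * (g u * cexp (s * RtoC u)))%C).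
  { split; [|split; [lra|]].
    - intros t. apply rcont_mult; auto. apply rcont_RtoC_id.
    - intros t. rewrite Cmod_mult, Cmod_R.
      destruct H as (_ & _ & H). specialize (H t).
      apply Rle_trans with (Rabs t * (M * exp (- d * Rabs t))).
      + apply Rmult_le_compat_l; auto. apply Rabs_pos.
      + replace (- d * Rabs t) with (- (d/2) * Rabs t + - (d/2) * Rabs t) by field.
        rewrite exp_plus.
        pose proof (xexp_le (d/2) (Rabs t) ltac:(lra) (Rabs_pos t)) as h.
        replace (/ (d / 2)) with (2 / d) in h by (field; lra).
        pose proof (exp_pos (- (d/2) * Rabs t)).
        replace (Rabs t * (M * (exp (- (d / 2) * Rabs t) * exp (- (d / 2) * Rabs t)))) with
          (M * (Rabs t * exp (- (d / 2) * Rabs t)) * exp (- (d / 2) * Rabs t)) by ring.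
        apply Rmult_le_compat_r; [lra|]. apply Rmult_le_compat_l; lra. }
  assert (Hw : forall w, Cmod (w - s) <= d / 4 -> Dom (fun u => g u * cexp (w * RtoC u))%C).
  { intros w hw. exists M, (d / 2). split; [|split; [lra|]].
    - intros t. apply rcont_mult; auto. apply rcont_expi.
    - intros t. destruct H as (_ & _ & H). specialize (H t).
      replace (g t * cexp (w * RtoC t))%C with ((g t * cexp (s * RtoC t)) * cexp ((w - s) * RtoC t))%C
        by (rewrite <- Cmult_assoc, <- cexp_plus; f_equal; f_equal; ring).
      rewrite Cmod_mult, Cmod_cexp, Re_scalr.
      apply Rle_trans with (M * exp (- d * Rabs t) * exp (d / 4 * Rabs t)).
      + apply Rmult_le_compat; auto; [apply Cmod_ge_0|apply exp_ge0|].
        apply exp_le. apply Rle_trans with (Rabs (Re (w - s) * t)); [apply Rle_abs|].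
        rewrite Rabs_mult. apply Rmult_le_compat_r; [apply Rabs_pos|].
        eapply Rle_trans; [apply re_le_Cmod|auto].
      + rewrite Rmult_assoc, <- exp_plus. apply Rmult_le_compat_l; auto. apply exp_le.
        pose proof (Rabs_pos t). nra. }
  apply holo_cdiff. exists (intR (fun u => RtoC u * (g u * cexp (s * RtoC u)))%C).
  intros eps he.
  set (K := 2 * (3 * M * (16 / (d * d))) / (d / 4)).
  assert (hK : 0 <= K).
  { unfold K. repeat apply Rmult_le_pos; try lra; try (left; apply Rinv_0_lt_compat; nra). }
  exists (Rmin (d / 4) (eps / (1 + K))). split; [apply Rmin_pos; [lra|apply Rdiv_lt_0_compat; lra]|].
  intros w hw.
  assert (hw1 := Rlt_le_trans _ _ _ hw (Rmin_l _ _)). assert (hw2 := Rlt_le_trans _ _ _ hw (Rmin_r _ _)).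
  assert (Dw := Hw w (Rlt_le _ _ hw1)).
  set (h := (w - s)%C) in *. set (x := Cmod h) in *.
  assert (hx0 : 0 <= x) by apply Cmod_ge_0.
  assert (E : (mel g w - mel g s - intR (fun u => RtoC u * (g u * cexp (s * RtoC u))) * h)%C =
    intR (fun u => (g u * cexp (w * RtoC u) - g u * cexp (s * RtoC u)) - h * (RtoC u * (g u * cexp (s * RtoC u))))%C).
  { rewrite I_minus, I_minus, I_scal.
    - unfold mel. ring.
    - eexists _, _; eauto.
    - exact Dw.
    - eexists _, _; eauto.
    - apply Dom_minus; [exact Dw|eexists _, _; eauto].
    - apply Dom_scal. eexists _, _; eauto. }
  rewrite E.
  assert (D : dom (3 * (x * x) * M * (16 / (d * d))) (d / 4)
    (fun u => (g u * cexp (w * RtoC u) - g u * cexp (s * RtoC u)) - h * (RtoC u * (g u * cexp (s * RtoC u))))%C).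
  { split; [|split; [lra|]].
    - intros t. apply rcont_minus.
      + apply rcont_minus; auto. apply rcont_mult; auto. apply rcont_expi.
      + apply rcont_scal, H1.
    - intros t. destruct H as (_ & _ & H). specialize (H t).
      replace (g t * cexp (w * RtoC t) - g t * cexp (s * RtoC t) - h * (RtoC t * (g t * cexp (s * RtoC t))))%C
        with ((g t * cexp (s * RtoC t)) * (cexp (h * RtoC t) - 1 - h * RtoC t))%C.
      2:{ replace (cexp (w * RtoC t)) with (cexp (s * RtoC t) * cexp (h * RtoC t))%C
            by (rewrite <- cexp_plus; f_equal; unfold h; ring). ring. }
      rewrite Cmod_mult.
      pose proof (cexp_taylor1 (h * RtoC t)) as T. rewrite Cmod_mult, Cmod_R in T. fold x in T.
      set (a := Rabs t) in *. assert (ha : 0 <= a) by apply Rabs_pos.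
      apply Rle_trans with ((M * exp (- d * a)) * (3 * (x * a * (x * a)) * exp (d / 4 * a))).
      + apply Rmult_le_compat; auto; try apply Cmod_ge_0. eapply Rle_trans; [exact T|].
        apply Rmult_le_compat_l; [nra|]. apply exp_le. nra.
      + pose proof (xexp_le (d/4) a ltac:(lra) ha) as h4.
        assert (h0 : 0 <= a * exp (- (d/4) * a)) by (apply Rmult_le_pos; [auto|apply exp_ge0]).
        replace (/ (d / 4)) with (4 / d) in h4 by (field; lra).
        replace (M * exp (- d * a) * (3 * (x * a * (x * a)) * exp (d / 4 * a))) with
          (3 * (x * x) * M * ((a * exp (- (d/4) * a)) * (a * exp (- (d/4) * a))) * exp (- (d/4) * a)).
        2:{ replace (- d * a) with (- (d/4) * a + (- (d/4) * a + (- (d/4) * a + - (d/4 * a)))) by field.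
            rewrite !exp_plus, exp_Ropp. pose proof (exp_pos (d/4*a)). field. lra. }
        apply Rmult_le_compat_r; [apply exp_ge0|].
        apply Rmult_le_compat_l; [repeat apply Rmult_le_pos; lra|].
        replace (16 / (d * d)) with ((4 / d) * (4 / d)) by (field; lra).
        apply Rmult_le_compat; auto. }
  eapply Rle_trans; [apply (I_bound _ _ _ D)|].
  replace (2 * (3 * (x * x) * M * (16 / (d * d))) / (d / 4)) with (x * K * x) by (unfold K; field; lra).
  apply Rmult_le_compat_r; auto.
  apply Rle_trans with (eps / (1 + K) * (1 + K)); [apply Rmult_le_compat; lra|right; field; lra].
Qed.

(** * Partial fractions from Fourier series *)

Ltac eqR := match goal with |- ?a = ?b => change (@eq R a b) end.

Lemma Rser_tail (a b : nat -> R) (l B : R) (n : nat) :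
  (forall n, Rabs (a n) <= b n) -> is_series a l -> is_series b B -> Rabs (l - sum_n a n) <= B - sum_n b n.
Proof.
  intros H Ha Hb.
  pose proof (Cser_tail (fun n => RtoC (a n)) b (RtoC l) B n) as T.
  assert (E : Csum (fun n => RtoC (a n)) 0 n = RtoC (sum_n a n)).
  { clear. induction n as [|n IH].
    - rewrite Csum_nn, sum_O. reflexivity.
    - rewrite Csum_Sm, IH, sum_Sn by lia. symmetry. apply RtoC_plus. }
  rewrite E, <- RtoC_minus, Cmod_R in T. apply T; auto.
  - intros k. rewrite Cmod_R. auto.
  - apply Cser_RtoC; auto.
Qed.

Lemma Rser_abs_le (a b : nat -> R) (l B : R) :
  (forall n, Rabs (a n) <= b n) -> is_series a l -> is_series b B -> Rabs l <= B.
Proof.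
  intros H Ha Hb. rewrite <- Cmod_R.
  apply (Cser_Cmod_le (fun n => RtoC (a n)) b); auto.
  - intros. rewrite Cmod_R. auto.
  - apply Cser_RtoC; auto.
Qed.

Lemma Rser_dominated (a b : nat -> R) : (forall n, Rabs (a n) <= b n) -> ex_series b -> is_series a (Series a).
Proof.
  intros H Hb. apply Series_correct. exact (@ex_series_le R_AbsRing R_CompleteNormedModule a b H Hb).
Qed.

(** Finitely many terms are differentiated. By the mean value theorem each remaining term deviates
    from its linear part by at most [2 M1 n |y - x|], so the tail contributes a small multiple of
    [|y - x|]. *)
Lemma series_derive (f f' : nat -> R -> R) (M0 M1 : nat -> R) :
  (forall n x, is_derive (f n) x (f' n x)) -> (forall n x, Rabs (f n x) <= M0 n) ->
  (forall n x, Rabs (f' n x) <= M1 n) -> ex_series M0 -> ex_series M1 ->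
  forall x, is_derive (fun y => Series (fun n => f n y)) x (Series (fun n => f' n x)).
Proof.
  intros Hd H0 H1 E0 E1 x.
  assert (S0 : forall y, is_series (fun n => f n y) (Series (fun n => f n y)))
    by (intros y; apply (Rser_dominated _ M0); auto).
  assert (S1 : is_series (fun n => f' n x) (Series (fun n => f' n x)))
    by (apply (Rser_dominated _ M1); auto).
  destruct E1 as [B HB].
  assert (lip : forall n y, Rabs (f n y - f n x) <= M1 n * Rabs (y - x)).
  { intros n y. destruct (MVT_gen (f n) x y (f' n)) as (c & hc & E).
    - intros; auto.
    - intros z _. apply continuity_pt_filterlim, (@ex_derive_continuous R_AbsRing R_NormedModule). eexists; apply Hd.
    - rewrite E, Rabs_mult. apply Rmult_le_compat_r; [apply Rabs_pos|auto]. }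
  split; [apply (@is_linear_scal_l R_AbsRing R_NormedModule)|].
  intros x' hx. apply (@is_filter_lim_locally_unique R_AbsRing (AbsRing_NormedModule R_AbsRing) x x') in hx. subst x'.
  intros [eps he].
  assert (HB' := proj1 (filterlim_locally (U := R_NormedModule) _ _) HB (mkposreal (eps / 4) ltac:(lra))).
  destruct HB' as [N HN]. specialize (HN N (Nat.le_refl N)).
  change (Rabs (sum_n M1 N - B) < eps / 4) in HN. apply Rabs_def2 in HN.
  assert (DN : is_derive (fun y => sum_n (fun k => f k y) N) x (sum_n (fun k => f' k x) N))
    by exact (@is_derive_sum_n R_AbsRing R_NormedModule f N x (fun k => f' k x) (fun k _ => Hd k x)).
  destruct DN as [_ DN]. destruct (DN x (fun P h => h) (mkposreal (eps/2) ltac:(lra))) as [d Hd'].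
  exists d. intros y hy. specialize (Hd' y hy).
  change (Rabs (sum_n (fun k => f k y) N - sum_n (fun k => f k x) N - (y - x) * sum_n (fun k => f' k x) N) <= eps / 2 * Rabs (y - x)) in Hd'.
  change (Rabs (Series (fun n => f n y) - Series (fun n => f n x) - (y - x) * Series (fun n => f' n x)) <= eps * Rabs (y - x)).
  assert (T := Rser_tail (fun n => f n y - f n x - (y - x) * f' n x) (fun n => 2 * Rabs (y - x) * M1 n)
     (Series (fun n => f n y) - Series (fun n => f n x) - (y - x) * Series (fun n => f' n x)) (2 * Rabs (y - x) * B) N).
  assert (L : forall n, sum_n (fun n => f n y - f n x - (y - x) * f' n x) n =
     sum_n (fun k => f k y) n - sum_n (fun k => f k x) n - (y - x) * sum_n (fun k => f' k x) n).
  { induction n as [|n IH]; [rewrite !sum_O; reflexivity|].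
    rewrite !sum_Sn, IH. unfold plus; simpl. eqR. ring. }
  assert (L2 : sum_n (fun n => 2 * Rabs (y - x) * M1 n) N = 2 * Rabs (y - x) * sum_n M1 N)
    by exact (@sum_n_mult_l R_Ring (2 * Rabs (y - x)) M1 N).
  rewrite L, L2 in T.
  assert (T' := T ltac:(intros n; specialize (lip n y); specialize (H1 n x);
     eapply Rle_trans; [apply (Rabs_triang (f n y - f n x) (- ((y - x) * f' n x)))|];
     rewrite Rabs_Ropp, Rabs_mult; pose proof (Rabs_pos (y - x)); nra)
   ltac:(apply (is_series_minus (fun n => f n y - f n x) (fun n => (y - x) * f' n x));
     [apply (is_series_minus (fun n => f n y) (fun n => f n x)); apply S0
     |apply (is_series_scal (y - x) (fun n => f' n x)); exact S1])
   ltac:(apply (is_series_scal (2 * Rabs (y - x)) M1); exact HB)).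
  set (P := Series (fun n => f n y) - Series (fun n => f n x) - (y - x) * Series (fun n => f' n x)) in *.
  set (Q := sum_n (fun k => f k y) N - sum_n (fun k => f k x) N - (y - x) * sum_n (fun k => f' k x) N) in *.
  replace P with ((P - Q) + Q) by ring. eapply Rle_trans; [apply Rabs_triang|].
  pose proof (Rabs_pos (y - x)). nra.
Qed.

Lemma Series_zero (a : nat -> R) : (forall n, a n = 0) -> Series a = 0.
Proof.
  intros H. rewrite (Series_ext a (fun n => 0 * 0)) by (intros; rewrite H; ring). rewrite Series_scal_l. ring.
Qed.

Lemma is_series_zero (a : nat -> R) : (forall n, a n = 0) -> is_series a 0.
Proof.
  intros H. change (is_lim_seq (sum_n a) 0). apply (is_lim_seq_ext (fun _ => 0)); [|apply is_lim_seq_const].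
  intros n. induction n as [|n IH]; [rewrite sum_O; auto|]. rewrite sum_Sn, <- IH, H. unfold plus; simpl. ring.
Qed.

(** Series are indexed from 0; [ik n] is the real summation variable, which starts at 1. *)
Definition ik (n : nat) : R := INR (S n).

Lemma ik_ge1 (n : nat) : 1 <= ik n.
Proof. unfold ik. rewrite S_INR. pose proof (pos_INR n). lra. Qed.

Lemma Rinv_pow_Rpower (n k : nat) : / (ik n ^ k) = Rpower (ik n) (- INR k).
Proof. rewrite Rpower_Ropp, Rpower_pow; [reflexivity|]. pose proof (ik_ge1 n). lra. Qed.

(** * The Fourier series of the quadratic Bernoulli polynomial *)

Lemma ex_series_inv_sqr : ex_series (fun n => / (ik n ^ 2)).
Proof.
  eapply ex_series_ext; [|apply (ex_series_Rpower 2); lra].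
  intros n. rewrite Rinv_pow_Rpower. reflexivity.
Qed.

Lemma ex_series_sqr_lam (c : R) : ex_series (fun n => c * / (ik n ^ 2)).
Proof. apply (ex_series_scal_l c (fun n => / ik n ^ 2)). apply ex_series_inv_sqr. Qed.

(** Its value is a quadratic polynomial on [[0, 2 PI]]. Only the dependence on [t] is determined
    below; the constant [c2 PI] remains symbolic and cancels later. *)
Definition c2 (t : R) : R := Series (fun n => cos (ik n * t) / ik n ^ 2).

Lemma abs_cos_le1 (x : R) : Rabs (cos x) <= 1.
Proof. apply Rabs_le. apply COS_bound. Qed.
Lemma abs_sin_le1 (x : R) : Rabs (sin x) <= 1.
Proof. apply Rabs_le. apply SIN_bound. Qed.

Lemma c2_correct (t : R) : is_series (fun n => cos (ik n * t) / ik n ^ 2) (c2 t).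
Proof.
  apply (Rser_dominated _ (fun n => / (ik n ^ 2))); [|apply ex_series_inv_sqr].
  intros n. unfold Rdiv. rewrite Rabs_mult.
  pose proof (ik_ge1 n). assert (0 < / ik n ^ 2) by (apply Rinv_0_lt_compat, pow_lt; lra).
  rewrite (Rabs_pos_eq (/ _)) by lra. pose proof (abs_cos_le1 (ik n * t)). nra.
Qed.

(* Any sequence with the recurrence of [cos (k t)] and [sin (k t)] has a closed generating function. *)
Lemma trig_geom (x : nat -> R) (r t : R) : 0 <= r < 1 -> (forall k, Rabs (x k) <= 1) ->
  (forall k, x (S (S k)) = 2 * cos t * x (S k) - x k) ->
  is_series (fun n => r ^ (S n) * x (S n)) ((r * x 1%nat - r ^ 2 * x 0%nat) / (1 - 2 * r * cos t + r ^ 2)).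
Proof.
  intros hr hb hx.
  set (D := 1 - 2 * r * cos t + r ^ 2).
  assert (hD : 0 < D).
  { unfold D. pose proof (COS_bound t). assert (0 < (1 - r) * (1 - r)) by nra. nra. }
  assert (E : forall n, sum_n (fun n => r ^ (S n) * x (S n)) n =
     (r * x 1%nat - r ^ 2 * x 0%nat - r ^ (S (S n)) * x (S (S n)) + r ^ (S (S (S n))) * x (S n)) / D).
  { induction n as [|n IH].
    - rewrite sum_O, hx. unfold D in *. eqR. field. lra.
    - rewrite sum_Sn, IH, (hx (S n)). unfold plus; cbn -[pow]. unfold D in *. eqR. rewrite <- !tech_pow_Rmult. field. lra. }
  assert (L : is_lim_seq (fun n => (r * x 1%nat - r ^ 2 * x 0%nat - r ^ (S (S n)) * x (S (S n)) + r ^ (S (S (S n))) * x (S n)) / D)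
     ((r * x 1%nat - r ^ 2 * x 0%nat) / D)).
  { assert (Z : forall j k, is_lim_seq (fun n => r ^ (j + n) * x (k + n)%nat) 0).
    { intros j k. apply is_lim_seq_abs_0.
      apply (is_lim_seq_le_le (fun _ => 0) _ (fun n => r ^ n)).
      - intros n. split; [apply Rabs_pos|]. rewrite Rabs_mult, (Rabs_pos_eq (r ^ (j + n))) by (apply pow_le; lra).
        rewrite pow_add. assert (0 <= r ^ n) by (apply pow_le; lra). assert (0 <= r ^ j) by (apply pow_le; lra).
        assert (r ^ j <= 1) by (rewrite <- (pow1 j); apply pow_incr; lra).
        specialize (hb (k + n)%nat). pose proof (Rabs_pos (x (k + n)%nat)).
        assert (r ^ j * r ^ n <= r ^ n) by nra. nra.
      - apply is_lim_seq_const.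
      - apply is_lim_seq_geom. rewrite Rabs_pos_eq; lra. }
    replace ((r * x 1%nat - r ^ 2 * x 0%nat) / D) with ((r * x 1%nat - r ^ 2 * x 0%nat - 0 + 0) * / D) by (unfold Rdiv; ring).
    apply (is_lim_seq_mult' _ (fun _ => / D)); [|apply is_lim_seq_const].
    apply is_lim_seq_plus'; [|apply (Z 3%nat 1%nat)].
    apply is_lim_seq_minus'; [apply is_lim_seq_const|apply (Z 2%nat 2%nat)]. }
  change (is_lim_seq (sum_n (fun n => r ^ (S n) * x (S n))) ((r * x 1%nat - r ^ 2 * x 0%nat) / D)).
  eapply is_lim_seq_ext; [|exact L]. intros n. symmetry. apply E.
Qed.

Lemma trig_geom_cos (r t : R) : 0 <= r < 1 ->
  is_series (fun n => r ^ (S n) * cos (ik n * t)) ((r * cos t - r ^ 2) / (1 - 2 * r * cos t + r ^ 2)).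
Proof.
  intros hr. assert (H := trig_geom (fun k => cos (INR k * t)) r t hr).
  cbv beta in H. simpl (INR 1) in H. simpl (INR 0) in H. rewrite Rmult_1_l, Rmult_0_l, cos_0, Rmult_1_r in H.
  apply H.
  - intros; apply abs_cos_le1.
  - intros k. rewrite !S_INR. replace ((INR k + 1 + 1) * t) with ((INR k + 1) * t + t) by ring.
    replace (INR k * t) with ((INR k + 1) * t - t) by ring. rewrite cos_plus, cos_minus. ring.
Qed.

Lemma trig_geom_sin (r t : R) : 0 <= r < 1 ->
  is_series (fun n => r ^ (S n) * sin (ik n * t)) (r * sin t / (1 - 2 * r * cos t + r ^ 2)).
Proof.
  intros hr. assert (H := trig_geom (fun k => sin (INR k * t)) r t hr).
  cbv beta in H. simpl (INR 1) in H. simpl (INR 0) in H. rewrite Rmult_1_l, Rmult_0_l, sin_0, Rmult_0_r, Rminus_0_r in H.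
  apply H.
  - intros; apply abs_sin_le1.
  - intros k. rewrite !S_INR. replace ((INR k + 1 + 1) * t) with ((INR k + 1) * t + t) by ring.
    replace (INR k * t) with ((INR k + 1) * t - t) by ring. rewrite sin_plus, sin_minus. ring.
Qed.

Lemma ex_series_geom_S (r : R) : 0 <= r < 1 -> ex_series (fun n => r ^ (S n)).
Proof.
  intros hr. apply (ex_series_scal_l r (fun n => r ^ n)). exists (/ (1 - r)).
  apply is_series_geom. rewrite Rabs_pos_eq; lra.
Qed.

(** Abel means of [c2] and their derivative. The geometric factor permits two termwise
    differentiations, which the decay [1 / k^2] alone does not, and makes the second derivative an
    explicit rational function of [cos t]. *)
Definition c2r (r t : R) : R := Series (fun n => r ^ (S n) * (cos (ik n * t) / ik n ^ 2)).
Definition s1r (r t : R) : R := Series (fun n => r ^ (S n) * - (sin (ik n * t) / ik n)).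

Lemma abs_div_ik (x : R) (n k : nat) : Rabs x <= 1 -> Rabs (x / ik n ^ k) <= 1.
Proof.
  intros h. pose proof (ik_ge1 n) as h1. unfold Rdiv. rewrite Rabs_mult.
  assert (hp : 1 <= ik n ^ k) by (apply pow_R1_Rle; auto).
  assert (0 < / ik n ^ k <= 1) by (split; [apply Rinv_0_lt_compat; lra|rewrite <- Rinv_1; apply Rinv_le_contravar; lra]).
  rewrite (Rabs_pos_eq (/ _)) by lra. pose proof (Rabs_pos x). nra.
Qed.

Lemma abs_pow_mul (r x : R) (n : nat) : 0 <= r -> Rabs x <= 1 -> Rabs (r ^ n * x) <= r ^ n.
Proof.
  intros. assert (0 <= r ^ n) by (apply pow_le; auto).
  rewrite Rabs_mult, (Rabs_pos_eq (r ^ n)) by auto. pose proof (Rabs_pos x). nra.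
Qed.

Lemma c2r_derive (r t : R) : 0 <= r < 1 -> is_derive (c2r r) t (s1r r t).
Proof.
  intros hr. apply (series_derive (fun n t => r ^ (S n) * (cos (ik n * t) / ik n ^ 2))
    (fun n t => r ^ (S n) * - (sin (ik n * t) / ik n)) (fun n => r ^ (S n)) (fun n => r ^ (S n))).
  - intros n x. pose proof (ik_ge1 n). auto_derive; auto. simpl (r ^ S n). eqR. field. lra.
  - intros n x. apply abs_pow_mul; [lra|]. apply abs_div_ik, abs_cos_le1.
  - intros n x. apply abs_pow_mul; [lra|]. rewrite Rabs_Ropp. rewrite <- (pow_1 (ik n)). apply abs_div_ik, abs_sin_le1.
  - apply ex_series_geom_S; auto.
  - apply ex_series_geom_S; auto.
Qed.

Lemma s1r_derive (r t : R) : 0 <= r < 1 ->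
  is_derive (s1r r) t (- ((r * cos t - r ^ 2) / (1 - 2 * r * cos t + r ^ 2))).
Proof.
  intros hr.
  assert (H := series_derive (fun n t => r ^ (S n) * - (sin (ik n * t) / ik n))
    (fun n t => r ^ (S n) * - cos (ik n * t)) (fun n => r ^ (S n)) (fun n => r ^ (S n))).
  assert (E : Series (fun n => r ^ (S n) * - cos (ik n * t)) = - ((r * cos t - r ^ 2) / (1 - 2 * r * cos t + r ^ 2))).
  { rewrite <- (is_series_unique _ _ (trig_geom_cos r t hr)). rewrite <- Series_opp. apply Series_ext. intros; ring. }
  rewrite <- E. apply H.
  - intros n x. pose proof (ik_ge1 n). auto_derive; auto. simpl (r ^ S n). eqR. field. lra.
  - intros n x. apply abs_pow_mul; [lra|]. rewrite Rabs_Ropp. rewrite <- (pow_1 (ik n)). apply abs_div_ik, abs_sin_le1.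
  - intros n x. apply abs_pow_mul; [lra|]. rewrite Rabs_Ropp. apply abs_cos_le1.
  - apply ex_series_geom_S; auto.
  - apply ex_series_geom_S; auto.
Qed.

Lemma sin_ik_PI (n : nat) : sin (ik n * PI) = 0.
Proof.
  unfold ik. apply sin_eq_0_1. exists (Z.of_nat (S n)). rewrite INR_IZR_INZ. reflexivity.
Qed.

Lemma s1r_PI (r : R) : s1r r PI = 0.
Proof.
  unfold s1r. apply Series_zero. intros n. rewrite sin_ik_PI. unfold Rdiv. ring.
Qed.

Lemma cos_between (s t : R) : 0 < t < 2 * PI -> Rmin PI t <= s <= Rmax PI t -> cos s <= cos t.
Proof.
  intros ht hs. destruct (Rle_or_lt t PI) as [h|h].
  - rewrite Rmin_right, Rmax_left in hs by lra. destruct (Req_dec s t) as [->|hn]; [lra|].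
    left. apply cos_decreasing_1; lra.
  - rewrite Rmin_left, Rmax_right in hs by lra. destruct (Req_dec s t) as [->|hn]; [lra|].
    left. apply cos_increasing_1; lra.
Qed.

Lemma cos_lt_1 (t : R) : 0 < t < 2 * PI -> cos t < 1.
Proof.
  intros ht. replace t with (2 * (t / 2)) by field. rewrite cos_2a_sin.
  assert (0 < sin (t / 2)) by (apply sin_gt_0; lra). nra.
Qed.

Lemma MVT_Rabs_le (f df : R -> R) (a b K : R) : (forall x, is_derive f x (df x)) ->
  (forall x, Rmin a b <= x <= Rmax a b -> Rabs (df x) <= K) -> Rabs (f b - f a) <= K * Rabs (b - a).
Proof.
  intros Hd HK. destruct (MVT_gen f a b df) as (c & hc & E).
  - intros; auto.
  - intros z _. apply continuity_pt_filterlim, (@ex_derive_continuous R_AbsRing R_NormedModule). eexists; apply Hd.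
  - rewrite E, Rabs_mult. apply Rmult_le_compat_r; [apply Rabs_pos|auto].
Qed.

(** The second derivative of the Abel mean differs from [1/2] by a Poisson kernel, which is at most
    a multiple of [1 - r] between [PI] and [t] because [cos] does not exceed [cos t] there. Two
    integrations from [PI], where the first derivative vanishes, give the quadratic. *)
Lemma c2r_approx (r t : R) : 0 < r < 1 -> 0 < t < 2 * PI ->
  Rabs (c2r r t - c2r r PI - (t - PI) ^ 2 / 4) <= (1 - r) / (2 * r * (1 - cos t)) * (PI * PI).
Proof.
  intros hr ht. pose proof (cos_lt_1 t ht) as hc. pose proof PI_RGT_0 as hpi.
  set (K := (1 - r) / (2 * r * (1 - cos t))).
  assert (hK : 0 <= K) by (apply Rmult_le_pos; [lra|left; apply Rinv_0_lt_compat; nra]).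
  assert (B2 : forall s, Rmin PI t <= s <= Rmax PI t ->
     Rabs (- ((r * cos s - r ^ 2) / (1 - 2 * r * cos s + r ^ 2)) - 1 / 2) <= K).
  { intros s hs. pose proof (cos_between s t ht hs) as hcs.
    assert (hDt : 0 < 2 * r * (1 - cos t)) by nra.
    assert (hD : 2 * r * (1 - cos t) <= 1 - 2 * r * cos s + r ^ 2) by nra.
    replace (- ((r * cos s - r ^ 2) / (1 - 2 * r * cos s + r ^ 2)) - 1 / 2) with
      (- ((1 - r) * (1 + r) / 2 * / (1 - 2 * r * cos s + r ^ 2))) by (field; lra).
    rewrite Rabs_Ropp, Rabs_pos_eq.
    2:{ apply Rmult_le_pos; [nra|left; apply Rinv_0_lt_compat; lra]. }
    unfold K, Rdiv. apply Rmult_le_compat; [nra|left; apply Rinv_0_lt_compat; lra|nra|].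
    apply Rinv_le_contravar; auto. }
  assert (B1 : forall s, Rmin PI t <= s <= Rmax PI t -> Rabs (s1r r s - (s - PI) / 2) <= K * PI).
  { intros s hs.
    pose proof (MVT_Rabs_le (fun s => s1r r s - (s - PI) / 2)
      (fun s => - ((r * cos s - r ^ 2) / (1 - 2 * r * cos s + r ^ 2)) - 1 / 2) PI s K) as M.
    simpl in M. rewrite s1r_PI in M. replace (0 - (PI - PI) / 2) with 0 in M by field. rewrite Rminus_0_r in M.
    eapply Rle_trans; [apply M|].
    - intros x. apply (is_derive_minus (s1r r) (fun s => (s - PI) / 2)).
      + apply s1r_derive. lra.
      + auto_derive; [trivial|]. eqR. field.
    - intros x hx. apply B2. revert hs hx. unfold Rmin, Rmax. repeat destruct Rle_dec; lra.
    - apply Rmult_le_compat_l; auto. apply Rabs_le. revert hs. unfold Rmin, Rmax. repeat destruct Rle_dec; lra. }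
  pose proof (MVT_Rabs_le (fun s => c2r r s - (s - PI) ^ 2 / 4) (fun s => s1r r s - (s - PI) / 2) PI t (K * PI)) as M.
  simpl in M.
  replace (c2r r t - c2r r PI - (t - PI) ^ 2 / 4) with
    (c2r r t - (t - PI) * ((t - PI) * 1) / 4 - (c2r r PI - (PI - PI) * ((PI - PI) * 1) / 4)) by field.
  eapply Rle_trans; [apply M|].
  - intros x. apply (is_derive_minus (c2r r) (fun s => (s - PI) * ((s - PI) * 1) / 4)).
    + apply c2r_derive. lra.
    + auto_derive; [trivial|]. eqR. field.
  - exact B1.
  - rewrite <- Rmult_assoc. apply Rmult_le_compat_l; [nra|]. apply Rabs_le. lra.
Qed.

Lemma ex_series_32 : ex_series (fun n => sqrt (ik n) * / (ik n ^ 2)).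
Proof.
  eapply ex_series_ext; [|apply (ex_series_Rpower (3/2)); lra].
  intros n. change (INR (S n)) with (ik n). pose proof (ik_ge1 n). rewrite Rinv_pow_Rpower, <- Rpower_sqrt by lra.
  rewrite <- Rpower_plus. f_equal. simpl. lra.
Qed.

(** [1 - r^k] is at most 1 and at most [k (1 - r)], hence at most [sqrt (k (1 - r))]. The square
    root leaves the convergent sum of [k^(-3/2)] and gives a rate uniform in [t]. *)
Lemma c2r_Abel : exists K, 0 <= K /\ forall r t, 0 < r < 1 -> Rabs (c2 t - c2r r t) <= K * sqrt (1 - r).
Proof.
  destruct ex_series_32 as [K HK]. exists K. split.
  { eapply Rle_trans; [apply Rabs_pos|]. apply (Rser_abs_le (fun n => 0) (fun n => sqrt (ik n) * / (ik n ^ 2)) 0); auto.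
    - intros n. rewrite Rabs_R0. pose proof (ik_ge1 n). apply Rmult_le_pos; [apply sqrt_pos|left; apply Rinv_0_lt_compat, pow_lt; lra].
    - apply is_series_zero. auto. }
  intros r t hr.
  apply (Rser_abs_le (fun n => cos (ik n * t) / ik n ^ 2 - r ^ S n * (cos (ik n * t) / ik n ^ 2))
     (fun n => (sqrt (ik n) * / (ik n ^ 2)) * sqrt (1 - r))).
  - intros n. pose proof (ik_ge1 n) as hn.
    assert (hp : 0 <= r ^ S n <= 1) by (split; [apply pow_le; lra|rewrite <- (pow1 (S n)); apply pow_incr; lra]).
    assert (hi : 0 < / ik n ^ 2) by (apply Rinv_0_lt_compat, pow_lt; lra).
    replace (cos (ik n * t) / ik n ^ 2 - r ^ S n * (cos (ik n * t) / ik n ^ 2)) with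
      ((1 - r ^ S n) * cos (ik n * t) * / ik n ^ 2) by (unfold Rdiv; ring).
    rewrite Rabs_mult, Rabs_mult, (Rabs_pos_eq (1 - r ^ S n)), (Rabs_pos_eq (/ _)) by lra.
    pose proof (abs_cos_le1 (ik n * t)) as hcos. pose proof (Rabs_pos (cos (ik n * t))).
    assert (B : 1 - r ^ S n <= sqrt (ik n) * sqrt (1 - r)).
    { rewrite <- sqrt_mult by lra.
      assert (Bern : 1 - r ^ S n <= ik n * (1 - r)).
      { unfold ik. clear - hr. induction n as [|n IH]; [simpl; lra|].
        rewrite S_INR. simpl pow in *. rewrite S_INR in *.
        assert (0 <= r * r ^ n <= 1).
        { split; [apply Rmult_le_pos; [lra|apply pow_le; lra]|].
          assert (0 <= r ^ n <= 1) by (split; [apply pow_le; lra|rewrite <- (pow1 n); apply pow_incr; lra]). nra. }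
        nra. }
      set (y := ik n * (1 - r)) in *.
      assert (hy : 0 <= y) by (unfold y; nra).
      destruct (Rle_or_lt y 1) as [h|h].
      - eapply Rle_trans; [exact Bern|]. rewrite <- (sqrt_square y) at 1 by auto. apply sqrt_le_1_alt. nra.
      - apply Rle_trans with 1; [lra|]. rewrite <- sqrt_1. apply sqrt_le_1_alt. lra. }
    replace (sqrt (ik n) * / ik n ^ 2 * sqrt (1 - r)) with (sqrt (ik n) * sqrt (1 - r) * / ik n ^ 2) by ring.
    apply Rmult_le_compat_r; [lra|]. nra.
  - apply (is_series_minus (fun n => cos (ik n * t) / ik n ^ 2)); [apply c2_correct|].
    apply (Rser_dominated _ (fun n => r ^ S n)).
    + intros n. apply abs_pow_mul; [lra|]. apply abs_div_ik, abs_cos_le1.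
    + apply ex_series_geom_S. lra.
  - apply (is_series_scal_r (sqrt (1 - r)) (fun n => sqrt (ik n) * / ik n ^ 2)). auto.
Qed.

Lemma Rabs_small_eq (x : R) : (forall eps, 0 < eps -> Rabs x <= eps) -> x = 0.
Proof.
  intros H. apply RtoC_inj. apply Cmod_small_eq. intros eps he. rewrite Cmod_R. auto.
Qed.

Lemma c2_value (t : R) : 0 < t < 2 * PI -> c2 t = (t - PI) ^ 2 / 4 + c2 PI.
Proof.
  intros ht. destruct c2r_Abel as (K & hK & HK). pose proof (cos_lt_1 t ht) as hc. pose proof PI_RGT_0 as hpi.
  assert (E : c2 t - c2 PI - (t - PI) ^ 2 / 4 = 0).
  { apply Rabs_small_eq. intros eps he.
    set (L := / (1 - cos t) * (PI * PI)).
    assert (hL : 0 <= L) by (apply Rmult_le_pos; [left; apply Rinv_0_lt_compat; lra|nra]).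
    set (e := Rmin (1/2) (eps / (1 + 2 * K + L))).
    assert (he0 : 0 < e) by (apply Rmin_pos; [lra|apply Rdiv_lt_0_compat; lra]).
    assert (he1 : e <= 1/2) by apply Rmin_l.
    assert (he2 : e * (1 + 2 * K + L) <= eps).
    { apply Rle_trans with (eps / (1 + 2 * K + L) * (1 + 2 * K + L)); [apply Rmult_le_compat_r; [lra|apply Rmin_r]|right; field; lra]. }
    (* With this [r] the rate [sqrt (1 - r)] is exactly [e]. *)
    set (r := 1 - e * e). assert (hr : 1/2 <= r < 1) by (unfold r; nra).
    assert (hs : sqrt (1 - r) = e) by (unfold r; replace (1 - (1 - e * e)) with (e * e) by ring; apply sqrt_square; lra).
    pose proof (HK r t ltac:(lra)) as h1. pose proof (HK r PI ltac:(lra)) as h2. rewrite hs in h1, h2.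
    pose proof (c2r_approx r t ltac:(lra) ht) as h3.
    assert (h4 : (1 - r) / (2 * r * (1 - cos t)) * (PI * PI) <= e * L).
    { unfold L. replace (e * (/ (1 - cos t) * (PI * PI))) with (e * / (1 - cos t) * (PI * PI)) by ring. apply Rmult_le_compat_r; [nra|].
      replace (1 - r) with (e * e) by (unfold r; ring).
      apply Rmult_le_reg_r with (2 * r * (1 - cos t)); [nra|].
      replace (e * e / (2 * r * (1 - cos t)) * (2 * r * (1 - cos t))) with (e * e) by (field; lra).
      replace (e * / (1 - cos t) * (2 * r * (1 - cos t))) with (e * (2 * r)) by (field; lra). nra. }
    replace (c2 t - c2 PI - (t - PI) ^ 2 / 4) with
      ((c2 t - c2r r t) + ((c2r r t - c2r r PI - (t - PI) ^ 2 / 4) - (c2 PI - c2r r PI))) by ring.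
    eapply Rle_trans; [apply Rabs_triang|].
    eapply Rle_trans; [apply Rplus_le_compat_l, Rabs_triang|]. rewrite Rabs_Ropp. lra. }
  lra.
Qed.

(** The formula holds inside the interval and extends to the end point by continuity; the same
    square root device gives [|c2 t - c2 0| <= K sqrt (2 t)]. *)
Lemma c2_zero : c2 0 = PI ^ 2 / 4 + c2 PI.
Proof.
  destruct ex_series_32 as [K HK]. pose proof PI_RGT_0 as hpi.
  assert (B : forall t, 0 <= t -> Rabs (c2 t - c2 0) <= K * sqrt (2 * t)).
  { intros t ht.
    apply (Rser_abs_le (fun n => cos (ik n * t) / ik n ^ 2 - cos (ik n * 0) / ik n ^ 2)
       (fun n => (sqrt (ik n) * / (ik n ^ 2)) * sqrt (2 * t))).
    - intros n. pose proof (ik_ge1 n) as hn.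
      assert (hi : 0 < / ik n ^ 2) by (apply Rinv_0_lt_compat, pow_lt; lra).
      rewrite Rmult_0_r, cos_0.
      replace (cos (ik n * t) / ik n ^ 2 - 1 / ik n ^ 2) with ((cos (ik n * t) - 1) * / ik n ^ 2) by (unfold Rdiv; ring).
      rewrite Rabs_mult, (Rabs_pos_eq (/ _)) by lra.
      replace (sqrt (ik n) * / ik n ^ 2 * sqrt (2 * t)) with (sqrt (ik n) * sqrt (2 * t) * / ik n ^ 2) by ring.
      apply Rmult_le_compat_r; [lra|]. rewrite <- sqrt_mult by lra.
      pose proof (cos_sub1_le (ik n * t)) as [_ h]. rewrite (Rabs_pos_eq (ik n * t)) in h by nra.
      pose proof (COS_bound (ik n * t)) as hb.
      assert (h2 : Rabs (cos (ik n * t) - 1) <= 2) by (apply Rabs_le; lra).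
      rewrite <- (sqrt_square (Rabs (cos (ik n * t) - 1))) by apply Rabs_pos.
      apply sqrt_le_1_alt. pose proof (Rabs_pos (cos (ik n * t) - 1)). nra.
    - apply (is_series_minus (fun n => cos (ik n * t) / ik n ^ 2)); apply c2_correct.
    - apply (is_series_scal_r (sqrt (2 * t)) (fun n => sqrt (ik n) * / ik n ^ 2)). auto. }
  assert (hK : 0 <= K).
  { pose proof (B (1/2) ltac:(lra)) as h. replace (2 * (1/2)) with 1 in h by field. rewrite sqrt_1 in h.
    pose proof (Rabs_pos (c2 (1/2) - c2 0)). lra. }
  assert (E : PI ^ 2 / 4 + c2 PI - c2 0 = 0).
  { apply Rabs_small_eq. intros eps he.
    set (e := Rmin 1 (eps / (1 + K + PI))).
    assert (he0 : 0 < e) by (apply Rmin_pos; [lra|apply Rdiv_lt_0_compat; lra]).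
    assert (he1 : e <= 1) by apply Rmin_l.
    assert (he2 : e * (1 + K + PI) <= eps).
    { apply Rle_trans with (eps / (1 + K + PI) * (1 + K + PI)); [apply Rmult_le_compat_r; [lra|apply Rmin_r]|right; field; lra]. }
    set (t := e * e / 2). assert (ht : 0 < t <= 1/2) by (unfold t; nra).
    pose proof PI2_1.
    pose proof (B t ltac:(lra)) as h. rewrite (c2_value t) in h by lra.
    replace (2 * t) with (e * e) in h by (unfold t; field). rewrite sqrt_square in h by lra.
    replace (PI ^ 2 / 4 + c2 PI - c2 0) with (((t - PI) ^ 2 / 4 + c2 PI - c2 0) + (2 * PI - t) * t / 4) by field.
    eapply Rle_trans; [apply Rabs_triang|].
    rewrite (Rabs_pos_eq ((2 * PI - t) * t / 4)) by (apply Rmult_le_pos; [nra|lra]).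
    assert (ht2 : t <= e) by (unfold t; nra).
    assert ((2 * PI - t) * t / 4 <= e * PI) by nra. lra. }
  lra.
Qed.

(** * Trigonometric sums with denominators [k^2 + lam], by the equation [f'' = lam f] *)

Section Resolvent.
Variables (lam : R) (Cc Sc : R -> R).
Hypothesis Hlam : lam <> 0.
Hypothesis Hlam1 : -1 < lam.
Hypothesis HC : forall t, is_derive Cc t (lam * Sc t).
Hypothesis HS : forall t, is_derive Sc t (Cc t).
Hypothesis HC0 : Cc 0 = 1.
Hypothesis HS0 : Sc 0 = 0.
Hypothesis HSpi : Sc PI <> 0.

(** [cst] comes from [k^2 + lam >= min (1, 1 + lam) k^2]. The additional [k^2] in [phi] makes it and
    its first two termwise derivatives [sig] and [rho] absolutely convergent, with
    [rho = lam phi - c2]; so [phi] solves an equation with quadratic right-hand side on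
    [(0, 2 PI)]. *)
Let cst := / Rmin 1 (1 + lam).
Let phi (t : R) := Series (fun n => cos (ik n * t) / (ik n ^ 2 * (ik n ^ 2 + lam))).
Let sig (t : R) := Series (fun n => - (sin (ik n * t) / (ik n * (ik n ^ 2 + lam)))).
Let rho (t : R) := Series (fun n => - (cos (ik n * t) / (ik n ^ 2 + lam))).

Lemma res_den (n : nat) : 0 < ik n ^ 2 + lam /\ / (ik n ^ 2 + lam) <= cst * / ik n ^ 2.
Proof.
  pose proof (ik_ge1 n) as hn.
  assert (h1 : 1 <= ik n ^ 2) by nra.
  assert (hm : 0 < Rmin 1 (1 + lam)) by (apply Rmin_pos; lra).
  assert (k : Rmin 1 (1 + lam) * ik n ^ 2 <= ik n ^ 2 + lam).
  { pose proof (Rmin_l 1 (1 + lam)). pose proof (Rmin_r 1 (1 + lam)).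
    destruct (Rle_or_lt 0 lam); nra. }
  split; [nra|]. unfold cst. rewrite <- Rinv_mult. apply Rinv_le_contravar; nra.
Qed.

Lemma res_bound (x : R) (n j : nat) : Rabs x <= 1 ->
  Rabs (x / (ik n ^ j * (ik n ^ 2 + lam))) <= cst * / ik n ^ 2.
Proof.
  intros hx. destruct (res_den n) as [h1 h2]. unfold Rdiv. rewrite Rinv_mult.
  replace (x * (/ ik n ^ j * / (ik n ^ 2 + lam))) with (x / ik n ^ j * / (ik n ^ 2 + lam)) by (unfold Rdiv; ring).
  rewrite Rabs_mult. assert (0 < / (ik n ^ 2 + lam)) by (apply Rinv_0_lt_compat; auto).
  rewrite (Rabs_pos_eq (/ (ik n ^ 2 + lam))) by lra.
  pose proof (abs_div_ik x n j hx). pose proof (Rabs_pos (x / ik n ^ j)). nra.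
Qed.

Lemma phi_derive (t : R) : is_derive phi t (sig t).
Proof.
  apply (series_derive (fun n t => cos (ik n * t) / (ik n ^ 2 * (ik n ^ 2 + lam)))
    (fun n t => - (sin (ik n * t) / (ik n * (ik n ^ 2 + lam)))) (fun n => cst * / ik n ^ 2) (fun n => cst * / ik n ^ 2)).
  - intros n x. pose proof (ik_ge1 n). destruct (res_den n) as [h _]. auto_derive; auto. eqR. field. simpl in h. lra.
  - intros n x. apply res_bound, abs_cos_le1.
  - intros n x. rewrite Rabs_Ropp. rewrite <- (pow_1 (ik n)) at 2. apply res_bound, abs_sin_le1.
  - apply ex_series_sqr_lam.
  - apply ex_series_sqr_lam.
Qed.

Lemma sig_derive (t : R) : is_derive sig t (rho t).
Proof.
  apply (series_derive (fun n t => - (sin (ik n * t) / (ik n * (ik n ^ 2 + lam))))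
    (fun n t => - (cos (ik n * t) / (ik n ^ 2 + lam))) (fun n => cst * / ik n ^ 2) (fun n => cst * / ik n ^ 2)).
  - intros n x. pose proof (ik_ge1 n). destruct (res_den n) as [h _]. auto_derive; auto. eqR. field. simpl in h. lra.
  - intros n x. rewrite Rabs_Ropp. rewrite <- (pow_1 (ik n)) at 2. apply res_bound, abs_sin_le1.
  - intros n x. rewrite Rabs_Ropp. rewrite <- (Rmult_1_l (ik n ^ 2 + lam)), <- (pow_O (ik n)). apply res_bound, abs_cos_le1.
  - apply ex_series_sqr_lam.
  - apply ex_series_sqr_lam.
Qed.

Lemma rho_eq (t : R) : rho t = lam * phi t - c2 t.
Proof.
  unfold rho. apply is_series_unique.
  eapply is_series_ext.
  2:{ apply (is_series_minus (fun n => lam * (cos (ik n * t) / (ik n ^ 2 * (ik n ^ 2 + lam)))) (fun n => cos (ik n * t) / ik n ^ 2) (lam * phi t) (c2 t)); [|apply (c2_correct t)].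
      apply (is_series_scal lam (fun n => cos (ik n * t) / (ik n ^ 2 * (ik n ^ 2 + lam)))).
      apply (Rser_dominated _ (fun n => cst * / ik n ^ 2)); [intros; apply res_bound, abs_cos_le1|apply ex_series_sqr_lam]. }
  intros n. simpl. unfold minus, plus, opp; simpl. pose proof (ik_ge1 n). destruct (res_den n) as [h _]. eqR. field. simpl in h. lra.
Qed.

(** [e0] is [phi] minus the expected solution: a polynomial particular solution plus
    [K Cc (PI - t)]. The constant [K] is forced by the condition that the derivative vanish at [0],
    as [sig 0 = 0]; symmetry about [PI] excludes the other homogeneous solution. *)
Let K := - PI / (2 * lam ^ 2 * Sc PI).
Let e0 (t : R) := phi t - (((t - PI) ^ 2 / 4 + c2 PI) / lam + / (2 * lam ^ 2) + K * Cc (PI - t)).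
Let e1 (t : R) := sig t - ((t - PI) / (2 * lam) - K * lam * Sc (PI - t)).

Lemma e0_derive (t : R) : is_derive e0 t (e1 t).
Proof.
  apply (is_derive_minus phi _ t (sig t)); [apply phi_derive|].
  assert (D : is_derive (fun t => Cc (PI - t)) t (- (lam * Sc (PI - t)))).
  { replace (- (lam * Sc (PI - t))) with (scal (-1) (lam * Sc (PI - t))) by (unfold scal; simpl; unfold mult; simpl; ring).
    apply (is_derive_comp Cc (fun t => PI - t) t (lam * Sc (PI - t)) (-1)); [apply HC|auto_derive; [trivial|]; eqR; ring]. }
  assert (D1 : is_derive (fun t => ((t - PI) ^ 2 / 4 + c2 PI) / lam + / (2 * lam ^ 2)) t ((t - PI) / (2 * lam))).
  { auto_derive; [trivial|]. eqR. field. auto. }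
  replace ((t - PI) / (2 * lam) - K * lam * Sc (PI - t)) with
    (plus ((t - PI) / (2 * lam)) (K * - (lam * Sc (PI - t)))) by (unfold plus; simpl; ring).
  apply (is_derive_plus _ (fun t => K * Cc (PI - t))); auto.
  apply (is_derive_scal (fun t => Cc (PI - t)) t K). auto.
Qed.

Lemma e1_derive (t : R) : is_derive e1 t (rho t - (/ (2 * lam) + K * lam * Cc (PI - t))).
Proof.
  apply (is_derive_minus sig _ t (rho t)); [apply sig_derive|].
  assert (D : is_derive (fun t => Sc (PI - t)) t (- Cc (PI - t))).
  { replace (- Cc (PI - t)) with (scal (-1) (Cc (PI - t))) by (unfold scal; simpl; unfold mult; simpl; ring).
    apply (is_derive_comp Sc (fun t => PI - t) t (Cc (PI - t)) (-1)); [apply HS|auto_derive; [trivial|]; eqR; ring]. }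
  assert (D1 : is_derive (fun t => (t - PI) / (2 * lam)) t (/ (2 * lam))) by (auto_derive; [trivial|]; eqR; field; auto).
  replace (/ (2 * lam) + K * lam * Cc (PI - t)) with (minus (/ (2 * lam)) (K * lam * - Cc (PI - t)))
    by (unfold minus, plus, opp; simpl; ring).
  apply (is_derive_minus _ (fun t => K * lam * Sc (PI - t))); auto.
  apply (is_derive_scal (fun t => Sc (PI - t)) t (K * lam)). auto.
Qed.

Lemma e1_derive_in (t : R) : 0 < t < 2 * PI -> is_derive e1 t (lam * e0 t).
Proof.
  intros ht. replace (lam * e0 t) with (rho t - (/ (2 * lam) + K * lam * Cc (PI - t))); [apply e1_derive|].
  rewrite rho_eq, (c2_value t ht). unfold e0. field. auto.
Qed.

Lemma is_derive_cont (f : R -> R) (x l : R) : is_derive f x l -> continuity_pt f x.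
Proof.
  intros H. apply continuity_pt_filterlim, (@ex_derive_continuous R_AbsRing R_NormedModule). eexists; eauto.
Qed.

(** The Wronskian of [e0] with the homogeneous solution [Cc (t - t0)]. Its derivative is computed
    only in the open interval, where [c2] is known, but the mean value theorem carries constancy to
    the end points. The shift [t0] selects what is read off. *)
Lemma wronskian_const (t0 a b : R) : 0 <= a <= 2 * PI -> 0 <= b <= 2 * PI ->
  e1 a * Cc (a - t0) - e0 a * (lam * Sc (a - t0)) = e1 b * Cc (b - t0) - e0 b * (lam * Sc (b - t0)).
Proof.
  intros ha hb.
  set (W := fun t => e1 t * Cc (t - t0) - e0 t * (lam * Sc (t - t0))).
  assert (DC : forall t, is_derive (fun t => Cc (t - t0)) t (lam * Sc (t - t0))).
  { intros t. replace (lam * Sc (t - t0)) with (scal 1 (lam * Sc (t - t0))) by (unfold scal; simpl; unfold mult; simpl; ring).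
    apply (is_derive_comp Cc (fun t => t - t0) t); [apply HC|auto_derive; [trivial|]; eqR; ring]. }
  assert (DS : forall t, is_derive (fun t => lam * Sc (t - t0)) t (lam * Cc (t - t0))).
  { intros t. apply (is_derive_scal (fun t => Sc (t - t0)) t lam).
    replace (Cc (t - t0)) with (scal 1 (Cc (t - t0))) by (unfold scal; simpl; unfold mult; simpl; ring).
    apply (is_derive_comp Sc (fun t => t - t0) t); [apply HS|auto_derive; [trivial|]; eqR; ring]. }
  assert (DW : forall t l, is_derive e1 t l -> is_derive W t ((l * Cc (t - t0) + e1 t * (lam * Sc (t - t0))) - (e1 t * (lam * Sc (t - t0)) + e0 t * (lam * Cc (t - t0))))).
  { intros t l Hl. apply (is_derive_minus (fun t => e1 t * Cc (t - t0)) (fun t => e0 t * (lam * Sc (t - t0)))).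
    - apply (is_derive_mult e1 (fun t => Cc (t - t0))); auto. intros; apply Rmult_comm.
    - apply (is_derive_mult e0 (fun t => lam * Sc (t - t0))); auto; [apply e0_derive|intros; apply Rmult_comm]. }
  destruct (MVT_gen W a b (fun _ => 0)) as (c & hc & E).
  - intros t ht. assert (ht' : 0 < t < 2 * PI) by (revert ht; unfold Rmin, Rmax; repeat destruct Rle_dec; lra).
    replace 0 with ((lam * e0 t * Cc (t - t0) + e1 t * (lam * Sc (t - t0))) - (e1 t * (lam * Sc (t - t0)) + e0 t * (lam * Cc (t - t0)))) by ring.
    apply DW, e1_derive_in; auto.
  - intros t _. eapply is_derive_cont, DW, e1_derive.
  - unfold W in E. lra.
Qed.

Lemma sig_0 : sig 0 = 0.
Proof.
  unfold sig. apply Series_zero. intros n.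
  rewrite Rmult_0_r, sin_0. unfold Rdiv. ring.
Qed.

Lemma sig_PI : sig PI = 0.
Proof.
  unfold sig. apply Series_zero. intros n.
  rewrite sin_ik_PI. unfold Rdiv. ring.
Qed.

Lemma e1_PI : e1 PI = 0.
Proof. unfold e1. rewrite sig_PI. replace (PI - PI) with 0 by ring. rewrite HS0. unfold Rdiv. ring. Qed.

(** [e1] vanishes at [0] and at [PI], so the Wronskian with [t0 = 0] reduces to
    [e0 PI * lam * Sc PI = 0]; the assumption [Sc PI <> 0] excludes resonance. *)
Lemma e0_PI : e0 PI = 0.
Proof.
  pose proof PI_RGT_0. pose proof (wronskian_const 0 0 PI ltac:(lra) ltac:(lra)) as W.
  rewrite e1_PI, !Rminus_0_r, HC0, HS0 in W.
  assert (E : e1 0 = 0).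
  { unfold e1. rewrite sig_0, Rminus_0_r. unfold K. field. split; auto. }
  rewrite E in W.
  assert (Z : e0 PI * (lam * Sc PI) = 0) by lra.
  apply Rmult_integral in Z. destruct Z as [Z|Z]; auto. exfalso. apply Rmult_integral in Z. tauto.
Qed.

Lemma e1_zero (t : R) : 0 <= t <= 2 * PI -> e1 t = 0.
Proof.
  intros ht. pose proof PI_RGT_0. pose proof (wronskian_const t t PI ltac:(lra) ltac:(lra)) as W.
  rewrite e1_PI, e0_PI, Rminus_eq_0, HC0, HS0 in W. lra.
Qed.

(** The cosine sum is needed at [t = 0], an end point that the differential equation misses; it is
    reached from [PI] by the mean value theorem. *)
Lemma e0_zero : e0 0 = 0.
Proof.
  pose proof PI_RGT_0.
  destruct (MVT_gen e0 0 PI e1) as (c & hc & E).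
  - intros; apply e0_derive.
  - intros t _. eapply is_derive_cont, e0_derive.
  - rewrite Rmin_left, Rmax_right in hc by lra. rewrite e1_zero, e0_PI in E by lra. lra.
Qed.

Lemma resolvent_sin (t : R) : 0 <= t <= 2 * PI ->
  is_series (fun n => sin (ik n * t) / (ik n * (ik n ^ 2 + lam))) ((PI - t) / (2 * lam) - PI * Sc (PI - t) / (2 * lam * Sc PI)).
Proof.
  intros ht. pose proof (e1_zero t ht) as E. unfold e1 in E.
  replace ((PI - t) / (2 * lam) - PI * Sc (PI - t) / (2 * lam * Sc PI)) with (opp (sig t)).
  2:{ unfold opp; simpl. replace (sig t) with ((t - PI) / (2 * lam) - K * lam * Sc (PI - t)) by lra.
      unfold K. field. split; auto. }
  eapply is_series_ext; [|apply (@is_series_opp R_AbsRing R_NormedModule), (Rser_dominated (fun n => - (sin (ik n * t) / (ik n * (ik n ^ 2 + lam)))) (fun n => cst * / ik n ^ 2))].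
  - intros n. unfold opp; simpl. ring.
  - intros n. rewrite Rabs_Ropp. rewrite <- (pow_1 (ik n)) at 2. apply res_bound, abs_sin_le1.
  - apply ex_series_sqr_lam.
Qed.

Lemma resolvent_cos0 :
  is_series (fun n => / (ik n ^ 2 + lam)) (- / (2 * lam) + PI * Cc PI / (2 * lam * Sc PI)).
Proof.
  pose proof e0_zero as E. unfold e0 in E. pose proof (rho_eq 0) as Rq. rewrite c2_zero in Rq.
  replace (- / (2 * lam) + PI * Cc PI / (2 * lam * Sc PI)) with (opp (rho 0)).
  2:{ unfold opp; simpl. rewrite Rq.
      replace (phi 0) with (((0 - PI) ^ 2 / 4 + c2 PI) / lam + / (2 * lam ^ 2) + K * Cc (PI - 0)) by lra.
      rewrite Rminus_0_r. unfold K. field. split; auto. }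
  eapply is_series_ext; [|apply (@is_series_opp R_AbsRing R_NormedModule), (Rser_dominated (fun n => - (cos (ik n * 0) / (ik n ^ 2 + lam))) (fun n => cst * / ik n ^ 2))].
  - intros n. unfold opp; simpl. rewrite Rmult_0_r, cos_0. unfold Rdiv. ring.
  - intros n. rewrite Rabs_Ropp. rewrite <- (Rmult_1_l (ik n ^ 2 + lam)), <- (pow_O (ik n)). apply res_bound, abs_cos_le1.
  - apply ex_series_sqr_lam.
Qed.

End Resolvent.

Lemma sinh_pos (x : R) : 0 < x -> 0 < sinh x.
Proof. intros. unfold sinh. assert (exp (- x) < exp x) by (apply exp_increasing; lra). lra. Qed.

Lemma cosh_ge1 (x : R) : 1 <= cosh x.
Proof. unfold cosh. pose proof (exp_ineq1_le x). pose proof (exp_ineq1_le (- x)). lra. Qed.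

Lemma is_derive_cosh_lin (V t : R) : is_derive (fun t => cosh (V * t)) t (V * sinh (V * t)).
Proof. unfold cosh, sinh. auto_derive; [trivial|]. eqR. field. Qed.

Lemma is_derive_sinh_lin (V t : R) : is_derive (fun t => sinh (V * t)) t (V * cosh (V * t)).
Proof. unfold cosh, sinh. auto_derive; [trivial|]. eqR. field. Qed.

Section Hyperbolic.
Variable V : R.
Hypothesis HV : 0 < V.

Let Cc t := cosh (V * t).
Let Sc t := sinh (V * t) / V.

Lemma hyp_C (t : R) : is_derive Cc t (V ^ 2 * Sc t).
Proof.
  replace (V ^ 2 * Sc t) with (V * sinh (V * t)) by (unfold Sc; field; lra). apply is_derive_cosh_lin.
Qed.

Lemma hyp_S (t : R) : is_derive Sc t (Cc t).
Proof.
  replace (Cc t) with (/ V * (V * cosh (V * t))) by (unfold Cc; field; lra).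
  apply (is_derive_ext (fun t => / V * sinh (V * t))); [intros; unfold Sc, Rdiv; apply Rmult_comm|].
  apply is_derive_scal, is_derive_sinh_lin.
Qed.

Lemma hyp_lam : V ^ 2 <> 0 /\ -1 < V ^ 2 /\ Cc 0 = 1 /\ Sc 0 = 0 /\ Sc PI <> 0.
Proof.
  assert (0 < V ^ 2) by nra. pose proof PI_RGT_0.
  unfold Cc, Sc. rewrite Rmult_0_r, cosh_0, sinh_0.
  split; [lra|]. split; [lra|]. split; [reflexivity|]. split; [unfold Rdiv; ring|].
  assert (0 < sinh (V * PI)) by (apply sinh_pos; nra).
  apply Rgt_not_eq. apply Rdiv_lt_0_compat; auto.
Qed.

Lemma sum_sin_hyp (t : R) : 0 <= t <= 2 * PI ->
  is_series (fun n => sin (ik n * t) / (ik n * (ik n ^ 2 + V ^ 2)))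
    ((PI - t) / (2 * V ^ 2) - PI * sinh (V * (PI - t)) / (2 * V ^ 2 * sinh (V * PI))).
Proof.
  intros ht. destruct hyp_lam as (h1 & h2 & h3 & h4 & h5).
  assert (H := resolvent_sin (V ^ 2) Cc Sc h1 h2 hyp_C hyp_S h3 h4 h5 t ht).
  replace (PI * sinh (V * (PI - t)) / (2 * V ^ 2 * sinh (V * PI))) with (PI * Sc (PI - t) / (2 * V ^ 2 * Sc PI)); auto.
  unfold Sc. field. split; [|lra]. intros E. apply h5. unfold Sc. rewrite E. unfold Rdiv. ring.
Qed.

Lemma sum_inv_sqr_hyp :
  is_series (fun n => / (ik n ^ 2 + V ^ 2)) (- / (2 * V ^ 2) + PI * cosh (V * PI) / (2 * V * sinh (V * PI))).
Proof.
  destruct hyp_lam as (h1 & h2 & h3 & h4 & h5).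
  assert (H := resolvent_cos0 (V ^ 2) Cc Sc h1 h2 hyp_C hyp_S h3 h4 h5).
  replace (PI * cosh (V * PI) / (2 * V * sinh (V * PI))) with (PI * Cc PI / (2 * V ^ 2 * Sc PI)); auto.
  unfold Sc, Cc. field. split; [|lra]. intros E. apply h5. unfold Sc. rewrite E. unfold Rdiv. ring.
Qed.
End Hyperbolic.

(** The oscillating case [lam = - mu^2] at [t = PI/2]; the coefficients [sin (k PI/2)] are those of
    the expansion of [1 / (2 cosh u)]. *)
Lemma sum_sin_trig (mu : R) : 0 < mu < 1 ->
  is_series (fun n => sin (ik n * (PI / 2)) / (ik n * (ik n ^ 2 + - mu ^ 2)))
    (- PI / (4 * mu ^ 2) + PI / (4 * mu ^ 2 * cos (mu * (PI / 2)))).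
Proof.
  intros hmu. pose proof PI_RGT_0 as hpi.
  set (Cc := fun t => cos (mu * t)). set (Sc := fun t => sin (mu * t) / mu).
  assert (hs : 0 < sin (mu * (PI / 2))) by (apply sin_gt_0; nra).
  assert (hc : 0 < cos (mu * (PI / 2))) by (apply cos_gt_0; nra).
  assert (h2s : sin (mu * PI) = 2 * sin (mu * (PI / 2)) * cos (mu * (PI / 2))).
  { rewrite <- sin_2a. f_equal. field. }
  assert (H := resolvent_sin (- mu ^ 2) Cc Sc).
  assert (H' : is_series (fun n => sin (ik n * (PI/2)) / (ik n * (ik n ^ 2 + - mu ^ 2)))
    ((PI - PI/2) / (2 * - mu ^ 2) - PI * Sc (PI - PI/2) / (2 * - mu ^ 2 * Sc PI))).
  { apply H.
    - nra.
    - nra.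
    - intros t. unfold Cc, Sc. auto_derive; [trivial|]. eqR. field. lra.
    - intros t. unfold Cc, Sc. auto_derive; [trivial|]. eqR. field. lra.
    - unfold Cc. rewrite Rmult_0_r. apply cos_0.
    - unfold Sc. rewrite Rmult_0_r, sin_0. unfold Rdiv. ring.
    - unfold Sc. rewrite h2s. apply Rgt_not_eq. apply Rdiv_lt_0_compat; [|lra]. nra.
    - lra. }
  replace (- PI / (4 * mu ^ 2) + PI / (4 * mu ^ 2 * cos (mu * (PI / 2)))) with
    ((PI - PI/2) / (2 * - mu ^ 2) - PI * Sc (PI - PI/2) / (2 * - mu ^ 2 * Sc PI)); auto.
  unfold Sc. rewrite h2s. replace (PI - PI / 2) with (PI / 2) by field. field. lra.
Qed.

(** * The functions [B] and [D] of the overview *)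

Definition Bf (w : R) : R := / (exp (2 * PI * w) - 1).
Definition Df (w : R) : R := Bf w - / (2 * PI * w) + 1 / 2.

Lemma exp_gt1 (x : R) : 0 < x -> 1 < exp x.
Proof. intros. rewrite <- exp_0. apply exp_increasing. auto. Qed.

Lemma Df_series (w : R) : 0 < w -> is_series (fun n => w / PI * / (ik n ^ 2 + w ^ 2)) (Df w).
Proof.
  intros hw. pose proof PI_RGT_0 as hpi.
  replace (Df w) with (w / PI * (- / (2 * w ^ 2) + PI * cosh (w * PI) / (2 * w * sinh (w * PI)))).
  - apply (is_series_scal (w / PI) (fun n => / (ik n ^ 2 + w ^ 2))). apply sum_inv_sqr_hyp. auto.
  - unfold Df, Bf, cosh, sinh.
    replace (2 * PI * w) with (w * PI + w * PI) at 1 by ring. rewrite exp_plus, exp_Ropp.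
    assert (1 < exp (w * PI)) by (apply exp_gt1; nra).
    set (E := exp (w * PI)) in *. field. repeat split; try lra; nra.
Qed.

Lemma Bf_series (w : R) : 0 < w -> is_series (fun n => exp (- (2 * PI * w) * ik n)) (Bf w).
Proof.
  intros hw. pose proof PI_RGT_0 as hpi.
  set (r := exp (- (2 * PI * w))).
  assert (hx : 0 < 2 * PI * w) by (apply Rmult_lt_0_compat; lra).
  assert (hr : 0 < r < 1).
  { split; [apply exp_pos|]. unfold r. rewrite <- exp_0. apply exp_increasing. lra. }
  assert (H : is_series (fun n => r * r ^ n) (r * / (1 - r))).
  { apply (is_series_scal r (fun n => r ^ n)), is_series_geom. rewrite Rabs_pos_eq; lra. }
  replace (Bf w) with (r * / (1 - r)).
  - eapply is_series_ext; [|exact H]. intros n. simpl. unfold r, ik.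
    induction n as [|n IH]; [simpl; rewrite !Rmult_1_r; reflexivity|].
    rewrite (S_INR (S n)), Rmult_plus_distr_l, exp_plus, <- IH, Rmult_1_r. simpl. eqR. ring.
  - unfold Bf. unfold r in *. rewrite exp_Ropp in *. pose proof (exp_gt1 _ hx). field. lra.
Qed.

Lemma Df_bounds (w : R) : 0 < w -> 0 <= Df w <= w / PI * Series (fun n => / ik n ^ 2).
Proof.
  intros hw. pose proof PI_RGT_0 as hpi. pose proof (Df_series w hw) as H.
  assert (hwp : 0 < w / PI) by (apply Rdiv_lt_0_compat; lra).
  assert (pos : forall n, 0 <= w / PI * / (ik n ^ 2 + w ^ 2) <= w / PI * / ik n ^ 2).
  { intros n. pose proof (ik_ge1 n). assert (0 < ik n ^ 2) by nra. assert (0 < w ^ 2) by nra. split.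
    - apply Rmult_le_pos; [lra|left; apply Rinv_0_lt_compat; lra].
    - apply Rmult_le_compat_l; [lra|]. apply Rinv_le_contravar; lra. }
  rewrite <- (is_series_unique _ _ H). split.
  - rewrite <- (Series_zero (fun _ => 0)) by auto. apply Series_le.
    + intros n. split; [lra|]. apply pos.
    + eexists; eauto.
  - rewrite <- Series_scal_l. apply Series_le; auto.
    apply (ex_series_scal_l (w / PI) (fun n => / ik n ^ 2)). apply ex_series_inv_sqr.
Qed.

(** * The Mellin transform of 1/(1+v^2) *)

Lemma continuous_abs (t : R) : continuous Rabs t.
Proof. apply continuity_pt_filterlim, Rcontinuity_abs. Qed.

Lemma CInt_RtoC (g : R -> R) (a b l : R) : is_RInt g a b l -> CInt (fun t => RtoC (g t)) a b = RtoC l.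
Proof.
  intros H. apply CInt_unique.
  apply (@is_RInt_fct_extend_pair R_NormedModule R_NormedModule); simpl; auto.
  assert (E := @is_RInt_const R_NormedModule a b 0).
  refine (eq_rect _ (fun z => @is_RInt R_NormedModule (fun _ => 0) a b z) E _ _).
  change ((b - a) * 0 = 0). ring.
Qed.

Lemma dom_RtoC (M d : R) (g : R -> R) : (forall t, continuous g t) -> 0 < d ->
  (forall t, Rabs (g t) <= M * exp (- d * Rabs t)) -> dom M d (fun t => RtoC (g t)).
Proof.
  intros h1 h2 h3. split; [|split; auto].
  - intros t. apply rcont_RtoC; auto.
  - intros t. rewrite Cmod_R. auto.
Qed.

Lemma dom_exp_abs (a b : R) : Rabs b < a ->
  dom 1 (a - Rabs b) (fun u => RtoC (exp (- a * Rabs u + b * u))).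
Proof.
  intros h. apply dom_RtoC; [|lra|].
  - intros t. apply continuous_comp; [|apply continuous_exp].
    apply (continuous_plus (fun u => - a * Rabs u) (fun u => b * u)).
    + apply (continuous_scal_r (- a) Rabs), continuous_abs.
    + deriv_cont. trivial.
  - intros t. rewrite Rabs_pos_eq, Rmult_1_l by (apply exp_ge0). apply exp_le.
    pose proof (Rle_abs (b * t)). rewrite Rabs_mult in H. pose proof (Rabs_pos t). nra.
Qed.

Lemma I_exp_abs (a b : R) : Rabs b < a ->
  intR (fun u => RtoC (exp (- a * Rabs u + b * u))) = RtoC (/ (a - b) + / (a + b)).
Proof.
  intros h. assert (hb : - a < b < a) by (apply Rabs_def2 in h; lra).
  apply I_unique. intros eps he.
  destruct (exp_small (/ (a + b)) (a + b) (eps/2)) as (M1 & hM1 & H1); [lra|lra|].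
  destruct (exp_small (/ (a - b)) (a - b) (eps/2)) as (M2 & hM2 & H2); [lra|lra|].
  exists (Rmax M1 M2). intros A B hA hB. pose proof (Rmax_l M1 M2). pose proof (Rmax_r M1 M2).
  assert (D := dom_exp_abs a b h).
  rewrite <- (CInt_Chasles _ A 0 B) by (intros t _; apply D).
  rewrite (CInt_ext _ (fun u => RtoC (1 * exp ((a + b) * u))) A 0).
  2:{ intros t ht. rewrite Rmin_left, Rmax_right in ht by lra. rewrite Rabs_left by lra. do 2 f_equal. rewrite Rmult_1_l. f_equal. ring. }
  rewrite (CInt_ext _ (fun u => RtoC (1 * exp (- (a - b) * u))) 0 B).
  2:{ intros t ht. rewrite Rmin_left, Rmax_right in ht by lra. rewrite Rabs_pos_eq by lra. do 2 f_equal. rewrite Rmult_1_l. f_equal. ring. }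
  rewrite (CInt_RtoC _ _ _ _ (is_RInt_exp_lin 1 (a + b) A 0 ltac:(lra))).
  rewrite (CInt_RtoC _ _ _ _ (is_RInt_exp_lin 1 (- (a - b)) 0 B ltac:(lra))).
  rewrite !Rmult_0_r, exp_0, <- RtoC_plus, <- RtoC_minus, Cmod_R.
  specialize (H1 (- A) ltac:(lra)). specialize (H2 B ltac:(lra)).
  replace (- (a + b) * - A) with ((a + b) * A) in H1 by ring.
  replace (1 / (a + b) * 1 - 1 / (a + b) * exp ((a + b) * A) +
     (1 / - (a - b) * exp (- (a - b) * B) - 1 / - (a - b) * 1) - (/ (a - b) + / (a + b))) with
    (- (/ (a + b) * exp ((a + b) * A) + / (a - b) * exp (- (a - b) * B))) by (field; lra).
  rewrite Rabs_Ropp, Rabs_pos_eq; [lra|].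
  apply Rplus_le_le_0_compat; apply Rmult_le_pos; try (apply exp_ge0); left; apply Rinv_0_lt_compat; lra.
Qed.

Lemma atan_le (x : R) : 0 <= x -> atan x <= x.
Proof.
  intros hx. pose proof (MVT_Rabs_le atan (fun x => / (1 + x ^ 2)) 0 x 1) as M.
  rewrite atan_0, !Rminus_0_r, Rmult_1_l, (Rabs_pos_eq x) in M by auto.
  eapply Rle_trans; [apply Rle_abs|]. apply M.
  - intros y. rewrite <- Rsqr_pow2. apply is_derive_atan.
  - intros y _. assert (0 < 1 + y ^ 2) by nra. rewrite Rabs_pos_eq by (left; apply Rinv_0_lt_compat; auto).
    rewrite <- Rinv_1. apply Rinv_le_contravar; nra.
Qed.

Lemma is_derive_inv_cosh (t : R) : ex_derive (fun u => / (2 * cosh u)) t.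
Proof. unfold cosh. auto_derive. pose proof (exp_pos t). pose proof (exp_pos (- t)). lra. Qed.

Lemma cosh_exp_lower (t : R) : exp (Rabs t) <= 2 * cosh t.
Proof.
  unfold cosh. pose proof (exp_pos t). pose proof (exp_pos (- t)). unfold Rabs. destruct Rcase_abs; lra.
Qed.

Lemma dom_inv_cosh : dom 1 1 (fun u => RtoC (/ (2 * cosh u))).
Proof.
  apply dom_RtoC; [|lra|].
  - intros t. apply (@ex_derive_continuous R_AbsRing R_NormedModule), is_derive_inv_cosh.
  - intros t. pose proof (cosh_ge1 t). rewrite Rabs_pos_eq, Rmult_1_l by (left; apply Rinv_0_lt_compat; lra).
    replace (- (1) * Rabs t) with (- Rabs t) by ring. rewrite exp_Ropp.
    apply Rinv_le_contravar; [apply exp_pos|apply cosh_exp_lower].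
Qed.

(** The primitive is [atan (exp u)]. This is the value at exponent zero, which the general Mellin
    transform is compared with. *)
Lemma I_inv_cosh : intR (fun u => RtoC (/ (2 * cosh u))) = RtoC (PI / 2).
Proof.
  apply I_unique. intros eps he.
  destruct (exp_small 1 1 (eps/2)) as (M1 & hM1 & H1); [lra|lra|].
  exists M1. intros A B hA hB.
  assert (E : is_RInt (fun u => / (2 * cosh u)) A B (atan (exp B) - atan (exp A))).
  { apply (is_RInt_derive (fun u => atan (exp u))).
    - intros u _.
      replace (/ (2 * cosh u)) with (scal (exp u) (/ (1 + exp u ^ 2))).
      + rewrite <- Rsqr_pow2. apply (is_derive_comp atan exp); [apply is_derive_atan|apply is_derive_exp].
      + unfold scal; simpl; unfold mult; simpl. unfold cosh. rewrite exp_Ropp. pose proof (exp_pos u). field. split; nra.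
    - intros u _. apply (@ex_derive_continuous R_AbsRing R_NormedModule), is_derive_inv_cosh. }
  rewrite (CInt_RtoC _ _ _ _ E), <- RtoC_minus, Cmod_R.
  pose proof (H1 (- A) ltac:(lra)) as k1. pose proof (H1 B hB) as k2.
  replace (- (1) * - A) with A in k1 by ring. replace (- (1) * B) with (- B) in k2 by ring.
  assert (a1 : 0 <= atan (exp A) <= exp A).
  { split; [|apply atan_le; apply exp_ge0]. rewrite <- atan_0. left. apply atan_increasing, exp_pos. }
  assert (a2 : atan (exp B) = PI / 2 - atan (exp (- B))).
  { rewrite exp_Ropp. rewrite atan_inv by apply exp_pos. ring. }
  assert (a3 : 0 <= atan (exp (- B)) <= exp (- B)).
  { split; [|apply atan_le; apply exp_ge0]. rewrite <- atan_0. left. apply atan_increasing, exp_pos. }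
  rewrite a2. apply Rabs_le. lra.
Qed.

Lemma cosh_sub1 (x : R) : 0 <= cosh x - 1 <= x * x * exp (Rabs x).
Proof.
  pose proof (exp_taylor1 x) as h1. pose proof (exp_taylor1 (- x)) as h2. rewrite Rabs_Ropp in h2.
  unfold cosh. split; [|]; nra.
Qed.

Lemma exp_ik (n : nat) (x : R) : exp x ^ (S n) = exp (ik n * x).
Proof.
  unfold ik. induction n as [|n IH]; [simpl; rewrite Rmult_1_l, Rmult_1_r; reflexivity|].
  rewrite <- tech_pow_Rmult, IH, <- exp_plus. f_equal. rewrite (S_INR (S n)). ring.
Qed.

(** A geometric series in [exp (- |u|)] with the periodic coefficients [1, 0, -1, 0]. At [u = 0] its
    terms do not tend to zero, which is why [u] is required to be nonzero. *)
Lemma inv_cosh_series (u : R) : u <> 0 ->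
  is_series (fun n => sin (ik n * (PI / 2)) * exp (- ik n * Rabs u)) (/ (2 * cosh u)).
Proof.
  intros hu. set (r := exp (- Rabs u)).
  assert (hr : 0 <= r < 1).
  { split; [apply exp_ge0|]. unfold r. rewrite <- exp_0. apply exp_increasing.
    pose proof (Rabs_pos_lt u hu). lra. }
  assert (H := trig_geom_sin r (PI / 2) hr). rewrite sin_PI2, cos_PI2 in H.
  replace (/ (2 * cosh u)) with (r * 1 / (1 - 2 * r * 0 + r ^ 2)).
  - eapply is_series_ext; [|exact H]. intros n. simpl.
    change (r * r ^ n) with (r ^ S n). unfold r. rewrite exp_ik.
    replace (ik n * - Rabs u) with (- ik n * Rabs u) by ring. eqR. ring.
  - assert (E : 2 * cosh u = / r + r).
    { pose proof (exp_pos u). unfold r, cosh, Rabs. destruct Rcase_abs.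
      - replace (- - u) with u by ring. rewrite (exp_Ropp u). field. lra.
      - rewrite (exp_Ropp u), Rinv_inv. field. lra. }
    rewrite E. assert (0 < r) by apply exp_pos. field. split; nra.
Qed.

(** Termwise integration of [cosh (mu u) / (2 cosh u)] would lack a summable majorant. Replacing
    [cosh (mu u)] by [cosh (mu u) - 1], which vanishes to second order at 0, gives terms of order
    [k^(-2)] and repairs the series at [u = 0]; the missing part is [I_inv_cosh]. *)
Lemma inv_cosh_mellin_real (mu : R) : 0 < mu < 1 ->
  intR (fun u => RtoC (/ (2 * cosh u)) * cexp (RtoC mu * RtoC u))%C = RtoC (PI / 2 / cos (mu * (PI / 2))).
Proof.
  intros hmu. pose proof PI_RGT_0 as hpi.
  (* The rate [k - mu] of the [k]th term is split as [(k - m) + d]: the common rate [d] is kept and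
     [k - m], of order [k], absorbs the factor [u^2]. *)
  set (m := (1 + mu) / 2). set (d := (1 - mu) / 2).
  assert (hm : 0 < m < 1) by (unfold m; lra). assert (hd : 0 < d) by (unfold d; lra).
  set (g := fun (n : nat) (u : R) => sin (ik n * (PI / 2)) * ((cosh (mu * u) - 1) * exp (- ik n * Rabs u))).
  set (G := fun u => (cosh (mu * u) - 1) * / (2 * cosh u)).
  set (M := fun n : nat => 4 / ((1 - m) * (1 - m)) * / ik n ^ 2).
  assert (cg : forall n t, continuous (g n) t).
  { intros n t. apply (continuous_scal_r (sin (ik n * (PI/2))) (fun u => (cosh (mu * u) - 1) * exp (- ik n * Rabs u))).
    apply (continuous_mult (fun u => cosh (mu * u) - 1) (fun u => exp (- ik n * Rabs u))).
    - apply (@ex_derive_continuous R_AbsRing R_NormedModule). unfold cosh. auto_derive. trivial.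
    - apply continuous_comp; [|apply continuous_exp]. apply (continuous_scal_r (- ik n) Rabs), continuous_abs. }
  assert (Dg : forall n, dom (M n) d (fun u => RtoC (g n u))).
  { intros n. pose proof (ik_ge1 n) as hn. apply dom_RtoC; auto. intros t. unfold g.
    rewrite Rabs_mult. pose proof (abs_sin_le1 (ik n * (PI/2))) as hs. pose proof (Rabs_pos (sin (ik n * (PI/2)))) as hs0.
    pose proof (cosh_sub1 (mu * t)) as [c1 c2]. pose proof (exp_pos (- ik n * Rabs t)) as he.
    rewrite (Rabs_pos_eq ((cosh (mu * t) - 1) * exp (- ik n * Rabs t))) by (apply Rmult_le_pos; lra).
    apply Rle_trans with (1 * ((mu * t) * (mu * t) * exp (Rabs (mu * t)) * exp (- ik n * Rabs t))).
    { apply Rmult_le_compat; auto; [apply Rmult_le_pos; lra|]. apply Rmult_le_compat_r; lra. }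
    rewrite Rmult_1_l, Rabs_mult, (Rabs_pos_eq mu) by lra.
    set (a := Rabs t). assert (ha : 0 <= a) by apply Rabs_pos.
    replace (mu * t * (mu * t)) with (mu * mu * (a * a)).
    2:{ unfold a. rewrite <- Rabs_mult, Rabs_pos_eq by apply Rle_0_sqr. ring. }
    set (c := (ik n - m) / 2).
    assert (hc : (1 - m) * ik n / 2 <= c) by (unfold c; nra).
    assert (hc0 : 0 < c) by nra.
    replace (mu * mu * (a * a) * exp (mu * a) * exp (- ik n * a)) with
      (mu * mu * ((a * exp (- c * a)) * (a * exp (- c * a))) * exp (- d * a)).
    2:{ rewrite (Rmult_assoc (mu * mu * (a * a))).
        replace (exp (mu * a) * exp (- ik n * a)) with (exp (- c * a) * exp (- c * a) * exp (- d * a)).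
        - ring.
        - rewrite <- !exp_plus. f_equal. unfold c, d, m. field. }
    apply Rmult_le_compat_r; [apply exp_ge0|].
    pose proof (xexp_le c a hc0 ha) as hx.
    assert (hx0 : 0 <= a * exp (- c * a)) by (apply Rmult_le_pos; [auto|apply exp_ge0]).
    assert (hic : / c <= 2 / ((1 - m) * ik n)).
    { replace (2 / ((1 - m) * ik n)) with (/ ((1 - m) * ik n / 2)) by (field; lra). apply Rinv_le_contravar; nra. }
    apply Rle_trans with (1 * ((2 / ((1 - m) * ik n)) * (2 / ((1 - m) * ik n)))).
    - apply Rmult_le_compat; [nra|nra|nra|]. apply Rmult_le_compat; lra.
    - right. unfold M. field. lra. }
  assert (EM : ex_series M) by apply ex_series_sqr_lam.
  assert (cG : forall t, rcont (fun u => RtoC (G u)) t).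
  { intros t. apply rcont_RtoC. apply (@ex_derive_continuous R_AbsRing R_NormedModule). unfold G, cosh. auto_derive.
    pose proof (exp_pos t). pose proof (exp_pos (- t)). lra. }
  assert (Sg : forall t, Cser (fun n => RtoC (g n t)) (RtoC (G t))).
  { intros t. apply Cser_RtoC. unfold g, G. destruct (Req_dec t 0) as [->|ht].
    - rewrite Rmult_0_r, cosh_0, Rminus_eq_0, Rmult_0_l.
      apply is_series_zero. intros n. ring.
    - eapply is_series_ext; [|apply (@is_series_scal R_AbsRing R_NormedModule (cosh (mu * t) - 1) _ _ (inv_cosh_series t ht))].
      intros n. unfold scal; simpl; unfold mult; simpl. eqR. ring. }
  destruct (I_series (fun n u => RtoC (g n u)) (fun u => RtoC (G u)) M d Dg EM cG Sg) as [DG SG].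
  assert (Ig : forall n, intR (fun u => RtoC (g n u)) = RtoC (2 * mu ^ 2 * (sin (ik n * (PI / 2)) / (ik n * (ik n ^ 2 + - mu ^ 2))))).
  { intros n. pose proof (ik_ge1 n) as hn.
    assert (D1 := dom_exp_abs (ik n) mu ltac:(rewrite Rabs_pos_eq; lra)).
    assert (D2 := dom_exp_abs (ik n) (- mu) ltac:(rewrite Rabs_Ropp, Rabs_pos_eq; lra)).
    assert (D3 := dom_exp_abs (ik n) 0 ltac:(rewrite Rabs_R0; lra)).
    set (s := sin (ik n * (PI / 2))).
    set (e := fun b u => RtoC (exp (- ik n * Rabs u + b * u))).
    assert (D1' : Dom (e mu)) by (eexists _, _; exact D1).
    assert (D2' : Dom (e (- mu))) by (eexists _, _; exact D2).
    assert (D3' : Dom (e 0)) by (eexists _, _; exact D3).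
    rewrite <- (I_ext (fun u => RtoC (s / 2) * (e mu u + e (- mu)%R u) - RtoC s * e 0%R u)%C).
    - rewrite I_minus, !I_scal, I_plus by (auto; try apply Dom_scal; auto; try apply Dom_plus; auto).
      unfold e. rewrite !I_exp_abs by (rewrite ?Rabs_Ropp, ?Rabs_R0, ?(Rabs_pos_eq mu); lra).
      rewrite <- RtoC_plus, <- !RtoC_mult, <- RtoC_minus. f_equal. field. repeat split; nra.
    - intros u. unfold e. rewrite <- RtoC_plus, <- !RtoC_mult, <- RtoC_minus. f_equal.
      unfold g, cosh. fold s. rewrite !exp_plus, Rmult_0_l, exp_0. replace (- mu * u) with (- (mu * u)) by ring. field.
    - apply Dom_minus; apply Dom_scal; auto. apply Dom_plus; auto. }
  assert (SG' : Cser (fun n => intR (fun u => RtoC (g n u))) (RtoC (2 * mu ^ 2 * (- PI / (4 * mu ^ 2) + PI / (4 * mu ^ 2 * cos (mu * (PI / 2))))))).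
  { eapply Cser_ext; [intros n; symmetry; apply Ig|]. apply Cser_RtoC.
    apply (is_series_scal (2 * mu ^ 2) (fun n => sin (ik n * (PI / 2)) / (ik n * (ik n ^ 2 + - mu ^ 2)))).
    apply sum_sin_trig. auto. }
  assert (EG := Cser_unique _ _ _ SG SG').
  assert (hc : 0 < cos (mu * (PI / 2))) by (apply cos_gt_0; nra).
  set (f := fun u => (RtoC (/ (2 * cosh u)) * cexp (RtoC mu * RtoC u))%C).
  assert (Df : Dom f).
  { exists 1, (1 - mu). split; [|split; [lra|]].
    - intros t. apply rcont_mult; [apply dom_inv_cosh|apply rcont_expi].
    - intros t. unfold f. rewrite Cmod_mult, Cmod_cexp, Re_scalr, Re_RtoC.
      destruct dom_inv_cosh as (_ & _ & Hb). specialize (Hb t).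
      apply Rle_trans with (1 * exp (- (1) * Rabs t) * exp (mu * Rabs t)).
      + apply Rmult_le_compat; [apply Cmod_ge_0|apply exp_ge0|exact Hb|].
        apply exp_le. pose proof (Rle_abs t). nra.
      + rewrite !Rmult_1_l, <- exp_plus. right. f_equal. ring. }
  assert (Dr : Dom (fun u => f (- u))).
  { destruct Df as (M0 & d0 & (q1 & q2 & q3)). exists M0, d0. split; [|split]; auto.
    - intros t. apply (rcont_comp_r f (fun u => - u)); auto. deriv_cont. trivial.
    - intros t. rewrite <- (Rabs_Ropp t). apply q3. }
  (* Adding the reflected integral turns [exp (mu u)] into [2 cosh (mu u)]. *)
  assert (E2 : (intR f + intR f)%C = (RtoC 2 * intR (fun u => RtoC (G u)) + RtoC 2 * intR (fun u => RtoC (/ (2 * cosh u))))%C).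
  { rewrite <- (I_reflect f Df) at 2. rewrite <- I_plus by auto.
    rewrite <- !I_scal by (auto; eexists _, _; apply dom_inv_cosh).
    rewrite <- I_plus by (apply Dom_scal; auto; eexists _, _; apply dom_inv_cosh).
    apply I_ext; [|apply Dom_plus; auto].
    intros u. unfold f, G. replace (RtoC mu * RtoC u)%C with (RtoC (mu * u)) by apply RtoC_mult.
    replace (RtoC mu * RtoC (- u))%C with (RtoC (- (mu * u))) by (rewrite <- RtoC_mult; f_equal; ring).
    rewrite !cexp_RtoC, <- !RtoC_mult, <- !RtoC_plus. f_equal.
    replace (cosh (- u)) with (cosh u) by (unfold cosh; rewrite Ropp_involutive; field).
    pose proof (cosh_ge1 u). change (cosh (mu * u)) with ((exp (mu * u) + exp (- (mu * u))) / 2).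
    field. lra. }
  rewrite EG, I_inv_cosh in E2. fold f.
  replace (intR f) with (RtoC (/ 2) * (intR f + intR f))%C.
  - rewrite E2, <- !RtoC_mult, <- RtoC_plus, <- RtoC_mult. f_equal. field. split; lra.
  - transitivity ((RtoC (/ 2) * RtoC 2) * intR f)%C; [|rewrite <- RtoC_mult, Rinv_l by lra; ring].
    replace (RtoC 2) with (1 + 1)%C by (rewrite <- RtoC_plus; f_equal; ring). ring.
Qed.

(** * Cosine and sine of [PI z / 2] for complex [z]: zeros and shifts *)

Lemma ccos_val (z : C) : ccos z = (cos (Re z) * cosh (Im z), - (sin (Re z) * sinh (Im z))).
Proof.
  destruct z as [a b]. unfold ccos.
  replace (Ci * (a, b))%C with ((- b)%R, a) by (apply C_eq; simpl; ring).
  replace (- ((- b)%R, a))%C with (b, (- a)%R) by (apply C_eq; simpl; ring).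
  unfold cexp, Re, Im, Cdiv. cbn [fst snd]. rewrite cos_neg, sin_neg.
  replace (/ RtoC 2)%C with (RtoC (/ 2)) by (apply RtoC_inv; lra).
  unfold cosh, sinh. apply C_eq; unfold Re, Im; simpl; field.
Qed.

Lemma csin_val (z : C) : csin z = (sin (Re z) * cosh (Im z), cos (Re z) * sinh (Im z)).
Proof.
  destruct z as [a b]. unfold csin.
  replace (Ci * (a, b))%C with ((- b)%R, a) by (apply C_eq; simpl; ring).
  replace (- ((- b)%R, a))%C with (b, (- a)%R) by (apply C_eq; simpl; ring).
  unfold cexp, Re, Im, Cdiv. cbn [fst snd]. rewrite cos_neg, sin_neg.
  replace (/ (RtoC 2 * Ci))%C with (RtoC (- / 2) * Ci)%C.
  - unfold cosh, sinh. apply C_eq; unfold Re, Im; simpl; field.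
  - apply C_eq; unfold Re, Im, Cinv, Ci, RtoC, Cmult; simpl; field; lra.
Qed.

Definition hpi (z : C) : C := (RtoC PI * z / RtoC 2)%C.

Lemma Re_hpi (z : C) : Re (hpi z) = PI * Re z / 2.
Proof. unfold hpi. rewrite Re_div2. f_equal. simpl. unfold Re. ring. Qed.

Lemma Im_hpi (z : C) : Im (hpi z) = PI * Im z / 2.
Proof. unfold hpi, Cdiv, Im. simpl. field. Qed.

Lemma hpi_RtoC (x : R) : hpi (RtoC x) = RtoC (x * (PI / 2)).
Proof. apply C_eq; [rewrite Re_hpi|rewrite Im_hpi]; simpl; field. Qed.

Lemma ccos_RtoC (x : R) : ccos (RtoC x) = RtoC (cos x).
Proof. rewrite ccos_val. simpl. rewrite cosh_0, sinh_0. apply C_eq; simpl; ring. Qed.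

Lemma ccos_neq0 (z : C) : cos (Re z) <> 0 -> ccos z <> RtoC 0.
Proof.
  intros h E. rewrite ccos_val in E. apply (f_equal Re) in E. change (cos (Re z) * cosh (Im z) = 0) in E.
  pose proof (cosh_ge1 (Im z)). apply Rmult_integral in E. destruct E; [auto|lra].
Qed.

Lemma ccos_hpi_neq0 (z : C) : Rabs (Re z) < 1 -> ccos (hpi z) <> RtoC 0.
Proof.
  intros h. apply ccos_neq0. rewrite Re_hpi. apply Rabs_def2 in h. pose proof PI_RGT_0.
  apply Rgt_not_eq, cos_gt_0; nra.
Qed.

Lemma sinh_eq0 (x : R) : sinh x = 0 -> x = 0.
Proof.
  intros h. destruct (Rtotal_order x 0) as [k|[k|k]]; auto.
  - assert (0 < sinh (- x)) by (apply sinh_pos; lra). unfold sinh in *. rewrite Ropp_involutive in H. lra.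
  - apply sinh_pos in k. lra.
Qed.

Lemma ccos_hpi_nonint (z : C) : (forall k : Z, z <> RtoC (IZR k)) -> ccos (hpi z) <> RtoC 0.
Proof.
  intros h E. rewrite ccos_val in E. pose proof (f_equal Re E) as E1. pose proof (f_equal Im E) as E2.
  change (cos (Re (hpi z)) * cosh (Im (hpi z)) = 0) in E1. change (- (sin (Re (hpi z)) * sinh (Im (hpi z))) = 0) in E2.
  pose proof (cosh_ge1 (Im (hpi z))) as hc. apply Rmult_integral in E1. destruct E1 as [E1|E1]; [|lra].
  assert (S : sin (Re (hpi z)) <> 0).
  { intros S. pose proof (sin2_cos2 (Re (hpi z))) as P. rewrite E1, S in P. unfold Rsqr in P. lra. }
  assert (E3 : sin (Re (hpi z)) * sinh (Im (hpi z)) = 0) by lra.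
  apply Rmult_integral in E3. destruct E3 as [E3|E3]; [auto|]. apply sinh_eq0 in E3.
  rewrite Im_hpi in E3. rewrite Re_hpi in E1. pose proof PI_RGT_0.
  apply cos_eq_0_0 in E1. destruct E1 as [k Hk].
  apply (h (2 * k + 1)%Z). apply C_eq.
  - rewrite Re_RtoC, plus_IZR, mult_IZR. apply Rmult_eq_reg_l with (PI / 2); [|lra]. lra.
  - simpl. apply Rmult_eq_reg_l with (PI / 2); [|lra]. lra.
Qed.

Lemma csin_hpi_neq0 (z : C) : -2 < Re z < 2 -> z <> RtoC 0 -> csin (hpi z) <> RtoC 0.
Proof.
  intros h hz E. rewrite csin_val in E. pose proof (f_equal Re E) as E1. pose proof (f_equal Im E) as E2.
  change (sin (Re (hpi z)) * cosh (Im (hpi z)) = 0) in E1. change (cos (Re (hpi z)) * sinh (Im (hpi z)) = 0) in E2.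
  pose proof (cosh_ge1 (Im (hpi z))) as hc. apply Rmult_integral in E1. destruct E1 as [E1|E1]; [|lra].
  pose proof PI_RGT_0 as hp.
  assert (R0 : Re z = 0).
  { rewrite Re_hpi in E1. destruct (Rtotal_order (Re z) 0) as [k|[k|k]]; auto; exfalso.
    - assert (0 < sin (- (PI * Re z / 2))) by (apply sin_gt_0; nra). rewrite sin_neg in H. lra.
    - assert (0 < sin (PI * Re z / 2)) by (apply sin_gt_0; nra). lra. }
  rewrite Re_hpi, R0 in E2. replace (PI * 0 / 2) with 0 in E2 by field. rewrite cos_0, Rmult_1_l in E2.
  apply sinh_eq0 in E2. rewrite Im_hpi in E2.
  apply hz, C_eq; [exact R0|]. simpl. apply Rmult_eq_reg_l with (PI / 2); [|lra]. lra.
Qed.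

Lemma ccos_hpi_plus1 (z : C) : ccos (hpi (z + RtoC 1)) = (- csin (hpi z))%C.
Proof.
  rewrite ccos_val, csin_val, Re_hpi, Im_hpi, Re_plus, Im_plus, Re_RtoC, Re_hpi, Im_hpi. simpl (Im (RtoC 1)).
  replace (PI * (Re z + 1) / 2) with (PI / 2 + PI * Re z / 2) by field.
  replace (cos (PI / 2 + PI * Re z / 2)) with (- sin (PI * Re z / 2)) by (rewrite cos_plus, cos_PI2, sin_PI2; ring).
  replace (sin (PI / 2 + PI * Re z / 2)) with (cos (PI * Re z / 2)) by (rewrite sin_plus, cos_PI2, sin_PI2; ring).
  rewrite Rplus_0_r. apply C_eq; simpl; ring.
Qed.

Lemma csin_hpi_plus1 (z : C) : csin (hpi (z + RtoC 1)) = ccos (hpi z).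
Proof.
  rewrite ccos_val, csin_val, Re_hpi, Im_hpi, Re_plus, Im_plus, Re_RtoC, Re_hpi, Im_hpi. simpl (Im (RtoC 1)).
  replace (PI * (Re z + 1) / 2) with (PI / 2 + PI * Re z / 2) by field.
  replace (cos (PI / 2 + PI * Re z / 2)) with (- sin (PI * Re z / 2)) by (rewrite cos_plus, cos_PI2, sin_PI2; ring).
  replace (sin (PI / 2 + PI * Re z / 2)) with (cos (PI * Re z / 2)) by (rewrite sin_plus, cos_PI2, sin_PI2; ring).
  rewrite Rplus_0_r. apply C_eq; simpl; ring.
Qed.

Lemma Dom_inv_cosh_exp (mu : C) : Rabs (Re mu) < 1 -> Dom (fun u => RtoC (/ (2 * cosh u)) * cexp (mu * RtoC u))%C.
Proof.
  intros h. exists 1, (1 - Rabs (Re mu)). split; [|split; [lra|]].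
  - intros t. apply rcont_mult; [apply dom_inv_cosh|apply rcont_expi].
  - intros t. rewrite Cmod_mult, Cmod_cexp, Re_scalr.
    destruct dom_inv_cosh as (_ & _ & Hb). specialize (Hb t).
    apply Rle_trans with (1 * exp (- (1) * Rabs t) * exp (Rabs (Re mu) * Rabs t)).
    + apply Rmult_le_compat; [apply Cmod_ge_0|apply exp_ge0|exact Hb|].
      apply exp_le. rewrite <- Rabs_mult. apply Rle_abs.
    + rewrite !Rmult_1_l, <- exp_plus. right. f_equal. ring.
Qed.

Lemma holo_hpi (z : C) : holo_at hpi z.
Proof. unfold hpi. holo. apply C2_neq0. Qed.

(** Both sides are holomorphic for [|Re mu| < 1] and agree on the real interval [(0, 1)]. *)
Lemma inv_cosh_mellin (mu : C) : Rabs (Re mu) < 1 ->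
  intR (fun u => RtoC (/ (2 * cosh u)) * cexp (mu * RtoC u))%C = (RtoC (PI / 2) / ccos (hpi mu))%C.
Proof.
  intros h. apply Rabs_def2 in h.
  apply (holo_eq_strip (mel (fun u => RtoC (/ (2 * cosh u)))) (fun mu => RtoC (PI / 2) / ccos (hpi mu))%C (-1) 1 (1/2) (1/2)); try lra.
  - intros z hz. apply mel_holo, Dom_inv_cosh_exp. apply Rabs_def1; lra.
  - intros z hz. apply holo_div.
    + apply ccos_hpi_neq0. apply Rabs_def1; lra.
    + holo.
    + apply (holo_ccos hpi). apply holo_hpi.
  - intros x hx. apply Rabs_def2 in hx. unfold mel. rewrite inv_cosh_mellin_real by lra.
    rewrite hpi_RtoC, ccos_RtoC, <- RtoC_div; [reflexivity|].
    pose proof PI_RGT_0. apply Rgt_not_eq, cos_gt_0; nra.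
Qed.

Lemma Dom_shift (f : R -> C) (c : R) : Dom f -> Dom (fun t => f (t + c)).
Proof.
  intros (M & d & H). pose proof (dom_M_pos _ _ _ H) as hM. destruct H as (h1 & h2 & h3).
  exists (M * exp (d * Rabs c)), d. split; [|split]; auto.
  - intros t. apply (rcont_comp_r f (fun t => t + c)); auto.
    deriv_cont. trivial.
  - intros t. eapply Rle_trans; [apply h3|]. rewrite Rmult_assoc, <- exp_plus.
    apply Rmult_le_compat_l; auto. apply exp_le.
    assert (Rabs t <= Rabs (t + c) + Rabs c).
    { replace t with ((t + c) + - c) at 1 by ring. eapply Rle_trans; [apply Rabs_triang|]. rewrite Rabs_Ropp. lra. }
    nra.
Qed.

(** With [c = ln (a / b)] the rational function is [a^(-2) exp (- (u - c)) / (2 cosh (u - c))], a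
    shifted hyperbolic secant. The extra exponential lowers the exponent [nu + 1] to [nu], whence
    the symmetric strip. *)
Lemma rat_mellin (a b : R) (nu : C) : 0 < a -> 0 < b -> Rabs (Re nu) < 1 ->
  Dom (fun u => RtoC (/ (a ^ 2 + b ^ 2 * exp (2 * u))) * cexp ((nu + RtoC 1) * RtoC u))%C /\
  intR (fun u => RtoC (/ (a ^ 2 + b ^ 2 * exp (2 * u))) * cexp ((nu + RtoC 1) * RtoC u))%C =
    (RtoC (/ a ^ 2) * cpow (a / b) (nu + RtoC 1) * (RtoC (PI / 2) / ccos (hpi nu)))%C.
Proof.
  intros ha hb hnu. set (c := ln (a / b)).
  assert (hab : 0 < a / b) by (apply Rdiv_lt_0_compat; auto).
  set (K := (RtoC (/ a ^ 2) * cpow (a / b) (nu + RtoC 1))%C).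
  set (g := fun u => (RtoC (/ (2 * cosh u)) * cexp (nu * RtoC u))%C).
  set (f := fun u => (RtoC (/ (a ^ 2 + b ^ 2 * exp (2 * u))) * cexp ((nu + RtoC 1) * RtoC u))%C).
  assert (hc : exp c = a / b) by (apply exp_ln; auto).
  assert (E : forall u, (K * g (u + - c)%R)%C = f u).
  { intros u. unfold K, g, f, cpow. fold c.
    replace (cexp ((nu + RtoC 1) * RtoC u)) with (cexp ((nu + RtoC 1) * RtoC c) * (cexp (nu * RtoC (u + - c)) * cexp (RtoC (u + - c))))%C.
    - rewrite cexp_RtoC.
      replace (/ (a ^ 2 + b ^ 2 * exp (2 * u))) with (/ a ^ 2 * / (2 * cosh (u + - c)) * / exp (u + - c)).
      + rewrite !RtoC_mult. replace (RtoC (/ exp (u + - c))) with (/ RtoC (exp (u + - c)))%C by (symmetry; apply RtoC_inv; apply Rgt_not_eq, exp_pos).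
        field. apply RtoC_neq0, Rgt_not_eq, exp_pos.
      + unfold cosh. rewrite Ropp_plus_distr, Ropp_involutive, !exp_plus, !exp_Ropp, hc.
        replace (2 * u) with (u + u) by ring. rewrite exp_plus.
        pose proof (exp_pos u). field. repeat split; try lra. apply Rgt_not_eq.
        assert (0 < a ^ 2) by nra. assert (0 < b ^ 2 * (exp u * exp u)) by (apply Rmult_lt_0_compat; nra). lra.
    - rewrite <- !cexp_plus. f_equal. rewrite RtoC_plus, RtoC_opp. ring. }
  assert (Dg : Dom g) by (apply Dom_inv_cosh_exp; auto).
  assert (Ds := Dom_shift g (- c) Dg).
  split.
  - apply (Dom_ext (fun u => K * g (u + - c)%R)%C); auto. apply Dom_scal; auto.
  - fold f. rewrite <- (I_ext (fun u => K * g (u + - c)%R)%C f) by (auto; apply Dom_scal; auto).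
    rewrite (I_scal K (fun u => g (u + - c))) by auto. rewrite I_shift by auto.
    unfold g. rewrite inv_cosh_mellin by auto. reflexivity.
Qed.

(** * Gauss sums *)

Section Characters.
Variables (q : nat) (chi : Z -> C).
Hypothesis Hchi : dirichlet_char q chi.

Lemma char_q : (1 <= q)%nat.
Proof. apply Hchi. Qed.

Lemma char_period (m k : Z) : chi (m + k * Z.of_nat q)%Z = chi m.
Proof.
  destruct Hchi as (_ & Hp & _).
  assert (N : forall (j : nat) m, chi (m + Z.of_nat j * Z.of_nat q)%Z = chi m).
  { induction j as [|j IH]; intros m'; [f_equal; lia|].
    rewrite Nat2Z.inj_succ, <- (IH m'), <- (Hp (m' + Z.of_nat j * Z.of_nat q)%Z). f_equal. lia. }
  destruct (Z_le_gt_dec 0 k) as [h|h].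
  - rewrite <- (Z2Nat.id k) by lia. apply N.
  - rewrite <- (N (Z.to_nat (- k)) (m + k * Z.of_nat q)%Z). f_equal. rewrite Z2Nat.id by lia. lia.
Qed.

Lemma char_mod (m : Z) : chi (m mod Z.of_nat q)%Z = chi m.
Proof.
  pose proof char_q. rewrite (Z.div_mod m (Z.of_nat q)) at 2 by lia.
  rewrite Z.add_comm, Z.mul_comm, char_period. reflexivity.
Qed.

Lemma char_mult (m n : Z) : chi (m * n)%Z = (chi m * chi n)%C.
Proof. apply Hchi. Qed.

Lemma char_1 : chi 1%Z = RtoC 1.
Proof. apply Hchi. Qed.

Lemma char_bounded : exists B, forall m, Cmod (chi m) <= B.
Proof.
  exists (Rsum (fun h => Cmod (chi (Z.of_nat h - 1)%Z)) 1 q). intros m.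
  pose proof char_q as hq.
  rewrite <- char_mod. pose proof (Z.mod_pos_bound m (Z.of_nat q) ltac:(lia)) as hm.
  set (r := (m mod Z.of_nat q)%Z) in *.
  assert (K : forall N, (Z.to_nat r < N)%nat -> Cmod (chi r) <= Rsum (fun h => Cmod (chi (Z.of_nat h - 1)%Z)) 1 N).
  { induction N as [|N IH]; intros h; [lia|]. rewrite Rsum_Sm by lia.
    assert (P : 0 <= Rsum (fun h => Cmod (chi (Z.of_nat h - 1)%Z)) 1 N).
    { clear. induction N as [|N IH]; [rewrite Rsum_0 by lia; lra|]. rewrite Rsum_Sm by lia.
      pose proof (Cmod_ge_0 (chi (Z.of_nat (S N) - 1)%Z)). lra. }
    destruct (Nat.eq_dec (Z.to_nat r) N) as [e|e].
    - replace (Z.of_nat (S N) - 1)%Z with r by lia. lra.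
    - pose proof (Cmod_ge_0 (chi (Z.of_nat (S N) - 1)%Z)). specialize (IH ltac:(lia)). lra. }
  apply K. lia.
Qed.

Lemma char_pow (m : Z) (n : nat) : chi (m ^ Z.of_nat n)%Z = (chi m ^ n)%C.
Proof.
  induction n as [|n IH]; [simpl; apply char_1|].
  rewrite Nat2Z.inj_succ, Z.pow_succ_r, char_mult, IH by lia. reflexivity.
Qed.

(** A character is bounded because it is periodic; were one value of modulus greater than 1, its
    powers, again values of the character, would be unbounded. *)
Lemma char_le1 (m : Z) : Cmod (chi m) <= 1.
Proof.
  destruct char_bounded as [B HB]. destruct (Rle_or_lt (Cmod (chi m)) 1) as [h|h]; auto. exfalso.
  destruct (Pow_x_infinity (Cmod (chi m))) with (b := B + 1) as [N HN].
  - rewrite Rabs_pos_eq by apply Cmod_ge_0. auto.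
  - specialize (HN N (Nat.le_refl N)). rewrite Rabs_pos_eq in HN by (apply pow_le, Cmod_ge_0).
    specialize (HB (m ^ Z.of_nat N)%Z). rewrite char_pow, Cmod_pow in HB. lra.
Qed.

Lemma char_coprime_inv (m : Z) : Z.gcd m (Z.of_nat q) = 1%Z -> (chi m * Cconj (chi m))%C = RtoC 1.
Proof.
  intros h. destruct (Z.gcd_bezout m (Z.of_nat q) 1 h) as (u & v & E).
  assert (K : (chi u * chi m)%C = RtoC 1).
  { rewrite <- char_mult, <- char_1. rewrite <- (char_period (u * m) v). f_equal. lia. }
  assert (M : Cmod (chi m) = 1).
  { apply Rle_antisym; [apply char_le1|].
    assert (Cmod (chi u) * Cmod (chi m) = 1) by (rewrite <- Cmod_mult, K; apply Cmod_1).
    pose proof (char_le1 u). pose proof (Cmod_ge_0 (chi m)). nra. }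
  rewrite <- Cmod2_conj, M. f_equal. ring.
Qed.

(** Sums over lists make a change of summation variable modulo [q] an invariance under
    permutation. *)
Definition lsum (F : Z -> C) (l : list nat) : C := fold_right (fun h s => F (Z.of_nat h) + s)%C (RtoC 0) l.

Lemma lsum_perm (F : Z -> C) (l l' : list nat) : Permutation l l' -> lsum F l = lsum F l'.
Proof.
  induction 1; simpl; auto.
  - rewrite IHPermutation. reflexivity.
  - ring.
  - congruence.
Qed.

Lemma Csum_lsum (F : Z -> C) (n : nat) : Csum (fun h => F (Z.of_nat h)) 1 n = lsum F (seq 1 n).
Proof.
  induction n as [|n IH]; [rewrite Csum_0 by lia; reflexivity|].
  rewrite Csum_Sm, IH, seq_S by lia.
  assert (A : forall l x, lsum F (l ++ x :: nil) = (lsum F l + F (Z.of_nat x))%C).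
  { induction l as [|y l IHl]; intros x; simpl; [ring|]. rewrite IHl. ring. }
  rewrite A. reflexivity.
Qed.

Definition zperiodic (F : Z -> C) : Prop := forall m k, F (m + k * Z.of_nat q)%Z = F m.

Lemma zperiodic_mod (F : Z -> C) (m : Z) : zperiodic F -> F (m mod Z.of_nat q)%Z = F m.
Proof.
  intros HF. pose proof char_q. rewrite (Z.div_mod m (Z.of_nat q)) at 2 by lia.
  rewrite Z.add_comm, Z.mul_comm, HF. reflexivity.
Qed.

Lemma Csum_period0 (F : Z -> C) : zperiodic F ->
  Csum (fun h => F (Z.of_nat h)) 1 q = lsum F (seq 0 q).
Proof.
  intros HF. rewrite Csum_lsum. pose proof char_q as hq.
  destruct q as [|n] eqn:E; [lia|]. rewrite seq_S.
  apply eq_trans with (lsum F (0%nat :: seq 1 n)); [|reflexivity].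
  assert (A : forall l x, lsum F (l ++ x :: nil) = (lsum F l + F (Z.of_nat x))%C).
  { induction l as [|y l IHl]; intros x; simpl; [ring|]. rewrite IHl. ring. }
  rewrite A. simpl lsum. rewrite Cplus_comm. f_equal.
  specialize (HF 0%Z 1%Z). unfold zperiodic in HF. rewrite E in HF. rewrite Z.mul_1_l, Z.add_0_l in HF. exact HF.
Qed.

(** Multiplication by a unit permutes the residues modulo [q]: it is injective by Gauss's lemma, and
    an injection of a finite set into itself is a permutation. *)
Lemma Csum_reindex (F : Z -> C) (a : Z) : zperiodic F -> Z.gcd a (Z.of_nat q) = 1%Z ->
  Csum (fun h => F (a * Z.of_nat h)%Z) 1 q = Csum (fun h => F (Z.of_nat h)) 1 q.
Proof.
  intros HF ha. pose proof char_q as hq.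
  assert (HFa : zperiodic (fun m => F (a * m)%Z)).
  { intros m k. replace (a * (m + k * Z.of_nat q))%Z with (a * m + (a * k) * Z.of_nat q)%Z by ring. apply HF. }
  rewrite (Csum_period0 (fun m => F (a * m)%Z) HFa), (Csum_period0 F HF).
  set (g := fun h => Z.to_nat ((a * Z.of_nat h) mod Z.of_nat q)).
  assert (hg : forall h, Z.of_nat (g h) = ((a * Z.of_nat h) mod Z.of_nat q)%Z).
  { intros h. unfold g. apply Z2Nat.id. apply Z.mod_pos_bound. lia. }
  assert (P : Permutation (map g (seq 0 q)) (seq 0 q)).
  { apply NoDup_Permutation_bis.
    - apply NoDup_map_NoDup_ForallPairs; [|apply seq_NoDup].
      intros x y hx hy exy. apply in_seq in hx. apply in_seq in hy.
      assert (E : ((a * Z.of_nat x) mod Z.of_nat q = (a * Z.of_nat y) mod Z.of_nat q)%Z) by (rewrite <- !hg, exy; reflexivity).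
      assert (D : (Z.of_nat q | a * (Z.of_nat x - Z.of_nat y))%Z).
      { apply Z.mod_divide; [lia|]. rewrite Z.mul_sub_distr_l, Zminus_mod, E, Z.sub_diag. apply Z.mod_0_l. lia. }
      apply Z.gauss in D; [|rewrite Z.gcd_comm; auto].
      destruct D as [c Hc]. assert (c = 0)%Z by nia. lia.
    - rewrite length_map. lia.
    - intros z hz. apply in_map_iff in hz. destruct hz as (x & <- & hx). apply in_seq. split; [lia|].
      pose proof (Z.mod_pos_bound (a * Z.of_nat x) (Z.of_nat q) ltac:(lia)). specialize (hg x). lia. }
  rewrite <- (lsum_perm F _ _ P). unfold lsum.
  generalize (seq 0 q). induction l as [|h l IH]; simpl; auto. rewrite IH. f_equal.
  rewrite hg, zperiodic_mod; auto.
Qed.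

Definition ez (m : Z) : C := cexp (0, 2 * PI * IZR m / INR q).

Lemma INRq_pos : 0 < INR q.
Proof. apply lt_0_INR. pose proof char_q. lia. Qed.

Lemma ez_plus (m n : Z) : ez (m + n) = (ez m * ez n)%C.
Proof.
  unfold ez. rewrite <- cexp_plus. f_equal. pose proof INRq_pos.
  apply C_eq; unfold Re, Im; simpl; [ring|]. rewrite plus_IZR. field. lra.
Qed.

Lemma ez_q (k : Z) : ez (k * Z.of_nat q) = RtoC 1.
Proof.
  pose proof INRq_pos as hq. unfold ez. rewrite mult_IZR, <- INR_IZR_INZ.
  replace (2 * PI * (IZR k * INR q) / INR q) with (2 * IZR k * PI) by (field; lra).
  unfold cexp, Re, Im. cbn [fst snd]. rewrite exp_0.
  replace (2 * IZR k * PI) with (IZR (2 * k) * PI) by (rewrite mult_IZR; reflexivity).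
  assert (S : sin (IZR (2 * k) * PI) = 0) by (apply sin_eq_0_1; eauto).
  assert (Cs : cos (IZR (2 * k) * PI) = 1).
  { rewrite mult_IZR. replace (IZR 2 * IZR k * PI) with (2 * (IZR k * PI)) by ring. rewrite cos_2a_sin.
    assert (S1 : sin (IZR k * PI) = 0) by (apply sin_eq_0_1; eauto). rewrite S1. ring. }
  rewrite S, Cs. apply C_eq; simpl; ring.
Qed.

Lemma ez_period (m k : Z) : ez (m + k * Z.of_nat q) = ez m.
Proof. rewrite ez_plus, ez_q. ring. Qed.

Lemma ez_0 : ez 0 = RtoC 1.
Proof. replace 0%Z with (0 * Z.of_nat q)%Z by ring. apply ez_q. Qed.

Lemma gauss_sum_ez : gauss_sum q chi = Csum (fun h => chi (Z.of_nat h) * ez (Z.of_nat h))%C 1 q.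
Proof.
  unfold gauss_sum. apply Csum_ext. intros h _. unfold ez. rewrite <- INR_IZR_INZ. reflexivity.
Qed.

Hypothesis Hprim : primitive_char q chi.

(** For [k] prime to [q] this is a change of variable. Otherwise the right side is zero, and
    primitivity supplies a unit [a], congruent to 1 modulo [q / gcd (k, q)] with [chi a <> 1], such
    that multiplying the sum by [chi a] does not change it. *)
Lemma gauss_separable (k : Z) :
  Csum (fun h => chi (Z.of_nat h) * ez (Z.of_nat h * k))%C 1 q = (Cconj (chi k) * gauss_sum q chi)%C.
Proof.
  pose proof char_q as hq.
  set (F := fun m => (chi m * ez (m * k))%C).
  assert (HF : zperiodic F).
  { intros m j. unfold F. rewrite char_period.
    replace ((m + j * Z.of_nat q) * k)%Z with (m * k + (j * k) * Z.of_nat q)%Z by ring. rewrite ez_period. reflexivity. }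
  change (Csum (fun h => F (Z.of_nat h)) 1 q = (Cconj (chi k) * gauss_sum q chi)%C).
  destruct (Z.eq_dec (Z.gcd k (Z.of_nat q)) 1) as [h|h].
  - set (G := fun m => (chi m * ez m)%C).
    assert (HG : zperiodic G) by (intros m j; unfold G; rewrite char_period, ez_period; reflexivity).
    assert (E : gauss_sum q chi = (chi k * Csum (fun h => F (Z.of_nat h)) 1 q)%C).
    { rewrite gauss_sum_ez. change (Csum (fun h => G (Z.of_nat h)) 1 q = (chi k * Csum (fun h => F (Z.of_nat h)) 1 q)%C).
      rewrite <- (Csum_reindex G k HG h), <- Csum_scal. apply Csum_ext. intros j _. unfold G, F.
      rewrite char_mult, (Z.mul_comm k). ring. }
    rewrite E, Cmult_assoc, (Cmult_comm (Cconj (chi k))), char_coprime_inv by auto. ring.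
  - destruct Hchi as (_ & _ & _ & _ & Hz).
    assert (Z0 : chi k = RtoC 0) by (apply Hz; auto).
    rewrite Z0. replace (Cconj (RtoC 0)) with (RtoC 0) by (apply C_eq; simpl; ring).
    set (g := Z.gcd k (Z.of_nat q)) in *.
    assert (hg0 : (0 <= g)%Z) by apply Z.gcd_nonneg.
    destruct (Z.gcd_divide_r k (Z.of_nat q)) as [d Hd]. fold g in Hd.
    destruct (Z.gcd_divide_l k (Z.of_nat q)) as [k' Hk']. fold g in Hk'.
    assert (hd : (0 < d)%Z) by nia. assert (hg1 : (1 < g)%Z) by nia.
    destruct Hprim as [_ Hp].
    destruct (Hp (Z.to_nat d)) as (a & ha1 & ha2 & ha3).
    + lia.
    + exists (Z.to_nat g). apply Nat2Z.inj. rewrite Nat2Z.inj_mul, !Z2Nat.id by lia. lia.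
    + apply Nat2Z.inj_lt. rewrite Z2Nat.id by lia. nia.
    + rewrite Z2Nat.id in ha2 by lia.
      (* [a - 1] is divisible by [d] and [k] by [g] with [d g = q], so [a j k] and [j k] agree
         modulo [q]: the change of variable [a] affects only the factor [chi]. *)
      assert (E : (chi a * Csum (fun h => F (Z.of_nat h)) 1 q)%C = Csum (fun h => F (Z.of_nat h)) 1 q).
      { rewrite <- (Csum_reindex F a HF ha1) at 2. rewrite <- Csum_scal. apply Csum_ext. intros j _. unfold F.
        rewrite char_mult.
        assert (D : (d | a - 1)%Z).
        { apply Z.mod_divide; [lia|]. rewrite Zminus_mod, ha2, Z.sub_diag. apply Z.mod_0_l. lia. }
        destruct D as [c Hc].
        replace (a * Z.of_nat j * k)%Z with (Z.of_nat j * k + (c * Z.of_nat j * k') * Z.of_nat q)%Z.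
        - rewrite ez_period. ring.
        - rewrite Hk', Hd. replace a with (c * d + 1)%Z by lia. ring. }
      set (S := Csum (fun h => F (Z.of_nat h)) 1 q) in *.
      assert (Z1 : ((chi a - 1) * S)%C = RtoC 0) by (transitivity (chi a * S - S)%C; [ring|rewrite E; ring]).
      assert (N : (chi a - 1)%C <> RtoC 0).
      { intros e. apply ha3. replace (chi a) with ((chi a - 1) + 1)%C by ring. rewrite e. ring. }
      replace S with (/ (chi a - 1) * ((chi a - 1) * S))%C by (field; auto). rewrite Z1. ring.
Qed.

End Characters.

Lemma conj_char_dirichlet (q : nat) (chi : Z -> C) : dirichlet_char q chi -> dirichlet_char q (conj_char chi).
Proof.
  intros (h1 & h2 & h3 & h4 & h5). unfold conj_char. repeat split; auto.
  - intros m. rewrite h2. reflexivity.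
  - intros m n. rewrite h3. apply Cmult_conj.
  - rewrite h4. apply C_eq; simpl; ring.
  - intros E. apply h5. rewrite <- (Cconj_conj (chi m)), E. apply C_eq; simpl; ring.
  - intros E. apply h5 in E. rewrite E. apply C_eq; simpl; ring.
Qed.

Lemma conj_char_primitive (q : nat) (chi : Z -> C) : primitive_char q chi -> primitive_char q (conj_char chi).
Proof.
  intros [h1 h2]. split; [apply conj_char_dirichlet; auto|].
  intros d hd1 hd2 hd3. destruct (h2 d hd1 hd2 hd3) as (a & k1 & k2 & k3).
  exists a. repeat split; auto. intros E. apply k3. unfold conj_char in E.
  rewrite <- (Cconj_conj (chi a)), E. apply C_eq; simpl; ring.
Qed.

Lemma conj_char_odd (chi : Z -> C) : odd_char chi -> odd_char (conj_char chi).
Proof. unfold odd_char, conj_char. intros ->. apply C_eq; simpl; ring. Qed.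

Lemma conj_char_invol (chi : Z -> C) (m : Z) : conj_char (conj_char chi) m = chi m.
Proof. apply Cconj_conj. Qed.

(** * Odd primitive characters: products of Gauss sums and the partial fractions of [A] *)

Section OddCharacters.
Variables (q : nat) (chi : Z -> C).
Hypothesis Hprim : primitive_char q chi.
Hypothesis Hodd : odd_char chi.

Let chib := conj_char chi.
Let Hd : dirichlet_char q chi := proj1 Hprim.
Let Hdb : dirichlet_char q chib := conj_char_dirichlet q chi (proj1 Hprim).

Lemma char_neg (m : Z) : chi (- m)%Z = (- chi m)%C.
Proof.
  replace (- m)%Z with (-1 * m)%Z by lia. rewrite (char_mult q chi Hd), Hodd. 
  replace (RtoC (-1)) with (- RtoC 1)%C by (rewrite <- RtoC_opp; reflexivity). ring.
Qed.

Lemma char_0 : chi 0%Z = RtoC 0.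
Proof.
  pose proof (char_neg 0%Z) as E. simpl (- 0)%Z in E.
  assert (E2 : (RtoC 2 * chi 0%Z)%C = RtoC 0).
  { replace (RtoC 2) with (1 + 1)%C by (rewrite <- RtoC_plus; f_equal; ring).
    transitivity (chi 0%Z + chi 0%Z)%C; [ring|]. rewrite E at 1. ring. }
  replace (chi 0%Z) with (/ RtoC 2 * (RtoC 2 * chi 0%Z))%C by (field; apply C2_neq0). rewrite E2. ring.
Qed.

Lemma char_qz : chi (Z.of_nat q) = RtoC 0.
Proof. rewrite <- (Z.add_0_l (Z.of_nat q)), <- (Z.mul_1_l (Z.of_nat q)), (char_period q chi Hd). apply char_0. Qed.

Lemma gcd_m1 : Z.gcd (-1) (Z.of_nat q) = 1%Z.
Proof. change (-1)%Z with (Z.opp 1). rewrite Z.gcd_opp_l. apply Z.gcd_1_l. Qed.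

Lemma ez_geom (h : nat) : (1 <= h <= q)%nat ->
  Csum (fun k => ez q ((Z.of_nat h - 1) * Z.of_nat k)) 1 q = if Nat.eqb h 1 then RtoC (INR q) else RtoC 0.
Proof.
  intros hh. destruct (Nat.eqb_spec h 1) as [->|hn].
  - rewrite (Csum_ext _ (fun _ => RtoC 1)).
    + clear. induction q as [|n IH]; [rewrite Csum_0 by lia; reflexivity|].
      rewrite Csum_Sm, IH, S_INR, RtoC_plus by lia. reflexivity.
    + intros k _. replace ((Z.of_nat 1 - 1) * Z.of_nat k)%Z with 0%Z by lia. apply (ez_0 q chi Hd).
  - set (w := ez q (Z.of_nat h - 1)).
    assert (P : forall k, ez q ((Z.of_nat h - 1) * Z.of_nat k) = (w ^ k)%C).
    { induction k as [|k IH].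
      - replace ((Z.of_nat h - 1) * Z.of_nat 0)%Z with 0%Z by lia. apply (ez_0 q chi Hd).
      - replace ((Z.of_nat h - 1) * Z.of_nat (S k))%Z with ((Z.of_nat h - 1) + (Z.of_nat h - 1) * Z.of_nat k)%Z by lia.
        rewrite (ez_plus q chi Hd), IH. reflexivity. }
    assert (Wq : (w ^ q)%C = RtoC 1) by (rewrite <- P; apply (ez_q q chi Hd)).
    assert (W1 : w <> RtoC 1).
    { unfold w, ez. intros E. apply (f_equal Re) in E. unfold cexp, Re, Im in E. simpl in E.
      rewrite exp_0 in E.
      pose proof (INRq_pos q chi Hd) as hq. pose proof PI_RGT_0 as hpi.
      assert (hz : 0 < IZR (Z.of_nat h - 1) < INR q).
      { rewrite INR_IZR_INZ. split; apply IZR_lt; lia. }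
      assert (C1 : cos (2 * PI * IZR (Z.of_nat h - 1) / INR q) < 1).
      { apply cos_lt_1. split.
        - apply Rdiv_lt_0_compat; auto. apply Rmult_lt_0_compat; lra.
        - apply Rmult_lt_reg_r with (INR q); auto. unfold Rdiv. rewrite Rmult_assoc, Rinv_l by lra. nra. }
      lra. }
    rewrite (Csum_ext _ (fun k => w ^ k)%C) by (intros; apply P).
    assert (G : forall n, ((w - 1) * Csum (fun k => w ^ k) 1 n)%C = (w * (w ^ n - 1))%C).
    { induction n as [|n IH]; [rewrite Csum_0 by lia; simpl; ring|].
      rewrite Csum_Sm by lia. rewrite Cmult_plus_distr_l, IH. simpl. ring. }
    assert (N : (w - 1)%C <> RtoC 0) by (intros e; apply W1; replace w with ((w - 1) + 1)%C by ring; rewrite e; ring).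
    replace (Csum (fun k => w ^ k)%C 1 q) with (/ (w - 1) * ((w - 1) * Csum (fun k => w ^ k) 1 q))%C by (field; auto).
    rewrite G, Wq. ring.
Qed.

(** The double sum [T] is evaluated twice. Summing over [k] first, orthogonality of additive
    characters leaves [q]; summing over [h] first, separability leaves the product of Gauss sums,
    with a sign from [chi (-1) = -1]. *)
Lemma gauss_product : (gauss_sum q chi * gauss_sum q chib)%C = RtoC (- INR q).
Proof.
  pose proof (char_q q chi Hd) as hq.
  set (T := Csum (fun k => Csum (fun h => chib (Z.of_nat h) * ez q (Z.of_nat h * Z.of_nat k) * ez q (- Z.of_nat k))%C 1 q) 1 q).
  assert (E1 : T = RtoC (INR q)).
  { unfold T. rewrite Csum_swap.
    rewrite (Csum_ext _ (fun h => chib (Z.of_nat h) * (if Nat.eqb h 1 then RtoC (INR q) else RtoC 0))%C).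
    - rewrite (Csum_single _ q 1); [|lia|].
      + rewrite Nat.eqb_refl. change (Z.of_nat 1) with 1%Z. rewrite (char_1 q chib Hdb). ring.
      + intros k hk hk1. destruct (Nat.eqb_spec k 1); [lia|ring].
    - intros h hh. rewrite <- ez_geom, <- Csum_scal by auto. apply Csum_ext. intros k _.
      rewrite <- Cmult_assoc, <- (ez_plus q chi Hd). f_equal. f_equal. lia. }
  assert (E2 : T = (- (gauss_sum q chi * gauss_sum q chib))%C).
  { unfold T.
    rewrite (Csum_ext _ (fun k => gauss_sum q chib * (chi (Z.of_nat k) * ez q (- Z.of_nat k)))%C).
    - rewrite Csum_scal.
      set (F := fun m => (chi m * ez q (- m))%C).
      assert (HF : zperiodic q F).
      { intros m j. unfold F. rewrite (char_period q chi Hd).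
        replace (- (m + j * Z.of_nat q))%Z with (- m + (- j) * Z.of_nat q)%Z by ring. rewrite (ez_period q chi Hd). reflexivity. }
      change (Csum (fun k => chi (Z.of_nat k) * ez q (- Z.of_nat k))%C 1 q) with (Csum (fun k => F (Z.of_nat k)) 1 q).
      rewrite <- (Csum_reindex q chi Hd F (-1) HF gcd_m1).
      rewrite (Csum_ext _ (fun h => RtoC (-1) * (chi (Z.of_nat h) * ez q (Z.of_nat h)))%C).
      + rewrite Csum_scal, (gauss_sum_ez q chi).
        replace (RtoC (-1)) with (- RtoC 1)%C by (rewrite <- RtoC_opp; reflexivity). ring.
      + intros h _. unfold F. replace (-1 * Z.of_nat h)%Z with (- Z.of_nat h)%Z by lia.
        rewrite char_neg, Z.opp_involutive.
        replace (RtoC (-1)) with (- RtoC 1)%C by (rewrite <- RtoC_opp; reflexivity). ring.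
    - intros k _.
      transitivity (ez q (- Z.of_nat k) * Csum (fun h => chib (Z.of_nat h) * ez q (Z.of_nat h * Z.of_nat k)) 1 q)%C.
      + rewrite <- Csum_scal. apply Csum_ext. intros; ring.
      + rewrite (gauss_separable q chib Hdb (conj_char_primitive q chi Hprim)).
        replace (Cconj (chib (Z.of_nat k))) with (chi (Z.of_nat k)) by (symmetry; apply conj_char_invol). ring. }
  replace (gauss_sum q chi * gauss_sum q chib)%C with (- T)%C by (rewrite E2; ring).
  rewrite E1, RtoC_opp. reflexivity.
Qed.

Lemma gauss_neq0 : gauss_sum q chi <> RtoC 0 /\ gauss_sum q chib <> RtoC 0.
Proof.
  pose proof gauss_product as E. pose proof (INRq_pos q chi Hd) as hq.
  assert (N : RtoC (- INR q) <> RtoC 0) by (apply RtoC_neq0; lra).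
  split; intros e; apply N; rewrite <- E, e; ring.
Qed.

Definition th (h : nat) : R := 2 * PI * INR h / INR q.

Lemma ez_split (h k : nat) : ez q (Z.of_nat h * Z.of_nat k) = (cos (INR k * th h), sin (INR k * th h)).
Proof.
  unfold ez, th. pose proof (INRq_pos q chi Hd) as hq. unfold cexp, Re, Im. cbn [fst snd]. rewrite exp_0.
  rewrite mult_IZR, <- !INR_IZR_INZ.
  replace (2 * PI * (INR h * INR k) / INR q) with (INR k * (2 * PI * INR h / INR q)) by (field; lra).
  apply C_eq; simpl; ring.
Qed.

(** Separability written in cosines and sines: the substitution of [- h] for [h] shows that the
    cosine part [X] equals its negative. Only sine series therefore have to be summed. *)
Lemma char_sine (k : nat) :
  (chi (Z.of_nat k) * gauss_sum q chib)%C = (Ci * Csum (fun h => chib (Z.of_nat h) * RtoC (sin (INR k * th h))) 1 q)%C.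
Proof.
  set (X := Csum (fun h => chib (Z.of_nat h) * RtoC (cos (INR k * th h)))%C 1 q).
  set (Y := Csum (fun h => chib (Z.of_nat h) * RtoC (sin (INR k * th h)))%C 1 q).
  assert (E1 : (chi (Z.of_nat k) * gauss_sum q chib)%C = (X + Ci * Y)%C).
  { replace (chi (Z.of_nat k)) with (Cconj (chib (Z.of_nat k))) by apply conj_char_invol.
    rewrite <- (gauss_separable q chib Hdb (conj_char_primitive q chi Hprim)).
    unfold X, Y. rewrite <- Csum_scal, <- Csum_plus. apply Csum_ext. intros h _. rewrite ez_split.
    replace ((cos (INR k * th h), sin (INR k * th h)) : C) with (RtoC (cos (INR k * th h)) + Ci * RtoC (sin (INR k * th h)))%C
      by (apply C_eq; simpl; ring). ring. }
  assert (E2 : X = RtoC 0).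
  { set (F := fun m => (chib m * (RtoC (/ 2) * (ez q (m * Z.of_nat k) + ez q (- (m * Z.of_nat k)))))%C).
    assert (HF : zperiodic q F).
    { intros m j. unfold F. rewrite (char_period q chib Hdb).
      replace ((m + j * Z.of_nat q) * Z.of_nat k)%Z with (m * Z.of_nat k + (j * Z.of_nat k) * Z.of_nat q)%Z by ring.
      rewrite (ez_period q chi Hd).
      replace (- (m * Z.of_nat k + j * Z.of_nat k * Z.of_nat q))%Z with (- (m * Z.of_nat k) + (- (j * Z.of_nat k)) * Z.of_nat q)%Z by ring.
      rewrite (ez_period q chi Hd). reflexivity. }
    assert (EX : X = Csum (fun h => F (Z.of_nat h)) 1 q).
    { unfold X. apply Csum_ext. intros h _. unfold F. f_equal.
      assert (Em : ez q (- (Z.of_nat h * Z.of_nat k)) = (cos (INR k * th h), - sin (INR k * th h))).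
      { pose proof (ez_plus q chi Hd (Z.of_nat h * Z.of_nat k) (- (Z.of_nat h * Z.of_nat k))) as e.
        rewrite Z.add_opp_diag_r, (ez_0 q chi Hd), ez_split in e.
        set (c := cos (INR k * th h)) in *. set (s := sin (INR k * th h)) in *.
        assert (cs : c * c + s * s = 1) by (pose proof (sin2_cos2 (INR k * th h)) as p; unfold Rsqr in p; fold c s in p; lra).
        transitivity ((c, (- s)%R) * ((c, s) * ez q (- (Z.of_nat h * Z.of_nat k))))%C.
        - rewrite Cmult_assoc. replace ((c, (- s)%R) * (c, s))%C with (RtoC 1); [ring|].
          apply C_eq; unfold Re, Im; simpl; lra.
        - rewrite <- e. ring. }
      rewrite ez_split, Em. apply C_eq; simpl; field. }
    assert (EN : X = (- X)%C).
    { rewrite EX at 1. rewrite <- (Csum_reindex q chi Hd F (-1) HF gcd_m1).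
      rewrite (Csum_ext _ (fun h => RtoC (-1) * F (Z.of_nat h))%C).
      - rewrite Csum_scal, <- EX. replace (RtoC (-1)) with (- RtoC 1)%C by (rewrite <- RtoC_opp; reflexivity). ring.
      - intros h _. unfold F. replace (-1 * Z.of_nat h)%Z with (- Z.of_nat h)%Z by lia.
        replace (chib (- Z.of_nat h)%Z) with (- chib (Z.of_nat h))%C.
        + replace (- Z.of_nat h * Z.of_nat k)%Z with (- (Z.of_nat h * Z.of_nat k))%Z by ring. rewrite Z.opp_involutive.
          replace (RtoC (-1)) with (- RtoC 1)%C by (rewrite <- RtoC_opp; reflexivity). ring.
        + unfold chib, conj_char. rewrite char_neg. apply C_eq; simpl; ring. }
    assert (E0 : (RtoC 2 * X)%C = RtoC 0).
    { replace (RtoC 2) with (1 + 1)%C by (rewrite <- RtoC_plus; f_equal; ring).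
      transitivity (X + X)%C; [ring|]. rewrite EN at 1. ring. }
    replace X with (/ RtoC 2 * (RtoC 2 * X))%C by (field; apply C2_neq0). rewrite E0. ring. }
  rewrite E1, E2. fold Y. ring.
Qed.

(** Closed form of the exponential series with coefficients [chib n], obtained by summing over
    residues and symmetrising; [Af_series] confirms it. As a finite sum it gives continuity directly
    and matches the sine series of [sum_sin_hyp]. [A0] is its limit at [v = 0]. *)
Definition Afun (v : R) : C :=
  (RtoC (1 / 2) * Csum (fun h => chib (Z.of_nat h) * RtoC (sinh (PI * v * (INR q - 2 * INR h)) / sinh (PI * v * INR q))) 1 q)%C.
Definition A0 : C :=
  (RtoC (1 / 2) * Csum (fun h => chib (Z.of_nat h) * RtoC (1 - 2 * INR h / INR q)) 1 q)%C.
Definition kap : C := (Ci * RtoC (INR q) / (RtoC PI * gauss_sum q chi))%C.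

Lemma Cser_Csum (a : nat -> nat -> C) (l : nat -> C) (N : nat) : (forall h, (1 <= h <= N)%nat -> Cser (a h) (l h)) ->
  Cser (fun n => Csum (fun h => a h n) 1 N) (Csum l 1 N).
Proof.
  induction N as [|N IH]; intros H.
  - rewrite Csum_0 by lia. apply (Cser_ext (fun n => RtoC 0)); [intros; rewrite Csum_0 by lia; reflexivity|].
    apply (Cser_RtoC (fun _ => 0) 0), is_series_zero. auto.
  - rewrite Csum_Sm by lia. eapply Cser_ext.
    2:{ apply Cser_plus; [apply IH; intros; apply H; lia|apply (H (S N)); lia]. }
    intros n. simpl. rewrite Csum_Sm by lia. reflexivity.
Qed.

(** The theorem carries [1 / gauss_sum q chi], whereas the sine expansion of [chi] produces the
    Gauss sum of [chib]; their product converts one into the other. *)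
Lemma kap_alt : kap = (gauss_sum q chib / (Ci * RtoC PI))%C.
Proof.
  unfold kap. destruct gauss_neq0 as [n1 n2]. pose proof gauss_product as E.
  assert (np : RtoC PI <> RtoC 0) by (apply RtoC_neq0; pose proof PI_RGT_0; lra).
  pose proof Ci_neq0 as ni. 
  assert (E' : RtoC (INR q) = (- (gauss_sum q chi * gauss_sum q chib))%C).
  { rewrite E, RtoC_opp. ring. }
  rewrite E'. replace (gauss_sum q chib / (Ci * RtoC PI))%C with (- (Ci * Ci) * (gauss_sum q chib / (Ci * RtoC PI)))%C.
  - field. repeat split; auto.
  - replace (Ci * Ci)%C with (- RtoC 1)%C by (apply C_eq; simpl; ring). ring.
Qed.

Lemma kap_neq0 : kap <> RtoC 0.
Proof.
  destruct gauss_neq0 as [n1 n2]. intros E. apply n2.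
  replace (gauss_sum q chib) with (kap * (Ci * RtoC PI))%C; [rewrite E; ring|].
  rewrite kap_alt. field. split; [apply RtoC_neq0; pose proof PI_RGT_0; lra|apply Ci_neq0].
Qed.

(** The hyperbolic sine series with [V = q v] is taken at the points [2 PI h / q] and summed against
    [chib h]: on the left [char_sine] recreates [chi], on the right the linear terms form [A0] and
    the hyperbolic ones [Afun v]. *)
Lemma Afun_partial_fractions (v : R) : 0 < v ->
  Cser (fun n => chi (Z.of_nat (S n)) * RtoC (/ (ik n * (ik n ^ 2 + (INR q * v) ^ 2))))%C
    ((A0 - Afun v) / (kap * RtoC ((INR q * v) ^ 2)))%C.
Proof.
  intros hv. pose proof (INRq_pos q chi Hd) as hq. pose proof PI_RGT_0 as hpi.
  set (V := INR q * v). assert (hV : 0 < V) by (unfold V; nra).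
  destruct gauss_neq0 as [n1 n2].
  assert (hth : forall h, (1 <= h <= q)%nat -> 0 <= th h <= 2 * PI).
  { intros h hh. unfold th. assert (h1 : 0 <= INR h <= INR q) by (split; [apply pos_INR|apply le_INR; lia]).
    split.
    - apply Rmult_le_pos; [nra|left; apply Rinv_0_lt_compat; auto].
    - apply Rmult_le_reg_r with (INR q); auto. unfold Rdiv. rewrite Rmult_assoc, Rinv_l by lra. nra. }
  assert (S := Cser_Csum (fun h n => chib (Z.of_nat h) * RtoC (sin (ik n * th h) / (ik n * (ik n ^ 2 + V ^ 2))))%C
    (fun h => chib (Z.of_nat h) * RtoC ((PI - th h) / (2 * V ^ 2) - PI * sinh (V * (PI - th h)) / (2 * V ^ 2 * sinh (V * PI))))%C q).
  assert (S' := S (fun h hh => Cser_scal (chib (Z.of_nat h)) _ _ (Cser_RtoC _ _ (sum_sin_hyp V hV (th h) (hth h hh))))).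
  clear S. apply (Cser_scal (Ci / gauss_sum q chib)%C) in S'.
  assert (hs : 0 < sinh (V * PI)) by (apply sinh_pos; nra).
  match type of S' with Cser _ ?L => replace ((A0 - Afun v) / (kap * RtoC (V ^ 2)))%C with L end.
  - eapply Cser_ext; [|exact S']. intros n. cbv beta.
    transitivity (/ gauss_sum q chib * (chi (Z.of_nat (S n)) * gauss_sum q chib) * RtoC (/ (ik n * (ik n ^ 2 + V ^ 2))))%C;
      [|field; auto].
    rewrite char_sine. unfold Cdiv.
    rewrite (Csum_ext (fun h => chib (Z.of_nat h) * RtoC (sin (ik n * th h) / (ik n * (ik n ^ 2 + V ^ 2))))%C
       (fun h => RtoC (/ (ik n * (ik n ^ 2 + V ^ 2))) * (chib (Z.of_nat h) * RtoC (sin (INR (S n) * th h))))%C).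
    + rewrite Csum_scal. ring.
    + intros h _. unfold Rdiv. rewrite RtoC_mult. unfold ik. ring.
  - assert (B : (A0 - Afun v)%C = (RtoC (V ^ 2 / PI) * Csum (fun h => chib (Z.of_nat h) * RtoC ((PI - th h) / (2 * V ^ 2) - PI * sinh (V * (PI - th h)) / (2 * V ^ 2 * sinh (V * PI)))) 1 q)%C).
    { unfold A0, Afun. rewrite <- !Csum_scal.
      match goal with |- (Csum ?a 1 q - Csum ?b 1 q)%C = _ =>
        replace (Csum a 1 q - Csum b 1 q)%C with (Csum (fun k => a k + RtoC (-1) * b k)%C 1 q)
          by (rewrite (Csum_plus a), (Csum_scal (RtoC (-1)) b); replace (RtoC (-1)) with (- RtoC 1)%C by (rewrite <- RtoC_opp; reflexivity); ring) end.
      apply Csum_ext. intros h _. cbv beta.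
      match goal with |- (RtoC ?k * (?x * RtoC ?a) + RtoC ?m * (RtoC ?k * (?x * RtoC ?b)))%C = (RtoC ?p * (?x * RtoC ?c))%C =>
        assert (Er : k * a + m * k * b = p * c);
        [|transitivity (x * RtoC (k * a + m * k * b))%C;
          [rewrite RtoC_plus, !RtoC_mult; ring|rewrite Er, RtoC_mult; ring]] end.
      replace (PI * v * (INR q - 2 * INR h)) with (V * (PI - th h)) by (unfold V, th; field; lra).
      replace (PI * v * INR q) with (V * PI) by (unfold V; ring).
      unfold th. field. repeat split; lra. }
    rewrite B, kap_alt.
    replace (RtoC (V ^ 2 / PI)) with (RtoC (V ^ 2) / RtoC PI)%C by (symmetry; apply RtoC_div; lra).
    field. repeat split; auto; try apply Ci_neq0; apply RtoC_neq0; try lra. nra.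
Qed.

End OddCharacters.

(** * Holomorphic series *)

(** A second-order remainder with summable constants replaces locally uniform convergence, so
    differentiation needs no limit theorem for holomorphic functions: the remainders are simply
    added. *)
Lemma series_holo (f : nat -> C -> C) (f' : nat -> C) (M : nat -> R) (F : C -> C) (w : C) (r : R) :
  0 < r -> ex_series M ->
  (forall n, Cmod (f' n) <= M n) ->
  (forall n z, Cmod (z - w) < r -> Cmod (f n z - f n w - f' n * (z - w)) <= M n * (Cmod (z - w) * Cmod (z - w))) ->
  (forall z, Cmod (z - w) < r -> Cser (fun n => f n z) (F z)) ->
  holo_at F w.
Proof.
  intros hr [S HS] H1 H2 HF.
  destruct (Cser_dominated f' M H1 (ex_intro _ S HS)) as [l Hl].
  apply holo_cdiff. exists l. intros eps he.
  assert (hS : 0 <= S).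
  { eapply Rle_trans; [apply Cmod_ge_0|]. eapply Cser_Cmod_le; [exact H1|exact Hl|exact HS]. }
  exists (Rmin r (eps / (1 + S))). split; [apply Rmin_pos; auto; apply Rdiv_lt_0_compat; lra|].
  intros z hz. assert (hz1 := Rlt_le_trans _ _ _ hz (Rmin_l _ _)). assert (hz2 := Rlt_le_trans _ _ _ hz (Rmin_r _ _)).
  assert (hw : Cmod (w - w) < r) by (replace (w - w)%C with (RtoC 0) by ring; rewrite Cmod_0; auto).
  set (x := Cmod (z - w)) in *. assert (hx : 0 <= x) by apply Cmod_ge_0.
  assert (T : Cser (fun n => f n z - f n w - (z - w) * f' n)%C (F z - F w - (z - w) * l)%C).
  { apply Cser_minus; [apply Cser_minus; auto|apply Cser_scal; auto]. }
  replace (F z - F w - l * (z - w))%C with (F z - F w - (z - w) * l)%C by ring.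
  apply Rle_trans with (S * (x * x)).
  - eapply Cser_Cmod_le; [|exact T|apply (is_series_scal_r (x * x) M S HS)].
    intros n. cbv beta. replace (f n z - f n w - (z - w) * f' n)%C with (f n z - f n w - f' n * (z - w))%C by ring. apply H2; auto.
  - rewrite <- Rmult_assoc. apply Rmult_le_compat_r; auto.
    apply Rle_trans with ((1 + S) * (eps / (1 + S))); [apply Rmult_le_compat; lra|right; field; lra].
Qed.

(** The powers [l] and [l^2] arising from differentiation in the exponent are absorbed in the weight
    [exp (d |l|)]. The constant is [48 = 3 * 4^2], from [cexp_taylor1] and twice [xexp_le] at rate
    [d/4]. *)
Lemma exp_remainder (w z : C) (l d : R) : 0 < d -> Cmod (z - w) <= d / 2 ->
  Cmod (cexp (z * RtoC l) - cexp (w * RtoC l) - (RtoC l * cexp (w * RtoC l)) * (z - w))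
    <= 48 / (d * d) * exp (Re w * l + d * Rabs l) * (Cmod (z - w) * Cmod (z - w)) /\
  Cmod (RtoC l * cexp (w * RtoC l)) <= / d * exp (Re w * l + d * Rabs l).
Proof.
  intros hd hz. set (h := (z - w)%C) in *. set (x := Cmod h) in *. set (a := Rabs l).
  assert (ha : 0 <= a) by apply Rabs_pos. assert (hx : 0 <= x) by apply Cmod_ge_0.
  assert (E : Cmod (cexp (w * RtoC l)) = exp (Re w * l)) by (rewrite Cmod_cexp, Re_scalr; reflexivity).
  pose proof (exp_pos (Re w * l)) as hE. split.
  - replace (cexp (z * RtoC l)) with (cexp (w * RtoC l) * cexp (h * RtoC l))%C
      by (rewrite <- cexp_plus; f_equal; unfold h; ring).
    replace (cexp (w * RtoC l) * cexp (h * RtoC l) - cexp (w * RtoC l) - RtoC l * cexp (w * RtoC l) * h)%C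
      with (cexp (w * RtoC l) * (cexp (h * RtoC l) - 1 - h * RtoC l))%C by ring.
    rewrite Cmod_mult, E.
    pose proof (cexp_taylor1 (h * RtoC l)) as T. rewrite Cmod_mult, Cmod_R in T. fold x a in T.
    rewrite exp_plus.
    assert (B : 3 * (x * a * (x * a)) * exp (x * a) <= 48 / (d * d) * exp (d * a) * (x * x)).
    { pose proof (xexp_le (d/4) a ltac:(lra) ha) as h4.
      assert (h0 : 0 <= a * exp (- (d/4) * a)) by (apply Rmult_le_pos; [auto|apply exp_ge0]).
      replace (/ (d / 4)) with (4 / d) in h4 by (field; lra).
      assert (hx2 : exp (x * a) <= exp (d / 2 * a)) by (apply exp_le; apply Rmult_le_compat_r; lra).
      apply Rle_trans with (3 * (x * x) * ((a * exp (- (d/4) * a)) * (a * exp (- (d/4) * a))) * exp (d * a)).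
      - apply Rle_trans with (3 * (x * a * (x * a)) * exp (d / 2 * a)); [apply Rmult_le_compat_l; nra|].
        right. replace (exp (d * a)) with (exp (d/4 * a) * exp (d/4*a) * exp (d/2 * a)) by (rewrite <- !exp_plus; f_equal; field).
        replace (- (d/4) * a) with (- (d/4 * a)) by ring. rewrite exp_Ropp. pose proof (exp_pos (d/4*a)). field. lra.
      - replace (48 / (d * d) * exp (d * a) * (x * x)) with (3 * (x * x) * ((4 / d) * (4 / d)) * exp (d * a)) by (field; lra).
        apply Rmult_le_compat_r; [apply exp_ge0|]. apply Rmult_le_compat_l; [nra|].
        apply Rmult_le_compat; auto. }
    apply Rle_trans with (exp (Re w * l) * (48 / (d * d) * exp (d * a) * (x * x))).
    + apply Rmult_le_compat_l; lra.
    + right. ring.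
  - rewrite Cmod_mult, Cmod_R, E. fold a. rewrite exp_plus.
    pose proof (xexp_le d a hd ha) as h4. replace (- d * a) with (- (d * a)) in h4 by ring. rewrite exp_Ropp in h4.
    pose proof (exp_pos (d * a)) as hp.
    assert (a <= / d * exp (d * a)).
    { apply Rmult_le_reg_r with (/ exp (d * a)); [apply Rinv_0_lt_compat; auto|]. rewrite Rmult_assoc, Rinv_r by lra. lra. }
    nra.
Qed.

Lemma ex_series_scalR (c : R) (a : nat -> R) : ex_series a -> ex_series (fun n => c * a n).
Proof. intros. apply (ex_series_scal_l c a). auto. Qed.

(** The coefficient [c n] belongs to the integer [n + 1]. *)
Definition Dser (c : nat -> C) (w : C) : nat -> C := fun n => (c n * cpow (INR (S n)) (- w))%C.

Lemma Rpower_as_exp (n : nat) (s : R) : exp (s * ln (ik n)) = Rpower (ik n) s.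
Proof. reflexivity. Qed.

Lemma ln_ik_pos (n : nat) : 0 <= ln (ik n).
Proof. rewrite <- ln_1. pose proof (ik_ge1 n). destruct (Req_dec (ik n) 1) as [->|]; [lra|]. left. apply ln_increasing; lra. Qed.

Lemma ik_pos (n : nat) : 0 < ik n.
Proof. pose proof (ik_ge1 n). lra. Qed.

Lemma Dser_cv (c : nat -> C) (B : R) (w : C) : (forall n, Cmod (c n) <= B) -> 1 < Re w -> exists l, Cser (Dser c w) l.
Proof.
  intros Hc hw. apply (Cser_dominated _ (fun n => B * Rpower (INR (S n)) (- Re w))).
  - intros n. unfold Dser. rewrite Cmod_mult, Cmod_cpow, Re_opp by apply ik_pos.
    apply Rmult_le_compat_r; [apply exp_ge0|auto].
  - apply ex_series_scalR, ex_series_Rpower. auto.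
Qed.

Lemma Dser_abs (c : nat -> C) (B : R) (w : C) : (forall n, Cmod (c n) <= B) -> 1 < Re w ->
  ex_series (fun n => Cmod (Dser c w n)).
Proof.
  intros Hc hw. apply (@ex_series_le R_AbsRing R_CompleteNormedModule _ (fun n => B * Rpower (INR (S n)) (- Re w))).
  - intros n. change (Rabs (Cmod (Dser c w n)) <= B * Rpower (INR (S n)) (- Re w)). rewrite Rabs_pos_eq by apply Cmod_ge_0.
    unfold Dser. rewrite Cmod_mult, Cmod_cpow, Re_opp by apply ik_pos.
    apply Rmult_le_compat_r; [apply exp_ge0|auto].
  - apply ex_series_scalR, ex_series_Rpower. auto.
Qed.

Lemma Dser_holo (c : nat -> C) (B : R) (F : C -> C) (w : C) : (forall n, Cmod (c n) <= B) -> 1 < Re w ->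
  (forall z, 1 < Re z -> Cser (Dser c z) (F z)) -> holo_at F w.
Proof.
  intros Hc hw HF.
  assert (hB : 0 <= B) by (eapply Rle_trans; [apply Cmod_ge_0|apply (Hc 0%nat)]).
  (* Half of the distance to the line [Re = 1]: after losing [d] to the weight, the exponent
     [Re w - d = 1 + d] is still summable. *)
  set (d := (Re w - 1) / 2). assert (hd : 0 < d) by (unfold d; lra).
  set (K := 48 / (d * d) + / d).
  assert (hK1 : 0 < 48 / (d * d)) by (apply Rdiv_lt_0_compat; nra).
  assert (hK2 : 0 < / d) by (apply Rinv_0_lt_compat; auto).
  apply (series_holo (fun n z => Dser c z n) (fun n => c n * (RtoC (- ln (ik n)) * cexp (w * RtoC (- ln (ik n)))))%C
    (fun n => K * B * Rpower (INR (S n)) (- (1 + d))) F w (d / 2)).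
  - lra.
  - apply ex_series_scalR, ex_series_Rpower. lra.
  - intros n. rewrite Cmod_mult.
    destruct (exp_remainder w w (- ln (ik n)) d hd) as [_ h].
    { replace (w - w)%C with (RtoC 0) by ring. rewrite Cmod_0. lra. }
    rewrite Rabs_Ropp, (Rabs_pos_eq (ln (ik n))) in h by apply ln_ik_pos.
    replace (Re w * - ln (ik n) + d * ln (ik n)) with (- (1 + d) * ln (ik n)) in h by (unfold d; field).
    rewrite Rpower_as_exp in h. unfold ik in *.
    pose proof (exp_pos (- (1 + d) * ln (INR (S n)))) as hp. fold (Rpower (INR (S n)) (- (1 + d))) in hp.
    apply Rle_trans with (B * (/ d * Rpower (INR (S n)) (- (1 + d)))).
    + apply Rmult_le_compat; auto; apply Cmod_ge_0.
    + unfold K. assert (0 <= 48 / (d * d) * B * Rpower (INR (S n)) (- (1 + d))) by (repeat apply Rmult_le_pos; lra).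
      lra.
  - intros n z hz.
    destruct (exp_remainder w z (- ln (ik n)) d hd) as [h _]; [lra|].
    rewrite Rabs_Ropp, (Rabs_pos_eq (ln (ik n))) in h by apply ln_ik_pos.
    replace (Re w * - ln (ik n) + d * ln (ik n)) with (- (1 + d) * ln (ik n)) in h by (unfold d; field).
    rewrite Rpower_as_exp in h.
    assert (Ed : forall z, Dser c z n = (c n * cexp (z * RtoC (- ln (ik n))))%C).
    { intros z'. unfold Dser, cpow, ik. rewrite RtoC_opp. do 2 f_equal. ring. }
    rewrite !Ed.
    replace (c n * cexp (z * RtoC (- ln (ik n))) - c n * cexp (w * RtoC (- ln (ik n))) - c n * (RtoC (- ln (ik n)) * cexp (w * RtoC (- ln (ik n)))) * (z - w))%C
      with (c n * (cexp (z * RtoC (- ln (ik n))) - cexp (w * RtoC (- ln (ik n))) - RtoC (- ln (ik n)) * cexp (w * RtoC (- ln (ik n))) * (z - w)))%C by ring.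
    rewrite Cmod_mult. unfold ik in *.
    pose proof (exp_pos (- (1 + d) * ln (INR (S n)))) as hp. fold (Rpower (INR (S n)) (- (1 + d))) in hp.
    pose proof (Cmod_ge_0 (z - w)) as hx.
    apply Rle_trans with (B * (48 / (d * d) * Rpower (INR (S n)) (- (1 + d)) * (Cmod (z - w) * Cmod (z - w)))).
    + apply Rmult_le_compat; auto; apply Cmod_ge_0.
    + unfold K. assert (0 <= / d * B * Rpower (INR (S n)) (- (1 + d)) * (Cmod (z - w) * Cmod (z - w))) by (repeat apply Rmult_le_pos; lra).
      lra.
  - intros z hz. apply HF. pose proof (re_le_Cmod (z - w)) as h. rewrite Re_minus in h.
    assert (h2 : Rabs (Re z - Re w) < d / 2) by lra. apply Rabs_def2 in h2. unfold d in *. lra.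
Qed.

(** * Mellin transforms of series of rational functions *)

Lemma dom_two (f : R -> C) (M d : R) : (forall t, rcont f t) -> 0 < d ->
  (forall u, u <= 0 -> Cmod (f u) <= M * exp (d * u)) -> (forall u, 0 <= u -> Cmod (f u) <= M * exp (- d * u)) -> dom M d f.
Proof.
  intros h1 h2 h3 h4. split; [|split]; auto. intros t. destruct (Rle_or_lt 0 t) as [h|h].
  - rewrite Rabs_pos_eq by auto. auto.
  - rewrite Rabs_left by auto. replace (- d * - t) with (d * t) by ring. apply h3. lra.
Qed.

(** The fundamental strip of a Mellin transform: order [v^a] at zero and [v^(-b)] at infinity. *)
Lemma Dom_two_sided (f : R -> C) (K a b : R) (s : C) : (forall t, rcont f t) ->
  (forall u, u <= 0 -> Cmod (f u) <= K * exp (a * u)) -> (forall u, 0 <= u -> Cmod (f u) <= K * exp (- b * u)) ->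
  - a < Re s < b -> Dom (fun u => f u * cexp (s * RtoC u))%C.
Proof.
  intros hc ha hb hs.
  assert (hK : 0 <= K).
  { specialize (ha 0 ltac:(lra)). rewrite Rmult_0_r, exp_0 in ha. pose proof (Cmod_ge_0 (f 0)). lra. }
  exists K, (Rmin (a + Re s) (b - Re s)).
  assert (hm : 0 < Rmin (a + Re s) (b - Re s)) by (apply Rmin_pos; lra).
  pose proof (Rmin_l (a + Re s) (b - Re s)). pose proof (Rmin_r (a + Re s) (b - Re s)).
  apply dom_two; auto.
  - intros t. apply rcont_mult; [auto|apply rcont_expi].
  - intros u hu. rewrite Cmod_mult, Cmod_cexp, Re_scalr.
    apply Rle_trans with (K * exp (a * u) * exp (Re s * u)); [apply Rmult_le_compat_r; [apply exp_ge0|auto]|].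
    rewrite Rmult_assoc, <- exp_plus. apply Rmult_le_compat_l; auto. apply exp_le. nra.
  - intros u hu. rewrite Cmod_mult, Cmod_cexp, Re_scalr.
    apply Rle_trans with (K * exp (- b * u) * exp (Re s * u)); [apply Rmult_le_compat_r; [apply exp_ge0|auto]|].
    rewrite Rmult_assoc, <- exp_plus. apply Rmult_le_compat_l; auto. apply exp_le. nra.
Qed.

(** With [y = (b / a) exp u] this is [y^p <= 1 + y^2] for [0 <= p <= 2]; the free exponent [p]
    distributes the decay between [a] and [u]. *)
Lemma rat_bound (a b p u : R) : 0 < a -> 0 < b -> 0 <= p <= 2 ->
  0 < / (a ^ 2 + b ^ 2 * exp (2 * u)) <= / a ^ 2 * Rpower (a / b) p * exp (- p * u).
Proof.
  intros ha hb hp. set (y := b / a * exp u).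
  assert (hy : 0 < y) by (unfold y; apply Rmult_lt_0_compat; [apply Rdiv_lt_0_compat; auto|apply exp_pos]).
  assert (E : a ^ 2 + b ^ 2 * exp (2 * u) = a ^ 2 * (1 + y ^ 2)).
  { unfold y. replace (2 * u) with (u + u) by ring. rewrite exp_plus. field. lra. }
  assert (Y : Rpower y p <= 1 + y ^ 2).
  { assert (0 < y ^ 2) by nra. destruct (Rle_or_lt y 1) as [h|h].
    - apply Rle_trans with 1; [|lra]. rewrite <- (Rpower_O y hy). apply Rnot_lt_le. intros k.
      assert (L : ln y <= 0) by (rewrite <- ln_1; destruct h as [h| ->]; [left; apply ln_increasing; auto|lra]).
      unfold Rpower in k. apply exp_lt_inv in k. nra.
    - apply Rle_trans with (Rpower y 2); [apply Rle_Rpower; lra|].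
      replace 2 with (INR 2) by (simpl; ring). rewrite Rpower_pow by auto. simpl. lra. }
  assert (hpow : 0 < Rpower y p) by apply exp_pos.
  assert (EP : Rpower (a / b) p * exp (- p * u) = / Rpower y p).
  { unfold y. rewrite <- Rpower_Ropp, <- Rpower_mult_distr by (try apply Rdiv_lt_0_compat; auto; apply exp_pos).
    f_equal.
    - replace (a / b) with (/ (b / a)) by (field; lra). unfold Rpower. rewrite ln_Rinv by (apply Rdiv_lt_0_compat; auto). f_equal. ring.
    - unfold Rpower. rewrite ln_exp. reflexivity. }
  rewrite Rmult_assoc, EP, E. split.
  - apply Rinv_0_lt_compat. apply Rmult_lt_0_compat; [nra|]. nra.
  - rewrite <- Rinv_mult. apply Rinv_le_contravar; [apply Rmult_lt_0_compat; [nra|auto]|].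
    apply Rmult_le_compat_l; [nra|auto].
Qed.

Lemma rcont_rat (a b : R) (s : C) (t : R) : 0 < a ->
  rcont (fun u => RtoC (/ (a ^ 2 + b ^ 2 * exp (2 * u))) * cexp (s * RtoC u))%C t.
Proof.
  intros ha. apply rcont_mult; [|apply rcont_expi]. apply rcont_RtoC.
  deriv_cont.
  pose proof (exp_pos (2 * t)). apply Rgt_not_eq. assert (0 < a ^ 2) by nra. assert (0 <= b ^ 2) by nra. simpl in *. nra.
Qed.

(** Using [rat_bound] with [p = Re nu + 1 - d] on the left half-line and [p = Re nu + 1 + d] on the
    right one leaves exactly decay of rate [d] on both. *)
Lemma rat_dom (a b d M : R) (nu : C) : 0 < a -> 0 < b -> 0 < d -> 0 <= Re nu + 1 - d -> Re nu + 1 + d <= 2 ->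
  / a ^ 2 * Rpower (a / b) (Re nu + 1 - d) <= M -> / a ^ 2 * Rpower (a / b) (Re nu + 1 + d) <= M ->
  dom M d (fun u => RtoC (/ (a ^ 2 + b ^ 2 * exp (2 * u))) * cexp ((nu + RtoC 1) * RtoC u))%C.
Proof.
  intros ha hb hd h1 h2 hM1 hM2. apply dom_two; auto.
  - intros t. apply rcont_rat; auto.
  - intros u hu. rewrite Cmod_mult, Cmod_cexp, Re_scalr, Re_plus, Re_RtoC, Cmod_R.
    destruct (rat_bound a b (Re nu + 1 - d) u ha hb ltac:(lra)) as [k1 k2]. rewrite Rabs_pos_eq by lra.
    apply Rle_trans with ((/ a ^ 2 * Rpower (a / b) (Re nu + 1 - d) * exp (- (Re nu + 1 - d) * u)) * exp ((Re nu + 1) * u)).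
    + apply Rmult_le_compat_r; [apply exp_ge0|auto].
    + rewrite Rmult_assoc, <- exp_plus. replace (- (Re nu + 1 - d) * u + (Re nu + 1) * u) with (d * u) by ring.
      apply Rmult_le_compat_r; [apply exp_ge0|auto].
  - intros u hu. rewrite Cmod_mult, Cmod_cexp, Re_scalr, Re_plus, Re_RtoC, Cmod_R.
    destruct (rat_bound a b (Re nu + 1 + d) u ha hb ltac:(lra)) as [k1 k2]. rewrite Rabs_pos_eq by lra.
    apply Rle_trans with ((/ a ^ 2 * Rpower (a / b) (Re nu + 1 + d) * exp (- (Re nu + 1 + d) * u)) * exp ((Re nu + 1) * u)).
    + apply Rmult_le_compat_r; [apply exp_ge0|auto].
    + rewrite Rmult_assoc, <- exp_plus. replace (- (Re nu + 1 + d) * u + (Re nu + 1) * u) with (- d * u) by ring.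
      apply Rmult_le_compat_r; [apply exp_ge0|auto].
Qed.

(** Each term is dominated with constant of order [k^(Re nu + d - 1 - m)], summable since
    [Re nu + d < m]. It serves for [A - A0] with [m = 1] and for [D] with [m = 0]. *)
Lemma rat_series (c : nat -> C) (B m b d : R) (nu : C) (F : R -> C) :
  1 <= b -> 0 < d -> 0 <= Re nu + 1 - d -> Re nu + 1 + d <= 2 -> Rabs (Re nu) < 1 -> Re nu + d < m ->
  (forall n, Cmod (c n) <= B * Rpower (ik n) (- m)) ->
  (forall t, rcont F t) ->
  (forall u, Cser (fun n => c n * (RtoC (/ (ik n ^ 2 + b ^ 2 * exp (2 * u))) * cexp ((nu + RtoC 1) * RtoC u)))%C (F u)) ->
  Dom F /\ Cser (fun n => c n * (RtoC (/ ik n ^ 2) * cpow (ik n / b) (nu + RtoC 1) * (RtoC (PI / 2) / ccos (hpi nu))))%C (intR F).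
Proof.
  intros hb hd h1 h2 hnu hm Hc HF HS.
  set (g := fun n u => (RtoC (/ (ik n ^ 2 + b ^ 2 * exp (2 * u))) * cexp ((nu + RtoC 1) * RtoC u))%C).
  set (e := Re nu + 1 + d).
  assert (Hd : forall n, dom (Rpower (ik n) (e - 2)) d (g n)).
  { intros n. pose proof (ik_ge1 n) as hn.
    assert (P : forall p, 0 <= p <= e -> / ik n ^ 2 * Rpower (ik n / b) p <= Rpower (ik n) (e - 2)).
    { intros p hp. unfold Rminus. rewrite Rpower_plus, Rmult_comm.
      replace (Rpower (ik n) (- (2))) with (/ ik n ^ 2) by (rewrite Rinv_pow_Rpower; f_equal; simpl; ring).
      apply Rmult_le_compat_r; [left; apply Rinv_0_lt_compat, pow_lt; lra|].
      apply Rle_trans with (Rpower (ik n) p); [|apply Rle_Rpower; lra].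
      apply Rle_Rpower_l; [lra|]. split; [apply Rdiv_lt_0_compat; lra|].
      apply Rmult_le_reg_r with b; [lra|]. unfold Rdiv. rewrite Rmult_assoc, Rinv_l by lra. nra. }
    apply rat_dom; try lra.
    - apply P. unfold e. lra.
    - apply P. unfold e. lra. }
  destruct (I_series (fun n u => c n * g n u)%C F (fun n => B * Rpower (ik n) (- (1 + (m - Re nu - d)))) d) as [D S].
  - intros n. assert (D := dom_scal _ _ (c n) _ (Hd n)). eapply dom_weaken; [exact D| |lra].
    apply Rle_trans with ((B * Rpower (ik n) (- m)) * Rpower (ik n) (e - 2)).
    + apply Rmult_le_compat_r; [apply exp_ge0|apply Hc].
    + rewrite Rmult_assoc, <- Rpower_plus. right. do 2 f_equal. unfold e. ring.
  - apply ex_series_scalR, ex_series_Rpower. lra.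
  - auto.
  - auto.
  - split; auto. eapply Cser_ext; [|exact S]. intros n. cbv beta.
    destruct (rat_mellin (ik n) b nu (ik_pos n) ltac:(lra) hnu) as [Dn In].
    rewrite I_scal by exact Dn. unfold g. rewrite In. reflexivity.
Qed.

(** * The functions A and D *)

(** The constant is the maximum of [p u - exp u], attained at [u = ln p]. *)
Lemma exp_exp_le (p u : R) : 0 < p -> exp (- exp u) <= exp (p * ln p - p) * exp (- p * u).
Proof.
  intros hp. rewrite <- exp_plus. apply exp_le.
  pose proof (exp_ineq1_le (u - ln p)) as h.
  replace (exp u) with (p * exp (u - ln p)).
  - nra.
  - unfold Rminus. rewrite exp_plus, exp_Ropp, exp_ln by auto. field. lra.
Qed.

Lemma Bf_pos (v : R) : 0 < v -> 0 < Bf v <= exp (- v) * (1 + / v).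
Proof.
  intros hv. unfold Bf. pose proof PI2_1 as hp.
  set (x := 2 * PI * v). assert (hx : v <= x) by (unfold x; nra).
  pose proof (exp_gt1 x ltac:(lra)) as h1. pose proof (exp_ineq1_le x) as h2.
  split; [apply Rinv_0_lt_compat; lra|].
  replace (/ (exp x - 1)) with (/ exp x * (1 + / (exp x - 1))) by (field; lra).
  apply Rmult_le_compat.
  - left. apply Rinv_0_lt_compat. lra.
  - assert (0 < / (exp x - 1)) by (apply Rinv_0_lt_compat; lra). lra.
  - rewrite exp_Ropp. apply Rinv_le_contravar; [apply exp_pos|apply exp_le; auto].
  - apply Rplus_le_compat_l. apply Rinv_le_contravar; lra.
Qed.

Lemma Bf_deriv (v : R) : 0 < v -> ex_derive Bf v.
Proof.
  intros hv. unfold Bf. auto_derive. pose proof PI_RGT_0.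
  assert (h : 1 < exp (2 * PI * v)) by (apply exp_gt1; nra). lra.
Qed.

Lemma rcont_Bf_exp (a c t : R) : 0 < a -> rcont (fun u => RtoC (Bf (a * exp (c * u)))) t.
Proof.
  intros ha. apply rcont_RtoC. apply (continuous_comp (fun u => a * exp (c * u)) Bf).
  - deriv_cont. trivial.
  - apply (@ex_derive_continuous R_AbsRing R_NormedModule). apply Bf_deriv.
    apply Rmult_lt_0_compat; [auto|apply exp_pos].
Qed.

Section AFacts.
Variables (q : nat) (chi : Z -> C).
Hypothesis Hprim : primitive_char q chi.
Hypothesis Hodd : odd_char chi.

Let chib := conj_char chi.
Let Hd : dirichlet_char q chi := proj1 Hprim.
Let Hdb : dirichlet_char q chib := conj_char_dirichlet q chi (proj1 Hprim).
Let A := Afun q chi.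
Let hq : 0 < INR q := INRq_pos q chi Hd.

(** Advancing by a full period multiplies the terms by [E], so [(1 - E)] times the series is a
    finite sum over one period. Averaging it with its image under [h -> q - h], which changes the
    sign of [chib], turns exponentials into hyperbolic sines. *)
Lemma Af_series (v : R) : 0 < v ->
  Cser (fun n => chib (Z.of_nat (S n)) * RtoC (exp (- (2 * PI * v) * ik n)))%C (A v).
Proof.
  intros hv. pose proof PI_RGT_0 as hpi. pose proof (char_q q chi Hd) as hq1.
  set (a := fun n => (chib (Z.of_nat (S n)) * RtoC (exp (- (2 * PI * v) * ik n)))%C).
  assert (EX : exists S : C, Cser a S).
  { apply (Cser_dominated a (fun n => exp (- (2 * PI * v) * ik n))); [|eexists; apply Bf_series; auto].
    intros n. unfold a. rewrite Cmod_mult, Cmod_RtoC_pos by (apply exp_ge0).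
    pose proof (char_le1 q chib Hdb (Z.of_nat (S n))). pose proof (exp_pos (- (2 * PI * v) * ik n)). nra. }
  destruct EX as [S HS].
  set (E := exp (- (2 * PI * v) * INR q)).
  assert (P : forall n, a (q + n)%nat = (RtoC E * a n)%C).
  { intros n. unfold a, E. replace (Z.of_nat (Datatypes.S (q + n))) with (Z.of_nat (Datatypes.S n) + 1 * Z.of_nat q)%Z by lia.
    rewrite (char_period q chib Hdb). unfold ik. rewrite !S_INR, plus_INR.
    replace (- (2 * PI * v) * (INR q + INR n + 1)) with (- (2 * PI * v) * INR q + - (2 * PI * v) * (INR n + 1)) by ring.
    rewrite exp_plus, RtoC_mult. ring. }
  assert (SH : Cser (fun n => a (q + n)%nat) (S - Csum a 0 (pred q))%C).
  { assert (H := @is_series_incr_n C_AbsRing C_NormedModule a q (S - Csum a 0 (pred q))%C ltac:(lia)).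
    apply H. change (Cser a ((S - Csum a 0 (pred q)) + Csum a 0 (pred q))%C).
    replace ((S - Csum a 0 (pred q)) + Csum a 0 (pred q))%C with S by ring. exact HS. }
  assert (EQ : (S - Csum a 0 (pred q))%C = (RtoC E * S)%C).
  { apply (Cser_unique (fun n => a (q + n)%nat)); auto. apply (Cser_ext (fun n => RtoC E * a n)%C); [intros; symmetry; apply P|].
    apply Cser_scal; auto. }
  assert (hE : 0 < E < 1).
  { split; [apply exp_pos|]. unfold E. rewrite <- exp_0. apply exp_increasing.
    assert (0 < 2 * PI * v * INR q) by (apply Rmult_lt_0_compat; [nra|auto]). lra. }
  assert (T : Csum a 0 (pred q) = Csum (fun h => chib (Z.of_nat h) * RtoC (exp (- (2 * PI * v) * INR h)))%C 1 q).
  { replace q with (Datatypes.S (pred q)) at 2 by lia. rewrite <- Csum_shift. reflexivity. }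
  (* The residue is put into the exponent to make [F] periodic. At [h = q] it is 0 instead of [q],
     harmless since [chib] vanishes there. *)
  set (F := fun m => (chib m * RtoC (exp (- (2 * PI * v) * IZR (m mod Z.of_nat q))))%C).
  assert (HF : zperiodic q F).
  { intros m k. unfold F. rewrite (char_period q chib Hdb), Z_mod_plus_full. reflexivity. }
  assert (cq : chib (Z.of_nat q) = RtoC 0).
  { unfold chib, conj_char. rewrite (char_qz q chi Hprim Hodd). apply C_eq; simpl; ring. }
  assert (T1 : Csum (fun h => F (Z.of_nat h)) 1 q = Csum (fun h => chib (Z.of_nat h) * RtoC (exp (- (2 * PI * v) * INR h)))%C 1 q).
  { apply Csum_ext. intros h hh. unfold F. destruct (Nat.eq_dec h q) as [->|hn].
    - rewrite cq. ring.
    - rewrite Z.mod_small by lia. rewrite <- INR_IZR_INZ. reflexivity. }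
  assert (T2 : Csum (fun h => F (Z.of_nat h)) 1 q = Csum (fun h => chib (Z.of_nat h) * RtoC (- exp (- (2 * PI * v) * (INR q - INR h))))%C 1 q).
  { rewrite <- (Csum_reindex q chi Hd F (-1) HF (gcd_m1 q)). apply Csum_ext. intros h hh. unfold F.
    replace (-1 * Z.of_nat h)%Z with (- Z.of_nat h)%Z by lia.
    replace (chib (- Z.of_nat h)%Z) with (- chib (Z.of_nat h))%C
      by (unfold chib, conj_char; rewrite (char_neg q chi Hprim Hodd); apply C_eq; simpl; ring).
    destruct (Nat.eq_dec h q) as [->|hn].
    - rewrite cq. ring.
    - replace ((- Z.of_nat h) mod Z.of_nat q)%Z with (Z.of_nat q - Z.of_nat h)%Z.
      + rewrite minus_IZR, <- !INR_IZR_INZ, RtoC_opp. ring.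
      + apply Z.mod_unique with (q := (-1)%Z); lia. }
  assert (hs : 0 < sinh (PI * v * INR q)) by (apply sinh_pos; apply Rmult_lt_0_compat; nra).
  assert (U : (RtoC (1 - E) * A v)%C = Csum a 0 (pred q)).
  { rewrite T. unfold A, Afun. fold chib.
    transitivity (RtoC (1/2) * (Csum (fun h => F (Z.of_nat h)) 1 q + Csum (fun h => F (Z.of_nat h)) 1 q))%C.
    - rewrite T1 at 1. rewrite T2, <- Csum_plus, <- !Csum_scal.  apply Csum_ext. intros h _.
      match goal with |- (RtoC ?k * (RtoC ?c * (?x * RtoC ?d)))%C = (RtoC ?c * (?x * RtoC ?a + ?x * RtoC ?b))%C =>
        assert (Er : k * d = a + b);
        [|transitivity (RtoC c * x * RtoC (k * d))%C; [rewrite RtoC_mult; ring|rewrite Er, RtoC_plus; ring]] end.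
      unfold E. unfold sinh in *.
      replace (- (2 * PI * v) * INR q) with (- (PI * v * INR q) + - (PI * v * INR q)) by ring.
      replace (PI * v * (INR q - 2 * INR h)) with (PI * v * INR q + (- (2 * PI * v) * INR h)) by ring.
      replace (- (PI * v * INR q + - (2 * PI * v) * INR h)) with (- (PI * v * INR q) + - (- (2 * PI * v) * INR h)) by ring.
      replace (- (2 * PI * v) * (INR q - INR h)) with (- (PI * v * INR q) + (- (PI * v * INR q) + - (- (2 * PI * v) * INR h))) by ring.
      rewrite !exp_plus, !exp_Ropp in *.
      pose proof (exp_pos (PI * v * INR q)). pose proof (exp_pos (- (2 * PI * v) * INR h)).
      set (X := exp (PI * v * INR q)) in *. set (Y := exp (- (2 * PI * v) * INR h)) in *.
      assert (X - / X <> 0) by lra.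
      assert (X * X - 1 <> 0).
      { intros e. apply H1. replace (X - / X) with ((X * X - 1) / X) by (field; lra). rewrite e. unfold Rdiv. ring. }
      field. repeat split; try lra.
    - rewrite <- T1. replace (RtoC (1/2)) with (/ RtoC 2)%C by (rewrite <- RtoC_inv by lra; f_equal; field).
      replace (RtoC 2) with (1 + 1)%C by (rewrite <- RtoC_plus; f_equal; ring).
      field. }
  assert (n1 : RtoC (1 - E) <> RtoC 0) by (apply RtoC_neq0; lra).
  replace (A v) with S; auto.
  replace S with (/ RtoC (1 - E) * (RtoC (1 - E) * S))%C by (field; auto).
  replace (RtoC (1 - E) * S)%C with (RtoC (1 - E) * A v)%C; [field; auto|].
  rewrite U. replace (Csum a 0 (pred q)) with (S - (S - Csum a 0 (pred q)))%C by ring. rewrite EQ, RtoC_minus. ring.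
Qed.

Lemma rcont_Csum (f : nat -> R -> C) (n : nat) (t : R) : (forall k, rcont (f k) t) ->
  rcont (fun u => Csum (fun k => f k u) 1 n) t.
Proof.
  intros H. induction n as [|n IH].
  - eapply rcont_ext; [|apply (rcont_const (RtoC 0))]. intros. rewrite Csum_0 by lia. reflexivity.
  - eapply rcont_ext; [|apply (rcont_plus _ _ _ IH (H (S n)))]. intros. simpl. rewrite Csum_Sm by lia. reflexivity.
Qed.

Lemma rcont_A (t : R) : rcont (fun u => A (exp u)) t.
Proof.
  unfold A, Afun. apply rcont_mult; [apply rcont_const|]. apply rcont_Csum. intros h.
  apply rcont_mult; [apply rcont_const|]. apply rcont_RtoC.
  apply (@ex_derive_continuous R_AbsRing R_NormedModule). unfold sinh. auto_derive.
  pose proof PI_RGT_0. pose proof (exp_pos t).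
  assert (hs : 0 < sinh (PI * exp t * INR q)) by (apply sinh_pos; apply Rmult_lt_0_compat; [nra|auto]).
  unfold sinh in hs. lra.
Qed.

Let KA := Cmod (kap q chi) * INR q ^ 2 * Series (fun n => / ik n ^ 2).

Lemma KA_pos : 0 <= KA.
Proof.
  unfold KA. apply Rmult_le_pos; [apply Rmult_le_pos; [apply Cmod_ge_0|nra]|].
  pose proof (Df_bounds 1 ltac:(lra)) as [h1 h2]. pose proof PI_RGT_0.
  assert (0 < 1 / PI) by (apply Rdiv_lt_0_compat; lra). nra.
Qed.

Lemma A_sub_A0 (v : R) : 0 < v -> Cmod (A v - A0 q chi) <= KA * v ^ 2.
Proof.
  intros hv. assert (H := Afun_partial_fractions q chi Hprim Hodd v hv). fold A in H.
  set (S := ((A0 q chi - A v) / (kap q chi * RtoC ((INR q * v) ^ 2)))%C) in *.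
  assert (nk := kap_neq0 q chi Hprim Hodd).
  assert (hV : 0 < (INR q * v) ^ 2) by (apply pow_lt; nra).
  assert (E : (A v - A0 q chi)%C = (- (kap q chi * RtoC ((INR q * v) ^ 2) * S))%C).
  { unfold S. field. split; [apply RtoC_neq0; lra|auto]. }
  rewrite E, Cmod_opp, !Cmod_mult, (Cmod_RtoC_pos ((INR q * v) ^ 2)) by lra.
  assert (B : Cmod S <= Series (fun n => / ik n ^ 2)).
  { eapply Cser_Cmod_le; [|exact H|apply Series_correct, ex_series_inv_sqr].
    intros n. pose proof (ik_ge1 n) as hn. cbv beta. rewrite Cmod_mult.
    assert (hden : 0 < ik n * (ik n ^ 2 + (INR q * v) ^ 2)) by (apply Rmult_lt_0_compat; nra).
    rewrite Cmod_RtoC_pos by (left; apply Rinv_0_lt_compat; auto).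
    pose proof (char_le1 q chi Hd (Z.of_nat (Datatypes.S n))).
    assert (/ (ik n * (ik n ^ 2 + (INR q * v) ^ 2)) <= / ik n ^ 2) by (apply Rinv_le_contravar; nra).
    assert (0 < / (ik n * (ik n ^ 2 + (INR q * v) ^ 2))) by (apply Rinv_0_lt_compat; auto).
    pose proof (Cmod_ge_0 (chi (Z.of_nat (Datatypes.S n)))). nra. }
  unfold KA. rewrite Rpow_mult_distr.
  replace (Cmod (kap q chi) * INR q ^ 2 * Series (fun n => / ik n ^ 2) * v ^ 2) with
    (Cmod (kap q chi) * (INR q ^ 2 * v ^ 2) * Series (fun n => / ik n ^ 2)) by ring.
  apply Rmult_le_compat_l; [|auto]. apply Rmult_le_pos; [apply Cmod_ge_0|nra].
Qed.

Lemma A_Bf (v : R) : 0 < v -> Cmod (A v) <= Bf v.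
Proof.
  intros hv. eapply Cser_Cmod_le; [|apply (Af_series v hv)|apply (Bf_series v hv)].
  intros n. cbv beta. rewrite Cmod_mult, Cmod_RtoC_pos by (apply exp_ge0).
  pose proof (char_le1 q chib Hdb (Z.of_nat (S n))). pose proof (exp_pos (- (2 * PI * v) * ik n)). nra.
Qed.

(** For [v <= 1] the estimate comes from [A_sub_A0], as the majorant [Bf] blows up at zero; for
    [v > 1] it comes from [Bf]. Boundedness of [A] at zero is the effect of [chi] being odd and
    primitive. *)
Lemma A_bound : exists K, forall v, 0 < v -> Cmod (A v) <= K * exp (- v).
Proof.
  exists (2 + (Cmod (A0 q chi) + KA) * exp 1). intros v hv. pose proof KA_pos as hK. pose proof (Cmod_ge_0 (A0 q chi)) as h0.
  pose proof (exp_pos (- v)) as he. pose proof (exp_pos 1) as he1.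
  destruct (Rle_or_lt v 1) as [h|h].
  - assert (B : Cmod (A v) <= Cmod (A0 q chi) + KA).
    { replace (A v) with ((A v - A0 q chi) + A0 q chi)%C by ring. eapply Rle_trans; [apply Cmod_triangle|].
      pose proof (A_sub_A0 v hv). assert (v ^ 2 <= 1) by nra. nra. }
    assert (1 <= exp 1 * exp (- v)) by (rewrite <- exp_plus; pose proof (exp_ineq1_le (1 + - v)); lra).
    nra.
  - pose proof (A_Bf v hv). destruct (Bf_pos v hv) as [b1 b2].
    assert (/ v <= 1) by (rewrite <- Rinv_1; apply Rinv_le_contravar; lra).
    assert (0 <= (Cmod (A0 q chi) + KA) * exp 1) by nra. nra.
Qed.

Lemma A_powers (p : R) : 0 < p -> exists K, forall u,
  Cmod (A (exp u)) <= K /\ Cmod (A (exp u)) <= K * exp (- p * u).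
Proof.
  intros hp. destruct A_bound as [K HK].
  assert (hK : 0 <= K).
  { specialize (HK 1 ltac:(lra)). pose proof (Cmod_ge_0 (A 1)). pose proof (exp_pos (- (1))). nra. }
  exists (K + K * exp (p * ln p - p)). intros u. specialize (HK (exp u) (exp_pos u)).
  pose proof (exp_pos (p * ln p - p)). pose proof (exp_exp_le p u hp).
  assert (exp (- exp u) <= 1) by (rewrite <- exp_0; apply exp_le; pose proof (exp_pos u); lra).
  pose proof (exp_pos (- p * u)). split; [nra|].
  eapply Rle_trans; [exact HK|]. apply Rle_trans with (K * (exp (p * ln p - p) * exp (- p * u))); [apply Rmult_le_compat_l; auto|].
  assert (0 <= K * exp (- p * u)) by nra. nra.
Qed.

Lemma Dom_A (s : C) : 0 < Re s -> Dom (fun u => A (exp u) * cexp (s * RtoC u))%C.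
Proof.
  intros hs. destruct (A_powers (Re s + 1) ltac:(lra)) as [K HK].
  apply (Dom_two_sided (fun u => A (exp u)) K 0 (Re s + 1)); [apply rcont_A| | |lra].
  - intros u _. rewrite Rmult_0_l, exp_0, Rmult_1_r. apply HK.
  - intros u _. apply HK.
Qed.

Lemma Dom_A_sub (s : C) : -2 < Re s < 0 -> Dom (fun u => (A (exp u) - A0 q chi) * cexp (s * RtoC u))%C.
Proof.
  intros hs. destruct (A_powers 1 ltac:(lra)) as [K HK]. pose proof KA_pos as hKA. pose proof (Cmod_ge_0 (A0 q chi)) as h0.
  assert (hK : 0 <= K) by (specialize (HK 0); pose proof (Cmod_ge_0 (A (exp 0))); lra).
  apply (Dom_two_sided (fun u => A (exp u) - A0 q chi)%C (K + Cmod (A0 q chi) + KA) 2 0).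
  - intros t. apply rcont_minus; [apply rcont_A|apply rcont_const].
  - intros u _. pose proof (A_sub_A0 (exp u) (exp_pos u)) as h. 
    replace (exp u ^ 2) with (exp (2 * u)) in h by (simpl; rewrite Rmult_1_r, <- exp_plus; f_equal; ring).
    pose proof (exp_pos (2 * u)). nra.
  - intros u _. rewrite Ropp_0, Rmult_0_l, exp_0, Rmult_1_r. eapply Rle_trans; [apply Cmod_triangle_sub|].
    destruct (HK u). lra.
  - lra.
Qed.

(** [A - A0 / (1 + v^2)] is of order [v^2] at both ends in the respective sense, so its Mellin strip
    [(-2, 2)] overlaps those of [A - A0] and of [A], whose transforms differ from it by an
    elementary term. *)
Definition Areg (u : R) : C := (A (exp u) - A0 q chi * RtoC (/ (1 ^ 2 + 1 ^ 2 * exp (2 * u))))%C.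

Lemma Dom_Areg (s : C) : -2 < Re s < 2 -> Dom (fun u => Areg u * cexp (s * RtoC u))%C.
Proof.
  intros hs. destruct (A_powers 2 ltac:(lra)) as [K HK]. pose proof KA_pos as hKA. pose proof (Cmod_ge_0 (A0 q chi)) as h0.
  assert (hK : 0 <= K) by (specialize (HK 0); pose proof (Cmod_ge_0 (A (exp 0))); lra).
  apply (Dom_two_sided Areg (K + Cmod (A0 q chi) + KA) 2 2); [| | |lra].
  - intros t. unfold Areg. apply rcont_minus; [apply rcont_A|]. apply rcont_mult; [apply rcont_const|].
    apply rcont_RtoC. deriv_cont.
    pose proof (exp_pos (2 * t)). lra.
  - intros u _. pose proof (A_sub_A0 (exp u) (exp_pos u)) as h. pose proof (exp_pos (2 * u)) as he.
    replace (exp u ^ 2) with (exp (2 * u)) in h by (simpl; rewrite Rmult_1_r, <- exp_plus; f_equal; ring).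
    unfold Areg. replace (A (exp u) - A0 q chi * RtoC (/ (1 ^ 2 + 1 ^ 2 * exp (2 * u))))%C with
      ((A (exp u) - A0 q chi) + A0 q chi * RtoC (1 - / (1 ^ 2 + 1 ^ 2 * exp (2 * u))))%C by (rewrite RtoC_minus; ring).
    eapply Rle_trans; [apply Cmod_triangle|]. rewrite Cmod_mult, Cmod_R.
    replace (1 - / (1 ^ 2 + 1 ^ 2 * exp (2 * u))) with (exp (2 * u) * / (1 + exp (2 * u))) by (field; lra).
    assert (0 < / (1 + exp (2 * u)) <= 1) by (split; [apply Rinv_0_lt_compat; lra|rewrite <- Rinv_1; apply Rinv_le_contravar; lra]).
    rewrite Rabs_pos_eq by nra. assert (exp (2 * u) * / (1 + exp (2 * u)) <= exp (2 * u)) by nra. nra.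
  - intros u _. unfold Areg. eapply Rle_trans; [apply Cmod_triangle_sub|]. rewrite Cmod_mult, Cmod_R.
    destruct (HK u) as [_ h]. pose proof (exp_pos (2 * u)) as he. pose proof (exp_pos (-2 * u)) as he'.
    assert (hb : 0 < / (1 ^ 2 + 1 ^ 2 * exp (2 * u)) <= exp (-2 * u)).
    { split; [apply Rinv_0_lt_compat; lra|]. replace (-2 * u) with (- (2 * u)) by ring. rewrite exp_Ropp. apply Rinv_le_contravar; lra. }
    rewrite Rabs_pos_eq by lra. replace (- (2) * u) with (-2 * u) in * by ring. nra.
Qed.

End AFacts.

(** * Existence and uniqueness of the analytic continuations *)

Lemma holo_ext_re (f g : C -> C) (a b : R) (z : C) : a < Re z < b ->
  (forall w, a < Re w < b -> g w = f w) -> holo_at f z -> holo_at g z.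
Proof.
  intros hz E. apply (holo_ext_loc f g z (Rmin (Re z - a) (b - Re z))); [apply Rmin_pos; lra|].
  intros w hw. apply E. pose proof (Rmin_l (Re z - a) (b - Re z)). pose proof (Rmin_r (Re z - a) (b - Re z)).
  pose proof (re_le_Cmod (w - z)) as h. rewrite Re_minus in h.
  assert (h2 : Rabs (Re w - Re z) < Rmin (Re z - a) (b - Re z)) by lra. apply Rabs_def2 in h2. lra.
Qed.

(** Three functions on overlapping vertical regions; [P] allows the middle one to have a pole,
    needed for [zeta] but not for [Lfun]. *)
Lemma holo_glue3 (P : C -> Prop) (f1 f2 f3 : C -> C) (a1 b1 a2 b2 : R) : a1 < b1 -> b1 <= a2 -> a2 < b2 ->
  (forall z, Re z < b1 -> holo_at f1 z) -> (forall z, P z -> a1 < Re z < b2 -> holo_at f2 z) ->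
  (forall z, a2 < Re z -> holo_at f3 z) ->
  (forall z, a1 < Re z < b1 -> f1 z = f2 z) -> (forall z, a2 < Re z < b2 -> f2 z = f3 z) ->
  exists h, (forall z, P z -> holo_at h z) /\ (forall z, Re z < b1 -> h z = f1 z) /\
    (forall z, a1 < Re z < b2 -> h z = f2 z).
Proof.
  intros h1 h2 h3 H1 H2 H3 E1 E2.
  set (h := fun z => if Rlt_dec (Re z) b1 then f1 z else if Rlt_dec a2 (Re z) then f3 z else f2 z).
  assert (A1 : forall z, Re z < b1 -> h z = f1 z) by (intros z hz; unfold h; destruct Rlt_dec; auto; lra).
  assert (A2 : forall z, a1 < Re z < b2 -> h z = f2 z).
  { intros z hz. unfold h. destruct Rlt_dec; [apply E1; lra|]. destruct Rlt_dec; auto. symmetry. apply E2. lra. }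
  assert (A3 : forall z, a2 < Re z -> h z = f3 z).
  { intros z hz. unfold h. destruct Rlt_dec; [lra|]. destruct Rlt_dec; auto. lra. }
  exists h. split; [|split]; auto. intros z Pz.
  destruct (Rlt_dec (Re z) b1); [|destruct (Rlt_dec a2 (Re z))].
  - apply (holo_ext_re f1 h (Re z - 1) b1); [lra| |auto]. intros. apply A1. lra.
  - apply (holo_ext_re f3 h a2 (Re z + 1)); [lra| |auto]. intros. apply A3. lra.
  - apply (holo_ext_re f2 h a1 b2); [lra|auto|]. apply H2; auto. lra.
Qed.

(** Makes the sum a total function, so that it can be differentiated in a parameter; it is arbitrary
    for a divergent series. *)
Definition Cval (a : nat -> C) : C := epsilon (inhabits (RtoC 0)) (Cser a).

Lemma Cval_spec (a : nat -> C) : (exists l, Cser a l) -> Cser a (Cval a).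
Proof. apply epsilon_spec. Qed.

Lemma Dser_val_holo (c : nat -> C) (B : R) (s : C) : (forall n, Cmod (c n) <= B) -> Re s < 0 ->
  holo_at (fun s => Cval (Dser c (RtoC 1 - s))) s.
Proof.
  intros Hc hs. apply (holo_comp (fun s => RtoC 1 - s)%C (fun w => Cval (Dser c w))); [holo|].
  apply (Dser_holo c B); auto.
  - rewrite Re_minus, Re_RtoC. lra.
  - intros z hz. apply Cval_spec. apply (Dser_cv c B); auto.
Qed.

(** Integrability and value in one predicate, so that a linear combination of known transforms is a
    single term and [HI_unique] compares two evaluations of one integral. *)
Definition HI (f : R -> C) (l : C) : Prop := Dom f /\ intR f = l.

Lemma HI_I (f : R -> C) : Dom f -> HI f (intR f).
Proof. split; auto. Qed.
Lemma HI_unique (f : R -> C) (l m : C) : HI f l -> HI f m -> l = m.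
Proof. intros [_ <-] [_ <-]. reflexivity. Qed.
Lemma HI_ext (f g : R -> C) (l m : C) : (forall t, f t = g t) -> l = m -> HI f l -> HI g m.
Proof. intros E <- [D <-]. split; [eapply Dom_ext; eauto|]. symmetry. apply I_ext; auto. Qed.
Lemma HI_plus (f g : R -> C) (l m : C) : HI f l -> HI g m -> HI (fun t => f t + g t)%C (l + m)%C.
Proof. intros [D <-] [D' <-]. split; [apply Dom_plus; auto|apply I_plus; auto]. Qed.
Lemma HI_minus (f g : R -> C) (l m : C) : HI f l -> HI g m -> HI (fun t => f t - g t)%C (l - m)%C.
Proof. intros [D <-] [D' <-]. split; [apply Dom_minus; auto|apply I_minus; auto]. Qed.
Lemma HI_scal (c : C) (f : R -> C) (l : C) : HI f l -> HI (fun t => c * f t)%C (c * l)%C.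
Proof. intros [D <-]. split; [apply Dom_scal; auto|apply I_scal; auto]. Qed.

Definition rat1 (u : R) : R := / (1 ^ 2 + 1 ^ 2 * exp (2 * u)).

Lemma rat1_mellin (nu : C) : Rabs (Re nu) < 1 ->
  HI (fun u => RtoC (rat1 u) * cexp ((nu + RtoC 1) * RtoC u))%C (RtoC (PI / 2) / ccos (hpi nu))%C.
Proof.
  intros hnu. destruct (rat_mellin 1 1 nu ltac:(lra) ltac:(lra) hnu) as [D E]. split; [exact D|].
  unfold rat1. rewrite E. replace (1 / 1) with 1 by field. rewrite cpow_1.
  replace (/ 1 ^ 2) with 1 by field. ring.
Qed.

Lemma rat1_compl (u : R) : 1 - rat1 u = exp (2 * u) * rat1 u.
Proof. unfold rat1. pose proof (exp_pos (2 * u)). field. lra. Qed.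

Lemma cexp_shift (s : C) (k u : R) : cexp ((s + RtoC k) * RtoC u) = (RtoC (exp (k * u)) * cexp (s * RtoC u))%C.
Proof.
  rewrite <- cexp_RtoC, <- cexp_plus. f_equal. rewrite RtoC_mult. ring.
Qed.

(** * Continuation of the [L]-function of an odd primitive character *)

Section LExists.
Variables (q : nat) (chi : Z -> C).
Hypothesis Hprim : primitive_char q chi.
Hypothesis Hodd : odd_char chi.

Let Hd : dirichlet_char q chi := proj1 Hprim.
Let hq : 0 < INR q := INRq_pos q chi Hd.
Let c (n : nat) : C := chi (Z.of_nat (S n)).
Let hc : forall n, Cmod (c n) <= 1 := fun n => char_le1 q chi Hd (Z.of_nat (S n)).
Let pre (s : C) : C := (RtoC (2 / PI) / kap q chi * cpow (INR q) s)%C.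
(** A formula for [L(1 - s, chi)] in [-2 < Re s < 2]. The term [A0 * PI/2] is what the subtracted
    rational function contributes after its cosecant is multiplied by [csin (hpi s)]; at [s = 0] it
    alone survives and gives the value at 1. *)
Let f2 (s : C) : C := (pre s * (csin (hpi s) * mel (Areg q chi) s + A0 q chi * RtoC (PI / 2)))%C.

(** Termwise integration of the partial fraction expansion of [A - A0]. *)
Lemma A_sub_mellin (s : C) : -2 < Re s < 0 ->
  Cser (Dser c (RtoC 1 - s)) (pre s * (csin (hpi s) * intR (fun u => (Afun q chi (exp u) - A0 q chi) * cexp (s * RtoC u))))%C.
Proof.
  intros hs. pose proof (kap_neq0 q chi Hprim Hodd) as nk. pose proof PI_RGT_0 as hpi0.
  assert (hqq : 1 <= INR q) by (apply (le_INR 1); apply (char_q q chi Hd)).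
  assert (ns : csin (hpi s) <> RtoC 0) by (apply csin_hpi_neq0; [lra|intros e; rewrite e, Re_RtoC in hs; lra]).
  set (d := Rmin (Re s + 2) (- Re s) / 2).
  assert (hd : 0 < d) by (unfold d; pose proof (Rmin_pos (Re s + 2) (- Re s)); lra).
  pose proof (Rmin_l (Re s + 2) (- Re s)). pose proof (Rmin_r (Re s + 2) (- Re s)).
  destruct (rat_series (fun n => - kap q chi * RtoC (INR q ^ 2) * c n * RtoC (/ ik n))%C (Cmod (kap q chi) * INR q ^ 2) 1 (INR q) d
    (s + RtoC 1)%C (fun u => (Afun q chi (exp u) - A0 q chi) * cexp (s * RtoC u))%C) as [D S];
    try (rewrite Re_plus, Re_RtoC; unfold d in *; lra); auto.
  - rewrite Re_plus, Re_RtoC. apply Rabs_def1; lra.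
  - intros n. pose proof (ik_pos n) as hn.
    rewrite !Cmod_mult, Cmod_opp, !Cmod_RtoC_pos by (try (left; apply Rinv_0_lt_compat; auto); nra).
    replace (Rpower (ik n) (- (1))) with (/ ik n) by (rewrite Rpower_Ropp, Rpower_1; auto).
    apply Rmult_le_compat_r; [left; apply Rinv_0_lt_compat; auto|].
    rewrite <- (Rmult_1_r (Cmod (kap q chi) * INR q ^ 2)) at 2. apply Rmult_le_compat_l; [|apply hc].
    apply Rmult_le_pos; [apply Cmod_ge_0|nra].
  - intros t. apply rcont_mult; [|apply rcont_expi]. apply rcont_minus; [apply (rcont_A q chi Hprim)|apply rcont_const].
  - intros u. pose proof (exp_pos u) as hu.
    assert (P := Afun_partial_fractions q chi Hprim Hodd (exp u) hu).
    assert (nV : RtoC ((INR q * exp u) ^ 2) <> RtoC 0) by (apply RtoC_neq0; apply pow_nonzero; apply Rgt_not_eq; nra).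
    apply (Cser_scal (- kap q chi * RtoC ((INR q * exp u) ^ 2) * cexp (s * RtoC u))%C) in P.
    replace (- kap q chi * RtoC ((INR q * exp u) ^ 2) * cexp (s * RtoC u) * ((A0 q chi - Afun q chi (exp u)) / (kap q chi * RtoC ((INR q * exp u) ^ 2))))%C
      with ((Afun q chi (exp u) - A0 q chi) * cexp (s * RtoC u))%C in P by (field; split; auto).
    eapply Cser_ext; [|exact P]. intros n. cbv beta. unfold c.
    replace (s + RtoC 1 + RtoC 1)%C with (s + RtoC 2)%C by (rewrite <- Cplus_assoc, <- RtoC_plus; do 2 f_equal; ring).
    rewrite cexp_shift. pose proof (ik_pos n) as hn.
    replace (exp (2 * u)) with (exp u ^ 2) by (simpl; rewrite Rmult_1_r, <- exp_plus; f_equal; ring).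
    assert (0 < ik n ^ 2 + INR q ^ 2 * exp u ^ 2) by (assert (0 < ik n ^ 2) by nra; assert (0 <= INR q ^ 2 * exp u ^ 2) by nra; lra).
    match goal with |- (_ * RtoC ?a * ?e * (?x * RtoC ?b))%C = (?k * RtoC ?a' * ?x * RtoC ?b' * (RtoC ?c' * (RtoC ?d' * ?e)))%C =>
      assert (Er : a * b = a' * b' * (c' * d'));
      [|transitivity (k * x * e * RtoC (a * b))%C; [rewrite RtoC_mult; ring|rewrite Er, !RtoC_mult; ring]] end.
    rewrite Rpow_mult_distr. field. split; lra.
  - apply (Cser_scal (pre s * csin (hpi s))%C) in S. rewrite <- Cmult_assoc in S.
    eapply Cser_ext; [|exact S]. intros n. pose proof (ik_pos n) as hn. cbv beta. unfold Dser, pre.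
    change (INR (Datatypes.S n)) with (ik n). rewrite cpow_div by auto.
    replace (s + RtoC 1 + RtoC 1)%C with (s + RtoC (INR 2))%C by (simpl; rewrite <- Cplus_assoc, <- RtoC_plus; do 2 f_equal; ring).
    replace (- (RtoC 1 - s))%C with (s - RtoC 1)%C by ring.
    rewrite cpow_minus, !cpow_plus, !cpow_INR, cpow_one, ccos_hpi_plus1 by auto.
    pose proof (cpow_neq0 (INR q) s). unfold Rdiv. rewrite !RtoC_mult, !RtoC_inv by (try apply pow_nonzero; lra).
    assert (RtoC PI <> RtoC 0) by (apply RtoC_neq0; lra).
    assert (RtoC (ik n) <> RtoC 0) by (apply RtoC_neq0; lra).
    assert (RtoC (ik n ^ 2) <> RtoC 0) by (apply RtoC_neq0, pow_nonzero; lra).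
    assert (RtoC (INR q ^ 2) <> RtoC 0) by (apply RtoC_neq0, pow_nonzero; lra).
    pose proof C2_neq0. field. repeat split; auto.
Qed.

(** The functional equation serves as definition. In the variable [s], with argument [1 - s], three
    expressions are glued: the Dirichlet series for [Re s < 0], [f2] in the middle, and the Mellin
    transform of [A] for [Re s > 0]; the final function is composed with [1 - w]. *)
Lemma Lfun_exists : exists h, is_Lfun chi h /\ h (RtoC 1) = (A0 q chi / kap q chi)%C.
Proof.
  pose proof (kap_neq0 q chi Hprim Hodd) as nk. pose proof PI_RGT_0 as hpi0.
  destruct (holo_glue3 (fun _ => True) (fun s => Cval (Dser c (RtoC 1 - s))) f2
    (fun s => pre s * (csin (hpi s) * mel (fun u => Afun q chi (exp u)) s))%C (-2) 0 0 2) as (h & H1 & H2 & H3); try lra.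
  - intros s hs. apply (Dser_val_holo c 1); auto.
  - intros s _ hs. assert (M := mel_holo (Areg q chi) s (Dom_Areg q chi Hprim Hodd s hs)).
    unfold f2, pre. pose proof (holo_hpi s). holo; auto.
  - intros s hs. assert (M := mel_holo _ s (Dom_A q chi Hprim Hodd s hs)).
    unfold pre. pose proof (holo_hpi s). holo; auto.
  - intros s hs. symmetry. apply (Cser_unique (Dser c (RtoC 1 - s))).
    2: { apply Cval_spec. apply (Dser_cv c 1); auto. rewrite Re_minus, Re_RtoC. lra. }
    replace (f2 s) with (pre s * (csin (hpi s) * intR (fun u => (Afun q chi (exp u) - A0 q chi) * cexp (s * RtoC u))))%C;
      [apply A_sub_mellin; auto|].
    unfold f2. f_equal.
    assert (ns : csin (hpi s) <> RtoC 0) by (apply csin_hpi_neq0; [lra|intros e; rewrite e, Re_RtoC in hs; lra]).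
    assert (R1 := rat1_mellin (s + RtoC 1)%C ltac:(rewrite Re_plus, Re_RtoC; apply Rabs_def1; lra)).
    assert (E := HI_plus _ _ _ _ (HI_I _ (Dom_A_sub q chi Hprim Hodd s hs)) (HI_scal (A0 q chi) _ _ R1)).
    assert (E' := HI_I _ (Dom_Areg q chi Hprim Hodd s ltac:(lra))).
    assert (U : mel (Areg q chi) s = (intR (fun u => (Afun q chi (exp u) - A0 q chi) * cexp (s * RtoC u)) + A0 q chi * (RtoC (PI / 2) / ccos (hpi (s + RtoC 1))))%C).
    { eapply HI_unique; [exact E'|]. eapply HI_ext; [|reflexivity|exact E]. intros u. cbv beta.
      replace (s + RtoC 1 + RtoC 1)%C with (s + RtoC 2)%C by (rewrite <- Cplus_assoc, <- RtoC_plus; do 2 f_equal; ring).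
      rewrite cexp_shift. pose proof (rat1_compl u) as rc.
      replace (RtoC (rat1 u) * (RtoC (exp (2 * u)) * cexp (s * RtoC u)))%C with (RtoC (1 - rat1 u) * cexp (s * RtoC u))%C
        by (rewrite rc, RtoC_mult; ring).
      rewrite RtoC_minus. unfold Areg. fold (rat1 u). ring. }
    rewrite U, ccos_hpi_plus1. field. auto.
  - intros s hs. unfold f2. f_equal.
    assert (ns : csin (hpi s) <> RtoC 0) by (apply csin_hpi_neq0; [lra|intros e; rewrite e, Re_RtoC in hs; lra]).
    assert (R1 := rat1_mellin (s - RtoC 1)%C ltac:(rewrite Re_minus, Re_RtoC; apply Rabs_def1; lra)).
    replace (s - RtoC 1 + RtoC 1)%C with s in R1 by ring.
    replace (ccos (hpi (s - RtoC 1))) with (csin (hpi s)) in R1 by (rewrite <- csin_hpi_plus1; do 2 f_equal; ring).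
    assert (E := HI_minus _ _ _ _ (HI_I _ (Dom_A q chi Hprim Hodd s (proj1 hs))) (HI_scal (A0 q chi) _ _ R1)).
    assert (E' := HI_I _ (Dom_Areg q chi Hprim Hodd s ltac:(lra))).
    assert (U : mel (Areg q chi) s = (mel (fun u => Afun q chi (exp u)) s - A0 q chi * (RtoC (PI / 2) / csin (hpi s)))%C).
    { eapply HI_unique; [exact E'|]. eapply HI_ext; [|reflexivity|exact E]. intros u. cbv beta.
      unfold Areg. fold (rat1 u). ring. }
    rewrite U. field. auto.
  - exists (fun w => h (RtoC 1 - w)%C). split; [split|].
    + intros z. apply (holo_comp (fun w => RtoC 1 - w)%C h); [holo|auto].
    + intros w hw. rewrite H2 by (rewrite Re_minus, Re_RtoC; lra).
      replace (RtoC 1 - (RtoC 1 - w))%C with w by ring. apply Cval_spec. apply (Dser_cv c 1); auto.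
    + replace (RtoC 1 - RtoC 1)%C with (RtoC 0) by ring. rewrite H3 by (rewrite Re_RtoC; lra).
      unfold f2, pre, csin, cpow, hpi. replace (Ci * (RtoC PI * RtoC 0 / RtoC 2))%C with (RtoC 0) by (field; apply C2_neq0).
      replace (- RtoC 0)%C with (RtoC 0) by ring. replace (RtoC 0 * RtoC (ln (INR q)))%C with (RtoC 0) by ring.
      rewrite cexp_0. unfold Rdiv. rewrite !RtoC_mult, !RtoC_inv by lra.
      assert (RtoC PI <> RtoC 0) by (apply RtoC_neq0; lra).
      field. repeat split; auto; try apply C2_neq0; apply Ci_neq0.
Qed.

End LExists.

Lemma entire_unique (f g : C -> C) : (forall z, holo_at f z) -> (forall z, holo_at g z) ->
  (forall z, 1 < Re z -> f z = g z) -> forall z, f z = g z.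
Proof.
  intros Hf Hg E z. pose proof (Rabs_pos (Re z)).
  apply (holo_eq_strip f g (- Rabs (Re z) - 1) (Rabs (Re z) + 3) (Rabs (Re z) + 2) 1); auto; try lra.
  - intros x hx. apply E. rewrite Re_RtoC. apply Rabs_def2 in hx. lra.
  - destruct (Rle_or_lt 0 (Re z)); [rewrite Rabs_pos_eq by lra|rewrite Rabs_left by lra]; lra.
Qed.

(** Existence makes the chosen [Lfun chi] satisfy its specification; entire functions with the same
    Dirichlet series coincide, so the value at 1 found for the constructed function transfers. *)
Lemma Lfun_spec (q : nat) (chi : Z -> C) : primitive_char q chi -> odd_char chi ->
  is_Lfun chi (Lfun chi) /\ Lfun chi (RtoC 1) = (A0 q chi / kap q chi)%C.
Proof.
  intros Hp Ho. destruct (Lfun_exists q chi Hp Ho) as (h & Hh & E).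
  assert (S : is_Lfun chi (Lfun chi)) by (unfold Lfun; apply (epsilon_spec (inhabits (fun _ : C => RtoC 0)) (is_Lfun chi)); eauto).
  split; auto. rewrite <- E. destruct S as [S1 S2], Hh as [h1 h2]. apply entire_unique; auto.
  intros z hz. eapply Cser_unique; eauto.
Qed.

(** * Continuation of the Riemann zeta function *)

Lemma exp_double (u : R) : exp (2 * u) = exp u ^ 2.
Proof. simpl. rewrite Rmult_1_r, <- exp_plus. f_equal. ring. Qed.

Lemma rat1_bounds (u : R) : 0 < rat1 u <= 1 /\ rat1 u <= exp (- (2) * u) /\ exp u * rat1 u <= 1.
Proof.
  unfold rat1. pose proof (exp_pos u) as h. rewrite exp_double.
  assert (hp : 0 < / (1 ^ 2 + 1 ^ 2 * exp u ^ 2)) by (apply Rinv_0_lt_compat; nra).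
  repeat split; auto.
  - rewrite <- Rinv_1. apply Rinv_le_contravar; nra.
  - replace (- (2) * u) with (- (2 * u)) by ring. rewrite exp_Ropp, exp_double. apply Rinv_le_contravar; nra.
  - apply Rmult_le_reg_r with (1 ^ 2 + 1 ^ 2 * exp u ^ 2); [nra|]. rewrite Rmult_assoc, Rinv_l by nra. nra.
Qed.

Lemma rcont_Bf (t : R) : rcont (fun u => RtoC (Bf (exp u))) t.
Proof.
  eapply rcont_ext; [|apply (rcont_Bf_exp 1 1 t); lra]. intros u. cbv beta. do 2 f_equal. rewrite !Rmult_1_l. reflexivity.
Qed.

Lemma rcont_Df (t : R) : rcont (fun u => RtoC (Df (exp u))) t.
Proof.
  eapply rcont_ext; [|apply rcont_plus; [apply (rcont_Bf t)|apply (rcont_RtoC (fun u => - / (2 * PI * exp u) + 1 / 2))]].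
  - intros u. cbv beta. unfold Df. rewrite <- RtoC_plus. f_equal. ring.
  - deriv_cont. pose proof (exp_pos t). pose proof PI_RGT_0. nra.
Qed.

(** Termwise integration of the partial fractions of [D] gives the functional equation
    [zeta(1 - s) = 2 cos(pi s/2)] times the transform of [D], in the strip where the Dirichlet
    series still converges. *)
Lemma Df_mellin (s : C) : -1 < Re s < 0 ->
  Dom (fun u => RtoC (Df (exp u)) * cexp (s * RtoC u))%C /\
  Cser (Dser (fun _ => RtoC 1) (RtoC 1 - s)) (RtoC 2 * ccos (hpi s) * mel (fun u => RtoC (Df (exp u))) s)%C.
Proof.
  intros hs. pose proof PI_RGT_0 as hpi0.
  assert (nc : ccos (hpi s) <> RtoC 0) by (apply ccos_hpi_neq0; apply Rabs_def1; lra).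
  set (d := Rmin (Re s + 1) (- Re s) / 2).
  assert (hd : 0 < d) by (unfold d; pose proof (Rmin_pos (Re s + 1) (- Re s)); lra).
  pose proof (Rmin_l (Re s + 1) (- Re s)). pose proof (Rmin_r (Re s + 1) (- Re s)).
  assert (hp : 0 < / PI) by (apply Rinv_0_lt_compat; lra).
  destruct (rat_series (fun n => RtoC (/ PI)) (/ PI) 0 1 d s (fun u => RtoC (Df (exp u)) * cexp (s * RtoC u))%C) as [D S];
    try (unfold d in *; lra); auto.
  - apply Rabs_def1; lra.
  - intros n. rewrite Cmod_RtoC_pos by lra. rewrite Ropp_0, Rpower_O by apply ik_pos. lra.
  - intros t. apply rcont_mult; [apply rcont_Df|apply rcont_expi].
  - intros u. assert (P := Cser_RtoC _ _ (Df_series (exp u) (exp_pos u))).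
    apply (Cser_scal (cexp (s * RtoC u))) in P. rewrite (Cmult_comm (cexp (s * RtoC u)) (RtoC (Df (exp u)))) in P.
    eapply Cser_ext; [|exact P]. intros n. cbv beta. rewrite cexp_shift, exp_double, Rmult_1_l.
    replace (1 ^ 2 * exp u ^ 2) with (exp u ^ 2) by ring. unfold Rdiv. rewrite !RtoC_mult. ring.
  - split; auto. apply (Cser_scal (RtoC 2 * ccos (hpi s))%C) in S.
    eapply Cser_ext; [|exact S]. intros n. pose proof (ik_pos n) as hn. cbv beta. unfold Dser.
    change (INR (Datatypes.S n)) with (ik n). replace (ik n / 1) with (ik n) by field.
    replace (- (RtoC 1 - s))%C with (s - RtoC 1)%C by ring.
    rewrite cpow_minus, cpow_plus, cpow_one by auto.
    unfold Rdiv. rewrite !RtoC_mult, !RtoC_inv by (try apply pow_nonzero; lra). rewrite RtoC_pow.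
    assert (RtoC PI <> RtoC 0) by (apply RtoC_neq0; lra).
    assert (RtoC (ik n) <> RtoC 0) by (apply RtoC_neq0; lra).
    pose proof C2_neq0. field. repeat split; auto.
Qed.

Lemma Bf_decay (p u : R) : 0 < p -> 0 <= u -> 0 < Bf (exp u) <= 2 * exp (p * ln p - p) * exp (- p * u).
Proof.
  intros hp hu. destruct (Bf_pos (exp u) (exp_pos u)) as [b1 b2]. split; auto.
  pose proof (exp_exp_le p u hp). pose proof (exp_pos (- exp u)).
  assert (/ exp u <= 1) by (rewrite <- Rinv_1; apply Rinv_le_contravar; [lra|]; pose proof (exp_ineq1_le u); lra).
  pose proof (Rinv_0_lt_compat _ (exp_pos u)). nra.
Qed.

Lemma Dom_Bf (s : C) : 1 < Re s -> Dom (fun u => RtoC (Bf (exp u)) * cexp (s * RtoC u))%C.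
Proof.
  intros hs. set (p := Re s + 1). set (E := exp (p * ln p - p)). assert (hE : 0 < E) by apply exp_pos.
  apply (Dom_two_sided (fun u => RtoC (Bf (exp u))) (2 + 2 * E) (-1) p); [intros; apply rcont_Bf| | |unfold p; lra].
  - intros u hu. destruct (Bf_pos (exp u) (exp_pos u)) as [b1 b2]. rewrite Cmod_RtoC_pos by lra.
    replace (-1 * u) with (- u) by ring. rewrite exp_Ropp.
    assert (1 <= / exp u) by (rewrite <- exp_Ropp; pose proof (exp_ineq1_le (- u)); lra).
    assert (exp (- exp u) <= 1) by (rewrite <- exp_0; apply exp_le; pose proof (exp_pos u); lra).
    pose proof (exp_pos (- exp u)). nra.
  - intros u hu. destruct (Bf_decay p u ltac:(unfold p; lra) hu) as [b1 b2]. rewrite Cmod_RtoC_pos by lra.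
    fold E in b2. pose proof (exp_pos (- p * u)). nra.
Qed.

(** The role of [Areg] for [D]: rational corrections remove the limit [1/2] at infinity and the
    following [1 / (2 pi v)] there without disturbing the order [v] at zero, so the transform exists
    in [(-1, 2)]. *)
Definition Zreg (u : R) : R := Df (exp u) - 1 / 2 * (exp (2 * u) * rat1 u) + / (2 * PI) * (exp u * rat1 u).

Lemma Zreg_Bf (u : R) : Zreg u = Bf (exp u) + 1 / 2 * rat1 u - / (2 * PI) * (exp (- (1) * u) * rat1 u).
Proof.
  unfold Zreg, Df, rat1. pose proof PI_RGT_0. pose proof (exp_pos u).
  replace (- (1) * u) with (- u) by ring. rewrite exp_double, exp_Ropp. field. repeat split; nra.
Qed.

Lemma Dom_Zreg (s : C) : -1 < Re s < 2 -> Dom (fun u => RtoC (Zreg u) * cexp (s * RtoC u))%C.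
Proof.
  intros hs. pose proof PI2_1 as hp.
  assert (hp1 : 0 < / PI < 1) by (split; [apply Rinv_0_lt_compat; lra|rewrite <- Rinv_1; apply Rinv_lt_contravar; lra]).
  assert (hp2 : 0 < / (2 * PI) < 1) by (rewrite Rinv_mult; lra).
  set (K := Series (fun n => / ik n ^ 2)). set (E := exp (2 * ln 2 - 2)). assert (hE : 0 < E) by apply exp_pos.
  assert (hK : 0 <= K).
  { destruct (Df_bounds 1 ltac:(lra)) as [k1 k2]. fold K in k2. assert (0 < 1 / PI) by (apply Rdiv_lt_0_compat; lra). nra. }
  apply (Dom_two_sided (fun u => RtoC (Zreg u)) (2 + K + 2 * E) 1 2); [| | |lra].
  - intros t. unfold Zreg.
    eapply rcont_ext; [|apply rcont_plus; [apply rcont_minus; [apply (rcont_Df t)|apply (rcont_RtoC (fun u => 1 / 2 * (exp (2 * u) * rat1 u)))]|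
      apply (rcont_RtoC (fun u => / (2 * PI) * (exp u * rat1 u)))]].
    + intros u. cbv beta. rewrite <- RtoC_minus, <- RtoC_plus. reflexivity.
    + apply (@ex_derive_continuous R_AbsRing R_NormedModule). unfold rat1. auto_derive. pose proof (exp_pos (2 * t)). lra.
    + apply (@ex_derive_continuous R_AbsRing R_NormedModule). unfold rat1. auto_derive. pose proof (exp_pos (2 * t)). lra.
  - intros u _. unfold Zreg. rewrite Cmod_R. destruct (Df_bounds (exp u) (exp_pos u)) as [b1 b2]. fold K in b2.
    destruct (rat1_bounds u) as ((r1 & r2) & r3 & r4). pose proof (exp_pos u) as he. rewrite exp_double, (Rmult_1_l u).
    assert (exp u / PI * K <= exp u * K) by (unfold Rdiv; nra).
    assert (t1 : 0 <= exp u ^ 2 * rat1 u <= exp u) by (split; nra).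
    assert (t2 : 0 <= exp u * rat1 u <= exp u) by (split; nra).
    assert (t3 : 0 <= / (2 * PI) * (exp u * rat1 u) <= exp u) by (split; nra).
    assert (0 <= exp u * K /\ 0 < E * exp u) by (split; nra).
    apply Rabs_le. split; lra.
  - intros u hu. rewrite Zreg_Bf, Cmod_R. destruct (Bf_decay 2 u ltac:(lra) hu) as [b1 b2]. fold E in b2.
    destruct (rat1_bounds u) as ((r1 & r2) & r3 & r4). pose proof (exp_pos (- (2) * u)) as he.
    assert (e1 : 0 < exp (- (1) * u) <= 1) by (split; [apply exp_pos|apply Rle_trans with (exp 0); [apply exp_le; lra|rewrite exp_0; lra]]).
    assert (t2 : 0 <= exp (- (1) * u) * rat1 u <= exp (- (2) * u)) by (split; nra).
    assert (t3 : 0 <= / (2 * PI) * (exp (- (1) * u) * rat1 u) <= exp (- (2) * u)) by (split; nra).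
    assert (0 <= exp (- (2) * u) * K) by nra.
    apply Rabs_le. split; lra.
Qed.

(** Gluing as for [Lfun]: Dirichlet series for [Re s < 0], the transform of [Zreg] in
    [-1 < Re s < 2], that of [B] for [Re s > 1]. The quotient of cosine by sine in the middle
    formula comes from the limit [1/2] of [D]; its singularity at [s = 0] is the pole of [zeta] at
    1. *)
Lemma zeta_spec : is_zeta zeta.
Proof.
  unfold zeta. apply (epsilon_spec (inhabits (fun _ : C => RtoC 0)) is_zeta).
  pose proof PI_RGT_0 as hpi0. assert (nP : RtoC PI <> RtoC 0) by (apply RtoC_neq0; lra). pose proof C2_neq0 as n2.
  set (c := fun _ : nat => RtoC 1). assert (hc : forall n, Cmod (c n) <= 1) by (intros; unfold c; rewrite Cmod_1; lra).
  destruct (holo_glue3 (fun s => s <> RtoC 0) (fun s => Cval (Dser c (RtoC 1 - s)))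
    (fun s => RtoC 2 * ccos (hpi s) * mel (fun u => RtoC (Zreg u)) s - RtoC (PI / 2) * ccos (hpi s) / csin (hpi s) - RtoC (1 / 2))%C
    (fun s => RtoC 2 * ccos (hpi s) * mel (fun u => RtoC (Bf (exp u))) s)%C (-1) 0 1 2) as (h & H1 & H2 & _); try lra.
  - intros s hs. apply (Dser_val_holo c 1); auto.
  - intros s ns hs. assert (M := mel_holo _ s (Dom_Zreg s hs)). pose proof (holo_hpi s).
    assert (csin (hpi s) <> RtoC 0) by (apply csin_hpi_neq0; auto; lra). holo.
  - intros s hs. assert (M := mel_holo _ s (Dom_Bf s hs)). pose proof (holo_hpi s). holo.
  - intros s hs. destruct (Df_mellin s hs) as [D S]. fold c in S.
    transitivity (RtoC 2 * ccos (hpi s) * mel (fun u => RtoC (Df (exp u))) s)%C.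
    { apply (Cser_unique (Dser c (RtoC 1 - s))); auto. apply Cval_spec. eauto. }
    assert (ns : csin (hpi s) <> RtoC 0) by (apply csin_hpi_neq0; [lra|intros e; rewrite e, Re_RtoC in hs; lra]).
    assert (nc : ccos (hpi s) <> RtoC 0) by (apply ccos_hpi_neq0; apply Rabs_def1; lra).
    assert (R1 := rat1_mellin (s + RtoC 1)%C ltac:(rewrite Re_plus, Re_RtoC; apply Rabs_def1; lra)).
    assert (R2 := rat1_mellin s ltac:(apply Rabs_def1; lra)).
    assert (E := HI_plus _ _ _ _ (HI_minus _ _ _ _ (HI_I _ D) (HI_scal (RtoC (1 / 2)) _ _ R1)) (HI_scal (RtoC (/ (2 * PI))) _ _ R2)).
    assert (U : mel (fun u => RtoC (Zreg u)) s = (mel (fun u => RtoC (Df (exp u))) s - RtoC (1 / 2) * (RtoC (PI / 2) / ccos (hpi (s + RtoC 1)))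
      + RtoC (/ (2 * PI)) * (RtoC (PI / 2) / ccos (hpi s)))%C).
    { eapply HI_unique; [exact (HI_I _ (Dom_Zreg s ltac:(lra)))|]. eapply HI_ext; [|reflexivity|exact E]. intros u. cbv beta.
      replace (s + RtoC 1 + RtoC 1)%C with (s + RtoC 2)%C by (rewrite <- Cplus_assoc, <- RtoC_plus; do 2 f_equal; ring).
      rewrite !cexp_shift, (Rmult_1_l u). unfold Zreg. rewrite RtoC_plus, RtoC_minus, !RtoC_mult. ring. }
    rewrite U, ccos_hpi_plus1. unfold Rdiv. rewrite !RtoC_mult, !RtoC_inv, !RtoC_mult by lra. field. repeat split; auto.
  - intros s hs.
    assert (ns : csin (hpi s) <> RtoC 0) by (apply csin_hpi_neq0; [lra|intros e; rewrite e, Re_RtoC in hs; lra]).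
    assert (R1 := rat1_mellin (s - RtoC 1)%C ltac:(rewrite Re_minus, Re_RtoC; apply Rabs_def1; lra)).
    assert (R2 := rat1_mellin (s - RtoC 2)%C ltac:(rewrite Re_minus, Re_RtoC; apply Rabs_def1; lra)).
    replace (s - RtoC 1 + RtoC 1)%C with s in R1 by ring.
    replace (ccos (hpi (s - RtoC 1))) with (csin (hpi s)) in R1 by (rewrite <- csin_hpi_plus1; do 2 f_equal; ring).
    assert (e2 : (s - RtoC 2 + RtoC 1)%C = (s + RtoC (- (1)))%C)
      by (unfold Cminus; rewrite <- Cplus_assoc, <- RtoC_opp, <- RtoC_plus; do 2 f_equal; ring).
    assert (c2 : ccos (hpi (s - RtoC 2)) = (- ccos (hpi s))%C).
    { rewrite <- csin_hpi_plus1, e2. replace (ccos (hpi s)) with (ccos (hpi (s + RtoC (- (1)) + RtoC 1))).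
      - rewrite ccos_hpi_plus1. ring.
      - do 2 f_equal. rewrite RtoC_opp. ring. }
    assert (nc : ccos (hpi s) <> RtoC 0).
    { replace (ccos (hpi s)) with (- ccos (hpi (s - RtoC 2)))%C by (rewrite c2; ring). intros e.
      apply (ccos_hpi_neq0 (s - RtoC 2)%C); [rewrite Re_minus, Re_RtoC; apply Rabs_def1; lra|].
      replace (ccos (hpi (s - RtoC 2))) with (- - ccos (hpi (s - RtoC 2)))%C by ring. rewrite e. ring. }
    rewrite c2, e2 in R2.
    assert (E := HI_minus _ _ _ _ (HI_plus _ _ _ _ (HI_I _ (Dom_Bf s (proj1 hs))) (HI_scal (RtoC (1 / 2)) _ _ R1)) (HI_scal (RtoC (/ (2 * PI))) _ _ R2)).
    assert (U : mel (fun u => RtoC (Zreg u)) s = (mel (fun u => RtoC (Bf (exp u))) s + RtoC (1 / 2) * (RtoC (PI / 2) / csin (hpi s))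
      - RtoC (/ (2 * PI)) * (RtoC (PI / 2) / - ccos (hpi s)))%C).
    { eapply HI_unique; [exact (HI_I _ (Dom_Zreg s ltac:(lra)))|]. eapply HI_ext; [|reflexivity|exact E]. intros u. cbv beta.
      rewrite cexp_shift, Zreg_Bf, RtoC_minus, RtoC_plus, !RtoC_mult. ring. }
    rewrite U. unfold Rdiv. rewrite !RtoC_mult, !RtoC_inv, !RtoC_mult by lra. field. repeat split; auto.
  - exists (fun w => h (RtoC 1 - w)%C). split.
    + intros z hz. apply (holo_comp (fun w => RtoC 1 - w)%C h); [holo|apply H1].
      intros e. apply hz. replace z with (RtoC 1 - (RtoC 1 - z))%C by ring. rewrite e. ring.
    + intros w hw. rewrite H2 by (rewrite Re_minus, Re_RtoC; lra).
      replace (RtoC 1 - (RtoC 1 - w))%C with w by ring.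
      apply (Cser_ext (Dser c w)); [intros n; unfold Dser, c; ring|].
      apply Cval_spec. apply (Dser_cv c 1); auto.
Qed.

(** * The Gamma function *)

Definition Gamma0 (s : C) : C := mel (fun u => RtoC (exp (- exp u))) s.

Lemma rcont_expexp (t : R) : rcont (fun u => RtoC (exp (- exp u))) t.
Proof. apply rcont_RtoC. deriv_cont. trivial. Qed.

Lemma Dom_Gamma0 (s : C) : 0 < Re s -> Dom (fun u => RtoC (exp (- exp u)) * cexp (s * RtoC u))%C.
Proof.
  intros hs. set (p := Re s + 1). pose proof (exp_pos (p * ln p - p)) as hE.
  apply (Dom_two_sided (fun u => RtoC (exp (- exp u))) (1 + exp (p * ln p - p)) 0 p); [intros; apply rcont_expexp| | |unfold p; lra].
  - intros u _. rewrite Cmod_RtoC_pos by (apply exp_ge0). rewrite Rmult_0_l, exp_0.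
    assert (exp (- exp u) <= exp 0) by (apply exp_le; pose proof (exp_pos u); lra). rewrite exp_0 in *. lra.
  - intros u _. rewrite Cmod_RtoC_pos by (apply exp_ge0). pose proof (exp_exp_le p u ltac:(unfold p; lra)).
    pose proof (exp_pos (- p * u)). nra.
Qed.

Lemma I_derivative (F F' : R -> C) : Dom F -> (forall t, rdiff F t (F' t)) -> (forall t, rcont F' t) -> intR F' = RtoC 0.
Proof.
  intros (M & d & Hc & hd & HM) H Hr. apply I_unique. intros eps he.
  destruct (exp_small M d (eps / 2) hd ltac:(lra)) as (X & hX & HX). exists X. intros a b ha hb.
  rewrite (CInt_FTC F F') by (intros; auto || (intros t _; auto)).
  replace (F b - F a - RtoC 0)%C with (F b - F a)%C by ring.
  eapply Rle_trans; [apply Cmod_triangle_sub|].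
  pose proof (HM a) as h1. pose proof (HM b) as h2. rewrite (Rabs_left1 a) in h1 by lra. rewrite (Rabs_pos_eq b) in h2 by lra.
  pose proof (HX (- a) ltac:(lra)). pose proof (HX b ltac:(lra)). lra.
Qed.

(** Integration by parts: the derivative of [exp (s u - exp u)] integrates to zero over the line. *)
Lemma Gamma0_rec (s : C) : 0 < Re s -> (s * Gamma0 s)%C = Gamma0 (s + RtoC 1).
Proof.
  intros hs. pose proof (Dom_Gamma0 s hs) as D. pose proof (Dom_Gamma0 (s + RtoC 1) ltac:(rewrite Re_plus, Re_RtoC; lra)) as D1.
  assert (E : intR (fun u => s * (RtoC (exp (- exp u)) * cexp (s * RtoC u)) - RtoC (exp (- exp u)) * cexp ((s + RtoC 1) * RtoC u))%C = RtoC 0).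
  { apply (I_derivative (fun u => RtoC (exp (- exp u)) * cexp (s * RtoC u))%C); auto.
    2: { apply Dom_rcont. apply Dom_minus; auto. apply Dom_scal. auto. }
    intros t. rewrite cexp_shift, Rmult_1_l.
    assert (R1 : rdiff (fun u => s * RtoC u - RtoC (exp u))%C t (s - RtoC (exp t))).
    { apply rdiff_of_ReIm.
      - apply (is_derive_ext (fun u => Re s * u - exp u)); [intros; rewrite Re_minus, Re_scalr, Re_RtoC; reflexivity|].
        rewrite Re_minus, Re_RtoC. auto_derive; [trivial|]. eqR. ring.
      - apply (is_derive_ext (fun u => Im s * u)); [intros; rewrite Im_minus, Im_scalr; simpl; ring|].
        rewrite Im_minus. simpl. auto_derive; [trivial|]. eqR. ring. }
    assert (EQ : forall u, (RtoC (exp (- exp u)) * cexp (s * RtoC u))%C = cexp (s * RtoC u - RtoC (exp u))).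
    { intros u. rewrite <- cexp_RtoC, <- cexp_plus. f_equal. rewrite RtoC_opp. ring. }
    assert (R2 := rdiff_cdiff_comp _ cexp t _ _ R1 (cdiff_cexp _)). cbv beta in R2. rewrite <- EQ in R2.
    intros eps he. destruct (R2 eps he) as (d & hd & H). exists d. split; auto. intros u hu. specialize (H u hu).
    rewrite <- !EQ in H.
    match goal with |- Cmod ?x <= _ => match type of H with Cmod ?y <= _ => replace x with y; [exact H|] end end. ring. }
  rewrite I_minus in E by (try apply Dom_scal; auto). rewrite I_scal in E by auto.
  unfold Gamma0, mel. match goal with |- ?x = ?y => replace x with ((x - y) + y)%C by ring end. rewrite E. ring.
Qed.

Lemma at_right_exp (M : R) : at_right 0 (fun a => 0 < a < exp (- M)).
Proof.
  exists (mkposreal _ (exp_pos (- M))). intros y hy hy0. split; auto.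
  change (Rabs (y - 0) < exp (- M)) in hy. apply Rabs_def2 in hy. lra.
Qed.

(** The substitution [t = exp u]. *)
Lemma Gamma0_integral (s : C) : 0 < Re s ->
  @is_RInt_gen C_R_NormedModule (fun t => Cmult (cpow t (Cminus s (RtoC 1))) (RtoC (exp (- t))))
    (at_right 0) (Rbar_locally p_infty) (Gamma0 s).
Proof.
  intros hs. set (g := fun t => Cmult (cpow t (Cminus s (RtoC 1))) (RtoC (exp (- t)))).
  pose proof (Dom_isI _ (Dom_Gamma0 s hs)) as H. fold (mel (fun u => RtoC (exp (- exp u))) s) in H. fold (Gamma0 s) in H.
  assert (gc : forall t, 0 < t -> rcont g t).
  { intros t ht. apply rcont_mult.
    - unfold cpow. apply rcont_cexp. apply rcont_mult; [apply rcont_const|]. apply rcont_RtoC.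
      deriv_cont. auto.
    - apply rcont_RtoC. deriv_cont. trivial. }
  intros P [[eps he] HP]. destruct (H (eps / 2) ltac:(lra)) as [M HM].
  apply (Filter_prod _ _ _ (fun a => 0 < a < exp (- M)) (fun b => exp M < b)).
  - apply at_right_exp.
  - exists (exp M). auto.
  - intros a b [ha ha'] hb. assert (hb0 : 0 < b) by (pose proof (exp_pos M); lra).
    exists (CInt g a b). split.
    + apply CInt_correct. intros t ht. apply gc. pose proof (Rmin_pos a b ha hb0). simpl in *. lra.
    + apply HP.
      assert (E : CInt (fun u => RtoC (exp (- exp u)) * cexp (s * RtoC u))%C (ln a) (ln b) = CInt g a b).
      { apply CInt_unique. assert (K := @is_RInt_comp C_R_CompleteNormedModule g exp exp (ln a) (ln b)).
        rewrite !exp_ln in K by auto. apply (@is_RInt_ext C_R_NormedModule (fun y => scal (exp y) (g (exp y)))).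
        - intros u _. rewrite scal_R_Cmult. unfold g. rewrite cpow_exp.
          replace (s * RtoC u)%C with ((s - RtoC 1 + RtoC 1) * RtoC u)%C by ring. rewrite cexp_shift, Rmult_1_l. match goal with |- @eq _ ?a ?b => change (@eq C a b) end. ring.
        - apply K.
          + intros u _. apply rcont_continuous. apply gc. apply exp_pos.
          + intros u _. split; [apply is_derive_Reals, derivable_pt_lim_exp|].
            deriv_cont. trivial. }
      rewrite <- E. apply C_NormedModule_mixin_compat1. eapply Rle_lt_trans; [apply HM|simpl; lra].
      * rewrite <- (ln_exp (- M)). left. apply ln_increasing; auto.
      * rewrite <- (ln_exp M). left. apply ln_increasing; auto. apply exp_pos.
Qed.

(** [Gamma0 (z + n)] divided by [z (z + 1) ... (z + n - 1)], a continuation to [Re z > - n]. *)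
Fixpoint Gamma_shift (n : nat) (z : C) : C :=
  match n with O => Gamma0 z | S n => (Gamma_shift n (z + RtoC 1) / z)%C end.

Definition nonpole (z : C) : Prop := forall k : nat, z <> RtoC (- INR k).

Lemma nonpole_succ (z : C) : nonpole z -> nonpole (z + RtoC 1).
Proof.
  intros H k e. apply (H (S k)). replace z with (z + RtoC 1 - RtoC 1)%C by ring. rewrite e, <- RtoC_minus, S_INR. f_equal. ring.
Qed.

Lemma nonpole_neq0 (z : C) : nonpole z -> z <> RtoC 0.
Proof. intros H e. apply (H 0%nat). rewrite e. simpl. f_equal. ring. Qed.

Lemma Gamma_shift_holo (n : nat) (z : C) : nonpole z -> - INR n < Re z -> holo_at (Gamma_shift n) z.
Proof.
  revert z. induction n as [|n IH]; intros z Hz h.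
  - apply mel_holo, Dom_Gamma0. simpl in h. lra.
  - simpl. apply holo_div; [apply nonpole_neq0; auto| |holo].
    apply (holo_comp (fun w => w + RtoC 1)%C (Gamma_shift n)); [holo|].
    apply IH; [apply nonpole_succ; auto|]. rewrite S_INR in h. rewrite Re_plus, Re_RtoC. lra.
Qed.

Lemma Gamma_shift_S (n : nat) (z : C) : nonpole z -> - INR n < Re z -> Gamma_shift (S n) z = Gamma_shift n z.
Proof.
  revert z. induction n as [|n IH]; intros z Hz h.
  - simpl in *. rewrite <- Gamma0_rec by lra. field. apply nonpole_neq0; auto.
  - change (Gamma_shift (S (S n)) z) with (Gamma_shift (S n) (z + RtoC 1) / z)%C. rewrite IH; [reflexivity|apply nonpole_succ; auto|].
    rewrite S_INR in h. rewrite Re_plus, Re_RtoC. lra.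
Qed.

Lemma Gamma_shift_le (n m : nat) (z : C) : nonpole z -> - INR n < Re z -> (n <= m)%nat -> Gamma_shift m z = Gamma_shift n z.
Proof.
  intros Hz h hnm. induction hnm as [|m hm IH]; auto. rewrite Gamma_shift_S; auto.
  apply le_INR in hm. lra.
Qed.

(** The continuation takes a number of shifts depending on [z]; consistency of [Gamma_shift] makes
    it agree near any point with a fixed number of shifts. On [Re s > 0] uniqueness of improper
    integrals identifies it with [Gamma0], with no appeal to the identity theorem. *)
Lemma Gamma_spec : is_Gamma Gamma /\ forall s, 0 < Re s -> Gamma s = Gamma0 s.
Proof.
  assert (S : is_Gamma Gamma).
  { unfold Gamma. apply (epsilon_spec (inhabits (fun _ : C => RtoC 0)) is_Gamma).
    set (N := fun z : C => Z.to_nat (up (Rabs (Re z)))).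
    assert (HN : forall z, - INR (N z) < Re z).
    { intros z. unfold N. destruct (archimed (Rabs (Re z))) as [h _]. pose proof (Rabs_pos (Re z)).
      rewrite INR_IZR_INZ, Z2Nat.id by (apply le_IZR; lra). pose proof (Rle_abs (- Re z)) as k. rewrite Rabs_Ropp in k. lra. }
    set (G := fun z => Gamma_shift (N z) z).
    assert (HG : forall n z, nonpole z -> - INR n < Re z -> G z = Gamma_shift n z).
    { intros n z Hz h. unfold G. destruct (Nat.le_ge_cases n (N z)); [|symmetry]; apply Gamma_shift_le; auto. }
    exists (fun z => if excluded_middle_informative (nonpole z) then G z else RtoC 0). split.
    - intros z Hz. set (n := N z). pose proof (HN z) as hn. fold n in hn.
      (* A disc free of poles in which [n] shifts suffice: poles with index at most [n] are finitely
         many, and the others lie to the left of [Re = - n]. *)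
      assert (R : exists r, 0 < r /\ forall y, Cmod (y - z) < r -> nonpole y /\ - INR n < Re y).
      { assert (K : forall m, exists r, 0 < r /\ forall k, (k < m)%nat -> r <= Cmod (z - RtoC (- INR k))).
        { induction m as [|m (r & hr & Hr)]; [exists 1; split; [lra|intros; lia]|].
          assert (0 < Cmod (z - RtoC (- INR m))).
          { apply Cmod_gt_0. intros e. apply (Hz m). replace z with (z - RtoC (- INR m) + RtoC (- INR m))%C by ring. rewrite e. ring. }
          exists (Rmin r (Cmod (z - RtoC (- INR m)))). split; [apply Rmin_pos; auto|]. intros k hk.
          destruct (Nat.eq_dec k m) as [->|]; [apply Rmin_r|]. eapply Rle_trans; [apply Rmin_l|apply Hr; lia]. }
        destruct (K (n + 1)%nat) as (r & hr & Hr). exists (Rmin r (Re z + INR n)). split; [apply Rmin_pos; lra|].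
        intros y hy. assert (h1 := Rlt_le_trans _ _ _ hy (Rmin_l _ _)). assert (h2 := Rlt_le_trans _ _ _ hy (Rmin_r _ _)).
        assert (hre : - INR n < Re y).
        { pose proof (re_le_Cmod (y - z)) as h. rewrite Re_minus in h. assert (h3 := Rle_lt_trans _ _ _ h h2). apply Rabs_def2 in h3. lra. }
        split; auto. intros k e. destruct (Nat.lt_ge_cases k (n + 1)) as [hk|hk].
        - specialize (Hr k hk). rewrite e, Cmod_sub_sym in h1. lra.
        - rewrite e, Re_RtoC in hre. apply le_INR in hk. rewrite plus_INR in hk. simpl in hk. lra. }
      destruct R as (r & hr & HR).
      apply (holo_ext_loc (Gamma_shift n) _ z r); auto.
      + intros y hy. destruct (HR y hy). destruct excluded_middle_informative as [|c]; [apply HG; auto|contradiction].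
      + apply Gamma_shift_holo; auto.
    - intros s hs. destruct excluded_middle_informative as [i|c].
      + rewrite (HG 0%nat s i) by (simpl; lra). apply Gamma0_integral; auto.
      + exfalso. apply c. intros k e. rewrite e, Re_RtoC in hs. pose proof (pos_INR k). lra. }
  split; auto. intros s hs. destruct S as [_ S2].
  rewrite <- (@is_RInt_gen_unique C_R_CompleteNormedModule _ _ _ _ _ _ (S2 s hs)).
  apply (@is_RInt_gen_unique C_R_CompleteNormedModule _ _ _ _ _ _ (Gamma0_integral s hs)).
Qed.

(** * Dirichlet convolutions under the integral sign *)

Lemma HI_zero : HI (fun _ => RtoC 0) (RtoC 0).
Proof.
  eapply HI_ext; [| |exact (HI_scal (RtoC 0) _ _ (HI_I _ (Dom_Gamma0 (RtoC 1) ltac:(rewrite Re_RtoC; lra))))]; intros; cbv beta; ring.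
Qed.

Lemma HI_Csum (f : nat -> R -> C) (l : nat -> C) (n : nat) : (forall k, (1 <= k <= n)%nat -> HI (f k) (l k)) ->
  HI (fun t => Csum (fun k => f k t) 1 n) (Csum l 1 n).
Proof.
  induction n as [|n IH]; intros H.
  - eapply HI_ext; [| |exact HI_zero]; intros; rewrite Csum_0 by lia; reflexivity.
  - eapply HI_ext; [| |apply HI_plus; [apply IH|apply (H (S n))]]; try (intros; rewrite Csum_Sm by lia; reflexivity); try lia.
    intros k hk. apply H. lia.
Qed.

Lemma HI_dconv (g : nat -> nat -> R -> C) (h : nat -> nat -> C) (n : nat) : (1 <= n)%nat ->
  (forall d m, (1 <= d)%nat -> (1 <= m)%nat -> HI (g d m) (h d m)) ->
  HI (fun t => dconv (fun d m => g d m t) n) (dconv h n).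
Proof.
  intros hn H. unfold dconv.
  apply (HI_Csum (fun d t => if Nat.eqb (Nat.modulo n d) 0 then g d (Nat.div n d) t else RtoC 0)).
  intros d hd. destruct (Nat.eqb_spec (n mod d) 0) as [e|]; [|apply HI_zero].
  pose proof (Nat.div_mod n d ltac:(lia)). apply H; nia.
Qed.

(** [I_series] for double series arranged by the product [d m]. A majorant that factors in [d] and
    [m] is summable over this arrangement by [ex_series_dconv]. *)
Lemma I_dconv (g : nat -> nat -> R -> C) (h : nat -> nat -> C) (al be : nat -> R) (del : R) (F : R -> C) :
  0 < del -> (forall d, 0 <= al d) -> (forall m, 0 <= be m) ->
  ex_series (fun n => al (S n)) -> ex_series (fun n => be (S n)) ->
  (forall d m, (1 <= d)%nat -> (1 <= m)%nat -> HI (g d m) (h d m)) ->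
  (forall d m u, (1 <= d)%nat -> (1 <= m)%nat -> Cmod (g d m u) <= al d * be m * exp (- del * Rabs u)) ->
  (forall u, rcont F u) -> (forall u, Cser (fun n => dconv (fun d m => g d m u) (S n)) (F u)) ->
  Dom F /\ Cser (fun n => dconv h (S n)) (intR F).
Proof.
  intros hd ha hb Ha Hb Hg Hbd HF HS.
  destruct (I_series (fun n u => dconv (fun d m => g d m u) (S n)) F
    (fun n => Re (dconv (fun d m => RtoC (al d) * RtoC (be m))%C (S n))) del) as [D S]; auto.
  - intros n. destruct (HI_dconv g h (S n) ltac:(lia) Hg) as [D _]. split; [apply Dom_rcont; auto|]. split; auto.
    intros u. cbv beta. rewrite <- Re_scalr, (Cmult_comm _ (RtoC _)).
    assert (hE := exp_pos (- del * Rabs u)).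
    rewrite <- dconv_scal. 
    eapply Rle_trans; [apply (dconv_Cmod_le _ (fun d => exp (- del * Rabs u) * al d) be); [lia|]|].
    + intros d m h1 h2 _. eapply Rle_trans; [apply Hbd; auto|]. right. ring.
    + right. f_equal. apply dconv_ext; [lia|]. intros. rewrite RtoC_mult. ring.
  - apply ex_series_dconv; auto.
  - split; auto. eapply Cser_ext; [|exact S]. intros n. cbv beta.
    destruct (HI_dconv g h (Datatypes.S n) ltac:(lia) Hg) as [_ E]. exact E.
Qed.

Lemma Cser_dconv_dominated (g : nat -> nat -> C) (al be : nat -> R) : (forall d, 0 <= al d) -> (forall m, 0 <= be m) ->
  ex_series (fun n => al (S n)) -> ex_series (fun n => be (S n)) ->
  (forall d m, (1 <= d)%nat -> (1 <= m)%nat -> Cmod (g d m) <= al d * be m) ->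
  exists l, Cser (fun n => dconv g (S n)) l.
Proof.
  intros ha hb Ha Hb H.
  apply (Cser_dominated _ (fun n => Re (dconv (fun d m => RtoC (al d) * RtoC (be m))%C (S n)))); [|apply ex_series_dconv; auto].
  intros n. apply dconv_Cmod_le; [lia|auto].
Qed.

Lemma dconv_plus (g h : nat -> nat -> C) (n : nat) : dconv (fun d m => g d m + h d m)%C n = (dconv g n + dconv h n)%C.
Proof. unfold dconv. rewrite <- Csum_plus. apply Csum_ext. intros d _. destruct Nat.eqb; ring. Qed.

(** [series_holo] for double series: estimates are made for a pair [(d, m)] and pass to the divisor
    sum with a factored majorant. *)
Lemma series_holo_dconv (g : nat -> nat -> C -> C) (g' : nat -> nat -> C) (al be : nat -> R) (F : C -> C) (w : C) (r : R) :
  0 < r -> (forall d, 0 <= al d) -> (forall m, 0 <= be m) ->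
  ex_series (fun n => al (S n)) -> ex_series (fun n => be (S n)) ->
  (forall d m, (1 <= d)%nat -> (1 <= m)%nat -> Cmod (g' d m) <= al d * be m) ->
  (forall d m z, (1 <= d)%nat -> (1 <= m)%nat -> Cmod (z - w) < r ->
     Cmod (g d m z - g d m w - g' d m * (z - w)) <= al d * be m * (Cmod (z - w) * Cmod (z - w))) ->
  (forall z, Cmod (z - w) < r -> Cser (fun n => dconv (fun d m => g d m z) (S n)) (F z)) ->
  holo_at F w.
Proof.
  intros hr ha hb Ha Hb H1 H2 HF.
  apply (series_holo (fun n z => dconv (fun d m => g d m z) (S n)) (fun n => dconv g' (S n))
    (fun n => Re (dconv (fun d m => RtoC (al d) * RtoC (be m))%C (S n))) F w r); auto.
  - apply ex_series_dconv; auto.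
  - intros n. apply dconv_Cmod_le; [lia|auto].
  - intros n z hz. cbv beta.
    replace (dconv (fun d m => g d m z) (S n) - dconv (fun d m => g d m w) (S n) - dconv g' (S n) * (z - w))%C
      with (dconv (fun d m => g d m z - g d m w - g' d m * (z - w))%C (S n)).
    + rewrite <- Re_scalr, (Cmult_comm _ (RtoC _)), <- dconv_scal.
      set (X := Cmod (z - w) * Cmod (z - w)).
      eapply Rle_trans; [apply (dconv_Cmod_le _ (fun d => X * al d) be); [lia|]|].
      * intros d m h1 h2 _. eapply Rle_trans; [apply H2; auto|]. right. unfold X. ring.
      * right. f_equal. apply dconv_ext; [lia|]. intros. rewrite RtoC_mult. ring.
    + transitivity (dconv (fun d m => g d m z + (- RtoC 1 * g d m w + - (z - w) * g' d m))%C (S n)).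
      * apply dconv_ext; [lia|]. intros. ring.
      * rewrite dconv_plus, dconv_plus, !dconv_scal. ring.
Qed.

(** * The Mellin transform of A *)

Lemma exp_decay (a p u : R) : 0 < a -> 0 < p ->
  exp (- (a * exp u)) <= exp (p * ln p - p) * Rpower a (- p) * exp (- p * u).
Proof.
  intros ha hp. assert (H := exp_exp_le p (u + ln a) hp). rewrite exp_plus, exp_ln in H by auto.
  replace (- (a * exp u)) with (- (exp u * a)) by ring. eapply Rle_trans; [exact H|]. right.
  unfold Rpower. rewrite <- !exp_plus. f_equal. ring.
Qed.

Lemma Gamma0_scaled (a : R) (s : C) : 0 < a -> 0 < Re s ->
  HI (fun u => RtoC (exp (- (a * exp u))) * cexp (s * RtoC u))%C (cpow a (- s) * Gamma0 s)%C.
Proof.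
  intros ha hs. pose proof (Dom_Gamma0 s hs) as D.
  assert (D' := Dom_shift _ (ln a) D). assert (E := I_shift _ (ln a) D).
  assert (H : HI (fun u => RtoC (exp (- exp (u + ln a))) * cexp (s * RtoC (u + ln a)))%C (Gamma0 s)) by (split; auto).
  apply (HI_scal (cpow a (- s))) in H. eapply HI_ext; [|reflexivity|exact H].
  intros u. cbv beta. rewrite exp_plus, exp_ln, RtoC_plus, Cmult_plus_distr_l, cexp_plus by auto.
  fold (cpow a s). rewrite cpow_opp. pose proof (cpow_neq0 a s). rewrite (Rmult_comm (exp u) a). field. auto.
Qed.

Section MellinA.
Variables (q : nat) (chi : Z -> C).
Hypothesis Hprim : primitive_char q chi.
Hypothesis Hodd : odd_char chi.

Let chib := conj_char chi.
Let Hdb : dirichlet_char q chib := conj_char_dirichlet q chi (proj1 Hprim).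

(** Termwise integration works where the Dirichlet series converges absolutely, [Re s > 1]. Since
    [A] is bounded at zero, the left side is holomorphic for [Re s > 0] and the identity theorem
    carries the formula there. *)
Lemma mel_A (s : C) : 0 < Re s ->
  mel (fun u => Afun q chi (exp u)) s = (cpow (2 * PI) (- s) * Gamma s * Lfun chib s)%C.
Proof.
  pose proof PI2_1 as hpi0.
  destruct (Lfun_spec q chib (conj_char_primitive q chi Hprim) (conj_char_odd chi Hodd)) as [[HL1 HL2] _].
  destruct Gamma_spec as [[HG1 _] HG2].
  assert (BIG : forall s, 1 < Re s -> mel (fun u => Afun q chi (exp u)) s = (cpow (2 * PI) (- s) * Gamma s * Lfun chib s)%C).
  (* Exponents on both sides of [Re s] give decay on the two half-lines; the smaller one, [p1],
     still exceeds 1 and ensures summability in [n]. *)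
  { clear s. intros s hs. set (e := (Re s - 1) / 2). set (p1 := Re s - e). set (p2 := Re s + e).
    set (K1 := exp (p1 * ln p1 - p1)). set (K2 := exp (p2 * ln p2 - p2)).
    assert (hK : 0 < K1 /\ 0 < K2) by (split; apply exp_pos). assert (he : 0 < e) by (unfold e; lra).
    assert (h1 : 1 < p1) by (unfold p1, e; lra). assert (h2 : p1 < p2) by (unfold p1, p2; lra).
    destruct (I_series (fun n u => chib (Z.of_nat (S n)) * (RtoC (exp (- ((2 * PI * ik n) * exp u))) * cexp (s * RtoC u)))%C
      (fun u => Afun q chi (exp u) * cexp (s * RtoC u))%C (fun n => (K1 + K2) * Rpower (INR (S n)) (- p1)) e) as [D S].
    - intros n. pose proof (ik_ge1 n) as hn.
      assert (B : forall u, Cmod (chib (Z.of_nat (S n)) * (RtoC (exp (- ((2 * PI * ik n) * exp u))) * cexp (s * RtoC u))) <= exp (- (ik n * exp u)) * exp (Re s * u)).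
      { intros u. rewrite !Cmod_mult, Cmod_cexp, Re_scalr, Cmod_RtoC_pos by (apply exp_ge0).
        pose proof (char_le1 q chib Hdb (Z.of_nat (S n))). pose proof (exp_pos (Re s * u)). pose proof (exp_pos u).
        assert (exp (- ((2 * PI * ik n) * exp u)) <= exp (- (ik n * exp u))) by (apply exp_le; assert (0 < ik n * exp u) by nra; nra).
        pose proof (exp_pos (- ((2 * PI * ik n) * exp u))). pose proof (Cmod_ge_0 (chib (Z.of_nat (S n)))).
        assert (0 <= exp (- ((2 * PI * ik n) * exp u)) * exp (Re s * u)) by nra.
        eapply Rle_trans; [apply Rmult_le_compat_r; [auto|exact H]|]. nra. }
      assert (B2 : forall p u, 1 < p -> p1 <= p -> exp (- (ik n * exp u)) * exp (Re s * u) <= exp (p * ln p - p) * Rpower (ik n) (- p1) * exp ((Re s - p) * u)).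
      { intros p u hp hpp. eapply Rle_trans; [apply Rmult_le_compat_r; [apply exp_ge0|apply (exp_decay (ik n) p u); lra]|].
        rewrite Rmult_assoc, <- exp_plus. replace (- p * u + Re s * u) with ((Re s - p) * u) by ring.
        apply Rmult_le_compat_r; [apply exp_ge0|]. apply Rmult_le_compat_l; [apply exp_ge0|].
        apply Rpower_le_one. lra. }
      assert (hR : 0 < Rpower (ik n) (- p1)) by apply exp_pos.
      apply dom_two; auto.
      + intros t. apply rcont_mult; [apply rcont_const|]. apply rcont_mult; [|apply rcont_expi]. apply rcont_RtoC.
        deriv_cont. trivial.
      + intros u hu. eapply Rle_trans; [apply B|]. eapply Rle_trans; [apply (B2 p1); lra|]. fold K1.
        replace (Re s - p1) with e by (unfold p1; ring). apply Rmult_le_compat_r; [apply exp_ge0|].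
        apply Rmult_le_compat_r; [left; exact hR|lra].
      + intros u hu. eapply Rle_trans; [apply B|]. eapply Rle_trans; [apply (B2 p2); lra|]. fold K2.
        replace (Re s - p2) with (- e) by (unfold p2; ring). apply Rmult_le_compat_r; [apply exp_ge0|].
        apply Rmult_le_compat_r; [left; exact hR|lra].
    - apply ex_series_scalR, ex_series_Rpower. auto.
    - intros t. apply rcont_mult; [apply (rcont_A q chi Hprim)|apply rcont_expi].
    - intros u. assert (P := Af_series q chi Hprim Hodd (exp u) (exp_pos u)).
      apply (Cser_scal (cexp (s * RtoC u))) in P. rewrite (Cmult_comm (cexp (s * RtoC u)) (Afun q chi (exp u))) in P.
      eapply Cser_ext; [|exact P]. intros n. cbv beta. replace (- (2 * PI * ik n * exp u)) with (- (2 * PI * exp u) * ik n) by ring.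
      unfold chib. ring.
    - unfold mel. apply (Cser_unique _ _ _ S). rewrite HG2 by lra.
      assert (P := Cser_scal (cpow (2 * PI) (- s) * Gamma0 s)%C _ _ (HL2 s hs)).
      eapply Cser_ext; [|exact P]. intros n. cbv beta. pose proof (ik_pos n) as hn.
      destruct (Gamma0_scaled (2 * PI * ik n) s ltac:(nra) ltac:(lra)) as [D' E].
      rewrite I_scal by exact D'. rewrite E, (cpow_mult (2 * PI) (ik n)) by lra. unfold ik. ring. }
  intros hs. apply (holo_eq_strip _ (fun s => cpow (2 * PI) (- s) * Gamma s * Lfun chib s)%C 0 (Re s + 3) (Re s + 2) 1); try lra.
  - intros z hz. apply mel_holo. apply (Dom_A q chi Hprim Hodd). lra.
  - intros z hz. pose proof (HL1 z). assert (holo_at Gamma z).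
    { apply HG1. intros k e. rewrite e, Re_RtoC in hz. pose proof (pos_INR k). lra. }
    holo.
  - intros x hx. apply BIG. rewrite Re_RtoC. apply Rabs_def2 in hx. lra.
Qed.

End MellinA.

(** * The Bessel function *)

Definition E2 (a b u : R) : R := exp (- (a * exp u + b * exp (- u))).

(** A majorant for the Bessel integrals that factors in the two summation variables: the double
    exponential decay at both ends buys any power of [a] and of [b], and squares suffice for
    summation. *)
Lemma E2_bound (sg x : R) : 0 < x -> exists K, 0 < K /\ forall a b u, 1 <= a -> 1 <= b ->
  E2 a (b * x) u * exp (sg * u) <= K * Rpower a (- (2)) * Rpower b (- (2)) * exp (- (1) * Rabs u).
Proof.
  (* The factor in [a] yields [exp (- p u)] and that in [b] yields [exp (r u)]. With
     [r = p + 1 - sg] for [u <= 0] and [r = p - 1 - sg] for [u > 0] the total exponent is [u] or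
     [- u]; the 3 in [p] keeps both powers at least 2. *)
  intros hx. set (p := 3 + Rabs sg). pose proof (Rle_abs sg) as s1. pose proof (Rle_abs (- sg)) as s2. rewrite Rabs_Ropp in s2.
  set (kc := fun r => exp (r * ln r - r)). assert (hk : forall r, 0 < kc r) by (intros; apply exp_pos).
  set (K := fun r => kc p * (kc r * Rpower x (- r))).
  assert (hK : forall r, 0 < K r) by (intros; unfold K; repeat apply Rmult_lt_0_compat; auto; apply exp_pos).
  exists (K (p + 1 - sg) + K (p - 1 - sg)). split; [pose proof (hK (p + 1 - sg)); pose proof (hK (p - 1 - sg)); lra|].
  intros a b u ha hb.
  assert (B : forall r, 2 <= r -> E2 a (b * x) u * exp (sg * u) <= K r * Rpower a (- (2)) * Rpower b (- (2)) * exp ((r - p + sg) * u)).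
  { intros r hr. unfold E2. replace (- (a * exp u + b * x * exp (- u))) with (- (a * exp u) + - (b * x * exp (- u))) by ring.
    rewrite exp_plus.
    assert (d1 := exp_decay a p u ltac:(lra) ltac:(unfold p; lra)). assert (d2 := exp_decay (b * x) r (- u) ltac:(nra) ltac:(lra)).
    fold (kc p) in d1. fold (kc r) in d2. rewrite <- Rpower_mult_distr in d2 by lra.
    assert (r1 : Rpower a (- p) <= Rpower a (- (2))) by (apply Rle_Rpower; unfold p; lra).
    assert (r2 : Rpower b (- r) <= Rpower b (- (2))) by (apply Rle_Rpower; lra).
    assert (hA : 0 < Rpower a (- p)) by apply exp_pos. assert (hB : 0 < Rpower b (- r)) by apply exp_pos.
    assert (hX : 0 < Rpower x (- r)) by apply exp_pos.
    apply Rle_trans with ((kc p * Rpower a (- (2)) * exp (- p * u)) * (kc r * (Rpower b (- (2)) * Rpower x (- r)) * exp (- r * - u)) * exp (sg * u)).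
    - apply Rmult_le_compat_r; [apply exp_ge0|]. apply Rmult_le_compat; try (apply exp_ge0).
      + eapply Rle_trans; [exact d1|]. apply Rmult_le_compat_r; [apply exp_ge0|]. apply Rmult_le_compat_l; [left; auto|auto].
      + eapply Rle_trans; [exact d2|]. apply Rmult_le_compat_r; [apply exp_ge0|]. apply Rmult_le_compat_l; [left; auto|].
        apply Rmult_le_compat_r; lra.
    - right. replace ((r - p + sg) * u) with (- p * u + - r * - u + sg * u) by ring. rewrite !exp_plus. unfold K. ring. }
  pose proof (hK (p + 1 - sg)). pose proof (hK (p - 1 - sg)).
  assert (hA : 0 < Rpower a (- (2))) by apply exp_pos. assert (hB : 0 < Rpower b (- (2))) by apply exp_pos.
  assert (F : forall k, 0 < k -> k <= K (p + 1 - sg) + K (p - 1 - sg) -> k * Rpower a (- (2)) * Rpower b (- (2)) * exp (- (1) * Rabs u) <=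
    (K (p + 1 - sg) + K (p - 1 - sg)) * Rpower a (- (2)) * Rpower b (- (2)) * exp (- (1) * Rabs u)).
  { intros k hk1 hk2. repeat (apply Rmult_le_compat_r; [left; auto; apply exp_pos|]). auto. }
  destruct (Rle_or_lt u 0) as [h|h].
  - eapply Rle_trans; [apply (B (p + 1 - sg)); unfold p; lra|]. replace ((p + 1 - sg - p + sg) * u) with (- (1) * Rabs u) by (rewrite Rabs_left1 by lra; ring).
    apply F; lra.
  - eapply Rle_trans; [apply (B (p - 1 - sg)); unfold p; lra|]. replace ((p - 1 - sg - p + sg) * u) with (- (1) * Rabs u) by (rewrite Rabs_pos_eq by lra; ring).
    apply F; lra.
Qed.

Lemma rcont_E2 (a b t : R) : rcont (fun u => RtoC (E2 a b u)) t.
Proof. apply rcont_RtoC. unfold E2. deriv_cont. trivial. Qed.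

Lemma Dom_E2 (a b : R) (nu : C) : 0 < a -> 0 < b -> Dom (fun u => RtoC (E2 a b u) * cexp (nu * RtoC u))%C.
Proof.
  intros ha hb. set (k := Rmin a b). assert (hk : 0 < k) by (apply Rmin_pos; auto).
  set (p := Rabs (Re nu) + 1). set (K := exp (p * ln p - p) * Rpower k (- p)).
  assert (hp : 0 < p) by (unfold p; pose proof (Rabs_pos (Re nu)); lra).
  assert (ka : k <= a) by apply Rmin_l. assert (kb : k <= b) by apply Rmin_r.
  apply (Dom_two_sided (fun u => RtoC (E2 a b u)) K p p); [intros; apply rcont_E2| | |].
  - intros u _. rewrite Cmod_RtoC_pos by (apply exp_ge0). unfold E2, K.
    replace (p * u) with (- p * - u) by ring. eapply Rle_trans; [|apply exp_decay; auto].
    apply exp_le. pose proof (exp_pos u). pose proof (exp_pos (- u)). nra.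
  - intros u _. rewrite Cmod_RtoC_pos by (apply exp_ge0). unfold E2, K. eapply Rle_trans; [|apply exp_decay; auto].
    apply exp_le. pose proof (exp_pos u). pose proof (exp_pos (- u)). nra.
  - unfold p. pose proof (Rle_abs (Re nu)) as s1. pose proof (Rle_abs (- Re nu)) as s2. rewrite Rabs_Ropp in s2. lra.
Qed.

Lemma E2_cosh (z u : R) : E2 (z / 2) (z / 2) u = exp (- z * cosh u).
Proof. unfold E2, cosh. f_equal. field. Qed.

(** The integrand defining [BesselK] is half the sum of [f] and its reflection, so the half-line
    integral is half of the one over the whole line. *)
Lemma BesselK_integral (nu : C) (z : R) : 0 < z ->
  HI (fun u => RtoC (E2 (z / 2) (z / 2) u) * cexp (nu * RtoC u))%C (RtoC 2 * BesselK nu z)%C.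
Proof.
  intros hz. set (f := fun u => (RtoC (E2 (z / 2) (z / 2) u) * cexp (nu * RtoC u))%C).
  assert (D : Dom f) by (apply Dom_E2; lra). split; auto.
  set (g := fun t => Cmult (RtoC (exp (- z * cosh t))) (ccosh (Cmult nu (RtoC t)))).
  assert (fc := Dom_rcont f D).
  assert (G : forall t, g t = (RtoC (1 / 2) * (f t + f (- t)%R))%C).
  { intros t. unfold g, f, ccosh. rewrite <- E2_cosh.
    replace (E2 (z / 2) (z / 2) (- t)) with (E2 (z / 2) (z / 2) t) by (unfold E2; f_equal; rewrite Ropp_involutive; ring).
    rewrite RtoC_opp. replace (nu * - RtoC t)%C with (- (nu * RtoC t))%C by ring.
    unfold Rdiv. rewrite !RtoC_mult, RtoC_inv by lra. field. }
  assert (rc : forall t, rcont (fun u => f (- u)%R) t).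
  { intros t. apply (rcont_comp_r f (fun u => - u)); [deriv_cont; trivial|apply fc]. }
  assert (V : forall b, CInt g 0 b = (RtoC (1 / 2) * CInt f (- b) b)%C).
  { intros b. rewrite (CInt_ext g (fun t => RtoC (1 / 2) * (f t + f (- t)%R))%C) by (intros; apply G).
    rewrite CInt_scal by (intros t _; apply rcont_plus; auto). rewrite CInt_plus by (intros t _; auto).
    rewrite (CInt_reflect f 0 b) by auto. rewrite Ropp_0. rewrite <- (CInt_Chasles f (- b) 0 b) by (intros t _; auto). f_equal. ring. }
  assert (L : @is_RInt_gen C_R_NormedModule g (at_point 0) (Rbar_locally p_infty) (RtoC (1 / 2) * intR f)%C).
  { intros P [[eps he] HP]. destruct (Dom_isI f D eps he) as [M HM].
    apply (Filter_prod _ _ _ (fun a => a = 0) (fun b => M < b)); [reflexivity|exists M; auto|].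
    intros a b -> hb. exists (CInt g 0 b). split.
    - apply CInt_correct. intros t _. eapply rcont_ext; [intros; symmetry; apply G|].
      apply rcont_mult; [apply rcont_const|apply rcont_plus; auto].
    - apply HP. apply C_NormedModule_mixin_compat1. rewrite V.
      change (Cmod (RtoC (1 / 2) * CInt f (- b) b - RtoC (1 / 2) * intR f) < eps).
      replace (RtoC (1 / 2) * CInt f (- b) b - RtoC (1 / 2) * intR f)%C with (RtoC (1 / 2) * (CInt f (- b) b - intR f))%C by ring.
      rewrite Cmod_mult, Cmod_RtoC_pos by lra. specialize (HM (- b) b ltac:(lra) ltac:(lra)). lra. }
  unfold BesselK. fold g. rewrite (@is_RInt_gen_unique C_R_CompleteNormedModule _ _ _ _ _ _ L).
  rewrite Cmult_assoc, <- RtoC_mult. replace (2 * (1 / 2)) with 1 by field. ring.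
Qed.

(** Shifting [u] by half of [ln (b / a)] makes both coefficients equal to [sqrt (a b)]; the shift in
    the exponential factor produces the power of [b / a]. *)
Lemma E2_Bessel (a b : R) (nu : C) : 0 < a -> 0 < b ->
  HI (fun u => RtoC (E2 a b u) * cexp (nu * RtoC u))%C (RtoC 2 * cpow (b / a) (nu / RtoC 2) * BesselK nu (2 * sqrt (a * b)))%C.
Proof.
  intros ha hb. assert (hab : 0 < a * b) by nra. pose proof (sqrt_lt_R0 _ hab) as hs.
  set (z := 2 * sqrt (a * b)). set (c := ln (b / a) / 2). assert (hba : 0 < b / a) by (apply Rdiv_lt_0_compat; auto).
  assert (D := Dom_E2 a b nu ha hb). split; auto. rewrite <- (I_shift _ c D).
  assert (B := BesselK_integral nu z ltac:(unfold z; lra)). apply (HI_scal (cpow (b / a) (nu / RtoC 2))) in B.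
  refine (eq_trans _ (proj2 (HI_ext _ _ _ _ _ _ B))); [reflexivity| |ring].
  intros u. cbv beta.
  assert (E : E2 (z / 2) (z / 2) u = E2 a b (u + c)).
  { unfold E2. f_equal. f_equal. rewrite Ropp_plus_distr, !exp_plus.
    assert (c1 : exp c * exp c = b / a) by (rewrite <- exp_plus; unfold c; replace (ln (b / a) / 2 + ln (b / a) / 2) with (ln (b / a)) by field; apply exp_ln; auto).
    assert (c2 : sqrt (a * b) = a * exp c).
    { apply Rsqr_inj; [lra|pose proof (exp_pos c); nra|]. rewrite Rsqr_sqrt by lra. unfold Rsqr.
      replace (a * exp c * (a * exp c)) with (a * a * (exp c * exp c)) by ring. rewrite c1. field. lra. }
    assert (c3 : b * exp (- c) = a * exp c).
    { rewrite exp_Ropp. pose proof (exp_pos c). replace b with (a * (b / a)) by (field; lra). rewrite <- c1. field. lra. }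
    unfold z. replace (2 * sqrt (a * b) / 2) with (sqrt (a * b)) by field.
    replace (b * (exp (- u) * exp (- c))) with (exp (- u) * (b * exp (- c))) by ring. rewrite c3, c2. ring. }
  rewrite E, RtoC_plus, Cmult_plus_distr_l, cexp_plus. unfold cpow.
  replace (nu / RtoC 2 * RtoC (ln (b / a)))%C with (nu * RtoC c)%C; [ring|].
  unfold c, Rdiv. rewrite !RtoC_mult, RtoC_inv by lra. field.
Qed.

Lemma ex_series_Rpower_INR (c p : R) : 1 < p -> ex_series (fun n => c * Rpower (INR (S n)) (- p)).
Proof. intros. apply ex_series_scalR, ex_series_Rpower. auto. Qed.

Lemma ex_series_Cmod_le (a : nat -> C) (b : nat -> R) (l : R) : (forall n, Cmod (a n) <= b n) -> is_series b l ->
  ex_series (fun n => Cmod (a n)).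
Proof.
  intros H S. apply (@ex_series_le R_AbsRing R_CompleteNormedModule _ b); [|exists l; auto].
  intros n. change (Rabs (Cmod (a n)) <= b n). rewrite Rabs_pos_eq by apply Cmod_ge_0. auto.
Qed.

Lemma INR_ge1 (d : nat) : (1 <= d)%nat -> 1 <= INR d.
Proof. apply (le_INR 1). Qed.

Lemma Dom_reflect (f : R -> C) : Dom f -> Dom (fun t => f (- t)).
Proof.
  intros (M & d & Hc & hd & H). exists M, d. split; [|split]; auto.
  - intros t. apply (rcont_comp_r f (fun u => - u)); [deriv_cont; trivial|apply Hc].
  - intros t. rewrite <- (Rabs_Ropp t). apply H.
Qed.

Lemma ccos_hpi_opp (z : C) : ccos (hpi (- z)) = ccos (hpi z).
Proof.
  unfold ccos, hpi. replace (Ci * (RtoC PI * - z / RtoC 2))%C with (- (Ci * (RtoC PI * z / RtoC 2)))%C by (field; apply C2_neq0).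
  set (w := (Ci * (RtoC PI * z / RtoC 2))%C). replace (- - w)%C with w by ring. f_equal. ring.
Qed.

(** The substitution [v -> x / v] in [Df_mellin] at [s = - nu]; there [1 - s = nu + 1] is in the
    half-plane of the Dirichlet series of [zeta]. *)
Lemma Df_mellin_inv (x : R) (nu : C) : 0 < x -> 0 < Re nu < 1 ->
  HI (fun u => RtoC (Df (x * exp (- u))) * cexp (nu * RtoC u))%C (cpow x nu * (zeta (nu + RtoC 1) / (RtoC 2 * ccos (hpi nu))))%C.
Proof.
  intros hx hnu. destruct (Df_mellin (- nu)%C ltac:(rewrite Re_opp; lra)) as [D S].
  assert (nc : ccos (hpi nu) <> RtoC 0) by (apply ccos_hpi_neq0; apply Rabs_def1; lra).
  assert (Z : mel (fun u => RtoC (Df (exp u))) (- nu) = (zeta (nu + RtoC 1) / (RtoC 2 * ccos (hpi nu)))%C).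
  { assert (E : (RtoC 2 * ccos (hpi (- nu)) * mel (fun u => RtoC (Df (exp u))) (- nu))%C = zeta (nu + RtoC 1)).
    { apply (Cser_unique _ _ _ S). eapply Cser_ext; [|apply (proj2 zeta_spec); rewrite Re_plus, Re_RtoC; lra].
      intros n. unfold Dser. replace (RtoC 1 - - nu)%C with (nu + RtoC 1)%C by ring. ring. }
    rewrite <- E, ccos_hpi_opp. field. auto. }
  rewrite <- Z.
  assert (D1 := Dom_reflect _ D). assert (E1 := I_reflect _ D). cbv beta in D1, E1.
  assert (D2 := Dom_shift _ (- ln x) D1). assert (E2 := I_shift _ (- ln x) D1). cbv beta in D2, E2. rewrite E1 in E2.
  assert (H := HI_scal (cpow x nu) _ _ (conj D2 E2)). eapply HI_ext; [|reflexivity|exact H].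
  intros u. cbv beta. replace (- (u + - ln x)) with (- u + ln x) by ring. rewrite exp_plus, exp_ln by auto.
  rewrite (Rmult_comm (exp (- u)) x), RtoC_plus, RtoC_opp.
  replace (- nu * (- RtoC u + RtoC (ln x)))%C with (nu * RtoC u + - nu * RtoC (ln x))%C by ring.
  rewrite cexp_plus. fold (cpow x (- nu)). rewrite cpow_opp. field. apply cpow_neq0.
Qed.

(** * The integral of [A(v) B(x/v)]: Bessel series and product of partial fractions *)

Section Identity.
Variables (q : nat) (chi : Z -> C) (x : R).
Hypothesis Hprim : primitive_char q chi.
Hypothesis Hodd : odd_char chi.
Hypothesis hx : 0 < x.
Hypothesis Hne : forall m : nat, (0 < m)%nat -> INR q * x <> INR m.

Let chib := conj_char chi.
Let Hd : dirichlet_char q chi := proj1 Hprim.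
Let Hdb : dirichlet_char q chib := conj_char_dirichlet q chi (proj1 Hprim).
Let hq : 0 < INR q := INRq_pos q chi Hd.
Let hq1 : 1 <= INR q := INR_ge1 q (char_q q chi Hd).
Let y : R := INR q * x.
Let hy : 0 < y := Rmult_lt_0_compat _ _ hq hx.

Definition Jint (nu : C) : C := mel (fun u => Afun q chi (exp u) * RtoC (Bf (x * exp (- u))))%C nu.

Lemma rcont_Bf_inv (t : R) : rcont (fun u => RtoC (Bf (x * exp (- u)))) t.
Proof.
  eapply rcont_ext; [|apply (rcont_Bf_exp x (-1) t hx)]. intros u. cbv beta. do 4 f_equal. ring.
Qed.

(** Both [A] and [B] are expanded in exponentials, and the pairs [(d, m)] are collected by their
    product [n = d m]. Absence of any condition on [nu] makes [Jint] entire. *)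
Lemma Jint_series (nu : C) : Dom (fun u => Afun q chi (exp u) * RtoC (Bf (x * exp (- u))) * cexp (nu * RtoC u))%C /\
  Cser (fun n => sigma_chi (- nu) chib (S n) * cpow (INR (S n)) (nu / RtoC 2) * BesselK nu (4 * PI * sqrt (INR (S n) * x)))%C
    (Jint nu / (RtoC 2 * cpow x (nu / RtoC 2)))%C.
Proof.
  pose proof PI2_1 as hpi0. destruct (E2_bound (Re nu) x hx) as (K & hK & HK).
  set (g := fun d m u => (chib (Z.of_nat d) * (RtoC (E2 (2 * PI * INR d) (2 * PI * INR m * x) u) * cexp (nu * RtoC u)))%C).
  set (h := fun d m => (chib (Z.of_nat d) * (RtoC 2 * cpow (2 * PI * INR m * x / (2 * PI * INR d)) (nu / RtoC 2)
     * BesselK nu (2 * sqrt (2 * PI * INR d * (2 * PI * INR m * x)))))%C).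
  destruct (I_dconv g h (fun d => K * Rpower (INR d) (- (2))) (fun m => 1 * Rpower (INR m) (- (2))) 1
    (fun u => Afun q chi (exp u) * RtoC (Bf (x * exp (- u))) * cexp (nu * RtoC u))%C) as [D S].
  - lra.
  - intros d. apply Rmult_le_pos; [lra|apply exp_ge0].
  - intros d. apply Rmult_le_pos; [lra|apply exp_ge0].
  - apply ex_series_Rpower_INR. lra.
  - apply ex_series_Rpower_INR. lra.
  - intros d m hd hm. apply INR_ge1 in hd, hm. apply HI_scal. apply E2_Bessel; [nra|apply Rmult_lt_0_compat; nra].
  - intros d m u hd hm. apply INR_ge1 in hd, hm. unfold g.
    rewrite !Cmod_mult, Cmod_cexp, Re_scalr, Cmod_RtoC_pos by (apply exp_ge0).
    pose proof (char_le1 q chib Hdb (Z.of_nat d)) as c1. pose proof (Cmod_ge_0 (chib (Z.of_nat d))) as c0.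
    specialize (HK (INR d) (INR m) u hd hm).
    assert (E : E2 (2 * PI * INR d) (2 * PI * INR m * x) u <= E2 (INR d) (INR m * x) u).
    { apply exp_le. pose proof (exp_pos u). pose proof (exp_pos (- u)).
      assert (0 < INR d * exp u) by nra. assert (0 < INR m * x * exp (- u)) by (apply Rmult_lt_0_compat; nra). nra. }
    assert (0 < E2 (2 * PI * INR d) (2 * PI * INR m * x) u) by apply exp_pos. pose proof (exp_pos (Re nu * u)).
    apply Rle_trans with (1 * (E2 (INR d) (INR m * x) u * exp (Re nu * u))).
    + apply Rmult_le_compat; auto; nra.
    + rewrite Rmult_1_l. eapply Rle_trans; [exact HK|]. right. ring.
  - intros u. apply rcont_mult; [|apply rcont_expi]. apply rcont_mult; [apply (rcont_A q chi Hprim)|apply rcont_Bf_inv].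
  - intros u. assert (hw : 0 < x * exp (- u)) by (apply Rmult_lt_0_compat; [auto|apply exp_pos]).
    assert (SA := Af_series q chi Hprim Hodd (exp u) (exp_pos u)). assert (SB := Cser_RtoC _ _ (Bf_series _ hw)).
    assert (P := dconv_series (fun d => chib (Z.of_nat d) * RtoC (exp (- (2 * PI * exp u) * INR d)))%C
      (fun m => RtoC (exp (- (2 * PI * (x * exp (- u))) * INR m))) _ _ SA SB).
    assert (P' := Cser_scal (cexp (nu * RtoC u)) _ _ (P ltac:(eapply ex_series_Cmod_le; [|apply (Bf_series (exp u) (exp_pos u))];
        intros n; rewrite Cmod_mult, Cmod_RtoC_pos by (apply exp_ge0);
        pose proof (char_le1 q chib Hdb (Z.of_nat (S n))); pose proof (exp_pos (- (2 * PI * exp u) * INR (S n))); unfold ik; nra)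
      ltac:(eapply ex_series_Cmod_le; [|apply (Bf_series _ hw)]; intros n; rewrite Cmod_RtoC_pos by (apply exp_ge0); apply Rle_refl))).
    rewrite (Cmult_comm (cexp (nu * RtoC u)) (Afun q chi (exp u) * RtoC (Bf (x * exp (- u))))) in P'.
    eapply Cser_ext; [|exact P']. intros n. cbv beta. rewrite <- dconv_scal. apply dconv_ext; [lia|]. intros d m _ _ _.
    unfold g, E2. replace (- (2 * PI * INR d * exp u + 2 * PI * INR m * x * exp (- u))) with
      (- (2 * PI * exp u) * INR d + - (2 * PI * (x * exp (- u))) * INR m) by ring. rewrite exp_plus, RtoC_mult. ring.
  - split; auto. pose proof (cpow_neq0 x (nu / RtoC 2)) as nx.
    replace (Jint nu / (RtoC 2 * cpow x (nu / RtoC 2)))%C with (/ (RtoC 2 * cpow x (nu / RtoC 2)) * Jint nu)%C by (field; auto).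
    apply (Cser_scal (/ (RtoC 2 * cpow x (nu / RtoC 2)))%C) in S. eapply Cser_ext; [|exact S]. intros n. cbv beta.
    set (N := Datatypes.S n).
    transitivity ((cpow (INR N) (nu / RtoC 2) * BesselK nu (4 * PI * sqrt (INR N * x))) *
      dconv (fun d m => cpow (INR d) (- nu) * chib (Z.of_nat d))%C N)%C;
      [|change (sigma_chi (- nu) chib N) with (dconv (fun d m => cpow (INR d) (- nu) * chib (Z.of_nat d))%C N); ring].
    rewrite <- !dconv_scal. apply dconv_ext; [unfold N; lia|]. intros d m hd hm hdm. apply INR_ge1 in hd, hm.
    assert (EN : INR N = INR d * INR m) by (rewrite <- hdm, mult_INR; reflexivity). unfold h.
    replace (2 * PI * INR d * (2 * PI * INR m * x)) with ((2 * PI) * (2 * PI) * (INR N * x)) by (rewrite EN; ring).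
    assert (0 < INR N * x) by (rewrite EN; apply Rmult_lt_0_compat; nra).
    rewrite sqrt_mult, sqrt_square by nra. replace (2 * (2 * PI * sqrt (INR N * x))) with (4 * PI * sqrt (INR N * x)) by ring.
    (* [m x / d = n x / d^2], whose power [nu/2] separates into [n^(nu/2) x^(nu/2)] and the weight
       [d^(- nu)] of [sigma_chi]. *)
    replace (2 * PI * INR m * x / (2 * PI * INR d)) with ((INR N * x) / (INR d * INR d)) by (rewrite EN; field; lra).
    assert (0 < INR N) by (rewrite EN; nra).
    rewrite cpow_div, !cpow_mult, cpow_opp by nra.
    replace (cpow (INR d) nu) with (cpow (INR d) (nu / RtoC 2) * cpow (INR d) (nu / RtoC 2))%C
      by (rewrite <- cpow_plus; f_equal; field; apply C2_neq0).
    pose proof (cpow_neq0 (INR d) (nu / RtoC 2)). field. auto.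
Qed.

Lemma Jint_holo (nu : C) : holo_at Jint nu.
Proof. apply mel_holo. apply Jint_series. Qed.

Lemma nm_neq (d m : nat) : (1 <= d)%nat -> (1 <= m)%nat -> (INR d * INR m) ^ 2 - y ^ 2 <> 0.
Proof.
  intros hd hm e. assert (h := Hne (d * m) ltac:(nia)). rewrite mult_INR in h. apply INR_ge1 in hd, hm.
  apply h. fold y. assert (0 < INR d * INR m) by nra.
  assert ((INR d * INR m - y) * (INR d * INR m + y) = 0) by lra. apply Rmult_integral in H0. lra.
Qed.

(** With [v = exp u], [v^2/((m^2+q^2v^2)(x^2+d^2v^2)) = (m^2/(m^2+q^2v^2) - x^2/(x^2+d^2v^2))/(d^2m^2-q^2x^2)]. *)
Lemma product_term (d m : nat) (nu : C) : (1 <= d)%nat -> (1 <= m)%nat -> Rabs (Re nu) < 1 ->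
  HI (fun u => RtoC (exp (2 * u) * (/ (INR m ^ 2 + INR q ^ 2 * exp (2 * u)) * / (x ^ 2 + INR d ^ 2 * exp (2 * u)))) * cexp ((nu + RtoC 1) * RtoC u))%C
    (RtoC (/ ((INR d * INR m) ^ 2 - y ^ 2)) * ((cpow (INR m / INR q) (nu + RtoC 1) - cpow (x / INR d) (nu + RtoC 1)) * (RtoC (PI / 2) / ccos (hpi nu))))%C.
Proof.
  intros hd hm hnu. pose proof (nm_neq d m hd hm) as hn. apply INR_ge1 in hd, hm.
  assert (R1 := rat_mellin (INR m) (INR q) nu ltac:(lra) hq hnu). assert (R2 := rat_mellin x (INR d) nu hx ltac:(lra) hnu).
  assert (E := HI_scal (RtoC (/ ((INR d * INR m) ^ 2 - y ^ 2))) _ _ (HI_minus _ _ _ _ (HI_scal (RtoC (INR m ^ 2)) _ _ R1) (HI_scal (RtoC (x ^ 2)) _ _ R2))).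
  assert (RtoC (INR m ^ 2) <> RtoC 0) by (apply RtoC_neq0; nra). assert (RtoC (x ^ 2) <> RtoC 0) by (apply RtoC_neq0; nra).
  assert (nc : ccos (hpi nu) <> RtoC 0) by (apply ccos_hpi_neq0; auto).
  eapply HI_ext; [| |exact E].
  - intros u. cbv beta. pose proof (exp_pos (2 * u)) as he.
    set (V := exp (2 * u)) in *. assert (0 < INR m ^ 2 + INR q ^ 2 * V) by (assert (0 < INR m ^ 2) by nra; assert (0 <= INR q ^ 2 * V) by nra; lra).
    assert (0 < x ^ 2 + INR d ^ 2 * V) by (assert (0 < x ^ 2) by nra; assert (0 <= INR d ^ 2 * V) by nra; lra).
    assert (Er : V * (/ (INR m ^ 2 + INR q ^ 2 * V) * / (x ^ 2 + INR d ^ 2 * V)) =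
      / ((INR d * INR m) ^ 2 - y ^ 2) * (INR m ^ 2 * / (INR m ^ 2 + INR q ^ 2 * V) - x ^ 2 * / (x ^ 2 + INR d ^ 2 * V))).
    { unfold y in *. field. repeat split; lra. }
    rewrite Er, RtoC_mult, RtoC_minus, !RtoC_mult. ring.
  - rewrite !RtoC_inv by nra. field. repeat split; auto. intros e. apply hn. apply (f_equal Re) in e. rewrite !Re_RtoC in e. exact e.
Qed.

(** [rat_bound] is used on each factor: exponent [2 - e] for the one in [d], and [1 + sg] or
    [1 + sg + 2 e] for the one in [m], according to the sign of [u]. The choice [e = (1 - sg) / 3]
    makes both resulting powers of [d] and [m] summable. *)
Lemma product_bound (sg : R) : 0 < sg < 1 -> exists K e, 0 < K /\ 0 < e /\ e < (1 - sg) / 2 /\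
  forall d m u, (1 <= d)%nat -> (1 <= m)%nat ->
  / INR m * (exp (2 * u) * (/ (INR m ^ 2 + INR q ^ 2 * exp (2 * u)) * / (x ^ 2 + INR d ^ 2 * exp (2 * u)))) * exp ((sg + 1) * u) <=
  K * Rpower (INR d) (- (2 - e)) * Rpower (INR m) (- (2 - sg - 2 * e)) * exp (- e * Rabs u).
Proof.
  intros hs. set (e := (1 - sg) / 3). set (p' := 2 - e).
  assert (he : 0 < e < 1 / 3) by (unfold e; lra).
  exists (/ x ^ 2 * Rpower x p'), e. assert (hx2 : 0 < / x ^ 2) by (apply Rinv_0_lt_compat; nra).
  assert (hxp : 0 < Rpower x p') by apply exp_pos.
  split; [nra|]. split; [lra|]. split; [unfold e; lra|].
  intros d m u hd hm. apply INR_ge1 in hd, hm.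
  assert (B : forall p, 0 <= p <= 1 + sg + 2 * e ->
    / INR m * (exp (2 * u) * (/ (INR m ^ 2 + INR q ^ 2 * exp (2 * u)) * / (x ^ 2 + INR d ^ 2 * exp (2 * u)))) * exp ((sg + 1) * u) <=
    / x ^ 2 * Rpower x p' * Rpower (INR d) (- p') * Rpower (INR m) (- (2 - sg - 2 * e)) * exp ((3 + sg - p - p') * u)).
  { intros p hp. destruct (rat_bound (INR m) (INR q) p u ltac:(lra) hq ltac:(unfold e in *; lra)) as [a1 a2].
    destruct (rat_bound x (INR d) p' u hx ltac:(lra) ltac:(unfold p'; lra)) as [b1 b2].
    assert (c : / INR m ^ 2 * Rpower (INR m / INR q) p * exp (- p * u) <= INR m * Rpower (INR m) (- (2 - sg - 2 * e)) * exp (- p * u)).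
    { apply Rmult_le_compat_r; [apply exp_ge0|].
      replace (/ INR m ^ 2) with (Rpower (INR m) (- (2))) by (rewrite Rpower_Ropp; f_equal; replace 2 with (INR 2) by (simpl; ring); apply Rpower_pow; lra).
      rewrite <- (Rpower_1 (INR m)) at 3 by lra. rewrite <- Rpower_plus.
      replace (1 + - (2 - sg - 2 * e)) with (- (2) + (1 + sg + 2 * e)) by ring. rewrite Rpower_plus.
      apply Rmult_le_compat_l; [apply exp_ge0|].
      apply Rle_trans with (Rpower (INR m) p); [|apply Rle_Rpower; lra].
      apply Rle_Rpower_l; [lra|]. split; [apply Rdiv_lt_0_compat; lra|]. apply Rmult_le_reg_r with (INR q); [auto|].
      unfold Rdiv. rewrite Rmult_assoc, Rinv_l by lra. nra. }
    assert (f : / x ^ 2 * Rpower (x / INR d) p' = / x ^ 2 * Rpower x p' * Rpower (INR d) (- p')).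
    { unfold Rdiv. rewrite <- Rpower_mult_distr by (try apply Rinv_0_lt_compat; lra). rewrite Rpower_Ropp.
      replace (Rpower (/ INR d) p') with (/ Rpower (INR d) p'); [ring|].
      rewrite <- Rpower_Ropp. unfold Rpower. rewrite ln_Rinv by lra. f_equal. ring. }
    rewrite f in b2. assert (him : 0 < / INR m) by (apply Rinv_0_lt_compat; lra).
    apply Rle_trans with (/ INR m * (exp (2 * u) * ((INR m * Rpower (INR m) (- (2 - sg - 2 * e)) * exp (- p * u)) *
      (/ x ^ 2 * Rpower x p' * Rpower (INR d) (- p') * exp (- p' * u)))) * exp ((sg + 1) * u)).
    - apply Rmult_le_compat_r; [apply exp_ge0|]. apply Rmult_le_compat_l; [lra|]. apply Rmult_le_compat_l; [apply exp_ge0|].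
      apply Rmult_le_compat; lra.
    - right. replace ((3 + sg - p - p') * u) with (2 * u + - p * u + - p' * u + (sg + 1) * u) by ring. rewrite !exp_plus. field. lra. }
  destruct (Rle_or_lt u 0) as [h|h].
  - replace (- e * Rabs u) with ((3 + sg - (1 + sg) - p') * u) by (rewrite Rabs_left1 by lra; unfold p'; ring). apply B. lra.
  - replace (- e * Rabs u) with ((3 + sg - (1 + sg + 2 * e) - p') * u) by (rewrite Rabs_pos_eq by lra; unfold p'; ring). apply B. lra.
Qed.

Definition S2term (N : nat) (nu : C) (n : nat) : C :=
  (sigma_bar_chi (- nu) chi (S n) / RtoC (INR (S n)) *
   ((cpow (INR (S n)) (nu + RtoC 1 - RtoC (2 * INR N)) - cpow y (nu + RtoC 1 - RtoC (2 * INR N))) / RtoC (INR (S n) ^ 2 - y ^ 2)))%C.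

(** The two partial fraction series are multiplied and arranged by [d m]; each product of rational
    functions splits into two, whose transforms give the difference of powers in [S2term]. *)
Lemma product_mellin (nu : C) : 0 < Re nu < 1 -> exists S2,
  Cser (S2term 0 nu) S2 /\
  HI (fun u => (Afun q chi (exp u) - A0 q chi) * RtoC (Df (x * exp (- u))) * cexp (nu * RtoC u))%C
    (- (kap q chi * cpow (INR q) (- nu) * RtoC y / (RtoC 2 * ccos (hpi nu)) * S2))%C.
Proof.
  intros hnu. pose proof PI_RGT_0 as hpi0. pose proof (kap_neq0 q chi Hprim Hodd) as nk.
  assert (hnu' : Rabs (Re nu) < 1) by (apply Rabs_def1; lra).
  assert (nc : ccos (hpi nu) <> RtoC 0) by (apply ccos_hpi_neq0; auto).
  destruct (product_bound (Re nu) hnu) as (K & e & hK & he & he2 & HB).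
  (* The constants of both expansions: [- kap q^2] from [A - A0] and [x / PI] from [D] at
     [w = x / v]. *)
  set (c0 := (- kap q chi * RtoC (INR q ^ 2 * x / PI))%C).
  set (g := fun (d m : nat) u => (c0 * chi (Z.of_nat m) * RtoC (/ INR m) * (RtoC (exp (2 * u) * (/ (INR m ^ 2 + INR q ^ 2 * exp (2 * u)) * / (x ^ 2 + INR d ^ 2 * exp (2 * u)))) * cexp ((nu + RtoC 1) * RtoC u)))%C).
  set (h := fun d m => (c0 * chi (Z.of_nat m) * RtoC (/ INR m) * (RtoC (/ ((INR d * INR m) ^ 2 - y ^ 2)) * ((cpow (INR m / INR q) (nu + RtoC 1) - cpow (x / INR d) (nu + RtoC 1)) * (RtoC (PI / 2) / ccos (hpi nu)))))%C).
  set (F := fun u => ((Afun q chi (exp u) - A0 q chi) * RtoC (Df (x * exp (- u))) * cexp (nu * RtoC u))%C).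
  destruct (I_dconv g h (fun d => Cmod c0 * K * Rpower (INR d) (- (2 - e))) (fun m => 1 * Rpower (INR m) (- (2 - Re nu - 2 * e))) e F) as [D S].
  - lra.
  - intros d. apply Rmult_le_pos; [pose proof (Cmod_ge_0 c0); nra|apply exp_ge0].
  - intros d. apply Rmult_le_pos; [lra|apply exp_ge0].
  - apply ex_series_Rpower_INR. lra.
  - apply ex_series_Rpower_INR. lra.
  - intros d m hd hm. apply HI_scal. apply product_term; auto.
  - intros d m u hd hm. specialize (HB d m u hd hm). apply INR_ge1 in hd, hm. unfold g. clearbody c0.
    assert (0 < / INR m) by (apply Rinv_0_lt_compat; lra).
    assert (0 < exp (2 * u) * (/ (INR m ^ 2 + INR q ^ 2 * exp (2 * u)) * / (x ^ 2 + INR d ^ 2 * exp (2 * u)))).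
    { pose proof (exp_pos (2 * u)). repeat apply Rmult_lt_0_compat; auto; apply Rinv_0_lt_compat; apply Rplus_lt_0_compat; try nra;
        apply Rmult_lt_0_compat; auto; nra. }
    rewrite !Cmod_mult, Cmod_cexp, Re_scalr, !Cmod_RtoC_pos, Re_plus, Re_RtoC by lra.
    pose proof (char_le1 q chi Hd (Z.of_nat m)) as c1. pose proof (Cmod_ge_0 (chi (Z.of_nat m))) as c2.
    set (X := / INR m * (exp (2 * u) * (/ (INR m ^ 2 + INR q ^ 2 * exp (2 * u)) * / (x ^ 2 + INR d ^ 2 * exp (2 * u)))) * exp ((Re nu + 1) * u)) in *.
    assert (hX : 0 < X) by (apply Rmult_lt_0_compat; [apply Rmult_lt_0_compat; auto|apply exp_pos]).
    apply Rle_trans with (Cmod c0 * (1 * X)).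
    + apply Rle_trans with (Cmod c0 * (Cmod (chi (Z.of_nat m)) * X)); [right; unfold X; ring|].
      apply Rmult_le_compat_l; [apply Cmod_ge_0|]. apply Rmult_le_compat_r; lra.
    + rewrite Rmult_1_l. eapply Rle_trans; [apply Rmult_le_compat_l; [apply Cmod_ge_0|exact HB]|]. right. ring.
  - intros t. unfold F. apply rcont_mult; [|apply rcont_expi]. apply rcont_mult.
    + apply rcont_minus; [apply (rcont_A q chi Hprim)|apply rcont_const].
    + apply (rcont_ext (fun u => RtoC (Bf (x * exp (- u))) + RtoC (- / (2 * PI * (x * exp (- u))) + 1 / 2))%C).
      * intros u. cbv beta. unfold Df. rewrite <- RtoC_plus. f_equal. ring.
      * apply rcont_plus; [apply rcont_Bf_inv|]. apply rcont_RtoC. deriv_cont.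
        pose proof (exp_pos (- t)). assert (0 < x * exp (- t)) by nra. nra.
  - intros u. pose proof (exp_pos u) as hu. assert (hw : 0 < x * exp (- u)) by (apply Rmult_lt_0_compat; [auto|apply exp_pos]).
    assert (SB := Df_series _ hw).
    assert (SA := Afun_partial_fractions q chi Hprim Hodd (exp u) hu).
    assert (P := dconv_series (fun d => RtoC (x * exp (- u) / PI * / (INR d ^ 2 + (x * exp (- u)) ^ 2)))
      (fun m => chi (Z.of_nat m) * RtoC (/ (INR m * (INR m ^ 2 + (INR q * exp u) ^ 2))))%C _ _ (Cser_RtoC _ _ SB) SA).
    assert (hV : 0 < (INR q * exp u) ^ 2) by (apply pow_lt; nra).
    assert (P' := Cser_scal (- kap q chi * RtoC ((INR q * exp u) ^ 2) * cexp (nu * RtoC u))%C _ _ (P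
      ltac:(eapply ex_series_Cmod_le; [|exact SB]; intros n; pose proof (ik_ge1 n); rewrite Cmod_RtoC_pos; [apply Rle_refl|];
        left; apply Rmult_lt_0_compat; [apply Rdiv_lt_0_compat; lra|apply Rinv_0_lt_compat; unfold ik in *; nra])
      ltac:(eapply ex_series_Cmod_le; [|apply Series_correct, ex_series_inv_sqr]; intros n; cbv beta; pose proof (ik_ge1 n) as hn; fold (ik n); rewrite Cmod_mult;
        assert (hden : ik n ^ 2 <= ik n * (ik n ^ 2 + (INR q * exp u) ^ 2)) by nra; assert (0 < ik n ^ 2) by nra;
        assert (i1 : / (ik n * (ik n ^ 2 + (INR q * exp u) ^ 2)) <= / ik n ^ 2) by (apply Rinv_le_contravar; lra);
        assert (i2 : 0 < / (ik n * (ik n ^ 2 + (INR q * exp u) ^ 2))) by (apply Rinv_0_lt_compat; lra);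
        rewrite Cmod_RtoC_pos by lra; pose proof (char_le1 q chi Hd (Z.of_nat (S n))); pose proof (Cmod_ge_0 (chi (Z.of_nat (S n)))); nra))).
    assert (nV : RtoC ((INR q * exp u) ^ 2) <> RtoC 0) by (apply RtoC_neq0; lra).
    match type of P' with Cser _ ?l => replace l with (F u) in P' by (unfold F; field; split; auto) end.
    eapply Cser_ext; [|exact P']. intros n. cbv beta. rewrite <- dconv_scal. apply dconv_ext; [lia|]. intros d m hd hm _.
    apply INR_ge1 in hd, hm. unfold g, c0. rewrite cexp_shift, Rmult_1_l, exp_double, exp_Ropp.
    assert (Er : (INR q * exp u) ^ 2 * (x * / exp u / PI * / (INR d ^ 2 + (x * / exp u) ^ 2) * / (INR m * (INR m ^ 2 + (INR q * exp u) ^ 2))) =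
      INR q ^ 2 * x / PI * / INR m * (exp u ^ 2 * (/ (INR m ^ 2 + INR q ^ 2 * exp u ^ 2) * / (x ^ 2 + INR d ^ 2 * exp u ^ 2))) * exp u).
    { assert (0 < exp u ^ 2) by nra. assert (0 < INR q ^ 2 * exp u ^ 2) by (apply Rmult_lt_0_compat; nra). assert (0 < INR d ^ 2 * exp u ^ 2) by (apply Rmult_lt_0_compat; nra). field. repeat split; nra. }
    apply (f_equal RtoC) in Er. rewrite !RtoC_mult in Er.
    match type of Er with ?a = ?b => transitivity (- kap q chi * chi (Z.of_nat m) * cexp (nu * RtoC u) * a)%C; [rewrite !RtoC_mult; ring|rewrite Er, !RtoC_mult; ring] end.
  (* The factor [pf] is nonzero, so dividing by it shows convergence of the last sum together with
     its value. *)
  - set (pf := (- (kap q chi * cpow (INR q) (- nu) * RtoC y / (RtoC 2 * ccos (hpi nu))))%C).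
    pose proof C2_neq0 as n2. pose proof (cpow_neq0 (INR q) nu) as nqn.
    assert (nqR : RtoC (INR q) <> RtoC 0) by (apply RtoC_neq0; lra). assert (nxR : RtoC x <> RtoC 0) by (apply RtoC_neq0; lra).
    assert (npf : pf <> RtoC 0).
    { unfold pf, y. rewrite cpow_opp, RtoC_mult. intros E.
      assert (E' : (kap q chi)%C = RtoC 0); [|auto].
      replace (kap q chi) with (- (- (kap q chi * / cpow (INR q) nu * (RtoC (INR q) * RtoC x) / (RtoC 2 * ccos (hpi nu)))) *
        (RtoC 2 * ccos (hpi nu)) * cpow (INR q) nu / (RtoC (INR q) * RtoC x))%C by (field; repeat split; auto).
      rewrite E. field. repeat split; auto. }
    exists (/ pf * intR F)%C. split.
    + apply (Cser_scal (/ pf)%C) in S. eapply Cser_ext; [|exact S]. intros n. cbv beta. unfold S2term. set (N := Datatypes.S n).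
      transitivity ((/ RtoC (INR N) * ((cpow (INR N) (nu + RtoC 1 - RtoC (2 * INR 0)) - cpow y (nu + RtoC 1 - RtoC (2 * INR 0))) / RtoC (INR N ^ 2 - y ^ 2))) *
        dconv (fun d m => cpow (INR d) (- nu) * chi (Z.of_nat m))%C N)%C;
        [|change (sigma_bar_chi (- nu) chi N) with (dconv (fun d m => cpow (INR d) (- nu) * chi (Z.of_nat m))%C N); unfold Cdiv; ring].
      rewrite <- !dconv_scal. apply dconv_ext; [unfold N; lia|]. intros d m hd hm hdm. pose proof (nm_neq d m hd hm) as hnm. apply INR_ge1 in hd, hm.
      assert (EN : INR N = INR d * INR m) by (rewrite <- hdm, mult_INR; reflexivity). unfold h, pf, c0.
      replace (nu + RtoC 1 - RtoC (2 * INR 0))%C with (nu + RtoC 1)%C by (simpl; rewrite Rmult_0_r; ring).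
      rewrite EN. unfold y in *. rewrite !cpow_div, !cpow_mult by lra. rewrite !cpow_plus, !cpow_one, !cpow_opp by lra.
      pose proof (cpow_neq0 (INR d) nu).
      assert (RtoC (INR d) <> RtoC 0) by (apply RtoC_neq0; lra). assert (RtoC (INR m) <> RtoC 0) by (apply RtoC_neq0; lra).
      assert (RtoC PI <> RtoC 0) by (apply RtoC_neq0; lra).
      assert (nn : RtoC ((INR d * INR m) ^ 2 - (INR q * x) ^ 2) <> RtoC 0) by (apply RtoC_neq0; auto).
      unfold Rdiv. rewrite !RtoC_inv by (auto; lra). set (W := RtoC ((INR d * INR m) ^ 2 - (INR q * x) ^ 2)) in *.
      rewrite !RtoC_mult, !RtoC_inv, RtoC_pow by lra. field. repeat split; auto.
    + eapply HI_ext; [reflexivity| |apply (HI_I F D)]. transitivity (pf * (/ pf * intR F))%C; [field; auto|].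
      generalize (/ pf * intR F)%C. intros S2. unfold pf, Cdiv. ring.
Qed.

End Identity.

(** For [n > 2 y] one has [n^2 <= 2 (n^2 - y^2)]; the finitely many other [n] contribute to the
    constant, each difference being nonzero since [y] is not an integer. *)
Lemma sqr_gap (y : R) : 0 < y -> (forall m : nat, (0 < m)%nat -> y <> INR m) ->
  exists c, 0 < c /\ forall n : nat, (1 <= n)%nat -> / Rabs (INR n ^ 2 - y ^ 2) <= c * / INR n ^ 2.
Proof.
  intros hy Hne.
  assert (pos : forall n : nat, (1 <= n)%nat -> 0 < Rabs (INR n ^ 2 - y ^ 2)).
  { intros n hn. apply Rabs_pos_lt. intros e. pose proof (Hne n ltac:(lia)). pose proof (INR_ge1 n hn).
    assert (E : (INR n - y) * (INR n + y) = 0) by lra. apply Rmult_integral in E. lra. }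
  assert (F : forall K : nat, exists c, 0 < c /\ forall n : nat, (1 <= n <= K)%nat -> INR n ^ 2 <= c * Rabs (INR n ^ 2 - y ^ 2)).
  { induction K as [|K (c & hc & Hc)]; [exists 1; split; [lra|intros; lia]|].
    set (b := INR (S K) ^ 2 / Rabs (INR (S K) ^ 2 - y ^ 2)). assert (pK := pos (S K) ltac:(lia)).
    assert (hb : 0 <= b) by (apply Rmult_le_pos; [nra|left; apply Rinv_0_lt_compat; auto]).
    exists (c + b). split; [lra|]. intros n hn. destruct (Nat.eq_dec n (S K)) as [->|].
    - apply Rle_trans with (b * Rabs (INR (S K) ^ 2 - y ^ 2)); [right; unfold b; field; lra|]. apply Rmult_le_compat_r; lra.
    - pose proof (pos n ltac:(lia)). pose proof (Hc n ltac:(lia)). nra. }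
  destruct (archimed (2 * y)) as [ar _]. destruct (F (Z.to_nat (up (2 * y)))) as (c & hc & Hc).
  exists (c + 2). split; [lra|]. intros n hn. pose proof (pos n hn) as p. pose proof (INR_ge1 n hn) as h1.
  assert (G : INR n ^ 2 <= (c + 2) * Rabs (INR n ^ 2 - y ^ 2)).
  { destruct (Nat.le_gt_cases n (Z.to_nat (up (2 * y)))) as [h|h].
    - specialize (Hc n ltac:(lia)). nra.
    - apply lt_INR in h. rewrite (INR_IZR_INZ (Z.to_nat _)), Z2Nat.id in h by (apply le_IZR; lra).
      pose proof (Rle_abs (INR n ^ 2 - y ^ 2)). assert (INR n ^ 2 <= 2 * (INR n ^ 2 - y ^ 2)) by nra. nra. }
  apply Rmult_le_reg_r with (Rabs (INR n ^ 2 - y ^ 2)); [auto|]. rewrite Rinv_l by lra.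
  apply Rmult_le_reg_r with (INR n ^ 2); [nra|]. rewrite Rmult_1_l.
  replace ((c + 2) * / INR n ^ 2 * Rabs (INR n ^ 2 - y ^ 2) * INR n ^ 2) with ((c + 2) * Rabs (INR n ^ 2 - y ^ 2)) by (field; lra). auto.
Qed.

Lemma exp_weight (w : C) (l d : R) : 0 < d -> Cmod (cexp (w * RtoC l)) <= exp (Re w * l + d * Rabs l).
Proof. intros hd. rewrite Cmod_cexp, Re_scalr. apply exp_le. pose proof (Rabs_pos l). nra. Qed.

(** * Convergence and holomorphy in [nu] of the last sum *)

Section Continuation.
Variables (q : nat) (chi : Z -> C) (x : R).
Hypothesis Hprim : primitive_char q chi.
Hypothesis hx : 0 < x.
Hypothesis Hne : forall m : nat, (0 < m)%nat -> INR q * x <> INR m.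

Let Hd : dirichlet_char q chi := proj1 Hprim.
Let hq : 0 < INR q := INRq_pos q chi Hd.
Let y : R := INR q * x.
Let hy : 0 < y := Rmult_lt_0_compat _ _ hq hx.

Section Weights.
Variables (N : nat).
Let k1 : R := 1 - 2 * INR N.

Definition S2coef (d m : nat) : C := (chi (Z.of_nat m) * RtoC (/ (INR d * INR m * ((INR d * INR m) ^ 2 - y ^ 2))))%C.
(** The contribution of the pair [(d, m)] to [S2term]. After multiplication by [d^(- nu)] the powers
    of [d m] and of [y] become [m^nu] and [(y / d)^nu], so [nu] occurs only in two pure
    exponentials. *)
Definition S2g (d m : nat) (nu : C) : C :=
  (S2coef d m * (RtoC (Rpower (INR d * INR m) k1) * cexp (nu * RtoC (ln (INR m))) - RtoC (Rpower y k1) * cexp (nu * RtoC (ln (y / INR d)))))%C.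
Definition S2g' (w : C) (d m : nat) : C :=
  (S2coef d m * (RtoC (Rpower (INR d * INR m) k1) * (RtoC (ln (INR m)) * cexp (w * RtoC (ln (INR m))))
     - RtoC (Rpower y k1) * (RtoC (ln (y / INR d)) * cexp (w * RtoC (ln (y / INR d))))))%C.

Lemma S2term_dconv (nu : C) (n : nat) : S2term q chi x N nu n = dconv (fun d m => S2g d m nu) (S n).
Proof.
  unfold S2term. fold y. set (M := S n).
  transitivity ((/ RtoC (INR M) * ((cpow (INR M) (nu + RtoC 1 - RtoC (2 * INR N)) - cpow y (nu + RtoC 1 - RtoC (2 * INR N))) / RtoC (INR M ^ 2 - y ^ 2))) *
        dconv (fun d m => cpow (INR d) (- nu) * chi (Z.of_nat m))%C M)%C.
  { change (sigma_bar_chi (- nu) chi M) with (dconv (fun d m => cpow (INR d) (- nu) * chi (Z.of_nat m))%C M). unfold Cdiv. ring. }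
  rewrite <- !dconv_scal. apply dconv_ext; [unfold M; lia|]. intros d m hd hm hdm. pose proof (nm_neq q chi x Hprim hx Hne d m hd hm) as hnm. fold y in hnm.
  apply INR_ge1 in hd, hm. assert (EM : INR M = INR d * INR m) by (rewrite <- hdm, mult_INR; reflexivity).
  unfold S2g, S2coef. rewrite EM. fold (cpow (INR m) nu). fold (cpow (y / INR d) nu).
  replace (nu + RtoC 1 - RtoC (2 * INR N))%C with (nu + RtoC k1)%C by (unfold k1; rewrite RtoC_minus; ring).
  rewrite !cpow_plus, !cpow_RtoC, cpow_div, (cpow_mult (INR d) (INR m) nu), cpow_opp by lra.
  assert (n1 : RtoC ((INR d * INR m) ^ 2 - y ^ 2) <> RtoC 0) by (apply RtoC_neq0; auto).
  assert (n2 : RtoC (INR d * INR m) <> RtoC 0) by (apply RtoC_neq0; nra). pose proof (cpow_neq0 (INR d) nu).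
  rewrite RtoC_inv by (apply Rmult_integral_contrapositive_currified; [nra|auto]).
  rewrite (RtoC_mult (INR d * INR m) (_ - _)). field. repeat split; auto.
Qed.

(** Arbitrary [a1] and [a2] of weighted exponential size make the same estimate serve for terms,
    derivatives and second-order remainders. The upper limit [2 N + 1] comes from summability in [m]
    of the first part, [m^(sg + del - 2 N - 2)]; the lower limit [-1] bounds [d^(- s)] by [d] in the
    second part. *)
Lemma S2_weight (sg del : R) : 0 < del -> -1 < sg - del -> sg + del < 2 * INR N + 1 ->
  exists K p, 0 < K /\ 1 < p /\ forall d m a1 a2, (1 <= d)%nat -> (1 <= m)%nat ->
    Cmod a1 <= exp (sg * ln (INR m) + del * Rabs (ln (INR m))) -> Cmod a2 <= exp (sg * ln (y / INR d) + del * Rabs (ln (y / INR d))) ->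
    Cmod (S2coef d m * (RtoC (Rpower (INR d * INR m) k1) * a1 - RtoC (Rpower y k1) * a2)) <= K * Rpower (INR d) (- (2)) * Rpower (INR m) (- p).
Proof.
  intros hdel h1 h2. destruct (sqr_gap y hy Hne) as (c & hc & Hc).
  set (Y := Rpower y k1 * (Rpower y (sg + del) + Rpower y (sg - del))).
  assert (hY : 0 < Y) by (unfold Y; apply Rmult_lt_0_compat; [|apply Rplus_lt_0_compat]; apply exp_pos).
  set (p := Rmin (2 * INR N + 2 - sg - del) 2).
  exists (c * (1 + Y)), p. split; [nra|]. split; [unfold p; apply Rmin_glb_lt; lra|].
  intros d m a1 a2 hd hm H1 H2. assert (G := Hc (d * m)%nat ltac:(nia)). rewrite mult_INR in G. apply INR_ge1 in hd, hm.
  set (n := INR d * INR m) in *. assert (hn : 1 <= n) by (unfold n; nra).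
  assert (pw : forall z, 0 < z -> forall s, Rpower z s * Rpower z (-3) = Rpower z (s + -3)) by (intros; rewrite <- Rpower_plus; reflexivity).
  assert (C0 : Cmod (S2coef d m) <= c * Rpower n (-3)).
  { unfold S2coef. fold n. rewrite Cmod_mult, Cmod_R, Rabs_inv, Rabs_mult, (Rabs_pos_eq n) by lra. rewrite Rinv_mult.
    pose proof (char_le1 q chi Hd (Z.of_nat m)). pose proof (Cmod_ge_0 (chi (Z.of_nat m))).
    assert (hin : 0 < / n) by (apply Rinv_0_lt_compat; lra).
    replace (Rpower n (-3)) with (/ n * / n ^ 2).
    2: { replace (-3) with (- INR 3) by (simpl; ring). rewrite Rpower_Ropp, Rpower_pow by lra. field. lra. }
    assert (0 <= / Rabs (n ^ 2 - y ^ 2)).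
    { apply Rlt_le. apply Rinv_0_lt_compat. apply Rabs_pos_lt. apply (nm_neq q chi x Hprim hx Hne d m); apply INR_le; simpl; lra. }
    apply Rle_trans with (1 * (/ n * (c * / n ^ 2))); [|right; ring]. apply Rmult_le_compat; auto; [nra|]. apply Rmult_le_compat_l; lra. }
  assert (W1 : Rpower n k1 * exp (sg * ln (INR m) + del * Rabs (ln (INR m))) <= Rpower n k1 * Rpower (INR m) (sg + del)).
  { apply Rmult_le_compat_l; [apply exp_ge0|]. right. unfold Rpower. f_equal. rewrite Rabs_pos_eq; [ring|].
    rewrite <- ln_1. destruct (Req_dec (INR m) 1) as [->|]; [lra|]. left. apply ln_increasing; lra. }
  assert (W2 : exp (sg * ln (y / INR d) + del * Rabs (ln (y / INR d))) <= (Rpower y (sg + del) + Rpower y (sg - del)) * INR d).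
  { set (l := ln (y / INR d)).
    assert (E : exp (sg * l + del * Rabs l) <= exp ((sg + del) * l) + exp ((sg - del) * l)).
    { pose proof (exp_pos ((sg + del) * l)). pose proof (exp_pos ((sg - del) * l)). destruct (Rle_or_lt 0 l).
      - rewrite Rabs_pos_eq by auto. replace (sg * l + del * l) with ((sg + del) * l) by ring. lra.
      - rewrite Rabs_left by auto. replace (sg * l + del * - l) with ((sg - del) * l) by ring. lra. }
    eapply Rle_trans; [exact E|].
    assert (B : forall s, -1 <= s -> exp (s * l) <= Rpower y s * INR d).
    { intros s hs. unfold l, Rdiv. rewrite ln_mult, ln_Rinv by (try apply Rinv_0_lt_compat; lra).
      replace (s * (ln y + - ln (INR d))) with (s * ln y + - s * ln (INR d)) by ring. rewrite exp_plus.
      apply Rmult_le_compat_l; [apply exp_ge0|]. change (Rpower (INR d) (- s) <= INR d).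
      rewrite <- (Rpower_1 (INR d)) at 2 by lra. apply Rle_Rpower; lra. }
    pose proof (B (sg + del) ltac:(lra)). pose proof (B (sg - del) ltac:(lra)). lra. }
  assert (hP1 : 0 < Rpower n k1) by apply exp_pos. assert (hP2 : 0 < Rpower y k1) by apply exp_pos.
  assert (hP3 : 0 < Rpower n (-3)) by apply exp_pos.
  rewrite Cmod_mult.
  apply Rle_trans with ((c * Rpower n (-3)) * (Rpower n k1 * Rpower (INR m) (sg + del) + Y * INR d)).
  - apply Rmult_le_compat; auto; try apply Cmod_ge_0. eapply Rle_trans; [apply Cmod_triangle_sub|].
    rewrite !Cmod_mult, !Cmod_RtoC_pos by lra. apply Rplus_le_compat.
    + eapply Rle_trans; [|exact W1]. apply Rmult_le_compat_l; lra.
    + unfold Y. rewrite Rmult_assoc. apply Rmult_le_compat_l; lra.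
  - set (T := Rpower (INR d) (- (2)) * Rpower (INR m) (- p)).
    assert (p1 : p <= 2 * INR N + 2 - sg - del) by apply Rmin_l. assert (p2 : p <= 2) by apply Rmin_r. pose proof (pos_INR N) as hN.
    assert (T1 : Rpower n (-3) * (Rpower n k1 * Rpower (INR m) (sg + del)) <= T).
    { replace (Rpower n (-3) * (Rpower n k1 * Rpower (INR m) (sg + del))) with ((Rpower n k1 * Rpower n (-3)) * Rpower (INR m) (sg + del)) by ring.
      rewrite pw by lra. unfold n. rewrite <- Rpower_mult_distr by lra. rewrite Rmult_assoc, <- Rpower_plus. unfold T.
      apply Rmult_le_compat; try (apply exp_ge0); apply Rle_Rpower; try lra; unfold k1; lra. }
    assert (T2 : Rpower n (-3) * INR d <= T).
    { unfold n. rewrite <- Rpower_mult_distr by lra. rewrite Rmult_assoc, (Rmult_comm (Rpower (INR m) (-3))), <- Rmult_assoc.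
      rewrite <- (Rpower_1 (INR d)) at 2 by lra. rewrite <- Rpower_plus. unfold T.
      apply Rmult_le_compat; try (apply exp_ge0); apply Rle_Rpower; lra. }
    replace (c * Rpower n (-3) * (Rpower n k1 * Rpower (INR m) (sg + del) + Y * INR d)) with
      (c * (Rpower n (-3) * (Rpower n k1 * Rpower (INR m) (sg + del)) + Y * (Rpower n (-3) * INR d))) by ring.
    replace (c * (1 + Y) * Rpower (INR d) (- (2)) * Rpower (INR m) (- p)) with (c * (T + Y * T)) by (unfold T; ring).
    apply Rmult_le_compat_l; [lra|]. apply Rplus_le_compat; auto. apply Rmult_le_compat_l; lra.
Qed.

Let del (w : C) : R := Rmin (Re w + 1) (2 * INR N + 1 - Re w) / 2.

Lemma del_spec (w : C) : -1 < Re w < 2 * INR N + 1 -> 0 < del w /\ -1 < Re w - del w /\ Re w + del w < 2 * INR N + 1.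
Proof.
  intros hw. unfold del. pose proof (Rmin_pos (Re w + 1) (2 * INR N + 1 - Re w) ltac:(lra) ltac:(lra)).
  pose proof (Rmin_l (Re w + 1) (2 * INR N + 1 - Re w)). pose proof (Rmin_r (Re w + 1) (2 * INR N + 1 - Re w)). lra.
Qed.

Lemma S2_cv (w : C) : -1 < Re w < 2 * INR N + 1 -> exists l, Cser (S2term q chi x N w) l.
Proof.
  intros hw. destruct (del_spec w hw) as (d1 & d2 & d3). destruct (S2_weight (Re w) (del w) d1 d2 d3) as (K & p & hK & hp & H).
  destruct (Cser_dconv_dominated (fun d m => S2g d m w) (fun d => K * Rpower (INR d) (- (2))) (fun m => 1 * Rpower (INR m) (- p))) as [l Hl].
  - intros. apply Rmult_le_pos; [lra|apply exp_ge0].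
  - intros. apply Rmult_le_pos; [lra|apply exp_ge0].
  - apply ex_series_Rpower_INR; lra.
  - apply ex_series_Rpower_INR; lra.
  - intros d m hd hm. rewrite Rmult_1_l. apply H; auto; apply exp_weight; auto.
  - exists l. eapply Cser_ext; [|exact Hl]. intros n. symmetry. apply S2term_dconv.
Qed.

(** Derivatives and remainders of the two exponentials are rescaled to meet the hypotheses of
    [S2_weight], and the scale is multiplied back, giving the majorants for [series_holo_dconv]. *)
Lemma S2_holo (w : C) : -1 < Re w < 2 * INR N + 1 -> holo_at (fun nu => Cval (S2term q chi x N nu)) w.
Proof.
  intros hw. destruct (del_spec w hw) as (d1 & d2 & d3). destruct (S2_weight (Re w) (del w) d1 d2 d3) as (K & p & hK & hp & H).
  set (dl := del w) in *. set (k0 := 48 / (dl * dl)). set (k2 := / dl).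
  assert (hk0 : 0 < k0) by (apply Rdiv_lt_0_compat; nra). assert (hk2 : 0 < k2) by (apply Rinv_0_lt_compat; auto).
  apply (series_holo_dconv S2g (S2g' w) (fun d => (k0 + k2) * K * Rpower (INR d) (- (2))) (fun m => 1 * Rpower (INR m) (- p)) _ w (dl / 2)).
  - lra.
  - intros. apply Rmult_le_pos; [nra|apply exp_ge0].
  - intros. apply Rmult_le_pos; [lra|apply exp_ge0].
  - apply ex_series_Rpower_INR; lra.
  - apply ex_series_Rpower_INR; lra.
  - intros d m hd hm.
    set (l1 := ln (INR m)). set (l2 := ln (y / INR d)).
    assert (R1 : forall l, Cmod (RtoC dl * (RtoC l * cexp (w * RtoC l))) <= exp (Re w * l + dl * Rabs l)).
    { intros l. rewrite Cmod_mult, Cmod_RtoC_pos by lra.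
      destruct (exp_remainder w w l dl d1) as [_ h]; [replace (w - w)%C with (RtoC 0) by ring; rewrite Cmod_0; lra|].
      apply (Rmult_le_compat_l dl) in h; [|lra]. rewrite <- Rmult_assoc, Rinv_r, Rmult_1_l in h by lra. exact h. }
    assert (Q := H d m _ _ hd hm (R1 l1) (R1 l2)).
    replace (S2g' w d m) with (RtoC k2 * (S2coef d m * (RtoC (Rpower (INR d * INR m) k1) * (RtoC dl * (RtoC l1 * cexp (w * RtoC l1)))
      - RtoC (Rpower y k1) * (RtoC dl * (RtoC l2 * cexp (w * RtoC l2))))))%C.
    + rewrite Cmod_mult, Cmod_RtoC_pos by lra. apply (Rmult_le_compat_l k2) in Q; [|lra]. eapply Rle_trans; [exact Q|].
      assert (0 <= K * Rpower (INR d) (- (2)) * Rpower (INR m) (- p)) by (repeat apply Rmult_le_pos; try lra; apply exp_ge0). nra.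
    + unfold S2g', k2. fold l1 l2. rewrite RtoC_inv by lra. field. apply RtoC_neq0. lra.
  - intros d m z hd hm hz. set (l1 := ln (INR m)). set (l2 := ln (y / INR d)). set (X := Cmod (z - w) * Cmod (z - w)).
    (* The remainder is rescaled by [1 / (k0 X)], so [X = 0] is treated apart. *)
    destruct (Req_dec (Cmod (z - w)) 0) as [z0|z0].
    { assert (z = w) by (apply Cmod_eq_0 in z0; replace z with (z - w + w)%C by ring; rewrite z0; ring). subst z.
      match goal with |- Cmod ?a <= _ => replace a with (RtoC 0) by ring end. rewrite Cmod_0. unfold X. rewrite z0. lra. }
    assert (hX : 0 < X) by (unfold X; pose proof (Cmod_ge_0 (z - w)); nra).
    assert (hkX : 0 < / (k0 * X)) by (apply Rinv_0_lt_compat; nra).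
    set (rem := fun l => (cexp (z * RtoC l) - cexp (w * RtoC l) - RtoC l * cexp (w * RtoC l) * (z - w))%C).
    assert (R1 : forall l, Cmod (RtoC (/ (k0 * X)) * rem l) <= exp (Re w * l + dl * Rabs l)).
    { intros l. rewrite Cmod_mult, Cmod_RtoC_pos by lra.
      destruct (exp_remainder w z l dl d1) as [h _]; [lra|]. fold k0 X (rem l) in h.
      apply (Rmult_le_compat_l (/ (k0 * X))) in h; [|lra]. eapply Rle_trans; [exact h|]. right. field. split; lra. }
    assert (Q := H d m _ _ hd hm (R1 l1) (R1 l2)).
    replace (S2g d m z - S2g d m w - S2g' w d m * (z - w))%C with (RtoC (k0 * X) * (S2coef d m * (RtoC (Rpower (INR d * INR m) k1) * (RtoC (/ (k0 * X)) * rem l1)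
      - RtoC (Rpower y k1) * (RtoC (/ (k0 * X)) * rem l2))))%C.
    + rewrite Cmod_mult, Cmod_RtoC_pos by nra. apply (Rmult_le_compat_l (k0 * X)) in Q; [|nra]. eapply Rle_trans; [exact Q|].
      assert (0 <= K * Rpower (INR d) (- (2)) * Rpower (INR m) (- p)) by (repeat apply Rmult_le_pos; try lra; apply exp_ge0).
      assert (0 <= k2 * X * (K * Rpower (INR d) (- (2)) * Rpower (INR m) (- p))) by (apply Rmult_le_pos; [nra|auto]). fold X. lra.
    + unfold S2g, S2g', rem. fold l1 l2. rewrite RtoC_inv by nra. field. apply RtoC_neq0. nra.
  - intros z hz. assert (hz' : -1 < Re z < 2 * INR N + 1).
    { pose proof (re_le_Cmod (z - w)) as h. rewrite Re_minus in h. assert (h3 : Rabs (Re z - Re w) < dl) by lra. apply Rabs_def2 in h3. lra. }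
    eapply Cser_ext; [|apply Cval_spec, S2_cv; exact hz']. intros n. apply S2term_dconv.
Qed.

End Weights.
End Continuation.

(** * The identity for small [nu], the induction on [N], and the continuation *)

Section MainIdentity.
Variables (q : nat) (chi : Z -> C) (x : R).
Hypothesis Hprim : primitive_char q chi.
Hypothesis Hodd : odd_char chi.
Hypothesis hx : 0 < x.
Hypothesis Hne : forall m : nat, (0 < m)%nat -> INR q * x <> INR m.

Let chib := conj_char chi.
Let Hd : dirichlet_char q chi := proj1 Hprim.
Let hq : 0 < INR q := INRq_pos q chi Hd.
Let y : R := INR q * x.
Let hy : 0 < y := Rmult_lt_0_compat _ _ hq hx.

(** All terms outside the braces, with [8 pi x^(nu/2)] times the Bessel series written as [4 pi]
    times [Jint]. The cosine is left out of [pref], to be multiplied with [Lhs] instead, so that its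
    zeros at odd integers cause no singularity. *)
Let Lhs (nu : C) : C := (RtoC (4 * PI) * Jint q chi x nu + Gamma nu * Lfun chib nu / cpow (2 * PI) (nu - RtoC 1)
  - RtoC 2 * Gamma (RtoC 1 + nu) * Lfun chib (RtoC 1 + nu) / cpow (2 * PI) (nu + RtoC 1) * RtoC (/ x))%C.
Let pref (nu : C) : C := (RtoC 2 * Ci * cpow (INR q) (RtoC 1 - nu) / gauss_sum q chi)%C.
Let Bra (N : nat) (S2 nu : C) : C := (zeta (nu + RtoC 1) * Lfun chi (RtoC 1) * cpow y nu
  - Csum (fun j => zeta (RtoC (2 * INR j)) * Lfun chi (RtoC (2 * INR j) - nu) * RtoC (y ^ (2 * j - 1)))%C 1 N
  - RtoC (y ^ (2 * N + 1)) * S2)%C.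

(** Beyond the splitting of [B], the product [A D] is split as [(A - A0) D + A0 D]: the first has a
    product of partial fractions, the second is a transform of [D] alone. All pieces converge
    together for [0 < Re nu < 1]. *)
Lemma Jint_decomp (nu S2 : C) : 0 < Re nu < 1 -> Cser (S2term q chi x 0 nu) S2 ->
  Jint q chi x nu = (- (kap q chi * cpow (INR q) (- nu) * RtoC y / (RtoC 2 * ccos (hpi nu)) * S2)
    + A0 q chi * (cpow x nu * (zeta (nu + RtoC 1) / (RtoC 2 * ccos (hpi nu))))
    + RtoC (/ (2 * PI * x)) * mel (fun u => Afun q chi (exp u)) (nu + RtoC 1)
    - RtoC (1 / 2) * mel (fun u => Afun q chi (exp u)) nu)%C.
Proof.
  intros hnu HS. destruct (product_mellin q chi x Hprim Hodd hx Hne nu hnu) as (S & H1 & H2).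
  rewrite (Cser_unique _ _ _ HS H1). pose proof PI_RGT_0 as hpi0.
  assert (D1 := HI_I _ (Dom_A q chi Hprim Hodd (nu + RtoC 1)%C ltac:(rewrite Re_plus, Re_RtoC; lra))).
  assert (D0 := HI_I _ (Dom_A q chi Hprim Hodd nu ltac:(lra))).
  assert (E := HI_minus _ _ _ _ (HI_plus _ _ _ _ (HI_plus _ _ _ _ H2 (HI_scal (A0 q chi) _ _ (Df_mellin_inv x nu hx hnu)))
    (HI_scal (RtoC (/ (2 * PI * x))) _ _ D1)) (HI_scal (RtoC (1 / 2)) _ _ D0)).
  eapply HI_unique; [apply HI_I, (Jint_series q chi x Hprim Hodd hx nu)|].
  eapply HI_ext; [|reflexivity|exact E]. intros u. cbv beta. rewrite cexp_shift, Rmult_1_l.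
  assert (EB : Bf (x * exp (- u)) = Df (x * exp (- u)) + / (2 * PI * x) * exp u - 1 / 2).
  { unfold Df. rewrite exp_Ropp. pose proof (exp_pos u). field. repeat split; lra. }
  rewrite EB, RtoC_minus, RtoC_plus, RtoC_mult. ring.
Qed.

Lemma identity_zero (nu S2 : C) : 0 < Re nu < 1 -> Cser (S2term q chi x 0 nu) S2 ->
  (ccos (hpi nu) * Lhs nu)%C = (pref nu * Bra 0 S2 nu)%C.
Proof.
  intros hnu HS. pose proof PI_RGT_0 as hpi0.
  assert (nc : ccos (hpi nu) <> RtoC 0) by (apply ccos_hpi_neq0; apply Rabs_def1; lra).
  destruct (gauss_neq0 q chi Hprim Hodd) as [nt _]. pose proof (kap_neq0 q chi Hprim Hodd) as nk.
  unfold Lhs. rewrite (Jint_decomp nu S2 hnu HS).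
  rewrite (mel_A q chi Hprim Hodd nu), (mel_A q chi Hprim Hodd (nu + RtoC 1)) by (try rewrite Re_plus, Re_RtoC; lra).
  unfold Bra. rewrite Csum_0 by lia. replace (2 * 0 + 1)%nat with 1%nat by lia. rewrite pow_1.
  rewrite (proj2 (Lfun_spec q chi Hprim Hodd)). fold chib.
  replace (RtoC 1 + nu)%C with (nu + RtoC 1)%C by ring.
  unfold y. rewrite (cpow_mult (INR q) x) by auto. unfold pref.
  rewrite !cpow_minus, !cpow_opp, !cpow_plus, !cpow_one by lra.
  pose proof (cpow_neq0 (2 * PI) nu). pose proof (cpow_neq0 (INR q) nu). pose proof C2_neq0. pose proof Ci_neq0.
  assert (RtoC PI <> RtoC 0) by (apply RtoC_neq0; lra). assert (RtoC x <> RtoC 0) by (apply RtoC_neq0; lra).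
  assert (RtoC (INR q) <> RtoC 0) by (apply RtoC_neq0; lra).
  rewrite !RtoC_inv by nra. unfold Rdiv. rewrite !RtoC_mult, !RtoC_inv by lra.
  unfold kap. replace (RtoC 4) with (RtoC 2 * RtoC 2)%C by (rewrite <- RtoC_mult; f_equal; ring).
  field. repeat split; auto.
Qed.

(** Writing [n = d m], the summand factors into [d^(- 2N - 2)] and [chi m m^(nu - 2N - 2)]; the
    bound on [Re nu] is absolute convergence of the second series. *)
Lemma convolution_series (N : nat) (nu : C) : Re nu < 2 * INR N + 1 ->
  Cser (fun n => sigma_bar_chi (- nu) chi (S n) * cpow (INR (S n)) (nu - RtoC (2 * INR (S N))))%C
    (zeta (RtoC (2 * INR (S N))) * Lfun chi (RtoC (2 * INR (S N)) - nu))%C.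
Proof.
  intros hnu. rewrite S_INR. pose proof (pos_INR N) as hN. set (k := 2 * (INR N + 1)).
  destruct (Lfun_spec q chi Hprim Hodd) as [[_ HL] _].
  assert (hk : 1 < Re (RtoC k)) by (rewrite Re_RtoC; unfold k; lra).
  assert (hk' : 1 < Re (RtoC k - nu)) by (rewrite Re_minus, Re_RtoC; unfold k; lra).
  assert (P := dconv_series (fun d => cpow (INR d) (- RtoC k)) (fun m => chi (Z.of_nat m) * cpow (INR m) (- (RtoC k - nu)))%C _ _
    (proj2 zeta_spec _ hk) (HL _ hk')).
  eapply Cser_ext; [|apply P].
  - intros n. cbv beta.
    transitivity (cpow (INR (S n)) (nu - RtoC k) * dconv (fun d m => cpow (INR d) (- nu) * chi (Z.of_nat m))%C (S n))%C.
    2: { change (sigma_bar_chi (- nu) chi (S n)) with (dconv (fun d m => cpow (INR d) (- nu) * chi (Z.of_nat m))%C (S n)). ring. }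
    rewrite <- dconv_scal. apply dconv_ext; [lia|]. intros d m hd hm hdm. apply INR_ge1 in hd, hm.
    rewrite <- hdm, mult_INR, cpow_mult by lra.
    replace (- (RtoC k - nu))%C with (nu - RtoC k)%C by ring. rewrite !cpow_minus, !cpow_opp.
    pose proof (cpow_neq0 (INR d) nu). pose proof (cpow_neq0 (INR d) (RtoC k)). pose proof (cpow_neq0 (INR m) (RtoC k)). field. repeat split; auto.
  - assert (Q := Dser_abs (fun _ => RtoC 1) 1 (RtoC k) ltac:(intros; cbv beta; rewrite Cmod_1; lra) hk).
    eapply ex_series_ext; [|exact Q]. intros n. unfold Dser. rewrite Cmult_1_l. reflexivity.
  - apply (Dser_abs (fun n => chi (Z.of_nat (S n))) 1 (RtoC k - nu)); auto. intros n. apply (char_le1 q chi Hd).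
Qed.

(** [n^a - y^a = y^2 (n^(a-2) - y^(a-2)) + n^(a-2) (n^2 - y^2)], divided by [n^2 - y^2]: the second
    part no longer has a denominator and sums to the new product of [zeta] and [L]. *)
Lemma S2_step (N : nat) (nu S' : C) : Re nu < 2 * INR N + 1 -> Cser (S2term q chi x (S N) nu) S' ->
  Cser (S2term q chi x N nu) (RtoC (y ^ 2) * S' + zeta (RtoC (2 * INR (S N))) * Lfun chi (RtoC (2 * INR (S N)) - nu))%C.
Proof.
  intros hnu HS. assert (P := Cser_plus _ _ _ _ (Cser_scal (RtoC (y ^ 2)) _ _ HS) (convolution_series N nu hnu)).
  eapply Cser_ext; [|exact P]. intros n. cbv beta. unfold S2term. fold y. set (M := INR (S n)).
  assert (hM : 1 <= M) by (apply INR_ge1; lia).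
  assert (nn : M ^ 2 - y ^ 2 <> 0).
  { assert (E := nm_neq q chi x Hprim hx Hne 1 (S n) ltac:(lia) ltac:(lia)). fold y M in E. simpl INR in E. rewrite Rmult_1_l in E. exact E. }
  assert (e1 : (nu + RtoC 1 - RtoC (2 * INR (S N)))%C = (nu + RtoC 1 - RtoC (2 * INR N) - RtoC (INR 2))%C).
  { rewrite S_INR. replace (2 * (INR N + 1)) with (2 * INR N + INR 2) by (simpl; ring). rewrite RtoC_plus. ring. }
  assert (e2 : (nu - RtoC (2 * INR (S N)))%C = (nu + RtoC 1 - RtoC (2 * INR N) - RtoC (INR 2) - RtoC 1)%C) by (rewrite <- e1; ring).
  rewrite e1, e2. set (a := (nu + RtoC 1 - RtoC (2 * INR N))%C). rewrite !cpow_minus, !cpow_INR, cpow_one by lra.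
  assert (RtoC M <> RtoC 0) by (apply RtoC_neq0; lra). assert (RtoC y <> RtoC 0) by (apply RtoC_neq0; lra).
  assert (n2 : RtoC (M ^ 2 - y ^ 2) <> RtoC 0) by (apply RtoC_neq0; auto).
  rewrite RtoC_minus, !RtoC_pow in *. field. repeat split; auto.
Qed.

(** Induction within the first strip: the sum for [N] is recovered from the one for [N + 1] by
    [S2_step], and the extra product becomes the next term of the finite sum. *)
Lemma identity_strip1 (N : nat) (nu S2 : C) : 0 < Re nu < 1 -> Cser (S2term q chi x N nu) S2 ->
  (ccos (hpi nu) * Lhs nu)%C = (pref nu * Bra N S2 nu)%C.
Proof.
  intros hnu. revert S2. induction N as [|N IH]; intros S2 HS; [apply identity_zero; auto|].
  pose proof (pos_INR N). rewrite (IH _ (S2_step N nu S2 ltac:(lra) HS)). f_equal. unfold Bra. rewrite (Csum_Sm _ 1 N) by lia.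
  replace (2 * S N - 1)%nat with (2 * N + 1)%nat by lia. replace (2 * S N + 1)%nat with (2 * N + 1 + 2)%nat by lia.
  rewrite (pow_add y (2 * N + 1) 2), (RtoC_mult (y ^ (2 * N + 1))). ring.
Qed.

Let E (N : nat) (nu : C) : C := (ccos (hpi nu) * Lhs nu - pref nu * Bra N (Cval (S2term q chi x N nu)) nu)%C.

(** In this strip the poles of [Gamma nu] and of [zeta (nu + 1)] can occur at [nu = 0] only. The
    strip reaches to the left of the imaginary axis, so that the axis is interior to it. *)
Lemma E_holo (N : nat) (nu : C) : -1 < Re nu < 2 * INR N + 1 -> nu <> RtoC 0 -> holo_at (E N) nu.
Proof.
  intros hnu n0. unfold E, Lhs, pref, Bra.
  destruct (Lfun_spec q chib (conj_char_primitive q chi Hprim) (conj_char_odd chi Hodd)) as [[HL1 _] _].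
  destruct (Lfun_spec q chi Hprim Hodd) as [[HL2 _] _]. destruct Gamma_spec as [[HG _] _]. destruct zeta_spec as [HZ _].
  destruct (gauss_neq0 q chi Hprim Hodd) as [nt _].
  pose proof (holo_hpi nu). pose proof (HL1 nu).
  assert (holo_at (Jint q chi x) nu) by (apply (Jint_holo q chi x Hprim Hodd hx)).
  assert (holo_at (fun nu => Cval (S2term q chi x N nu)) nu) by (apply (S2_holo q chi x Hprim hx Hne N); auto).
  assert (holo_at Gamma nu).
  { apply HG. intros k e. destruct k as [|k].
    - apply n0. rewrite e. simpl. f_equal. ring.
    - rewrite e, Re_RtoC, S_INR in hnu. pose proof (pos_INR k). lra. }
  assert (holo_at (fun z => Gamma (RtoC 1 + z)) nu).
  { apply (holo_comp (fun z => RtoC 1 + z)%C Gamma); [holo|]. apply HG. intros k e. apply (f_equal Re) in e.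
    rewrite Re_plus, !Re_RtoC in e. pose proof (pos_INR k). lra. }
  assert (holo_at (fun z => Lfun chib (RtoC 1 + z)) nu) by (apply (holo_comp (fun z => RtoC 1 + z)%C (Lfun chib)); [holo|apply HL1]).
  assert (holo_at (fun z => zeta (z + RtoC 1)) nu).
  { apply (holo_comp (fun z => z + RtoC 1)%C zeta); [holo|]. apply HZ. intros e. apply n0. replace nu with (nu + RtoC 1 - RtoC 1)%C by ring. rewrite e. ring. }
  assert (HC : forall M, holo_at (fun z => Csum (fun j => zeta (RtoC (2 * INR j)) * Lfun chi (RtoC (2 * INR j) - z) * RtoC (y ^ (2 * j - 1)))%C 1 M) nu).
  { induction M as [|M IH].
    - apply (holo_ext (fun _ => RtoC 0)); [intros; rewrite Csum_0 by lia; reflexivity|holo].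
    - apply (holo_ext (fun z => Csum (fun j => zeta (RtoC (2 * INR j)) * Lfun chi (RtoC (2 * INR j) - z) * RtoC (y ^ (2 * j - 1)))%C 1 M
        + zeta (RtoC (2 * INR (S M))) * Lfun chi (RtoC (2 * INR (S M)) - z) * RtoC (y ^ (2 * S M - 1)))%C); [intros; rewrite Csum_Sm by lia; reflexivity|].
      assert (holo_at (fun z => Lfun chi (RtoC (2 * INR (S M)) - z)) nu) by (apply (holo_comp (fun z => RtoC (2 * INR (S M)) - z)%C (Lfun chi)); [holo|apply HL2]).
      holo. }
  pose proof (HC N). holo; auto; apply cpow_neq0.
Qed.

(** The identity theorem starts from the real interval [(0, 1)] and covers [0 < Re nu < 2 N + 1]. A
    nonzero point with [Re nu = 0] is approached from the right, where [E] vanishes. *)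
Lemma E_zero (N : nat) (nu : C) : 0 <= Re nu < 2 * INR N + 1 -> nu <> RtoC 0 -> E N nu = RtoC 0.
Proof.
  intros hnu n0. pose proof (pos_INR N) as hN.
  assert (Z : forall z, 0 < Re z < 2 * INR N + 1 -> E N z = RtoC 0).
  { apply (holo_zero_strip (E N) 0 (2 * INR N + 1) (1 / 2) (1 / 2)); try lra.
    - intros z hz. apply E_holo; [lra|]. intros e. rewrite e, Re_RtoC in hz. lra.
    - intros r hr. apply Rabs_def2 in hr. unfold E.
      rewrite (identity_strip1 N (RtoC r) (Cval (S2term q chi x N (RtoC r)))); [ring|rewrite Re_RtoC; lra|].
      apply Cval_spec. apply (S2_cv q chi x Hprim hx Hne N). rewrite Re_RtoC. lra. }
  destruct (Req_dec (Re nu) 0) as [h|h]; [|apply Z; lra].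
  apply Cmod_small_eq. intros eps he.
  destruct (holo_contin _ _ (E_holo N nu ltac:(lra) n0) eps he) as (d & hd & H).
  set (r := Rmin d 1 / 2). assert (hr : 0 < r < 1) by (unfold r; pose proof (Rmin_pos d 1 hd Rlt_0_1); pose proof (Rmin_r d 1); lra).
  assert (hr2 : r < d) by (unfold r in *; pose proof (Rmin_l d 1); lra).
  specialize (H (nu + RtoC r)%C). replace (nu + RtoC r - nu)%C with (RtoC r) in H by ring. rewrite Cmod_RtoC_pos in H by lra.
  specialize (H hr2). rewrite Z in H by (rewrite Re_plus, Re_RtoC; lra).
  replace (RtoC 0 - E N nu)%C with (- E N nu)%C in H by ring. rewrite Cmod_opp in H. lra.
Qed.

Lemma koshliakov_identity (N : nat) (nu S2 : C) : 0 <= Re nu < 2 * INR N + 1 -> nu <> RtoC 0 -> Cser (S2term q chi x N nu) S2 ->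
  (ccos (hpi nu) * Lhs nu)%C = (pref nu * Bra N S2 nu)%C.
Proof.
  intros hnu n0 HS. assert (H := E_zero N nu hnu n0). unfold E in H.
  assert (C := Cval_spec _ (ex_intro _ S2 HS)). rewrite (Cser_unique _ _ _ C HS) in H.
  replace (ccos (hpi nu) * Lhs nu)%C with (ccos (hpi nu) * Lhs nu - pref nu * Bra N S2 nu + pref nu * Bra N S2 nu)%C by ring.
  rewrite H. ring.
Qed.

End MainIdentity.

Theorem theorem3p5 (nu : C) (q : nat) (chi : Z -> C) (N : nat) :
  (forall k : Z, nu <> RtoC (IZR k)) ->
  0 <= Re nu ->
  primitive_char q chi ->
  odd_char chi ->
  (Int_part ((Re nu + 1) / 2) <= Z.of_nat N)%Z ->
  forall x : R, 0 < x ->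
  (forall m : nat, (0 < m)%nat -> INR q * x <> INR m) ->
  let chib := conj_char chi in
  let qx := INR q * x in
  exists S1 S2 : C,
    @is_series C_AbsRing C_NormedModule
      (fun n => Cmult (Cmult (sigma_chi (Copp nu) chib (S n)) (cpow (INR (S n)) (Cdiv nu (RtoC 2))))
                      (BesselK nu (4 * PI * sqrt (INR (S n) * x)))) S1 /\
    @is_series C_AbsRing C_NormedModule
      (fun n => Cmult (Cdiv (sigma_bar_chi (Copp nu) chi (S n)) (RtoC (INR (S n))))
                      (Cdiv (Cminus (cpow (INR (S n)) (Cminus (Cplus nu (RtoC 1)) (RtoC (2 * INR N))))
                                    (cpow qx (Cminus (Cplus nu (RtoC 1)) (RtoC (2 * INR N)))))
                            (RtoC (INR (S n) ^ 2 - qx ^ 2)))) S2 /\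
    Cmult (Cmult (RtoC (8 * PI)) (cpow x (Cdiv nu (RtoC 2)))) S1 =
    Cplus (Cplus
      (Copp (Cdiv (Cmult (Gamma nu) (Lfun chib nu)) (cpow (2 * PI) (Cminus nu (RtoC 1)))))
      (Cmult (Cdiv (Cmult (Cmult (RtoC 2) (Gamma (Cplus (RtoC 1) nu))) (Lfun chib (Cplus (RtoC 1) nu)))
                   (cpow (2 * PI) (Cplus nu (RtoC 1))))
             (RtoC (/ x))))
      (Cmult
        (Cdiv (Cmult (Cmult (RtoC 2) Ci) (cpow (INR q) (Cminus (RtoC 1) nu)))
              (Cmult (gauss_sum q chi) (ccos (Cdiv (Cmult (RtoC PI) nu) (RtoC 2)))))
        (Cminus (Cminus
           (Cmult (Cmult (zeta (Cplus nu (RtoC 1))) (Lfun chi (RtoC 1))) (cpow qx nu))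
           (@sum_n_m C_AbelianMonoid
              (fun j => Cmult (Cmult (zeta (RtoC (2 * INR j))) (Lfun chi (Cminus (RtoC (2 * INR j)) nu)))
                              (RtoC (qx ^ (2 * j - 1)))) 1 N))
           (Cmult (RtoC (qx ^ (2 * N + 1))) S2))).
Proof.
  intros Hnu h0 Hprim Hodd HN x hx Hne chib qx.
  (* The integer part of [(Re nu + 1) / 2] is at most [N] exactly when [(Re nu + 1) / 2 < N + 1]. *)
  assert (hN : Re nu < 2 * INR N + 1).
  { apply IZR_le in HN. rewrite <- INR_IZR_INZ in HN. destruct (base_Int_part ((Re nu + 1) / 2)). lra. }
  destruct (S2_cv q chi x Hprim hx Hne N nu ltac:(lra)) as [S2 HS2].
  destruct (Jint_series q chi x Hprim Hodd hx nu) as [_ HS1].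
  exists (Jint q chi x nu / (RtoC 2 * cpow x (nu / RtoC 2)))%C, S2. split; [exact HS1|]. split; [exact HS2|].
  assert (M := koshliakov_identity q chi x Hprim Hodd hx Hne N nu S2 ltac:(lra) (Hnu 0%Z) HS2). cbv beta zeta in M.
  assert (nc := ccos_hpi_nonint nu Hnu). destruct (gauss_neq0 q chi Hprim Hodd) as [nt _].
  fold chib qx in M. fold (hpi nu).
  match type of M with (_ * ?L)%C = (_ * ?B)%C => set (lhs := L) in M; set (bra := B) in M end.
  change (@sum_n_m C_AbelianMonoid) with Csum. fold bra.
  (* The only division by the cosine, nonzero because its zeros are odd integers and [nu] is not an
     integer. *)
  assert (M' : lhs = (RtoC 2 * Ci * cpow (INR q) (RtoC 1 - nu) / (gauss_sum q chi * ccos (hpi nu)) * bra)%C).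
  { transitivity (/ ccos (hpi nu) * (ccos (hpi nu) * lhs))%C; [field; auto|]. rewrite M. field. auto. }
  rewrite <- M'. unfold lhs. pose proof (cpow_neq0 x (nu / RtoC 2)). pose proof C2_neq0.
  replace (8 * PI) with (2 * (4 * PI)) by ring. rewrite (RtoC_mult 2).
  unfold Cdiv. set (a := (Gamma nu * _ * _)%C). set (b := (RtoC 2 * Gamma _ * _ * _ * _)%C). field. auto.
Qed.
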